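(* The minimal resolution, $\mathcal{HS}_\infty$, of the $2$-coloured operad $\mathcal{HS}$ of formal homogeneous spaces is the free $2$-coloured operad (colours ''straight'' and ''wavy'') generated by: - for each $m\ge 2$, a corolla $\ell_m$ of degree $2-m$ with straight output and $m$ straight inputs, skewsymmetric in its inputs; - for each $m\ge 1$, $n\ge 0$, a corolla $f_{m,n}$ of degree $1-m$ with wavy output, $m$ straight inputs in which it is skewsymmetric, and $n$ wavy inputs in which it is symmetric. The differential $\delta$ is given on the generators by $$\delta\,\ell_m(1,\dots,m)=\sum_{\substack{[m]=J_1\sqcup J_2\\ |J_1|\ge 2,\ |J_2|\ge 1}}(-1)^{J_1(J_2+1)+\sigma(J_1\sqcup J_2)}\ \ell_{|J_2|+1}\big(\ell_{|J_1|}(J_1),J_2\big)$$ and $$\delta f_{m,n}(1,\dots,m;\,m+1,\dots,m+n)=\sum_{\substack{[m]=J_1\sqcup J_2\\ |J_1|\ge 2,\ |J_2|\ge 0}}(-1)^{(J_1+1)J_2+\sigma(J_1\sqcup J_2)}\ f_{|J_2|+1,\,n}\big(\ell_{|J_1|}(J_1),J_2;\,m+1,\dots,m+n\big)$$ $$-\sum_{\substack{[m]=J_1\sqcup J_2,\ \ [m+1,m+n]=I_1\sqcup I_2\\ |J_1|\ge1,\ |J_2|\ge 1,\ |I_1|\ge0,\ |I_2|\ge 0}}(-1)^{J_1(J_2+1)+\sigma(J_1\sqcup J_2)}\ f_{|J_1|,\,|I_1|+1}\big(J_1;\,f_{|J_2|,|I_2|}(J_2;I_2),\,I_1\big).$$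
   Context: Work over a field $\mathbb K$ of characteristic zero. $[m]=\{1,\dots,m\}$ and $[p,q]=\{p,p+1,\dots,q\}$, naturally ordered. In exponents of $-1$, a finite set $J$ stands for its cardinality $|J|$. For a splitting $[m]=J_1\sqcup J_2$ into disjoint naturally ordered subsets, $(-1)^{\sigma(J_1\sqcup J_2)}$ is the sign of the permutation $[m]\to J_1\sqcup J_2$. An expression $a(\dots,b(\dots),\dots)$ denotes the two-vertex tree obtained by grafting the output leg of the corolla $b$ into the indicated input leg (of the same colour) of the corolla $a$, with the remaining input legs labelled as indicated; straight inputs of $f$ are written before the semicolon and wavy inputs after it. The operad of formal homogeneous spaces $\mathcal{HS}$ is the $2$-coloured operad generated by a skewsymmetric operation $[\ ,\ ]$ with two straight inputs and straight output and, for each $n\ge 0$, an operation $F_n$ with one straight input, $n$ wavy inputs (in which it is symmetric) and wavy output, modulo the relations $$[[1,2],3]+[[3,1],2]+[[2,3],1]=0,$$ $$F_n([1,2];3,\dots,n+2)+\sum_{[3,n+2]=I_1\sqcup I_2}\Big(F_{|I_2|+1}\big(1;F_{|I_1|}(2;I_1),I_2\big)-F_{|I_2|+1}\big(2;F_{|I_1|}(1;I_1),I_2\big)\Big)=0,\quad n\ge 0,$$ where the sum runs over all splittings into two (possibly empty) disjoint subsets. Its representations in a pair of vector spaces $(\mathfrak g,\mathfrak h)$ are the Lie algebra structures on $\mathfrak g$ together with a morphism of Lie algebras from $\mathfrak g$ to the Lie algebra of formal vector fields on $\mathfrak h$. A minimal resolution of $\mathcal{HS}$ is a free $2$-coloured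 operad $\mathcal{HS}_\infty$ equipped with a decomposable differential $\delta$ and with an epimorphism of dg operads $\pi:(\mathcal{HS}_\infty,\delta)\to(\mathcal{HS},0)$ inducing an isomorphism in cohomology; it is unique up to isomorphism.
   Formalization: With the printed signs δ²ℓ_4≠0, so two sign exponents are corrected: in δℓ_m the exponent is (J_2+1)+σ instead of J_1(J_2+1)+σ, and in the first sum of δf_{m,n} it is J_2+σ instead of (J_1+1)J_2+σ; the second sum is unchanged. *)

(* Defs.v *)
From HB Require Import structures.
From mathcomp Require Import all_boot all_order all_algebra all_fingroup.
From mathcomp Require Import generic_quotient boolp.

Set Implicit Arguments.
Unset Strict Implicit.
Unset Printing Implicit Defensive.

Import GRing.Theory.
Local Open Scope ring_scope.
Local Open Scope quotient_scope.

Inductive colour := straight | wavy.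

Definition juxt (T : Type) (m n : nat) (f : 'I_m -> T) (g : 'I_n -> T)
    (i : 'I_(m + n)) : T :=
  match split i with inl j => f j | inr k => g k end.

(* The permutation listing J in increasing order and then its complement. *)
Definition shuffle_fun (m : nat) (J : {set 'I_m}) (i : 'I_m) : 'I_m :=
  nth i (enum J ++ enum (~: J)) i.

Lemma shuffle_fun_inj (m : nat) (J : {set 'I_m}) : injective (shuffle_fun J).
Proof.
have sz : size (enum J ++ enum (~: J)) = m.
  by rewrite size_cat -!cardE cardsC card_ord.
move=> i j; rewrite /shuffle_fun (set_nth_default j) ?sz // => /eqP.
rewrite nth_uniq ?sz //; first by move/eqP/val_inj.
rewrite cat_uniq !enum_uniq andbT /=; apply/hasPn => k.
by rewrite !mem_enum inE.
Qed.

Definition shuffle_sign (m : nat) (J : {set 'I_m}) : bool :=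
  odd_perm (perm (@shuffle_fun_inj m J)).

(* The data of a two-vertex tree x(.., y(..), ..) with n inputs: [u] labels the
   inputs of x, the value None marking the input into which the output of y
   (of colour [e]) is grafted, and [v] labels the inputs of y.  Together the
   labels must exhaust 'I_n without repetition, and all colours must match. *)
Record grafting (p q n : nat) (a : 'I_p -> colour) (e : colour)
    (b : 'I_q -> colour) (z : 'I_n -> colour)
    (u : 'I_p -> option 'I_n) (v : 'I_q -> 'I_n) : Prop := Grafting {
  grafting_slot : exists! i, u i = None;
  grafting_slot_colour : forall i, u i = None -> a i = e;
  grafting_outer_colour : forall i l, u i = Some l -> a i = z l;
  grafting_inner_colour : forall j, b j = z (v j);
  grafting_labels : forall l : 'I_n, exists! w : 'I_p + 'I_q,
    match w with inl i => u i | inr j => Some (v j) end = Some l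
}.

(* Unital symmetric 2-coloured operads in Z-graded K-vector spaces, presented by
   partial compositions.  [op_ob c a d] is the degree d part of the space of
   operations with output colour c and inputs 0, .., n-1 of colours a.
   [op_act b s x] is x with its i-th input renamed s i, for a colouring b of
   the new inputs.  [op_comp z d u v x y] is the two-vertex tree
   x(.., y(..), ..), x preceding y, with inputs labelled as in [grafting].
   Both operations are total functions; their values are meaningful (and
   constrained up to linearity) only when colours, labels and degrees match.
   With labelled inputs no block permutations occur in the axioms, and the only
   Koszul sign is that of parallel composition. *)
Record operad (K : fieldType) := Operad {
  op_ob :> colour -> forall n : nat, ('I_n -> colour) -> int -> lmodType K;
  op_id : forall c, op_ob c (fun _ : 'I_1 => c) 0;
  op_act : forall c n (a b : 'I_n -> colour) d,
    'S_n -> op_ob c a d -> op_ob c b d;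
  op_comp : forall c e p q n (a : 'I_p -> colour) (b : 'I_q -> colour)
    (z : 'I_n -> colour) (d1 d2 d : int),
    ('I_p -> option 'I_n) -> ('I_q -> 'I_n) ->
    op_ob c a d1 -> op_ob e b d2 -> op_ob c z d;
  op_act_linear : forall c n (a b : 'I_n -> colour) d (s : 'S_n) k
    (x y : op_ob c a d),
    op_act b s (k *: x + y) = k *: op_act b s x + op_act b s y;
  op_comp_linearl : forall c e p q n (a : 'I_p -> colour) (b : 'I_q -> colour)
    (z : 'I_n -> colour) d1 d2 d u v k
    (x x' : op_ob c a d1) (y : op_ob e b d2),
    op_comp z d u v (k *: x + x') y
    = k *: op_comp z d u v x y + op_comp z d u v x' y;
  op_comp_linearr : forall c e p q n (a : 'I_p -> colour) (b : 'I_q -> colour)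
    (z : 'I_n -> colour) d1 d2 d u v k
    (x : op_ob c a d1) (y y' : op_ob e b d2),
    op_comp z d u v x (k *: y + y')
    = k *: op_comp z d u v x y + op_comp z d u v x y';
  op_act1 : forall c n (a : 'I_n -> colour) d (x : op_ob c a d),
    op_act a 1%g x = x;
  op_actM : forall c n (a b b' : 'I_n -> colour) d (s t : 'S_n)
    (x : op_ob c a d),
    (forall i, b (s i) = a i) -> (forall i, b' (t i) = b i) ->
    op_act b' t (op_act b s x) = op_act b' (s * t)%g x;
  op_act_comp : forall c e p q n (a : 'I_p -> colour) (b : 'I_q -> colour)
    (z z' : 'I_n -> colour) d1 d2 d u v (s : 'S_n)
    (x : op_ob c a d1) (y : op_ob e b d2),
    grafting a e b z u v -> d = d1 + d2 -> (forall i, z' (s i) = z i) ->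
    op_act z' s (op_comp z d u v x y) = op_comp z' d (omap s \o u) (s \o v) x y;
  op_comp_actl : forall c e p q n (a a' : 'I_p -> colour)
    (b : 'I_q -> colour) (z : 'I_n -> colour) d1 d2 d u v (s : 'S_p)
    (x : op_ob c a d1) (y : op_ob e b d2),
    grafting a' e b z u v -> d = d1 + d2 -> (forall i, a' (s i) = a i) ->
    op_comp z d u v (op_act a' s x) y = op_comp z d (u \o s) v x y;
  op_comp_actr : forall c e p q n (a : 'I_p -> colour)
    (b b' : 'I_q -> colour) (z : 'I_n -> colour) d1 d2 d u v (s : 'S_q)
    (x : op_ob c a d1) (y : op_ob e b d2),
    grafting a e b' z u v -> d = d1 + d2 -> (forall i, b' (s i) = b i) ->
    op_comp z d u v x (op_act b' s y) = op_comp z d u (v \o s) x y;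
  op_comp_idl : forall c n (a z : 'I_n -> colour) d (s : 'S_n)
    (x : op_ob c a d),
    (forall i, z (s i) = a i) ->
    op_comp z d (fun _ : 'I_1 => None) s (op_id c) x = op_act z s x;
  op_comp_idr : forall c e n (a z : 'I_n -> colour) d u v (s : 'S_n)
    (x : op_ob c a d),
    grafting a e (fun _ : 'I_1 => e) z u v ->
    (forall i, odflt (v ord0) (u i) = s i) ->
    op_comp z d u v x (op_id e) = op_act z s x;
  op_comp_sequential : forall c e g p q r m m' n
    (a : 'I_p -> colour) (b : 'I_q -> colour) (b' : 'I_r -> colour)
    (w : 'I_m -> colour) (w' : 'I_m' -> colour) (z : 'I_n -> colour)
    d1 d2 d3 d12 d23 d u1 v1 u2 v2 u3 v3 u4 v4
    (x : op_ob c a d1) (y : op_ob e b d2) (t : op_ob g b' d3),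
    grafting a e b w u1 v1 -> grafting w g b' z u2 v2 ->
    grafting b g b' w' u3 v3 -> grafting a e w' z u4 v4 ->
    d12 = d1 + d2 -> d23 = d2 + d3 -> d = d1 + d2 + d3 ->
    obind u2 \o u1 =1 u4 -> u2 \o v1 =1 omap v4 \o u3 -> v2 =1 v4 \o v3 ->
    op_comp z d u2 v2 (op_comp w d12 u1 v1 x y) t
    = op_comp z d u4 v4 x (op_comp w' d23 u3 v3 y t);
  op_comp_parallel : forall c e g p q r m m' n
    (a : 'I_p -> colour) (b : 'I_q -> colour) (b' : 'I_r -> colour)
    (w : 'I_m -> colour) (w' : 'I_m' -> colour) (z : 'I_n -> colour)
    d1 d2 d3 d12 d13 d u1 v1 u2 v2 u3 v3 u4 v4
    (x : op_ob c a d1) (y : op_ob e b d2) (t : op_ob g b' d3),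
    grafting a e b w u1 v1 -> grafting w g b' z u2 v2 ->
    grafting a g b' w' u3 v3 -> grafting w' e b z u4 v4 ->
    d12 = d1 + d2 -> d13 = d1 + d3 -> d = d1 + d2 + d3 ->
    (forall i, u1 i = None -> u3 i <> None) ->
    obind u2 \o u1 =1 obind u4 \o u3 ->
    u2 \o v1 =1 Some \o v4 -> Some \o v2 =1 u4 \o v3 ->
    op_comp z d u2 v2 (op_comp w d12 u1 v1 x y) t
    = (-1) ^ (d2 * d3) *: op_comp z d u4 v4 (op_comp w' d13 u3 v3 x t) y
}.
Arguments op_ob {K} _ c {n} a d.
Arguments op_id {K} _ c.
Arguments op_act {K _ c n a} b {d} s x.
Arguments op_comp {K _ c e p q n a b} z {d1 d2} d u v x y.

Record is_morphism (K : fieldType) (P Q : operad K)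
    (phi : forall c n (a : 'I_n -> colour) d, P c n a d -> Q c n a d) : Prop :=
  IsMorphism {
  mor_linear : forall c n (a : 'I_n -> colour) d k (x y : P c n a d),
    phi _ _ _ _ (k *: x + y) = k *: phi _ _ _ _ x + phi _ _ _ _ y;
  mor_id : forall c, phi _ _ _ _ (op_id P c) = op_id Q c;
  mor_act : forall c n (a b : 'I_n -> colour) d (s : 'S_n) (x : P c n a d),
    (forall i, b (s i) = a i) ->
    phi _ _ _ _ (op_act b s x) = op_act b s (phi _ _ _ _ x);
  mor_comp : forall c e p q n (a : 'I_p -> colour) (b : 'I_q -> colour)
    (z : 'I_n -> colour) d1 d2 d u v (x : P c p a d1) (y : P e q b d2),
    grafting a e b z u v -> d = d1 + d2 ->
    phi _ _ _ _ (op_comp z d u v x y)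
    = op_comp z d u v (phi _ _ _ _ x) (phi _ _ _ _ y)
}.

(* Generating corollas.  A corolla is always meant to be skewsymmetric in its
   straight inputs and symmetric in its wavy inputs, see [corolla_symmetric]. *)
Record corollas := Corollas {
  cor :> Type;
  cor_out : cor -> colour;
  cor_arity : cor -> nat;
  cor_in : forall g : cor, 'I_(cor_arity g) -> colour;
  cor_deg : cor -> int
}.

Definition corolla_symmetric (K : fieldType) (P : operad K) c n
    (a : 'I_n -> colour) d (x : P c n a d) : Prop :=
  forall i j : 'I_n, i <> j -> a i = a j ->
    op_act a (tperm i j) x = if a i is straight then - x else x.

Definition realization (K : fieldType) (G : corollas) (P : operad K) : Type :=
  forall g : G, P (cor_out g) _ (@cor_in G g) (cor_deg g).

Definition relations (K : fieldType) (G : corollas) : Type :=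
  forall P : operad K, realization G P -> Prop.

Definition is_model (K : fieldType) (G : corollas) (R : relations K G)
    (P : operad K) (p : realization G P) : Prop :=
  (forall g, corolla_symmetric (p g)) /\ R P p.

Definition presented_by (K : fieldType) (G : corollas) (R : relations K G)
    (P : operad K) (p : realization G P) : Prop :=
  is_model R p /\
  forall (Q : operad K) (q : realization G Q), is_model R q ->
    exists phi : forall c n (a : 'I_n -> colour) d, P c n a d -> Q c n a d,
      [/\ is_morphism phi, forall g, phi _ _ _ _ (p g) = q g
        & forall psi : (forall c n (a : 'I_n -> colour) d,
                         P c n a d -> Q c n a d),
            is_morphism psi -> (forall g, psi _ _ _ _ (p g) = q g) ->
            forall c n (a : 'I_n -> colour) d (x : P c n a d),
              psi _ _ _ _ x = phi _ _ _ _ x].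

Definition no_relations (K : fieldType) (G : corollas) : relations K G :=
  fun _ _ => True.

Definition free_on (K : fieldType) (G : corollas) (P : operad K)
    (p : realization G P) : Prop :=
  presented_by (no_relations (G := G)) p.

(* Construction of the operad with generators G and relations R: formal operadic
   expressions in the generators, two of them being identified when they take
   the same value in every operad with a realization of G satisfying R. *)
Section Presentation.
Variables (K : fieldType) (G : corollas) (R : relations K G).

Inductive expr : colour -> forall n, ('I_n -> colour) -> int -> Type :=
| Egen (g : G) : expr (cor_out g) (@cor_in G g) (cor_deg g)
| Eid c : expr c (fun _ : 'I_1 => c) 0
| Eact c n (a b : 'I_n -> colour) d (s : 'S_n)
    of (forall i, b (s i) = a i) & expr c a d : expr c b d
| Ecomp c e p q n (a : 'I_p -> colour) (b : 'I_q -> colour)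
    (z : 'I_n -> colour) d1 d2 d u v
    of grafting a e b z u v & d = d1 + d2 & expr c a d1 & expr e b d2 :
    expr c z d
| Ezero c n (a : 'I_n -> colour) d : expr c a d
| Elin c n (a : 'I_n -> colour) d of K & expr c a d & expr c a d : expr c a d.

Fixpoint value (Q : operad K) (q : realization G Q) c n (a : 'I_n -> colour) d
    (t : expr c a d) : Q c n a d :=
  match t in @expr c0 n0 a0 d0 return Q c0 n0 a0 d0 with
  | Egen g => q g
  | Eid c => op_id Q c
  | @Eact _ _ _ b _ s _ t => op_act b s (value q t)
  | @Ecomp _ _ _ _ _ _ _ z _ _ d u v _ _ t t' =>
      op_comp z d u v (value q t) (value q t')
  | Ezero _ _ _ _ => 0
  | Elin _ _ _ _ k t t' => k *: value q t + value q t'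
  end.

Definition same_value c n (a : 'I_n -> colour) d (t t' : expr c a d) : Prop :=
  forall (Q : operad K) (q : realization G Q), is_model R q ->
    value q t = value q t'.

Section Carrier.
Variables (c : colour) (n : nat) (a : 'I_n -> colour) (d : int).

HB.instance Definition _ := gen_eqMixin (expr c a d).
HB.instance Definition _ := gen_choiceMixin (expr c a d).

Definition same_valueb (t t' : expr c a d) : bool := `[< same_value t t' >].

Lemma same_value_refl : reflexive same_valueb.
Proof. by move=> t; apply/asboolP. Qed.

Lemma same_value_sym : symmetric same_valueb.
Proof.
by move=> t t'; apply/asboolP/asboolP => h Q q hq; rewrite h.
Qed.

Lemma same_value_trans : transitive same_valueb.
Proof.
move=> t2 t1 t3 /asboolP h /asboolP h'; apply/asboolP => Q q hq.
by rewrite h // h'.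
Qed.

Canonical same_value_equiv :=
  EquivRel same_valueb same_value_refl same_value_sym same_value_trans.

Definition pres_ob := {eq_quot same_valueb}.

HB.instance Definition _ := Choice.on pres_ob.

Definition cls (t : expr c a d) : pres_ob := \pi_{eq_quot same_valueb} t.

Definition qvalue (Q : operad K) (q : realization G Q) (x : pres_ob) :
  Q c n a d := value q (repr x).

Lemma qvalue_cls (Q : operad K) (q : realization G Q) (t : expr c a d) :
  is_model R q -> qvalue q (cls t) = value q t.
Proof.
move=> hq; rewrite /qvalue.
have /eqmodP/asboolP h : repr (cls t) = t %[mod {eq_quot same_valueb}].
  by rewrite reprK.
exact: h.
Qed.

Lemma qvalue_inj (x y : pres_ob) :
  (forall (Q : operad K) (q : realization G Q), is_model R q ->
     qvalue q x = qvalue q y) -> x = y.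
Proof.
move=> h; rewrite -[x]reprK -[y]reprK; apply/eqmodP/asboolP => Q q hq.
exact: h.
Qed.

Let zero : pres_ob := cls (Ezero c a d).
Let add (x y : pres_ob) := cls (Elin 1 (repr x) (repr y)).
Let opp (x : pres_ob) := cls (Elin (-1) (repr x) (Ezero c a d)).
Let scale (k : K) (x : pres_ob) := cls (Elin k (repr x) (Ezero c a d)).

Section Val.
Variables (Q : operad K) (q : realization G Q).
Hypothesis hq : is_model R q.
Let val0 : qvalue q zero = 0. Proof. by rewrite qvalue_cls. Qed.
Let valD x y : qvalue q (add x y) = qvalue q x + qvalue q y.
Proof. by rewrite qvalue_cls //= scale1r. Qed.
Let valN x : qvalue q (opp x) = - qvalue q x.
Proof. by rewrite qvalue_cls //= scaleN1r addr0. Qed.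
Let valZ k x : qvalue q (scale k x) = k *: qvalue q x.
Proof. by rewrite qvalue_cls //= addr0. Qed.
Definition valE := (val0, valD, valN, valZ).
End Val.

Let addA : associative add.
Proof. by move=> x y t; apply: qvalue_inj => Q q hq; rewrite !valE // addrA. Qed.
Let addC : commutative add.
Proof. by move=> x y; apply: qvalue_inj => Q q hq; rewrite !valE // addrC. Qed.
Let add0 : left_id zero add.
Proof. by move=> x; apply: qvalue_inj => Q q hq; rewrite !valE // add0r. Qed.
Let addN : left_inverse zero opp add.
Proof. by move=> x; apply: qvalue_inj => Q q hq; rewrite !valE // addNr. Qed.

HB.instance Definition _ := GRing.isZmodule.Build pres_ob addA addC add0 addN.

Let scaleA k l x : scale k (scale l x) = scale (k * l) x.
Proof. by apply: qvalue_inj => Q q hq; rewrite !valE // scalerA. Qed.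
Let scale1 : left_id 1 scale.
Proof. by move=> x; apply: qvalue_inj => Q q hq; rewrite !valE // scale1r. Qed.
Let scaleDr : right_distributive scale +%R.
Proof.
by move=> k x y; apply: qvalue_inj => Q q hq; rewrite !valE // scalerDr.
Qed.
Let scaleDl x : {morph scale^~ x : k l / k + l}.
Proof.
by move=> k l; apply: qvalue_inj => Q q hq; rewrite !valE // scalerDl.
Qed.

HB.instance Definition _ :=
  GRing.Zmodule_isLmodule.Build K pres_ob scaleA scale1 scaleDr scaleDl.

Section Linear.
Variables (Q : operad K) (q : realization G Q).
Hypothesis hq : is_model R q.
Lemma qvalue0 : qvalue q 0 = 0. Proof. by rewrite valE. Qed.
Lemma qvalueD x y : qvalue q (x + y) = qvalue q x + qvalue q y.
Proof. by rewrite valE. Qed.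
Lemma qvalueN x : qvalue q (- x) = - qvalue q x.
Proof. by rewrite valE. Qed.
Lemma qvalueZ k x : qvalue q (k *: x) = k *: qvalue q x.
Proof. by rewrite valE. Qed.
Lemma qvalue_sum (I : Type) (r : seq I) (P : pred I) (F : I -> pres_ob) :
  qvalue q (\sum_(i <- r | P i) F i) = \sum_(i <- r | P i) qvalue q (F i).
Proof. exact: (big_morph _ qvalueD qvalue0). Qed.
End Linear.

End Carrier.

Definition pres_act c n (a b : 'I_n -> colour) d (s : 'S_n)
    (x : pres_ob c a d) : pres_ob c b d :=
  match pselect (forall i, b (s i) = a i) with
  | left h => cls (Eact h (repr x))
  | right _ => 0
  end.

Definition pres_comp c e p q n (a : 'I_p -> colour) (b : 'I_q -> colour)
    (z : 'I_n -> colour) d1 d2 d u v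
    (x : pres_ob c a d1) (y : pres_ob e b d2) : pres_ob c z d :=
  match pselect (grafting a e b z u v), pselect (d = d1 + d2) with
  | left h, left h' => cls (Ecomp h h' (repr x) (repr y))
  | _, _ => 0
  end.

Definition pres_id c : pres_ob c (fun _ : 'I_1 => c) 0 := cls (Eid c).

Section ValOps.
Variables (Q : operad K) (q : realization G Q).
Hypothesis hq : is_model R q.

Lemma qvalue_id c : qvalue q (pres_id c) = op_id Q c.
Proof. by rewrite qvalue_cls. Qed.

Lemma qvalue_act c n (a b : 'I_n -> colour) d (s : 'S_n) (x : pres_ob c a d) :
  (forall i, b (s i) = a i) -> qvalue q (pres_act b s x) = op_act b s (qvalue q x).
Proof.
by rewrite /pres_act; case: pselect => // h _; rewrite qvalue_cls.
Qed.

Lemma qvalue_comp c e p r n (a : 'I_p -> colour) (b : 'I_r -> colour)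
    (z : 'I_n -> colour) d1 d2 d u v
    (x : pres_ob c a d1) (y : pres_ob e b d2) :
  grafting a e b z u v -> d = d1 + d2 ->
  qvalue q (pres_comp z d u v x y) = op_comp z d u v (qvalue q x) (qvalue q y).
Proof.
rewrite /pres_comp; case: pselect => // h _.
by case: pselect => // h' _; rewrite qvalue_cls.
Qed.
End ValOps.

Lemma pres_act_linear c n (a b : 'I_n -> colour) d (s : 'S_n) k
    (x y : pres_ob c a d) :
  pres_act b s (k *: x + y) = k *: pres_act b s x + pres_act b s y.
Proof.
case: (pselect (forall i, b (s i) = a i)) => h; last first.
  by rewrite /pres_act; case: pselect => // _; rewrite scaler0 addr0.
apply: qvalue_inj => Q q hq.
by rewrite !(qvalueD, qvalueZ, qvalue_act) // op_act_linear.
Qed.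

Lemma pres_comp_junk c e p q n (a : 'I_p -> colour) (b : 'I_q -> colour)
    (z : 'I_n -> colour) d1 d2 d u v :
  ~ (grafting a e b z u v /\ d = d1 + d2) ->
  forall (x : pres_ob c a d1) (y : pres_ob e b d2), pres_comp z d u v x y = 0.
Proof.
move=> h x y; rewrite /pres_comp.
by case: pselect => // h1; case: pselect => // h2; case: h.
Qed.

Lemma pres_comp_linearl c e p q n (a : 'I_p -> colour) (b : 'I_q -> colour)
    (z : 'I_n -> colour) d1 d2 d u v k
    (x x' : pres_ob c a d1) (y : pres_ob e b d2) :
  pres_comp z d u v (k *: x + x') y
  = k *: pres_comp z d u v x y + pres_comp z d u v x' y.
Proof.
case: (pselect (grafting a e b z u v /\ d = d1 + d2)) => [[h h']|h]; last first.
  by rewrite !pres_comp_junk // scaler0 addr0.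
apply: qvalue_inj => Q r hr.
by rewrite !(qvalueD, qvalueZ, qvalue_comp) // op_comp_linearl.
Qed.

Lemma pres_comp_linearr c e p q n (a : 'I_p -> colour) (b : 'I_q -> colour)
    (z : 'I_n -> colour) d1 d2 d u v k
    (x : pres_ob c a d1) (y y' : pres_ob e b d2) :
  pres_comp z d u v x (k *: y + y')
  = k *: pres_comp z d u v x y + pres_comp z d u v x y'.
Proof.
case: (pselect (grafting a e b z u v /\ d = d1 + d2)) => [[h h']|h]; last first.
  by rewrite !pres_comp_junk // scaler0 addr0.
apply: qvalue_inj => Q r hr.
by rewrite !(qvalueD, qvalueZ, qvalue_comp) // op_comp_linearr.
Qed.


Section Laws.
Local Notation ext := qvalue_inj.
Local Notation pact := pres_act.
Local Notation pcomp := pres_comp.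

Lemma pres_act1 c n (a : 'I_n -> colour) d (x : pres_ob c a d) :
  pact a 1%g x = x.
Proof.
apply: ext => Q r hr; rewrite qvalue_act ?op_act1 // => i.
by rewrite perm1.
Qed.

Lemma pres_actM c n (a b b' : 'I_n -> colour) d (s t : 'S_n)
    (x : pres_ob c a d) :
  (forall i, b (s i) = a i) -> (forall i, b' (t i) = b i) ->
  pact b' t (pact b s x) = pact b' (s * t)%g x.
Proof.
move=> hs ht; apply: ext => Q r hr.
by rewrite !qvalue_act ?op_actM // => i; rewrite permM ht.
Qed.

Lemma grafting_rename p q n (a : 'I_p -> colour) e (b : 'I_q -> colour)
    (z z' : 'I_n -> colour) u v (s : 'S_n) :
  grafting a e b z u v -> (forall i, z' (s i) = z i) ->
  grafting a e b z' (omap s \o u) (s \o v).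
Proof.
move=> [[i0 [hi0 ui0]] h1 h2 h3 h4] hz; split.
- exists i0; split=> [|i]; first by rewrite /= hi0.
  by move=> /= hi; apply: ui0; case: (u i) hi.
- by move=> i /= hi; apply: h1; case: (u i) hi.
- move=> i l /=; case E: (u i) => [l'|] //= [<-].
  by rewrite hz; apply: h2.
- by move=> j /=; rewrite hz.
- move=> l; have [w [hw uw]] := h4 (s^-1 l)%g; exists w; split.
    by case: w hw {uw} => [i|j] /= => [->|[->]] /=; rewrite permKV.
  move=> w' hw'; apply: uw; case: w' hw' => [i|j] /=.
    by case: (u i) => //= l' [<-]; rewrite permK.
  by move=> [<-]; rewrite permK.
Qed.

Lemma grafting_actl p q n (a a' : 'I_p -> colour) e (b : 'I_q -> colour)
    (z : 'I_n -> colour) u v (s : 'S_p) :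
  grafting a' e b z u v -> (forall i, a' (s i) = a i) ->
  grafting a e b z (u \o s) v.
Proof.
move=> [[i0 [hi0 ui0]] h1 h2 h3 h4] ha; split=> //.
- exists (s^-1 i0)%g; split=> [|i /= /ui0 ->]; last by rewrite permK.
  by rewrite /= permKV.
- by move=> i /= /h1 <-.
- by move=> i l /= /h2 <-.
- move=> l; have [w [hw uw]] := h4 l.
  exists (match w with inl i => inl (s^-1 i)%g | inr j => inr j end); split.
    by case: w hw {uw} => [i|j] //=; rewrite permKV.
  case=> [i|j] /= hi; first by rewrite (uw (inl (s i))) //= permK.
  by rewrite (uw (inr j)).
Qed.

Lemma grafting_actr p q n (a : 'I_p -> colour) e (b b' : 'I_q -> colour)
    (z : 'I_n -> colour) u v (s : 'S_q) :
  grafting a e b' z u v -> (forall i, b' (s i) = b i) ->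
  grafting a e b z u (v \o s).
Proof.
move=> [hs h1 h2 h3 h4] hb; split=> //.
- by move=> j /=; rewrite -h3.
- move=> l; have [w [hw uw]] := h4 l.
  exists (match w with inl i => inl i | inr j => inr (s^-1 j)%g end); split.
    by case: w hw {uw} => [i|j] //=; rewrite permKV.
  case=> [i|j] /= hi; first by rewrite (uw (inl i)).
  by rewrite (uw (inr (s j))) //= permK.
Qed.

Lemma grafting_idl c n (a z : 'I_n -> colour) (s : 'S_n) :
  (forall i, z (s i) = a i) ->
  grafting (fun _ : 'I_1 => c) c a z (fun _ => None) s.
Proof.
move=> hz; split=> //.
  by exists ord0; split=> // i _; rewrite (ord1 i).
move=> l; exists (inr (s^-1 l)%g); split; first by rewrite permKV.
by case=> [//|j] [<-]; rewrite permK.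
Qed.

Lemma grafting_idr e n (a z : 'I_n -> colour) u v (s : 'S_n) :
  grafting a e (fun _ : 'I_1 => e) z u v ->
  (forall i, odflt (v ord0) (u i) = s i) -> forall i, z (s i) = a i.
Proof.
move=> [_ h1 h2 h3 _] hs i; rewrite -hs.
case E: (u i) => [l|] /=; first by rewrite (h2 _ _ E).
by rewrite (h1 _ E) -h3.
Qed.

Lemma pres_act_comp c e p q n (a : 'I_p -> colour) (b : 'I_q -> colour)
    (z z' : 'I_n -> colour) d1 d2 d u v (s : 'S_n)
    (x : pres_ob c a d1) (y : pres_ob e b d2) :
  grafting a e b z u v -> d = d1 + d2 -> (forall i, z' (s i) = z i) ->
  pact z' s (pcomp z d u v x y) = pcomp z' d (omap s \o u) (s \o v) x y.
Proof.
move=> h hd hz; apply: ext => Q r hr.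
rewrite qvalue_act // !qvalue_comp //; last exact: grafting_rename h hz.
exact: op_act_comp.
Qed.

Lemma pres_comp_actl c e p q n (a a' : 'I_p -> colour)
    (b : 'I_q -> colour) (z : 'I_n -> colour) d1 d2 d u v (s : 'S_p)
    (x : pres_ob c a d1) (y : pres_ob e b d2) :
  grafting a' e b z u v -> d = d1 + d2 -> (forall i, a' (s i) = a i) ->
  pcomp z d u v (pact a' s x) y = pcomp z d (u \o s) v x y.
Proof.
move=> h hd ha; apply: ext => Q r hr.
rewrite !qvalue_comp ?qvalue_act //; last exact: grafting_actl h ha.
exact: op_comp_actl.
Qed.

Lemma pres_comp_actr c e p q n (a : 'I_p -> colour)
    (b b' : 'I_q -> colour) (z : 'I_n -> colour) d1 d2 d u v (s : 'S_q)
    (x : pres_ob c a d1) (y : pres_ob e b d2) :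
  grafting a e b' z u v -> d = d1 + d2 -> (forall i, b' (s i) = b i) ->
  pcomp z d u v x (pact b' s y) = pcomp z d u (v \o s) x y.
Proof.
move=> h hd hb; apply: ext => Q r hr.
rewrite !qvalue_comp ?qvalue_act //; last exact: grafting_actr h hb.
exact: op_comp_actr.
Qed.

Lemma pres_comp_idl c n (a z : 'I_n -> colour) d (s : 'S_n)
    (x : pres_ob c a d) :
  (forall i, z (s i) = a i) ->
  pcomp z d (fun _ : 'I_1 => None) s (pres_id c) x = pact z s x.
Proof.
move=> hz; apply: ext => Q r hr.
rewrite qvalue_comp ?add0r ?qvalue_id ?qvalue_act //; last exact: grafting_idl.
exact: op_comp_idl.
Qed.

Lemma pres_comp_idr c e n (a z : 'I_n -> colour) d u v (s : 'S_n)
    (x : pres_ob c a d) :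
  grafting a e (fun _ : 'I_1 => e) z u v ->
  (forall i, odflt (v ord0) (u i) = s i) ->
  pcomp z d u v x (pres_id e) = pact z s x.
Proof.
move=> h hs; apply: ext => Q r hr.
rewrite qvalue_comp ?addr0 ?qvalue_id ?qvalue_act //; last exact: grafting_idr h hs.
exact: op_comp_idr.
Qed.

Lemma pres_comp_sequential c e g p q r m m' n
    (a : 'I_p -> colour) (b : 'I_q -> colour) (b' : 'I_r -> colour)
    (w : 'I_m -> colour) (w' : 'I_m' -> colour) (z : 'I_n -> colour)
    d1 d2 d3 d12 d23 d u1 v1 u2 v2 u3 v3 u4 v4
    (x : pres_ob c a d1) (y : pres_ob e b d2) (t : pres_ob g b' d3) :
  grafting a e b w u1 v1 -> grafting w g b' z u2 v2 ->
  grafting b g b' w' u3 v3 -> grafting a e w' z u4 v4 ->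
  d12 = d1 + d2 -> d23 = d2 + d3 -> d = d1 + d2 + d3 ->
  obind u2 \o u1 =1 u4 -> u2 \o v1 =1 omap v4 \o u3 -> v2 =1 v4 \o v3 ->
  pcomp z d u2 v2 (pcomp w d12 u1 v1 x y) t
  = pcomp z d u4 v4 x (pcomp w' d23 u3 v3 y t).
Proof.
move=> h1 h2 h3 h4 e12 e23 ed k1 k2 k3; apply: ext => Q s hs.
have ed' : d = d12 + d3 by rewrite e12.
have ed'' : d = d1 + d23 by rewrite e23 addrA.
by rewrite !qvalue_comp //; apply: op_comp_sequential.
Qed.

Lemma pres_comp_parallel c e g p q r m m' n
    (a : 'I_p -> colour) (b : 'I_q -> colour) (b' : 'I_r -> colour)
    (w : 'I_m -> colour) (w' : 'I_m' -> colour) (z : 'I_n -> colour)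
    d1 d2 d3 d12 d13 d u1 v1 u2 v2 u3 v3 u4 v4
    (x : pres_ob c a d1) (y : pres_ob e b d2) (t : pres_ob g b' d3) :
  grafting a e b w u1 v1 -> grafting w g b' z u2 v2 ->
  grafting a g b' w' u3 v3 -> grafting w' e b z u4 v4 ->
  d12 = d1 + d2 -> d13 = d1 + d3 -> d = d1 + d2 + d3 ->
  (forall i, u1 i = None -> u3 i <> None) ->
  obind u2 \o u1 =1 obind u4 \o u3 ->
  u2 \o v1 =1 Some \o v4 -> Some \o v2 =1 u4 \o v3 ->
  pcomp z d u2 v2 (pcomp w d12 u1 v1 x y) t
  = (-1) ^ (d2 * d3) *: pcomp z d u4 v4 (pcomp w' d13 u3 v3 x t) y.
Proof.
move=> h1 h2 h3 h4 e12 e13 ed k0 k1 k2 k3; apply: ext => Q s hs.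
have ed' : d = d12 + d3 by rewrite e12.
have ed'' : d = d13 + d2 by rewrite e13 addrAC.
by rewrite qvalueZ // !qvalue_comp //; apply: op_comp_parallel.
Qed.

End Laws.

Definition presented : operad K :=
  Operad pres_act_linear pres_comp_linearl pres_comp_linearr
    pres_act1 pres_actM pres_act_comp pres_comp_actl pres_comp_actr
    pres_comp_idl pres_comp_idr pres_comp_sequential pres_comp_parallel.

Definition pres_gen : realization G presented := fun g => cls (Egen g).

Lemma qvalue_gen (Q : operad K) (q : realization G Q) (g : G) :
  is_model R q -> qvalue q (pres_gen g) = q g.
Proof. by move=> hq; rewrite qvalue_cls. Qed.

Lemma qvalue_morphism (Q : operad K) (q : realization G Q) :
  is_model R q ->
  is_morphism (fun c n (a : 'I_n -> colour) d (x : presented c n a d) =>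
    qvalue q x).
Proof.
move=> hq; split.
- by move=> *; rewrite qvalueD // qvalueZ.
- by move=> *; rewrite qvalue_id.
- by move=> *; rewrite qvalue_act.
- by move=> *; rewrite qvalue_comp.
Qed.

Lemma pres_gen_symmetric g : corolla_symmetric (pres_gen g).
Proof.
move=> i j ij aij; apply: qvalue_inj => Q q hq.
have hs k : cor_in (tperm i j k) = cor_in k by case: tpermP => // ->.
rewrite qvalue_act // qvalue_gen // (hq.1 g i j ij aij).
by case: (cor_in i); rewrite ?qvalueN // qvalue_gen.
Qed.

Lemma morphism_value (Q : operad K) (q : realization G Q)
    (psi : forall c n (a : 'I_n -> colour) d, presented c n a d -> Q c n a d) :
  is_morphism psi -> (forall g, psi _ _ _ _ (pres_gen g) = q g) ->
  forall c n (a : 'I_n -> colour) d (x : expr c a d),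
    psi _ _ _ _ (cls x : presented c n a d) = value q x.
Proof.
move=> hpsi hgen c n a d; elim=> {c n a d} /=.
- exact: hgen.
- by move=> c; rewrite -(mor_id hpsi).
- move=> c n a b d s h x <-; rewrite -(mor_act hpsi) //; congr psi.
  by apply: qvalue_inj => Q' q' hq; rewrite qvalue_act // !qvalue_cls.
- move=> c e p r n a b z d1 d2 d u v h h' x <- y <-.
  rewrite -(mor_comp hpsi) //; congr psi.
  by apply: qvalue_inj => Q' q' hq; rewrite qvalue_comp // !qvalue_cls.
- move=> c n a d.
  have -> : cls (Ezero c a d) = 0 :> presented c n a d.
    by apply: qvalue_inj => Q' q' hq; rewrite qvalue_cls // qvalue0.
  have -> : 0 = -1 *: 0 + 0 :> presented c n a d by rewrite scaler0 addr0.
  by rewrite (mor_linear hpsi) scaleN1r addNr.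
- move=> c n a d k x <- y <-; rewrite -(mor_linear hpsi); congr psi.
  apply: qvalue_inj => Q' q' hq.
  by rewrite qvalueD // qvalueZ // !qvalue_cls.
Qed.

Lemma presented_universal :
  R pres_gen -> presented_by R pres_gen.
Proof.
move=> hR; split=> [|Q q hq]; first by split; first exact: pres_gen_symmetric.
exists (fun c n a d (x : presented c n a d) => qvalue q x); split.
- exact: qvalue_morphism.
- by move=> g; rewrite qvalue_gen.
- move=> psi hpsi hgen c n a d x.
  have -> : x = cls (repr x) by rewrite /cls reprK.
  by rewrite (morphism_value hpsi hgen) qvalue_cls.
Qed.

End Presentation.

Section Differentials.
Variable K : fieldType.

(* A degree 1 derivation of square zero. *)
Record is_differential (P : operad K)
    (delta : forall c n (a : 'I_n -> colour) d, P c n a d -> P c n a (d + 1)) :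
    Prop := IsDifferential {
  diff_linear : forall c n (a : 'I_n -> colour) d k (x y : P c n a d),
    delta _ _ _ _ (k *: x + y) = k *: delta _ _ _ _ x + delta _ _ _ _ y;
  diff_square : forall c n (a : 'I_n -> colour) d (x : P c n a d),
    delta _ _ _ _ (delta _ _ _ _ x) = 0;
  diff_act : forall c n (a b : 'I_n -> colour) d (s : 'S_n) (x : P c n a d),
    (forall i, b (s i) = a i) ->
    delta _ _ _ _ (op_act b s x) = op_act b s (delta _ _ _ _ x);
  diff_comp : forall c e p q n (a : 'I_p -> colour) (b : 'I_q -> colour)
    (z : 'I_n -> colour) d1 d2 d u v (x : P c p a d1) (y : P e q b d2),
    grafting a e b z u v -> d = d1 + d2 ->
    delta _ _ _ _ (op_comp z d u v x y)
    = op_comp z (d + 1) u v (delta _ _ _ _ x) y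
      + (-1) ^ d1 *: op_comp z (d + 1) u v x (delta _ _ _ _ y)
}.

Definition zero_differential (P : operad K) c n (a : 'I_n -> colour) d
  (x : P c n a d) : P c n a (d + 1) := 0.

Definition is_dg_morphism (P Q : operad K)
    (deltaP : forall c n (a : 'I_n -> colour) d, P c n a d -> P c n a (d + 1))
    (deltaQ : forall c n (a : 'I_n -> colour) d, Q c n a d -> Q c n a (d + 1))
    (phi : forall c n (a : 'I_n -> colour) d, P c n a d -> Q c n a d) : Prop :=
  is_morphism phi /\
  forall c n (a : 'I_n -> colour) d (x : P c n a d),
    phi _ _ _ _ (deltaP _ _ _ _ x) = deltaQ _ _ _ _ (phi _ _ _ _ x).

Definition is_epi (P Q : operad K)
    (phi : forall c n (a : 'I_n -> colour) d, P c n a d -> Q c n a d) : Prop :=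
  forall c n (a : 'I_n -> colour) d (y : Q c n a d), exists x, phi _ _ _ _ x = y.

(* Injectivity and surjectivity on cohomology in degree d + 1. *)
Definition is_quasi_iso (P Q : operad K)
    (deltaP : forall c n (a : 'I_n -> colour) d, P c n a d -> P c n a (d + 1))
    (deltaQ : forall c n (a : 'I_n -> colour) d, Q c n a d -> Q c n a (d + 1))
    (phi : forall c n (a : 'I_n -> colour) d, P c n a d -> Q c n a d) : Prop :=
  forall c n (a : 'I_n -> colour) d,
    (forall x : P c n a (d + 1), deltaP _ _ _ _ x = 0 ->
       (exists y : Q c n a d, phi _ _ _ _ x = deltaQ _ _ _ _ y) ->
       exists x' : P c n a d, x = deltaP _ _ _ _ x') /\
    (forall y : Q c n a (d + 1), deltaQ _ _ _ _ y = 0 ->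
       exists (x : P c n a (d + 1)) (y' : Q c n a d),
         deltaP _ _ _ _ x = 0 /\ phi _ _ _ _ x = y + deltaQ _ _ _ _ y').

(* Linear combinations of composites of at least one generator. *)
Inductive augmentation (G : corollas) (P : operad K) (p : realization G P) :
    forall c n (a : 'I_n -> colour) d, P c n a d -> Prop :=
| Aug_gen g : augmentation p (p g)
| Aug_act c n (a b : 'I_n -> colour) d (s : 'S_n) (x : P c n a d) :
    (forall i, b (s i) = a i) -> augmentation p x -> augmentation p (op_act b s x)
| Aug_comp c e k l n (a : 'I_k -> colour) (b : 'I_l -> colour)
    (z : 'I_n -> colour) d1 d2 d u v (x : P c k a d1) (y : P e l b d2) :
    grafting a e b z u v -> d = d1 + d2 ->
    augmentation p x -> augmentation p y ->
    augmentation p (op_comp z d u v x y)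
| Aug_0 c n (a : 'I_n -> colour) d : augmentation p (0 : P c n a d)
| Aug_lin c n (a : 'I_n -> colour) d k (x y : P c n a d) :
    augmentation p x -> augmentation p y -> augmentation p (k *: x + y).

(* Linear combinations of composites of at least two generators. *)
Inductive decomposable (G : corollas) (P : operad K) (p : realization G P) :
    forall c n (a : 'I_n -> colour) d, P c n a d -> Prop :=
| Dec_comp c e k l n (a : 'I_k -> colour) (b : 'I_l -> colour)
    (z : 'I_n -> colour) d1 d2 d u v (x : P c k a d1) (y : P e l b d2) :
    grafting a e b z u v -> d = d1 + d2 ->
    augmentation p x -> augmentation p y ->
    decomposable p (op_comp z d u v x y)
| Dec_0 c n (a : 'I_n -> colour) d : decomposable p (0 : P c n a d)
| Dec_lin c n (a : 'I_n -> colour) d k (x y : P c n a d) :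
    decomposable p x -> decomposable p y -> decomposable p (k *: x + y).

(* (P, delta), with P free on the corollas p, is a minimal resolution of H. *)
Record is_minimal_resolution (H P : operad K) (G : corollas)
    (p : realization G P)
    (delta : forall c n (a : 'I_n -> colour) d, P c n a d -> P c n a (d + 1)) :
    Prop := IsMinimalResolution {
  minres_free : free_on p;
  minres_differential : is_differential delta;
  minres_decomposable : forall g, decomposable p (delta _ _ _ _ (p g));
  minres_projection :
    exists phi : forall c n (a : 'I_n -> colour) d, P c n a d -> H c n a d,
      [/\ is_dg_morphism delta (@zero_differential H) phi, is_epi phi
        & is_quasi_iso delta (@zero_differential H) phi]
}.

End Differentials.

Definition straight_wavy (m n : nat) : 'I_(m + n) -> colour :=
  juxt (fun _ : 'I_m => straight) (fun _ : 'I_n => wavy).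

Definition graft_slot {T : Type} : 'I_1 -> option T := fun _ => None.

Inductive HS_gen := HS_bracket | HS_field of nat.

Definition HS_corollas : corollas :=
  @Corollas HS_gen
    (fun g => match g with HS_bracket => straight | HS_field _ => wavy end)
    (fun g => match g with HS_bracket => 2 | HS_field n => 1 + n end%N)
    (fun g => match g with
              | HS_bracket => fun _ => straight
              | HS_field n => @straight_wavy 1 n end)
    (fun _ => 0).

(* Inputs are numbered from 0: the straight labels 1, 2, 3 are 0, 1, 1 + 1, and
   the wavy label j + 2 of the second relation is the j-th wavy input. *)
Section HSRelations.
Variables (K : fieldType) (P : operad K) (p : realization HS_corollas P).

Let bracket : P straight 2%N (fun _ => straight) 0 := p HS_bracket.
Let F (n : nat) : P wavy (1 + n)%N (@straight_wavy 1 n) 0 := p (HS_field n).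

(* [[i, j], k] *)
Definition HS_double_bracket (i j k : 'I_3) :
    P straight 3%N (fun _ => straight) 0 :=
  op_comp _ _ (tnth [tuple None; Some k]) (tnth [tuple i; j]) bracket bracket.

(* F_n([1, 2]; 3, .., n + 2) *)
Definition HS_field_bracket (n : nat) : P wavy (2 + n)%N (@straight_wavy 2 n) 0 :=
  op_comp _ _ (juxt graft_slot (fun j : 'I_n => Some (rshift 2 j)))
    (fun i : 'I_2 => lshift n i) (F n) bracket.

(* F_{|I2| + 1}(i; F_{|I1|}(j; I1), I2), where I1 = I, I2 = ~: I and i, j are
   two of the straight labels. *)
Definition HS_field_field (n : nat) (i j : 'I_2) (I : {set 'I_n}) :
    P wavy (2 + n)%N (@straight_wavy 2 n) 0 :=
  op_comp _ _
    (juxt (fun _ : 'I_1 => Some (lshift n i))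
       (juxt graft_slot (fun l : 'I_#|~: I| => Some (rshift 2 (enum_val l)))))
    (juxt (fun _ : 'I_1 => lshift n j)
       (fun l : 'I_#|I| => rshift 2 (enum_val l)))
    (F (1 + #|~: I|)%N) (F #|I|).

Definition HS_relations : Prop :=
  HS_double_bracket 0 1 (1 + 1) + HS_double_bracket (1 + 1) 0 1
    + HS_double_bracket 1 (1 + 1) 0 = 0 /\
  forall n : nat,
    HS_field_bracket n
    + \sum_(I : {set 'I_n}) (HS_field_field 0 1 I - HS_field_field 1 0 I) = 0.
End HSRelations.

Section Graftings.

Lemma juxtl T m n (f : 'I_m -> T) (g : 'I_n -> T) i :
  juxt f g (lshift n i) = f i.
Proof. by rewrite /juxt (unsplitK (inl i)). Qed.

Lemma juxtr T m n (f : 'I_m -> T) (g : 'I_n -> T) i :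
  juxt f g (rshift m i) = g i.
Proof. by rewrite /juxt (unsplitK (inr i)). Qed.

Lemma grafting_intro p q n (a : 'I_p -> colour) (e : colour)
    (b : 'I_q -> colour) (z : 'I_n -> colour)
    (u : 'I_p -> option 'I_n) (v : 'I_q -> 'I_n) (i0 : 'I_p) :
  u i0 = None -> a i0 = e ->
  (forall i, i <> i0 -> exists2 l, u i = Some l & a i = z l) ->
  (forall j, b j = z (v j)) ->
  (forall i i' l, u i = Some l -> u i' = Some l -> i = i') ->
  injective v -> (forall i j, u i <> Some (v j)) ->
  (forall l, (exists i, u i = Some l) \/ (exists j, v j = l)) ->
  grafting a e b z u v.
Proof.
move=> u0 a0 hu hb iu iv dis tot.
have slot i : u i = None -> i = i0.
  by case: (i =P i0) => // /hu [l ->].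
split=> //.
- by exists i0; split=> // i /slot.
- by move=> i /slot ->.
- move=> i l ui; have [|l' ui' ->] := hu i; last by move: ui'; rewrite ui => -[->].
  by move=> ii; rewrite ii u0 in ui.
- move=> l; case: (tot l) => [[i ui]|[j vj]].
    exists (inl i); split=> // -[i' /= ui'|j /= [vj]].
      by rewrite (iu _ _ _ ui ui').
    by case: (dis i j); rewrite vj.
  exists (inr j); split=> /= [|[i ui|j' [vj']]]; first by rewrite vj.
    by case: (dis i j); rewrite vj.
  by congr inr; apply: iv; rewrite vj.
Qed.

Definition juxtE := (juxtl, juxtr).

Lemma enum_val_neqC (T : finType) (J : {set T}) (j : 'I_#|J|) (k : 'I_#|~: J|) :
  enum_val j <> enum_val k.
Proof.
by move=> e; have := enum_valP k; rewrite inE -e enum_valP.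
Qed.

Lemma enum_val_surj (T : finType) (J : {set T}) (t : T) :
  t \in J -> exists j : 'I_#|J|, enum_val j = t.
Proof. by move=> tJ; exists (enum_rank_in tJ t); rewrite enum_rankK_in. Qed.

Lemma enum_val_cover (T : finType) (J : {set T}) (t : T) :
  (exists j : 'I_#|J|, enum_val j = t) \/ (exists k : 'I_#|~: J|, enum_val k = t).
Proof.
case tJ: (t \in J); [left|right]; apply: enum_val_surj => //.
by rewrite inE tJ.
Qed.

Lemma ell_ell_grafting m (J : {set 'I_m}) :
  grafting (fun _ : 'I_(1 + #|~: J|) => straight) straight
    (fun _ : 'I_#|J| => straight) (fun _ : 'I_m => straight)
    (juxt graft_slot (fun j : 'I_#|~: J| => Some (enum_val j)))
    (fun j : 'I_#|J| => enum_val j).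
Proof.
apply: (grafting_intro (i0 := lshift _ ord0)); rewrite ?juxtE //.
- move=> i; case: (split_ordP i) => k ->; rewrite ?juxtE ?ord1 // => _.
  by exists (enum_val k).
- move=> i i' l; case: (split_ordP i) => k ->; rewrite juxtE //.
  case: (split_ordP i') => k' ->; rewrite juxtE // => /Some_inj <- /Some_inj e.
  by rewrite (enum_val_inj e).
- exact: enum_val_inj.
- move=> i j; case: (split_ordP i) => k ->; rewrite juxtE // => /Some_inj e.
  exact: enum_val_neqC (esym e).
- move=> l; case: (enum_val_cover J l) => -[k <-]; [right|left].
    by exists k.
  by exists (rshift 1 k); rewrite juxtE.
Qed.

Lemma lshift_neq_rshift m n (i : 'I_m) (j : 'I_n) : lshift n i <> rshift m j.
Proof. by move/eqP; rewrite eq_lrshift. Qed.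

Lemma f_ell_grafting m n (J : {set 'I_m}) :
  grafting (@straight_wavy (1 + #|~: J|) n) straight
    (fun _ : 'I_#|J| => straight) (@straight_wavy m n)
    (juxt (juxt graft_slot (fun j : 'I_#|~: J| => Some (lshift n (enum_val j))))
       (fun k : 'I_n => Some (rshift m k)))
    (fun j : 'I_#|J| => lshift n (enum_val j)).
Proof.
apply: (grafting_intro (i0 := lshift _ (lshift _ ord0))).
- by rewrite !juxtE.
- by rewrite /straight_wavy !juxtE.
- move=> i; case: (split_ordP i) => [k ->|k -> _]; last first.
    by exists (rshift m k); rewrite /straight_wavy !juxtE.
  case: (split_ordP k) => [k' ->|k' -> _]; first by rewrite ord1.
  by exists (lshift n (enum_val k')); rewrite /straight_wavy !juxtE.
- by move=> j; rewrite /straight_wavy !juxtE.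
- move=> i i' l; case: (split_ordP i) => k ->; rewrite juxtE.
    case: (split_ordP k) => k1 ->; rewrite juxtE // => /Some_inj <-.
    case: (split_ordP i') => k' ->; rewrite juxtE; last first.
      by move=> /Some_inj/esym/lshift_neq_rshift.
    case: (split_ordP k') => k1' ->; rewrite juxtE // => /Some_inj.
    by move/lshift_inj/enum_val_inj => ->.
  move=> /Some_inj <-; case: (split_ordP i') => k' ->; rewrite juxtE.
    by case: (split_ordP k') => k1' ->; rewrite juxtE // => /Some_inj/lshift_neq_rshift.
  by move=> /Some_inj/rshift_inj ->.
- by move=> j j' /lshift_inj/enum_val_inj.
- move=> i j; case: (split_ordP i) => k ->; rewrite juxtE; last first.
    by move=> /Some_inj/esym/lshift_neq_rshift.
  case: (split_ordP k) => k1 ->; rewrite juxtE // => /Some_inj/lshift_inj e.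
  exact: enum_val_neqC (esym e).
- move=> l; case: (split_ordP l) => [l' ->|l' ->]; last first.
    by left; exists (rshift _ l'); rewrite juxtE.
  case: (enum_val_cover J l') => -[k <-]; [right|left].
    by exists k.
  by exists (lshift n (rshift 1 k)); rewrite !juxtE.
Qed.

Lemma f_f_grafting m n (J : {set 'I_m}) (I : {set 'I_n}) :
  grafting (@straight_wavy #|J| (1 + #|I|)) wavy
    (@straight_wavy #|~: J| #|~: I|) (@straight_wavy m n)
    (juxt (fun j : 'I_#|J| => Some (lshift n (enum_val j)))
       (juxt graft_slot (fun k : 'I_#|I| => Some (rshift m (enum_val k)))))
    (juxt (fun j : 'I_#|~: J| => lshift n (enum_val j))
       (fun k : 'I_#|~: I| => rshift m (enum_val k))).
Proof.
apply: (grafting_intro (i0 := rshift _ (lshift _ ord0))).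
- by rewrite !juxtE.
- by rewrite /straight_wavy !juxtE.
- move=> i; case: (split_ordP i) => [k -> _|k ->].
    by exists (lshift n (enum_val k)); rewrite /straight_wavy !juxtE.
  case: (split_ordP k) => [k' ->|k' -> _]; first by rewrite ord1.
  by exists (rshift m (enum_val k')); rewrite /straight_wavy !juxtE.
- move=> j; case: (split_ordP j) => k ->; by rewrite /straight_wavy !juxtE.
- move=> i i' l; case: (split_ordP i) => k ->; rewrite juxtE.
    move=> /Some_inj <-; case: (split_ordP i') => k' ->; rewrite juxtE.
      by move=> /Some_inj/lshift_inj/enum_val_inj ->.
    case: (split_ordP k') => k1' ->; rewrite juxtE // => /Some_inj.
    by move/esym/lshift_neq_rshift.
  case: (split_ordP k) => k1 ->; rewrite juxtE // => /Some_inj <-.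
  case: (split_ordP i') => k' ->; rewrite juxtE.
    by move=> /Some_inj/lshift_neq_rshift.
  case: (split_ordP k') => k1' ->; rewrite juxtE // => /Some_inj.
  by move/rshift_inj/enum_val_inj => ->.
- move=> j j'; case: (split_ordP j) => k ->; case: (split_ordP j') => k' ->;
    rewrite !juxtE.
  + by move=> /lshift_inj/enum_val_inj ->.
  + by move/lshift_neq_rshift.
  + by move/esym/lshift_neq_rshift.
  + by move=> /rshift_inj/enum_val_inj ->.
- move=> i j; case: (split_ordP i) => k ->; rewrite juxtE.
    case: (split_ordP j) => k' ->; rewrite juxtE => /Some_inj.
      by move/lshift_inj/enum_val_neqC.
    by move/lshift_neq_rshift.
  case: (split_ordP k) => k1 ->; rewrite juxtE //.
  case: (split_ordP j) => k' ->; rewrite juxtE => /Some_inj.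
    by move/esym/lshift_neq_rshift.
  by move/rshift_inj/enum_val_neqC.
- move=> l; case: (split_ordP l) => l' ->.
    case: (enum_val_cover J l') => -[k <-]; [left|right].
      by exists (lshift _ k); rewrite juxtE.
    by exists (lshift _ k); rewrite juxtE.
  case: (enum_val_cover I l') => -[k <-]; [left|right].
    by exists (rshift _ (rshift 1 k)); rewrite !juxtE.
  by exists (rshift _ k); rewrite juxtE.
Qed.

Lemma bracket_bracket_grafting (i j k : 'I_3) :
  uniq [:: i; j; k] ->
  grafting (fun _ : 'I_2 => straight) straight (fun _ : 'I_2 => straight)
    (fun _ : 'I_3 => straight) (tnth [tuple None; Some k]) (tnth [tuple i; j]).
Proof.
move=> un.
have all3 (l : 'I_3) : l \in [:: i; j; k].
  have h : {subset [:: i; j; k] <= enum 'I_3} by move=> x _; rewrite mem_enum.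
  have [_ ->] := uniq_min_size un h (eq_leq (size_enum_ord 3)).
  by rewrite mem_enum.
move: un; rewrite /= !inE negb_or => /andP[/andP[/eqP ij /eqP ik] /andP[/eqP jk _]].
have d2 (x : 'I_2) : x = ord0 \/ x = ord_max.
  by case: x => -[|[|//]] h; [left|right]; apply: val_inj.
apply: (grafting_intro (i0 := ord0)) => //.
- by move=> x; case: (d2 x) => -> // _; exists k.
- move=> x x' l; case: (d2 x) => ->; case: (d2 x') => -> //.
- move=> x x'; case: (d2 x) => ->; case: (d2 x') => -> // e.
  by case: (ij (esym e)).
- move=> x y; case: (d2 x) => ->; first by [].
  by case: (d2 y) => -> /Some_inj e; [case: ik | case: jk].
- move=> l; have := all3 l; rewrite !inE => /or3P[] /eqP ->.
  + by right; exists ord0.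
  + by right; exists ord_max.
  + by left; exists ord_max.
Qed.

Lemma field_bracket_grafting n :
  grafting (@straight_wavy 1 n) straight (fun _ : 'I_2 => straight)
    (@straight_wavy 2 n) (juxt graft_slot (fun j : 'I_n => Some (rshift 2 j)))
    (fun i : 'I_2 => lshift n i).
Proof.
apply: (grafting_intro (i0 := lshift _ ord0)).
- by rewrite juxtE.
- by rewrite /straight_wavy juxtE.
- move=> i; case: (split_ordP i) => [k ->|k -> _]; first by rewrite ord1.
  by exists (rshift 2 k); rewrite /straight_wavy !juxtE.
- by move=> j; rewrite /straight_wavy juxtE.
- move=> i i' l; case: (split_ordP i) => k ->; rewrite juxtE // => /Some_inj <-.
  by case: (split_ordP i') => k' ->; rewrite juxtE // => /Some_inj/rshift_inj ->.
- exact: lshift_inj.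
- move=> i j; case: (split_ordP i) => k ->; rewrite juxtE // => /Some_inj.
  by move/esym/lshift_neq_rshift.
- move=> l; case: (split_ordP l) => k ->; [right|left]; first by exists k.
  by exists (rshift 1 k); rewrite juxtE.
Qed.

Lemma field_field_grafting n (i j : 'I_2) (I : {set 'I_n}) :
  i <> j ->
  grafting (@straight_wavy 1 (1 + #|~: I|)) wavy (@straight_wavy 1 #|I|)
    (@straight_wavy 2 n)
    (juxt (fun _ : 'I_1 => Some (lshift n i))
       (juxt graft_slot (fun l : 'I_#|~: I| => Some (rshift 2 (enum_val l)))))
    (juxt (fun _ : 'I_1 => lshift n j)
       (fun l : 'I_#|I| => rshift 2 (enum_val l))).
Proof.
move=> ij; apply: (grafting_intro (i0 := rshift _ (lshift _ ord0))).
- by rewrite !juxtE.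
- by rewrite /straight_wavy !juxtE.
- move=> x; case: (split_ordP x) => [k -> _|k ->].
    by exists (lshift n i); rewrite /straight_wavy !juxtE.
  case: (split_ordP k) => [k' ->|k' -> _]; first by rewrite ord1.
  by exists (rshift 2 (enum_val k')); rewrite /straight_wavy !juxtE.
- by move=> y; case: (split_ordP y) => k ->; rewrite /straight_wavy !juxtE.
- move=> x x' l; case: (split_ordP x) => k ->; rewrite juxtE.
    move=> /Some_inj <-; case: (split_ordP x') => k' ->; rewrite juxtE.
      by rewrite !ord1.
    case: (split_ordP k') => k1' ->; rewrite juxtE // => /Some_inj.
    by move/esym/lshift_neq_rshift.
  case: (split_ordP k) => k1 ->; rewrite juxtE // => /Some_inj <-.
  case: (split_ordP x') => k' ->; rewrite juxtE.
    by move=> /Some_inj/lshift_neq_rshift.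
  case: (split_ordP k') => k1' ->; rewrite juxtE // => /Some_inj.
  by move/rshift_inj/enum_val_inj => ->.
- move=> y y'; case: (split_ordP y) => k ->; case: (split_ordP y') => k' ->;
    rewrite !juxtE.
  + by rewrite !ord1.
  + by move/lshift_neq_rshift.
  + by move/esym/lshift_neq_rshift.
  + by move=> /rshift_inj/enum_val_inj ->.
- move=> x y; case: (split_ordP x) => k ->; rewrite juxtE.
    case: (split_ordP y) => k' ->; rewrite juxtE => /Some_inj.
      by move/lshift_inj.
    by move/lshift_neq_rshift.
  case: (split_ordP k) => k1 ->; rewrite juxtE //.
  case: (split_ordP y) => k' ->; rewrite juxtE => /Some_inj.
    by move/esym/lshift_neq_rshift.
  by move/rshift_inj/esym/enum_val_neqC.
- move=> l; case: (split_ordP l) => l' ->.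
    have [->|->] : l' = i \/ l' = j.
      move: i j l' ij => [[|[|//]] ?] [[|[|//]] ?] [[|[|//]] ?] ij;
        by [left; apply: val_inj | right; apply: val_inj | case: ij; apply: val_inj].
    + by left; exists (lshift _ ord0); rewrite juxtE.
    + by right; exists (lshift _ ord0); rewrite juxtE.
  case: (enum_val_cover I l') => -[k <-]; [right|left].
    by exists (rshift _ k); rewrite juxtE.
  by exists (rshift _ (rshift 1 k)); rewrite !juxtE.
Qed.

End Graftings.

Definition HS (K : fieldType) : operad K := presented (@HS_relations K).

Inductive HSoo_gen :=
| HSoo_ell_gen (m : nat) of (2 <= m)%N
| HSoo_f_gen (m n : nat) of (1 <= m)%N.

Definition HSoo_corollas : corollas :=
  @Corollas HSoo_gen
    (fun g => match g with
              | HSoo_ell_gen _ _ => straight | HSoo_f_gen _ _ _ => wavy end)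
    (fun g => match g with
              | HSoo_ell_gen m _ => m | HSoo_f_gen m n _ => m + n end%N)
    (fun g => match g with
              | HSoo_ell_gen _ _ => fun _ => straight
              | HSoo_f_gen m n _ => @straight_wavy m n end)
    (fun g => match g with
              | HSoo_ell_gen m _ => 2 - m%:Z | HSoo_f_gen m _ _ => 1 - m%:Z end).

Definition HSoo (K : fieldType) : operad K :=
  presented (@no_relations K HSoo_corollas).

Definition HSoo_generators (K : fieldType) : realization HSoo_corollas (HSoo K) :=
  @pres_gen K HSoo_corollas (@no_relations K HSoo_corollas).

(* The generating corollas, with the value 0 in the arities m where there is no
   generator, so that they can be indexed by cardinalities inside sums. *)
Definition ell (K : fieldType) (m : nat) :
    HSoo K straight m (fun _ => straight) (2 - m%:Z) :=
  match @idP (2 <= m)%N with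
  | ReflectT h => HSoo_generators K (HSoo_ell_gen h)
  | ReflectF _ => 0
  end.

Definition fcor (K : fieldType) (m n : nat) :
    HSoo K wavy (m + n)%N (@straight_wavy m n) (1 - m%:Z) :=
  match @idP (1 <= m)%N with
  | ReflectT h => HSoo_generators K (HSoo_f_gen n h)
  | ReflectF _ => 0
  end.

Lemma HS_presented (K : fieldType) :
  presented_by (@HS_relations K) (@pres_gen K HS_corollas (@HS_relations K)).
Proof.
apply: presented_universal; split.
  apply: qvalue_inj => Q q hq; have [h _] := hq.2.
  have e : @qvalue _ _ _ straight 2%N (fun=> straight) 0 Q q
      (pres_gen (@HS_relations K) HS_bracket) = q HS_bracket.
    exact: (@qvalue_gen _ HS_corollas _ Q q HS_bracket hq).
  rewrite qvalue0 // !qvalueD //.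
  rewrite /HS_double_bracket /= !qvalue_comp ?e //;
    exact: bracket_bracket_grafting.
move=> n; apply: qvalue_inj => Q q hq; have [_ /(_ n) h] := hq.2.
have e : @qvalue _ _ _ straight 2%N (fun=> straight) 0 Q q
    (pres_gen (@HS_relations K) HS_bracket) = q HS_bracket.
  exact: (@qvalue_gen _ HS_corollas _ Q q HS_bracket hq).
have eF k : @qvalue _ _ _ wavy (1 + k)%N (@straight_wavy 1 k) 0 Q q
    (pres_gen (@HS_relations K) (HS_field k)) = q (HS_field k).
  exact: (@qvalue_gen _ HS_corollas _ Q q (HS_field k) hq).
rewrite qvalue0 // qvalueD // qvalue_sum // -[RHS]h; congr (_ + _).
  rewrite /HS_field_bracket /= qvalue_comp ?e ?eF //.
  exact: field_bracket_grafting.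
apply: eq_bigr => I _; rewrite qvalueD // qvalueN //.
rewrite /HS_field_field /= !qvalue_comp ?eF //;
  exact: field_field_grafting.
Qed.

Lemma HSoo_free (K : fieldType) : free_on (@HSoo_generators K).
Proof. exact: presented_universal. Qed.

(* Main.v *)
Require Import Defs.
From HB Require Import structures.
From mathcomp Require Import all_boot all_order all_algebra all_fingroup.
From mathcomp Require Import generic_quotient boolp zify.

Set Implicit Arguments.
Unset Strict Implicit.
Unset Printing Implicit Defensive.

Import Order.TTheory GRing.Theory Num.Theory.
Local Open Scope ring_scope.

(** The free operad on the corollas ell_m and f_{m,n} has a basis of trees, and
    the differential is, up to signs, the sum over all ways of expanding a
    vertex of a tree into two vertices joined by an edge. Dually, the
    coefficient of a tree T in the differential of x is the sum of the
    coefficients of x at the contractions of T along one internal edge. The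
    proof takes this as the definition and works with coefficients.

    A tree with inputs numbered by 'I_n is determined by a nested family of
    label sets: one set for each straight edge other than the output, and one
    for each vertex with wavy output. These symbols are the letters of a word,
    and an orientation of the tree is an ordering of its symbols up to even
    permutations. Thus a linear combination of trees is an alternating function
    of words supported on trees (tfun). Counting every letter as odd gives the
    degrees of the corollas and all Koszul signs, and contracting an edge is
    removing a letter. The functions form an operad (treeop), and removal of
    letters is a derivation of square zero (tdiff, tdiff_square, tdiff_comp),
    because the signs are those of the boundary of a simplex.

    The morphism Phi from the free operad to treeop that sends each corolla to
    its one-vertex tree is bijective. For injectivity, the associativity axioms
    allow a monomial to be cut at any internal edge of its tree (mono_factors),
    so by induction monomials with the same tree are proportional (mono_unique).
    For surjectivity, every tree can be cut at an internal edge into smaller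
    ones (tree_cut), and the trees without internal edges are corollas and
    identities. Transporting tdiff through Phi defines delta. The two formulas
    for delta are checked on trees with one internal edge: after normalizing the
    corollas by a sign quadratic in m (gsign), the removed edge accounts for the
    sign of the shuffle and the remaining exponent (delta_ell, delta_fcor).

    The cohomology vanishes below degree zero (tdiff_exact). If the output is
    wavy, fix the wavy vertices of a tree; if it is straight, fix the edges
    between the root and one chosen input. These special symbols distribute the
    remaining straight inputs among cells. In negative degree there are too few
    special symbols for all cells to have at most one input, and the straight
    edge that collects a larger cell can be added to, or removed from, any tree
    with these special symbols. Adding it is a contracting homotopy up to terms
    with more special symbols, which an induction removes.

    The projection to HS sends ell_2 to the bracket, f_{1,n} to - F_n and the
    other generators to zero. There is nothing in positive degree. In degree
    zero the boundaries of ell_3 and f_{2,n} are the relations of HS (delta_ell3,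
    delta_f2), so the quotient of the free operad by boundaries is a model of the
    relations, and the universal property of HS shows that the kernel of the
    projection consists of boundaries (projection_kernel). *)

(** * Functions on words *)

Section Words.
Variable K : fieldType.

(** The sign of carrying one letter past a word: letters are odd, so that a
    function evaluated on s is crossed with sign (-1)^(size s). *)
Definition hat (X : Type) (x : seq X -> K) (s : seq X) : K :=
  (-1) ^+ size s * x s.

(** The signed product of functions of words dual to splitting a word into two
    subwords by cl. A letter of the second factor crosses what remains of the
    first, hence hat; a letter that cl cannot place makes the value zero. *)
Fixpoint wcomp (X Y Z : Type) (cl : Z -> option (X + Y))
    (x : seq X -> K) (y : seq Y -> K) (s : seq Z) : K :=
  match s with
  | [::] => x [::] * y [::]
  | c :: s' =>
    match cl c with
    | None => 0
    | Some (inl a) => wcomp cl (x \o cons a) y s'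
    | Some (inr b) => wcomp cl (hat x) (y \o cons b) s'
    end
  end.

Lemma hat_cons X (x : seq X -> K) a : hat x \o cons a = fun s => - hat (x \o cons a) s.
Proof. by apply: funext => s; rewrite /hat /= exprS mulN1r mulNr. Qed.

Lemma hatK X (x : seq X -> K) : hat (hat x) = x.
Proof. by apply: funext => s; rewrite /hat mulrA -exprD addnn -mul2n exprM sqrrN !expr1n mul1r. Qed.

Lemma wcomp_linearl X Y Z (cl : Z -> option (X + Y)) k x x' y s :
  wcomp cl (fun t => k * x t + x' t) y s = k * wcomp cl x y s + wcomp cl x' y s.
Proof.
elim: s x x' y => [|c s IH] x x' y /=; first by rewrite mulrDl mulrA.
case: (cl c) => [[a|b]|]; last by rewrite mulr0 addr0.
  exact: IH.
by rewrite -IH; congr wcomp; apply: funext => t; rewrite /hat mulrDr mulrCA.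
Qed.

Lemma wcomp_linearr X Y Z (cl : Z -> option (X + Y)) k x y y' s :
  wcomp cl x (fun t => k * y t + y' t) s = k * wcomp cl x y s + wcomp cl x y' s.
Proof.
elim: s x y y' => [|c s IH] x y y' /=; first by rewrite mulrDr mulrCA.
by case: (cl c) => [[a|b]|]; rewrite ?mulr0 ?addr0 //; apply: IH.
Qed.

Lemma wcomp0l X Y Z (cl : Z -> option (X + Y)) y s : wcomp cl (fun=> 0) y s = 0.
Proof.
have := wcomp_linearl cl (-1) (fun=> 0) (fun=> 0) y s.
rewrite (_ : (fun _ => _) = fun=> 0); first by rewrite mulN1r addNr.
by apply: funext => t; rewrite mulr0 addr0.
Qed.

Lemma wcomp0r X Y Z (cl : Z -> option (X + Y)) x s : wcomp cl x (fun=> 0) s = 0.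
Proof.
have := wcomp_linearr cl (-1) x (fun=> 0) (fun=> 0) s.
rewrite (_ : (fun _ => _) = fun=> 0); first by rewrite mulN1r addNr.
by apply: funext => t; rewrite mulr0 addr0.
Qed.

Lemma wcompZl X Y Z (cl : Z -> option (X + Y)) k x y s :
  wcomp cl (fun t => k * x t) y s = k * wcomp cl x y s.
Proof.
have := wcomp_linearl cl k x (fun=> 0) y s; rewrite wcomp0l addr0 => <-.
by congr wcomp; apply: funext => t; rewrite addr0.
Qed.

Lemma wcompZr X Y Z (cl : Z -> option (X + Y)) k x y s :
  wcomp cl x (fun t => k * y t) s = k * wcomp cl x y s.
Proof.
have := wcomp_linearr cl k x y (fun=> 0) s; rewrite wcomp0r addr0 => <-.
by congr wcomp; apply: funext => t; rewrite addr0.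
Qed.

Lemma wcompNl X Y Z (cl : Z -> option (X + Y)) x y s :
  wcomp cl (fun t => - x t) y s = - wcomp cl x y s.
Proof.
rewrite -mulN1r -wcompZl; congr wcomp.
by apply: funext => t; rewrite mulN1r.
Qed.

Lemma wcompNr X Y Z (cl : Z -> option (X + Y)) x y s :
  wcomp cl x (fun t => - y t) s = - wcomp cl x y s.
Proof.
rewrite -mulN1r -wcompZr; congr wcomp.
by apply: funext => t; rewrite mulN1r.
Qed.

Lemma hat_wcomp X Y Z (cl : Z -> option (X + Y)) x y :
  hat (wcomp cl x y) = wcomp cl (hat x) (hat y).
Proof.
apply: funext => s; rewrite /hat.
elim: s x y => [|c s IH] x y /=; first by rewrite !expr0 !mul1r.
case: (cl c) => [[a|b]|]; last by rewrite mulr0.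
- rewrite exprS mulN1r mulNr IH -wcompNl; congr wcomp.
  by apply: funext => t /=; rewrite exprS mulN1r mulNr.
- rewrite exprS mulN1r mulNr IH -wcompNr; congr wcomp.
  by apply: funext => t /=; rewrite exprS mulN1r mulNr.
Qed.

Definition homog (X : Type) (p : bool) (y : seq X -> K) :=
  forall s, y s != 0 -> odd (size s) = p.

Lemma homog_hat X p (y : seq X -> K) :
  homog p y -> hat y = fun s => (-1) ^+ p * y s.
Proof.
move=> h; apply: funext => s; rewrite /hat -signr_odd.
by have [->|/h ->] := eqVneq (y s) 0; rewrite ?mulr0.
Qed.

Lemma homog_cons X p (y : seq X -> K) a : homog p y -> homog (~~ p) (y \o cons a).
Proof. by move=> h s /= /h /= <-; rewrite negbK. Qed.

(** Both sides distribute the letters among three factors, so that it suffices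
    to compare the two-step classifications letter by letter; hat_wcomp keeps
    the signs in step. *)
Lemma wcomp_sequential X Y T W W' Z
    (cl2 : Z -> option (W + T)) (cl1 : W -> option (X + Y))
    (cl4 : Z -> option (X + W')) (cl3 : W' -> option (Y + T)) :
  (forall c,
     match cl2 c with
     | None => None
     | Some (inl w) => match cl1 w with
         | None => None | Some (inl a) => Some (inl a)
         | Some (inr b) => Some (inr (inl b)) end
     | Some (inr t) => Some (inr (inr t)) end
   = match cl4 c with
     | None => None
     | Some (inl a) => Some (inl a)
     | Some (inr w) => match cl3 w with
         | None => None | Some b => Some (inr b) end end) ->
  forall x y t s,
    wcomp cl2 (wcomp cl1 x y) t s = wcomp cl4 x (wcomp cl3 y t) s.
Proof.
move=> h x y t s; elim: s x y t => [|c s IH] x y t /=; first by rewrite mulrA.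
have := h c; case: (cl2 c) => [[w|b2]|]; case: (cl4 c) => [[a4|w4]|] //=.
- case E1: (cl1 w) => [[a|b]|] //= -[eb]; subst; rewrite -IH; congr wcomp.
  by apply: funext => r /=; rewrite E1.
- case E1: (cl1 w) => [[a|b]|]; case E3: (cl3 w4) => [[b3|t3]|] //=.
    move=> [eb]; subst b3.
    have -> : wcomp cl1 x y \o cons w = wcomp cl1 (hat x) (y \o cons b).
      by apply: funext => r /=; rewrite E1.
    rewrite IH; congr wcomp; apply: funext => r /=; by rewrite E3.
  move=> _.
  have -> : wcomp cl1 x y \o cons w = fun=> 0 by apply: funext => r /=; rewrite E1.
  have -> : wcomp cl3 y t \o cons w4 = fun=> 0 by apply: funext => r /=; rewrite E3.
  by rewrite wcomp0l wcomp0r.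
- case E1: (cl1 w) => [[a|b]|] //= _.
  have -> : wcomp cl1 x y \o cons w = fun=> 0 by apply: funext => r /=; rewrite E1.
  by rewrite wcomp0l.
- case E3: (cl3 w4) => [[b3|t3]|] //= -[eb]; subst.
  rewrite hat_wcomp IH; congr wcomp.
  by apply: funext => r /=; rewrite E3.
- case E3: (cl3 w4) => [[b3|t3]|] //= _.
  have -> : wcomp cl3 y t \o cons w4 = fun=> 0 by apply: funext => r /=; rewrite E3.
  by rewrite wcomp0r.
Qed.

(** As in the sequential case, but y and t change places: every letter of y
    crosses every letter of t, which leaves the product of the two parities. *)
Lemma wcomp_parallel X Y T W W' Z
    (cl2 : Z -> option (W + T)) (cl1 : W -> option (X + Y))
    (cl4 : Z -> option (W' + Y)) (cl3 : W' -> option (X + T)) :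
  (forall c,
     match cl2 c with
     | None => None
     | Some (inl w) => match cl1 w with
         | None => None | Some (inl a) => Some (inl a)
         | Some (inr b) => Some (inr (inl b)) end
     | Some (inr t) => Some (inr (inr t)) end
   = match cl4 c with
     | None => None
     | Some (inl w) => match cl3 w with
         | None => None | Some (inl a) => Some (inl a)
         | Some (inr t) => Some (inr (inr t)) end
     | Some (inr b) => Some (inr (inl b)) end) ->
  forall p q x y t s, homog p y -> homog q t ->
    wcomp cl2 (wcomp cl1 x y) t s
    = (-1) ^+ (p && q) * wcomp cl4 (wcomp cl3 x t) y s.
Proof.
move=> h p q x y t s.
elim: s p q x y t => [|c s IH] p q x y t hy ht /=.
  have [hy0|/hy <-] := eqVneq (y [::]) 0; first by rewrite hy0 !(mulr0, mul0r).
  by rewrite /= expr0 mul1r mulrAC.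
have := h c; case: (cl2 c) => [[w|b2]|]; case: (cl4 c) => [[w4|b4]|] //=.
- case E1: (cl1 w) => [[a|b]|]; case E3: (cl3 w4) => [[a3|t3]|] //=.
    move=> [eb]; subst a3; have -> : wcomp cl1 x y \o cons w = wcomp cl1 (x \o cons a) y.
      by apply: funext => r /=; rewrite E1.
    rewrite (IH p q) //; congr (_ * wcomp _ _ _ _).
    by apply: funext => r /=; rewrite E3.
  move=> _.
  have -> : wcomp cl1 x y \o cons w = fun=> 0 by apply: funext => r /=; rewrite E1.
  have -> : wcomp cl3 x t \o cons w4 = fun=> 0 by apply: funext => r /=; rewrite E3.
  by rewrite !wcomp0l mulr0.
- case E1: (cl1 w) => [[a|b]|] //= -[eb]; subst b4.
  have -> : wcomp cl1 x y \o cons w = wcomp cl1 (hat x) (y \o cons b).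
    by apply: funext => r /=; rewrite E1.
  rewrite (IH (~~ p) q) //; last exact: homog_cons.
  rewrite hat_wcomp (homog_hat ht).
  have -> : wcomp cl3 (hat x) (fun s0 => (-1) ^+ q * t s0)
     = fun r => (-1) ^+ q * wcomp cl3 (hat x) t r.
    by apply: funext => r; rewrite wcompZr.
  rewrite wcompZl mulrA; congr (_ * _).
  by case: (p); case: (q); rewrite /= ?expr1 ?expr0 ?mulrNN ?mulr1 ?mul1r.
- case E1: (cl1 w) => [[a|b]|] //= _.
  have -> : wcomp cl1 x y \o cons w = fun=> 0 by apply: funext => r /=; rewrite E1.
  by rewrite wcomp0l mulr0.
- case E3: (cl3 w4) => [[a|t3]|] //= -[eb]; subst t3.
  rewrite hat_wcomp (homog_hat hy).
  have -> : wcomp cl1 (hat x) (fun s0 => (-1) ^+ p * y s0)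
     = fun r => (-1) ^+ p * wcomp cl1 (hat x) y r.
    by apply: funext => r; rewrite wcompZr.
  rewrite wcompZl (IH p (~~ q)) //; last exact: homog_cons.
  have -> : wcomp cl3 x t \o cons w4 = wcomp cl3 (hat x) (t \o cons b2).
    by apply: funext => r /=; rewrite E3.
  rewrite mulrA; congr (_ * _).
  by case: (p); case: (q); rewrite /= ?expr1 ?expr0 ?mulrNN ?mulr1 ?mul1r.
- case E3: (cl3 w4) => [[a|t3]|] //= _.
  have -> : wcomp cl3 x t \o cons w4 = fun=> 0 by apply: funext => r /=; rewrite E3.
  by rewrite wcomp0l mulr0.
- by rewrite mulr0.
Qed.

Lemma wcomp_map X Y Z Z' (cl : Z -> option (X + Y)) (f : Z' -> Z) x y s :
  wcomp cl x y (map f s) = wcomp (cl \o f) x y s.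
Proof.
elim: s x y => //= c s IH x y.
by case: (cl (f c)) => [[a|b]|].
Qed.

Lemma wcomp_mapl X X' Y Z (cl : Z -> option (X' + Y)) (f : X' -> X) x y s :
  wcomp cl (x \o map f) y s
  = wcomp (fun c => match cl c with Some (inl a) => Some (inl (f a))
                    | Some (inr b) => Some (inr b) | None => None end) x y s.
Proof.
elim: s x y => //= c s IH x y.
case: (cl c) => [[a|b]|] //; first by rewrite -IH.
rewrite -IH; congr wcomp; apply: funext => t /=.
by rewrite /hat size_map.
Qed.

Lemma wcomp_mapr X Y Y' Z (cl : Z -> option (X + Y')) (f : Y' -> Y) x y s :
  wcomp cl x (y \o map f) s
  = wcomp (fun c => match cl c with Some (inl a) => Some (inl a)
                    | Some (inr b) => Some (inr (f b)) | None => None end) x y s.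
Proof.
elim: s x y => //= c s IH x y.
by case: (cl c) => [[a|b]|] //; rewrite -IH.
Qed.

Lemma eq_wcomp X Y Z (cl cl' : Z -> option (X + Y)) x y s :
  cl =1 cl' -> wcomp cl x y s = wcomp cl' x y s.
Proof.
move=> e; elim: s x y => //= c s IH x y.
by rewrite e; case: (cl' c) => [[a|b]|].
Qed.

Definition outs X Y Z (cl : Z -> option (X + Y)) : seq Z -> seq X :=
  pmap (fun c => if cl c is Some (inl a) then Some a else None).
Definition inns X Y Z (cl : Z -> option (X + Y)) : seq Z -> seq Y :=
  pmap (fun c => if cl c is Some (inr b) then Some b else None).

(** Signs can thus be ignored when the support of a product is computed. *)
Lemma wcompE X Y Z (cl : Z -> option (X + Y)) s :
  exists k : nat, forall x y,
    wcomp cl x y s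
    = if all (fun c => cl c : bool) s
      then (-1) ^+ k * (x (outs cl s) * y (inns cl s)) else 0.
Proof.
elim: s => [|c s [k IH]]; first by exists 0%N => x y /=; rewrite mul1r.
rewrite /=; case E: (cl c) => [[a|b]|] /=; last by exists 0%N.
  by exists k => x y; rewrite IH.
exists (k + size (outs cl s))%N => x y; rewrite IH; case: ifP => // _.
by rewrite /hat exprD /= !mulrA.
Qed.

Lemma wcomp_neq0 X Y Z (cl : Z -> option (X + Y)) x y s :
  (wcomp cl x y s != 0)
  = [&& all (fun c => cl c : bool) s, x (outs cl s) != 0 & y (inns cl s) != 0].
Proof.
have [k ->] := wcompE cl s; case: ifP => //= _; last by rewrite eqxx.
by rewrite !mulf_eq0 signr_eq0 /= negb_or.
Qed.

Lemma size_outs_inns X Y Z (cl : Z -> option (X + Y)) s :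
  all (fun c => cl c : bool) s ->
  size s = (size (outs cl s) + size (inns cl s))%N.
Proof.
elim: s => //= c s IH /andP[]; rewrite /outs /inns /=.
by case: (cl c) => [[a|b]|] //= _ /IH ->; rewrite ?addSn ?addnS.
Qed.

Definition alternating (X : Type) (x : seq X -> K) :=
  forall s1 a b s2, x (s1 ++ a :: b :: s2) = - x (s1 ++ b :: a :: s2).

Lemma alternating_cons X (x : seq X -> K) a : alternating x -> alternating (x \o cons a).
Proof. by move=> h s1 b c s2; exact: (h (a :: s1)). Qed.

Lemma alternating_hat X (x : seq X -> K) : alternating x -> alternating (hat x).
Proof.
by move=> h s1 b c s2; rewrite /hat h mulrN !size_cat.
Qed.

Lemma wcomp_alternating X Y Z (cl : Z -> option (X + Y)) x y :
  alternating x -> alternating y -> alternating (wcomp cl x y).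
Proof.
move=> hx hy s1 a b s2; elim: s1 x y hx hy => [|c s1 IH] x y hx hy /=; last first.
  case: (cl c) => [[u|v]|]; rewrite ?oppr0 //; apply: IH => //;
  by [apply: alternating_cons | apply: alternating_hat].
case: (cl a) => [[ua|va]|] /=; case: (cl b) => [[ub|vb]|] //=; rewrite ?oppr0 //.
- rewrite -wcompNl; congr wcomp; apply: funext => t /=; exact: (hx [::]).
- rewrite -wcompNl; congr wcomp; apply: funext => t /=.
  by rewrite /hat /= exprS mulN1r mulNr opprK.
- rewrite -wcompNl; congr wcomp; apply: funext => t /=.
  by rewrite /hat /= exprS mulN1r mulNr.
- rewrite -wcompNr; congr wcomp; apply: funext => t /=; exact: (hy [::]).
Qed.

Lemma alternating_move X (x : seq X -> K) s1 a s2 s3 : alternating x ->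
  x (s1 ++ a :: s2 ++ s3) = (-1) ^+ size s2 * x (s1 ++ s2 ++ a :: s3).
Proof.
move=> hx; elim: s2 s1 => [|b s2 IH] s1; first by rewrite mul1r.
by rewrite hx exprS mulN1r mulNr /= -cat_rcons IH cat_rcons.
Qed.

Lemma alternating_cat X (x : seq X -> K) s s1 s2 s3 : alternating x ->
  x (s ++ s1 ++ s2 ++ s3) = (-1) ^+ (size s1 * size s2) * x (s ++ s2 ++ s1 ++ s3).
Proof.
move=> hx; elim: s1 s => [|b s1 IH] s; first by rewrite mul1r.
rewrite /= mulSn exprD -cat_rcons IH cat_rcons (alternating_move _ _ _ _ hx).
by rewrite mulrA; congr (_ * _); rewrite mulrC.
Qed.

(** The sign relating two orderings of a word is the same for all alternating
    functions; it need not be known to compare two such functions. *)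
Lemma alternating_perm (X : eqType) (s t : seq X) :
  perm_eq s t -> exists k : nat, forall y : seq X -> K, alternating y -> y s = (-1) ^+ k * y t.
Proof.
elim: s t => [|a s IH] t pst.
  by exists 0%N => y _; rewrite mul1r; case: t pst => // b t /perm_size.
have at_ : a \in t by rewrite -(perm_mem pst) mem_head.
case/splitPr: at_ pst => t1 t2 pst.
have /IH [k hk] : perm_eq s (t1 ++ t2).
  by rewrite -(perm_cons a) (perm_trans pst) // perm_catC /= perm_cons perm_catC.
exists (k + size t1)%N => y hy.
have /= -> := hk _ (alternating_cons a hy).
rewrite exprD -mulrA; congr (_ * _).
by have := alternating_move [::] a t1 t2 hy.
Qed.

Lemma alternating_neq0 (X : eqType) (x : seq X -> K) s t : alternating x ->
  perm_eq s t -> (x s != 0) = (x t != 0).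
Proof.
move=> hx /alternating_perm [k ->] //.
by rewrite mulf_eq0 signr_eq0.
Qed.

Lemma alternating_eq (X : eqType) (x y : seq X -> K) s t :
  alternating x -> alternating y -> perm_eq s t -> x t = y t -> x s = y s.
Proof.
move=> hx hy /alternating_perm [k hk] e.
by rewrite !hk // e.
Qed.

(** The signed indicator of the rearrangements of r, with value 1 at r itself. *)
Fixpoint alt (X : eqType) (r s : seq X) : K :=
  match r with
  | [::] => (nilp s)%:R
  | a :: r' => if a \in s then (-1) ^+ index a s * alt r' (rem a s) else 0
  end.

Lemma alt_refl (X : eqType) (r : seq X) : alt r r = 1.
Proof. by elim: r => //= a r IH; rewrite mem_head eqxx mul1r IH. Qed.

Lemma alt_neq0 (X : eqType) (r s : seq X) : (alt r s != 0) = perm_eq r s.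
Proof.
elim: r s => [|a r IH] s /=.
  by case: s => [|b s] /=; rewrite ?oner_eq0 ?eqxx //; apply/esym/negP => /perm_size.
case: ifP => [as_|as_].
  by rewrite mulf_eq0 signr_eq0 /= IH -(perm_cons a) (permPr (perm_to_rem as_)).
rewrite eqxx; apply/esym/negP => /perm_mem /(_ a).
by rewrite mem_head as_.
Qed.

Lemma rem_cat2 (X : eqType) (c : X) s1 s2 :
  rem c (s1 ++ s2) = if c \in s1 then rem c s1 ++ s2 else s1 ++ rem c s2.
Proof.
elim: s1 => //= b s1 IH; rewrite inE IH eq_sym.
by case: eqP => //= _; case: ifP.
Qed.

Lemma alt_alternating (X : eqType) (r : seq X) : uniq r -> alternating (alt r).
Proof.
elim: r => [|c r IH] /=.
  by move=> _ [|? ?] ? ? ? /=; rewrite oppr0.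
move=> /andP[cr ur] s1 a b s2.
have -> : (c \in s1 ++ b :: a :: s2) = (c \in s1 ++ a :: b :: s2).
  by rewrite !mem_cat !inE; congr (_ || _); rewrite orbCA.
case: ifP => [_|]; last by rewrite oppr0.
rewrite !index_cat !rem_cat2; case: ifP => cs1.
  by rewrite IH // mulrN.
have [ca|ca] := eqVneq c a.
  rewrite -ca /= eqxx.
  have [->|cb] := eqVneq b c.
    have -> : alt r (s1 ++ c :: s2) = 0.
      apply/eqP; apply/negPn; rewrite alt_neq0; apply/negP => /perm_mem /(_ c).
      by rewrite (negbTE cr) mem_cat mem_head orbT.
    by rewrite !mulr0 oppr0.
  by rewrite addn0 addn1 exprS mulN1r mulNr opprK.
have [->|cb] := eqVneq b c.
  by rewrite /= eqxx eq_sym (negbTE ca) addn0 addn1 exprS mulN1r mulNr.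
rewrite /= ![_ == c]eq_sym (negbTE ca) eq_sym (negbTE cb).
by rewrite IH // mulrN.
Qed.

(** The function x evaluated on the boundary of the simplex whose vertices are
    the letters, restricted to the faces opposite to letters that satisfy P. *)
Fixpoint dsum (X : Type) (P : pred X) (x : seq X -> K) (s : seq X) : K :=
  match s with
  | [::] => 0
  | a :: s' => (if P a then x s' else 0) - dsum P (x \o cons a) s'
  end.

Lemma dsum_linear X (P : pred X) k x x' s :
  dsum P (fun t => k * x t + x' t) s = k * dsum P x s + dsum P x' s.
Proof.
elim: s x x' => [|a s IH] x x' /=; first by rewrite mulr0 addr0.
rewrite (IH (x \o cons a) (x' \o cons a)) mulrBr.
by case: ifP => _; rewrite ?mulr0 ?add0r ?sub0r opprD // addrACA.
Qed.

Lemma dsum0 X (P : pred X) s : dsum P (fun=> 0) s = 0.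
Proof.
have := dsum_linear P (-1) (fun=> 0) (fun=> 0) s.
rewrite (_ : (fun _ => _) = fun=> 0); first by rewrite mulN1r addNr.
by apply: funext => t; rewrite mulr0 addr0.
Qed.

Lemma dsumZ X (P : pred X) k x s : dsum P (fun t => k * x t) s = k * dsum P x s.
Proof.
have := dsum_linear P k x (fun=> 0) s; rewrite dsum0 addr0 => <-.
by congr dsum; apply: funext => t; rewrite addr0.
Qed.

Lemma dsumN X (P : pred X) x s : dsum P (fun t => - x t) s = - dsum P x s.
Proof.
rewrite -mulN1r -dsumZ; congr dsum.
by apply: funext => t; rewrite mulN1r.
Qed.

Lemma dsumB X (P : pred X) x y s :
  dsum P (fun t => x t - y t) s = dsum P x s - dsum P y s.
Proof.
rewrite addrC -mulN1r -dsum_linear; congr dsum.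
by apply: funext => t; rewrite mulN1r addrC.
Qed.

Lemma dsum_hat X (P : pred X) x : dsum P (hat x) = fun s => - hat (dsum P x) s.
Proof.
apply: funext => s; rewrite /hat; elim: s x => [|a s IH] x /=.
  by rewrite mulr0 oppr0.
rewrite hat_cons dsumN /hat IH exprS mulN1r mulNr opprK mulrBr.
by case: ifP; rewrite ?mulr0 opprK.
Qed.

(** Two letters are removed in either order, with opposite signs. *)
Lemma dsum_dsum X (P : pred X) x s : dsum P (dsum P x) s = 0.
Proof.
elim: s x => [|a s IH] x //=.
have -> : dsum P x \o cons a
  = fun t => (if P a then x t else 0) - dsum P (x \o cons a) t.
  by apply: funext.
rewrite dsumB IH subr0; case: ifP => _; last by rewrite dsum0 subr0.
exact: subrr.
Qed.

Lemma dsum_alternating X (P : pred X) x : alternating x -> alternating (dsum P x).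
Proof.
move=> hx s1 a b s2; elim: s1 x hx => [|c s1 IH] x hx /=; last first.
  rewrite IH; last exact: alternating_cons.
  by rewrite hx opprD; case: ifP => _; rewrite ?oppr0.
have -> : dsum P ((x \o cons a) \o cons b) s2 = - dsum P ((x \o cons b) \o cons a) s2.
  rewrite -dsumN; congr dsum; apply: funext => t /=; exact: (hx [::]).
by rewrite opprK opprB opprD addrA addrAC.
Qed.

Lemma dsum_neq0 X (P : pred X) x s : dsum P x s != 0 ->
  exists s1 a s2, [/\ s = s1 ++ a :: s2, P a & x (s1 ++ s2) != 0].
Proof.
elim: s x => [|a s IH] x /=; first by rewrite eqxx.
have [|nz] := eqVneq (dsum P (x \o cons a) s) 0.
  move=> ->; rewrite subr0; case: ifP => [Pa xs|_]; last by rewrite eqxx.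
  by exists [::], a, s.
have [s1 [b [s2 [-> Pb h]]]] := IH _ nz.
by move=> _; exists (a :: s1), b, s2.
Qed.

Lemma eq_dsum X (P P' : pred X) x x' s :
  (forall s1 a s2, s = s1 ++ a :: s2 ->
     (if P a then x (s1 ++ s2) else 0) = (if P' a then x' (s1 ++ s2) else 0)) ->
  dsum P x s = dsum P' x' s.
Proof.
elim: s x x' => [|a s IH] x x' h //=.
rewrite (h [::] a s) // (IH (x \o cons a) (x' \o cons a)) // => s1 b s2 e.
by apply: (h (a :: s1)); rewrite e.
Qed.

Lemma dsum_map X Y (f : Y -> X) (P : pred X) x s :
  dsum P x (map f s) = dsum (P \o f) (x \o map f) s.
Proof. by elim: s x => //= a s IH x; rewrite IH. Qed.

(** The letters of a word must be removable exactly if they are so in their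
    subword. The sign for taking a removed letter past x is the one in hat x. *)
Lemma dsum_wcomp X Y Z (cl : Z -> option (X + Y)) (R : pred Z) (Ra : pred X) (Rb : pred Y) :
  (forall c a, cl c = Some (inl a) -> R c = Ra a) ->
  (forall c b, cl c = Some (inr b) -> R c = Rb b) ->
  (forall c, cl c = None -> R c = false) ->
  forall x y s, dsum R (wcomp cl x y) s
    = wcomp cl (dsum Ra x) y s + wcomp cl (hat x) (dsum Rb y) s.
Proof.
move=> hl hr h0 x y s; elim: s x y => [|c s IH] x y /=.
  by rewrite mul0r mulr0 addr0.
case E: (cl c) => [[a|b]|].
- have -> : wcomp cl x y \o cons c = wcomp cl (x \o cons a) y.
    by apply: funext => t /=; rewrite E.
  rewrite (hl _ _ E) IH hat_cons wcompNl opprD addrA; congr (_ - _).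
  have -> : dsum Ra x \o cons a
    = fun t => (if Ra a then 1 else 0) * x t + - dsum Ra (x \o cons a) t.
    by apply: funext => t /=; case: ifP => _; rewrite ?mul1r ?mul0r.
  by rewrite wcomp_linearl wcompNl; case: ifP => _; rewrite ?mul1r ?mul0r.
- have -> : wcomp cl x y \o cons c = wcomp cl (hat x) (y \o cons b).
    by apply: funext => t /=; rewrite E.
  rewrite (hr _ _ E) IH dsum_hat wcompNl opprD opprK hatK addrCA; congr (_ + _).
  have -> : dsum Rb y \o cons b
    = fun t => (if Rb b then 1 else 0) * y t + - dsum Rb (y \o cons b) t.
    by apply: funext => t /=; case: ifP => _; rewrite ?mul1r ?mul0r.
  by rewrite wcomp_linearr wcompNr; case: ifP => _; rewrite ?mul1r ?mul0r.
- have -> : wcomp cl x y \o cons c = fun=> 0.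
    by apply: funext => t /=; rewrite E.
  by rewrite (h0 _ E) dsum0 subr0 addr0.
Qed.

End Words.

(** * Symbols and cuts *)

(** A symbol stands for a part of a tree with inputs numbered by 'I_n,
    described by the set S of inputs above it: (S, false) is a straight edge,
    (S, true) is a vertex with wavy output. Straight edges include the input
    edges but not the output edge; wavy input edges and vertices with straight
    output have no symbol of their own. *)
Definition sym (n : nat) := ({set 'I_n} * bool)%type.

Definition iswavy (c : colour) : bool := if c is wavy then true else false.

Definition img q n (v : 'I_q -> 'I_n) : {set 'I_n} := v @: [set: 'I_q].

(** The set S seen from the outer tree of a composite, where A is the set of
    labels of the inner tree: the slot takes the place of A. *)
Definition outer_set p n (u : 'I_p -> option 'I_n) (A S : {set 'I_n}) : {set 'I_p} :=
  [set i | if u i is Some l then l \in S else A \subset S].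

(** S does not split A, as is the case for the sets of labels above the parts
    of the outer tree. *)
Definition sat n (A S : {set 'I_n}) := (A \subset S) || [disjoint A & S].

(** Whether a symbol on S belongs to the inner tree, whose set of labels is A.
    For S = A this depends on the output edge of the inner tree: if it is
    straight then it is the edge of the composite on A and counts as an input
    edge of the outer tree; if it is wavy then a symbol on A can only come from
    the inner tree. *)
Definition within n (w : bool) (A S : {set 'I_n}) := (S \subset A) && (w || (S != A)).

(** The factor of a two-vertex composite to which a symbol belongs, and the
    symbol there. *)
Definition cut p q n (e : colour) (u : 'I_p -> option 'I_n) (v : 'I_q -> 'I_n)
    (s : sym n) : option (sym p + sym q) :=
  if s.1 == set0 then None
  else if within (iswavy e) (img v) s.1 then Some (inr (v @^-1: s.1, s.2))
  else if sat (img v) s.1 then Some (inl (outer_set u (img v) s.1, s.2))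
  else None.

Section GraftingTheory.
Variables (p q n : nat) (a : 'I_p -> colour) (e : colour) (b : 'I_q -> colour)
  (z : 'I_n -> colour) (u : 'I_p -> option 'I_n) (v : 'I_q -> 'I_n).
Hypothesis h : grafting a e b z u v.

Lemma grafting_injv : injective v.
Proof.
move=> j j' e'; have [w [_ uw]] := grafting_labels h (v j).
have := uw (inr j); rewrite e' => /(_ erefl) E.
by have := uw (inr j'); rewrite e' E => /(_ erefl) [].
Qed.

Lemma grafting_inju i i' l : u i = Some l -> u i' = Some l -> i = i'.
Proof.
move=> e1 e2; have [w [_ uw]] := grafting_labels h l.
have E := uw (inl i) e1.
by have := uw (inl i') e2; rewrite E => -[].
Qed.

Lemma grafting_disj i j : u i <> Some (v j).
Proof.
move=> e1; have [w [_ uw]] := grafting_labels h (v j).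
have E := uw (inl i) e1.
by have := uw (inr j) erefl; rewrite E.
Qed.

Lemma grafting_slotP : exists i, u i = None.
Proof. by have [i [hi _]] := grafting_slot h; exists i. Qed.

Lemma grafting_slot_uniq i i' : u i = None -> u i' = None -> i = i'.
Proof. by have [i0 [_ ui]] := grafting_slot h => /ui <- /ui <-. Qed.

Lemma imgP l : reflect (exists j, v j = l) (l \in img v).
Proof.
apply: (iffP imsetP) => [[j _ ->]|[j <-]]; by exists j.
Qed.

Lemma mem_img j : v j \in img v.
Proof. by apply/imgP; exists j. Qed.

Lemma grafting_cover l : (exists i, u i = Some l) \/ l \in img v.
Proof.
have [[i|j] [/= hw _]] := grafting_labels h l; first by left; exists i.
by right; apply/imgP; exists j; case: hw.
Qed.

Lemma grafting_outP l : l \notin img v -> exists i, u i = Some l.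
Proof. by case: (grafting_cover l) => // ->. Qed.

Lemma grafting_notin i l : u i = Some l -> l \notin img v.
Proof. by move=> ui; apply/imgP => -[j vj]; apply: (grafting_disj (i := i) (j := j)); rewrite vj. Qed.

Lemma in_outer i S : (i \in outer_set u (img v) S)
  = if u i is Some l then l \in S else img v \subset S.
Proof. by rewrite inE. Qed.

(** For sets that do not split A nothing is lost in the passage to the outer
    tree: A is represented by the slot, which needs A to be nonempty. *)
Lemma outer_sub S T : sat (img v) S -> sat (img v) T -> img v != set0 ->
  (outer_set u (img v) S \subset outer_set u (img v) T) = (S \subset T).
Proof.
move=> sS sT A0; apply/subsetP/subsetP => [k l lS|k i]; last first.
  rewrite !in_outer; case: (u i) => [l|]; first exact: k.
  by move=> AS; apply: subset_trans AS _; apply/subsetP.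
case lA: (l \in img v); last first.
  have [i ui] := grafting_outP (negbT lA).
  by have := k i; rewrite !in_outer ui; apply.
have [i ui] := grafting_slotP.
have := k i; rewrite !in_outer ui => {}k; case/orP: sS => [AS|dS]; last first.
  by have := disjointFr dS lA; rewrite lS.
exact: (subsetP (k AS)).
Qed.

Lemma outer_eq S T : sat (img v) S -> sat (img v) T -> img v != set0 ->
  (outer_set u (img v) S == outer_set u (img v) T) = (S == T).
Proof. by move=> sS sT A0; rewrite !eqEsubset !outer_sub. Qed.

Lemma outer_disj S T : sat (img v) S -> sat (img v) T -> img v != set0 ->
  [disjoint outer_set u (img v) S & outer_set u (img v) T] = [disjoint S & T].
Proof.
move=> sS sT A0; apply/pred0P/pred0P => k => [l|i] /=.
  apply/negP => /andP[lS lT]; case lA: (l \in img v); last first.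
    have [i ui] := grafting_outP (negbT lA).
    by have /= := k i; rewrite !in_outer ui lS lT.
  have [i ui] := grafting_slotP.
  have /= := k i; rewrite !in_outer ui.
  case/orP: sS => [->|dS]; last by have := disjointFr dS lA; rewrite lS.
  by case/orP: sT => [->|dT] //; have := disjointFr dT lA; rewrite lT.
rewrite !in_outer; case: (u i) => [l|]; first exact: k.
apply/negP => /andP[AS AT]; case/set0Pn: A0 => l lA.
by have /= := k l; rewrite (subsetP AS) // (subsetP AT).
Qed.

Lemma outer_eq0 S : sat (img v) S -> img v != set0 ->
  (outer_set u (img v) S == set0) = (S == set0).
Proof.
move=> sS A0.
have s0 : sat (img v) set0 by rewrite /sat -setI_eq0 setI0 eqxx orbT.
rewrite -(outer_eq sS s0 A0); congr (_ == _); apply/esym/setP => i.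
rewrite in_outer inE; case: (u i) => [l|]; rewrite ?inE //.
by rewrite subset0 (negbTE A0).
Qed.

Lemma inner_sub (S T : {set 'I_n}) : S \subset img v ->
  (v @^-1: S \subset v @^-1: T) = (S \subset T).
Proof.
move=> SA; apply/subsetP/subsetP => [k l lS|k j]; last by rewrite !inE; apply: k.
have /imgP[j vj] := subsetP SA _ lS.
by have := k j; rewrite !inE vj; apply.
Qed.

Lemma inner_disj (S T : {set 'I_n}) : S \subset img v ->
  [disjoint v @^-1: S & v @^-1: T] = [disjoint S & T].
Proof.
move=> SA; apply/pred0P/pred0P => k => [l|j] /=; last by rewrite !inE; apply: k.
apply/negP => /andP[lS lT]; have /imgP[j vj] := subsetP SA _ lS.
by have /= := k j; rewrite !inE vj lS lT.
Qed.

Lemma inner_eq (S T : {set 'I_n}) : S \subset img v -> T \subset img v ->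
  (v @^-1: S == v @^-1: T) = (S == T).
Proof. by move=> SA TA; rewrite !eqEsubset !inner_sub. Qed.

Lemma inner_eq0 (S : {set 'I_n}) : S \subset img v -> (v @^-1: S == set0) = (S == set0).
Proof. by move=> SA; rewrite -!subset0 -(inner_sub set0 SA) preimset0. Qed.

Lemma inner_img : v @^-1: (img v) = setT.
Proof. by apply/setP => j; rewrite !inE mem_img. Qed.

Lemma img_neq0 : (0 < q)%N -> img v != set0.
Proof. by move=> q0; apply/set0Pn; exists (v (Ordinal q0)); apply: mem_img. Qed.

End GraftingTheory.

Lemma sat_sub n (A S : {set 'I_n}) : A \subset S -> sat A S.
Proof. by rewrite /sat => ->. Qed.

Lemma sat_disj n (A S : {set 'I_n}) : [disjoint A & S] -> sat A S.
Proof. by rewrite /sat orbC => ->. Qed.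

Section Sequential.
Variables (p q r m m' n : nat) (e g : colour)
    (a : 'I_p -> colour) (b : 'I_q -> colour) (b' : 'I_r -> colour)
    (w : 'I_m -> colour) (w' : 'I_m' -> colour) (z : 'I_n -> colour).
Variables (u1 : 'I_p -> option 'I_m) (v1 : 'I_q -> 'I_m)
  (u2 : 'I_m -> option 'I_n) (v2 : 'I_r -> 'I_n)
  (u3 : 'I_q -> option 'I_m') (v3 : 'I_r -> 'I_m')
  (u4 : 'I_p -> option 'I_n) (v4 : 'I_m' -> 'I_n).
Hypotheses (h1 : grafting a e b w u1 v1) (h2 : grafting w g b' z u2 v2)
  (h3 : grafting b g b' w' u3 v3) (h4 : grafting a e w' z u4 v4).
Hypotheses (k1 : obind u2 \o u1 =1 u4) (k2 : u2 \o v1 =1 omap v4 \o u3)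
  (k3 : v2 =1 v4 \o v3).
Hypotheses (r0 : (0 < r)%N) (eg : iswavy g -> iswavy e).

Let CB : img v2 \subset img v4.
Proof. by apply/subsetP => l /imgP[j <-]; rewrite k3; apply: mem_img. Qed.

Let innC : v4 @^-1: (img v2) = img v3.
Proof.
apply/setP => k; rewrite inE; apply/imgP/imgP => -[j].
  by rewrite k3 => /(grafting_injv h4) <-; exists j.
by move=> <-; exists j; rewrite k3.
Qed.

Let outB : outer_set u2 (img v2) (img v4) = img v1.
Proof.
apply/setP => i; rewrite in_outer; apply/idP/imgP.
  case E: (u2 i) => [l|].
    move=> /imgP[k vk]; case: (grafting_cover h3 k) => [[j uj]|/imgP[j vj]].
      exists j; have := k2 j; rewrite /= uj /= vk => ej.
      exact: (grafting_inju h2 ej E).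
    have := grafting_notin h2 E; rewrite -vk -vj.
    by have := k3 j => /= <-; rewrite mem_img.
  move=> _; have [j uj] := grafting_slotP h3.
  by exists j; have := k2 j; rewrite /= uj /= => ej; apply: (grafting_slot_uniq h2 ej E).
move=> [j <-]; have := k2 j; rewrite /=; case: (u3 j) => [k|] /= -> //.
exact: mem_img.
Qed.

(** Both ways of cutting in three depend only on the position of S relative to
    the label sets C and B of the upper trees, where C lies in B; each branch
    of the proof is one position. For g wavy and e straight the case S = B = C
    would be an exception, since the symbol would belong to the top tree
    without belonging to the upper two. *)
Lemma cut_sequential c :
     match cut g u2 v2 c with
     | None => None
     | Some (inl w) => match cut e u1 v1 w with
         | None => None | Some (inl a) => Some (inl a)
         | Some (inr b) => Some (inr (inl b)) end
     | Some (inr t) => Some (inr (inr t)) end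
   = match cut e u4 v4 c with
     | None => None
     | Some (inl a) => Some (inl a)
     | Some (inr w) => match cut g u3 v3 w with
         | None => None | Some b => Some (inr b) end end.
Proof.
case: c => S k; rewrite {1 3}/cut /=; have [//|S0] := eqVneq S set0.
have C0 := img_neq0 v2 r0.
have B0 : img v4 != set0 by apply: contraNneq C0 => B0; rewrite -subset0 -B0.
have sB : sat (img v2) (img v4) by apply: sat_sub.
case: ifP => [/andP[SC gS]|nC].
  have SB := subset_trans SC CB.
  have -> : within (iswavy e) (img v4) S.
    rewrite /within SB /=; case E: (iswavy e) => //=.
    move: gS; case G: (iswavy g); first by rewrite (eg G) in E.
    by move=> /= SC'; apply: contraNneq SC' => E'; rewrite eqEsubset SC E' CB.
  rewrite /cut /= (inner_eq0 SB) (negbTE S0) -innC /within (inner_sub _ SB) SC /=.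
  rewrite (inner_eq SB CB) gS; do 4 congr Some || congr inr || congr pair.
  by apply/setP => j; rewrite !inE k3.
case: ifP => [sS|nS]; last first.
  case: ifP => [/andP[SB _]|_].
    rewrite /cut /= (inner_eq0 SB) (negbTE S0) -innC /within (inner_sub _ SB).
    rewrite (inner_eq SB CB) -/(within (iswavy g) (img v2) S) nC.
    by rewrite /sat (inner_sub _ CB) disjoint_sym (inner_disj _ SB) disjoint_sym -/(sat _ _) nS.
  case: ifP => // /orP[BS|dS].
    by move: nS; rewrite sat_sub // (subset_trans CB).
  by move: nS; rewrite sat_disj // (disjointWl CB).
rewrite {1}/cut /= (outer_eq0 h2 sS C0) (negbTE S0) -outB.
rewrite /within (outer_sub h2 sS sB C0) (outer_eq h2 sS sB C0).
case: ifP => [/andP[SB _]|_].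
  rewrite /cut /= (inner_eq0 SB) (negbTE S0) -innC /within (inner_sub _ SB).
  rewrite (inner_eq SB CB) -/(within (iswavy g) (img v2) S) nC.
  rewrite /sat (inner_sub _ CB) disjoint_sym (inner_disj _ SB) disjoint_sym -/(sat _ _) sS.
  do 3 congr Some || congr inr || congr inl; congr pair.
  apply/setP => j; rewrite !inE (k2 j : u2 (v1 j) = omap v4 (u3 j)).
  by case: (u3 j) => [i|] /=; rewrite ?inE // (inner_sub _ CB).
rewrite {1}/sat (outer_sub h2 sB sS C0) (outer_disj h2 sB sS C0) -/(sat _ _).
case: ifP => // _; congr (Some (inl (_, _))); apply/setP => i.
rewrite !inE; have := k1 i; rewrite /=; case E: (u1 i) => [j|] /= => [ej|<-].
  rewrite inE ej; case E4: (u4 i) => [l|] //.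
  have [j' uj'] := grafting_slotP h3.
  have := k2 j'; rewrite /= uj' /= => ej'; rewrite E4 in ej.
  by have := grafting_notin h1 E; rewrite (grafting_slot_uniq h2 ej ej') mem_img.
by rewrite (outer_sub h2 sB sS C0).
Qed.
End Sequential.

Section Parallel.
Variables (p q r m m' n : nat) (e g : colour)
    (a : 'I_p -> colour) (b : 'I_q -> colour) (b' : 'I_r -> colour)
    (w : 'I_m -> colour) (w' : 'I_m' -> colour) (z : 'I_n -> colour).
Variables (u1 : 'I_p -> option 'I_m) (v1 : 'I_q -> 'I_m)
  (u2 : 'I_m -> option 'I_n) (v2 : 'I_r -> 'I_n)
  (u3 : 'I_p -> option 'I_m') (v3 : 'I_r -> 'I_m')
  (u4 : 'I_m' -> option 'I_n) (v4 : 'I_q -> 'I_n).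
Hypotheses (h1 : grafting a e b w u1 v1) (h2 : grafting w g b' z u2 v2)
  (h3 : grafting a g b' w' u3 v3) (h4 : grafting w' e b z u4 v4).
Hypotheses (k0 : forall i, u1 i = None -> u3 i <> None)
  (k1 : obind u2 \o u1 =1 obind u4 \o u3)
  (k2 : u2 \o v1 =1 Some \o v4) (k3 : Some \o v2 =1 u4 \o v3).
Hypotheses (q0 : (0 < q)%N) (r0 : (0 < r)%N).

Let dBC : [disjoint img v4 & img v2].
Proof.
apply/pred0P => l /=; apply/negP => /andP[/imgP[j <-] /imgP[i vi]].
have := grafting_notin h2 (k2 j : u2 (v1 j) = Some (v4 j)).
by rewrite -vi mem_img.
Qed.

Let outB : outer_set u2 (img v2) (img v4) = img v1.
Proof.
apply/setP => i; rewrite in_outer; apply/idP/imgP.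
  case E: (u2 i) => [l|].
    move=> /imgP[k vk]; exists k; have := k2 k; rewrite /= vk => ej.
    exact: (grafting_inju h2 ej E).
  move=> CB; have := dBC; rewrite disjoint_sym => /disjoint_setI0.
  by move/setIidPl: CB => -> C0; have := img_neq0 v2 r0; rewrite C0 eqxx.
by move=> [j <-]; have := k2 j; rewrite /= => ->; apply: mem_img.
Qed.

Let outC : outer_set u4 (img v4) (img v2) = img v3.
Proof.
apply/setP => i; rewrite in_outer; apply/idP/imgP.
  case E: (u4 i) => [l|].
    move=> /imgP[k vk]; exists k; have := k3 k; rewrite /= vk => ej.
    exact: (grafting_inju h4 (esym ej) E).
  move=> CB; have := dBC => /disjoint_setI0.
  by move/setIidPl: CB => -> C0; have := img_neq0 v4 q0; rewrite C0 eqxx.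
by move=> [j <-]; have := k3 j; rewrite /= => <-; apply: mem_img.
Qed.

(** The label sets of the two upper trees are disjoint, so that a symbol in one
    of them is in the outer part for the other. *)
Lemma cut_parallel c :
     match cut g u2 v2 c with
     | None => None
     | Some (inl w) => match cut e u1 v1 w with
         | None => None | Some (inl a) => Some (inl a)
         | Some (inr b) => Some (inr (inl b)) end
     | Some (inr t) => Some (inr (inr t)) end
   = match cut e u4 v4 c with
     | None => None
     | Some (inl w) => match cut g u3 v3 w with
         | None => None | Some (inl a) => Some (inl a)
         | Some (inr t) => Some (inr (inr t)) end
     | Some (inr b) => Some (inr (inl b)) end.
Proof.
case: c => S k; rewrite {1 3}/cut /=; have [//|S0] := eqVneq S set0.
have C0 := img_neq0 v2 r0; have B0 := img_neq0 v4 q0.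
have sB : sat (img v2) (img v4) by apply: sat_disj; rewrite disjoint_sym.
have sC : sat (img v4) (img v2) by apply: sat_disj.
have notboth : S \subset img v2 -> S \subset img v4 -> False.
  move=> SC SB; have /disjoint_setI0 I0 := dBC; case/negP: S0.
  by rewrite -subset0 -I0 subsetI SB SC.
case: ifP => [/andP[SC gS]|nC].
  have -> : within (iswavy e) (img v4) S = false.
    by apply/negP => /andP[SB _]; apply: notboth.
  have sS : sat (img v4) S by apply: sat_disj; rewrite (disjointWr SC).
  rewrite sS /cut /= (outer_eq0 h4 sS B0) (negbTE S0) -outC.
  rewrite /within (outer_sub h4 sS sC B0) SC (outer_eq h4 sS sC B0) /= gS.
  do 3 congr Some || congr inr; congr pair.
  by apply/setP => j; rewrite !inE -(k3 j : Some (v2 j) = u4 (v3 j)).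
case: (boolP (within (iswavy e) (img v4) S)) => [/andP[SB eS]|nB].
  have sS : sat (img v2) S by apply: sat_disj; rewrite disjoint_sym (disjointWl SB).
  rewrite sS /cut /= (outer_eq0 h2 sS C0) (negbTE S0) -outB.
  rewrite /within (outer_sub h2 sS sB C0) SB (outer_eq h2 sS sB C0) /= eS.
  congr (Some (inr (inl (_, _)))).
  by apply/setP => j; rewrite !inE (k2 j : u2 (v1 j) = Some (v4 j)).
case: (boolP (sat (img v2) S)) => sS2; case: (boolP (sat (img v4) S)) => sS4 //.
- rewrite /cut /= (outer_eq0 h2 sS2 C0) (outer_eq0 h4 sS4 B0) (negbTE S0) -outB -outC.
  rewrite /within (outer_sub h2 sS2 sB C0) (outer_eq h2 sS2 sB C0).
  rewrite (outer_sub h4 sS4 sC B0) (outer_eq h4 sS4 sC B0).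
  rewrite -/(within (iswavy e) _ S) (negbTE nB) -/(within (iswavy g) _ S) nC.
  rewrite /sat (outer_sub h2 sB sS2 C0) (outer_disj h2 sB sS2 C0) -/(sat _ _) sS4.
  rewrite (outer_sub h4 sC sS4 B0) (outer_disj h4 sC sS4 B0) -/(sat _ _) sS2.
  congr (Some (inl (_, _))); apply/setP => i; rewrite !inE.
  have := k1 i; rewrite /=; case E1: (u1 i) => [j|]; case E3: (u3 i) => [j'|] /=.
  + rewrite !inE; case E2: (u2 j) => [l|] <- //.
    have [i' ui'] := grafting_slotP h3.
    have : u1 i' <> None by move=> /k0.
    have := k1 i'; rewrite /= ui' /=; case E1': (u1 i') => [j1|] //= ej1 _.
    have ej : j1 = j by apply: (grafting_slot_uniq h2).
    rewrite ej in E1'; rewrite (grafting_inju h1 E1' E1) in ui'.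
    by rewrite ui' in E3.
  + by rewrite inE (outer_sub h4 sC sS4 B0) => ->.
  + by rewrite inE (outer_sub h2 sB sS2 C0) => <-.
  + by move: (k0 E1); rewrite E3.
- rewrite /cut /= (outer_eq0 h2 sS2 C0) (negbTE S0) -outB.
  rewrite /within (outer_sub h2 sS2 sB C0) (outer_eq h2 sS2 sB C0).
  rewrite -/(within (iswavy e) _ S) (negbTE nB).
  by rewrite /sat (outer_sub h2 sB sS2 C0) (outer_disj h2 sB sS2 C0) -/(sat _ _) (negbTE sS4).
- rewrite /cut /= (outer_eq0 h4 sS4 B0) (negbTE S0) -outC.
  rewrite /within (outer_sub h4 sS4 sC B0) (outer_eq h4 sS4 sC B0).
  rewrite -/(within (iswavy g) _ S) nC.
  by rewrite /sat (outer_sub h4 sC sS4 B0) (outer_disj h4 sC sS4 B0) -/(sat _ _) (negbTE sS2).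
Qed.
End Parallel.

(** * Trees as nested families *)

(** The symbols that all trees on the given labels share: the straight input
    edges and, for wavy output, the root vertex. Identities are exceptions: a
    straight one has no input edge apart from its output edge, and a wavy one
    has no vertex. *)
Record mandatory (c : colour) n (a : 'I_n -> colour) (s : seq (sym n)) : Prop :=
  Mandatory {
  t_pos : (0 < n)%N;
  t_col : ~~ iswavy c -> forall l, ~~ iswavy (a l);
  t_triv : iswavy c -> (forall l, iswavy (a l)) -> n = 1%N;
  t_leaf : forall l, ~~ iswavy (a l) -> iswavy c \/ n <> 1%N ->
    ([set l], false) \in s;
  t_root : forall l, iswavy c -> ~~ iswavy (a l) -> (setT, true) \in s
}.

(** Symbols are nested or disjoint, and no wavy vertex lies above a straight
    edge. The label l of t_wav is joined to the wavy vertex by straight edges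
    only; it witnesses that the vertex has a straight input, i.e. that m >= 1
    for f_{m,n}. *)
Record nested (c : colour) n (a : 'I_n -> colour) (s : seq (sym n)) : Prop :=
  Nested {
  t_uniq : uniq s;
  t_str : forall S, (S, false) \in s -> [/\ S != set0,
    forall l, l \in S -> ~~ iswavy (a l) & iswavy c || (S != setT)];
  t_wav : forall S, (S, true) \in s -> iswavy c /\
    exists l, [/\ l \in S, ~~ iswavy (a l)
      & forall S', (S', true) \in s -> S' \proper S -> l \notin S'];
  t_lam : forall S S' k, (S, k) \in s -> (S', k) \in s ->
    [\/ [disjoint S & S'], S \subset S' | S' \subset S];
  t_mix : forall S S', (S, false) \in s -> (S', true) \in s ->
    [disjoint S & S'] \/ S \subset S'
}.

Definition tree c n (a : 'I_n -> colour) s := mandatory c a s /\ nested c a s.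

(** The symbols whose removal contracts an internal edge. The rest are the
    input edges and the root vertex. *)
Definition removable n (s : sym n) : bool :=
  if s.2 then s.1 != setT else #|s.1| != 1%N.

Lemma mandatory_sub c n (a : 'I_n -> colour) s t :
  mandatory c a s -> (forall x, x \in s -> ~~ removable x -> x \in t) ->
  mandatory c a t.
Proof.
case=> h1 h2 h3 h4 h5 k; split=> // l.
  by move=> al nt; apply: k; rewrite ?h4 // /removable /= cards1.
by move=> cw al; apply: k; rewrite ?(h5 l) // /removable /= eqxx.
Qed.

Lemma nested_sub c n (a : 'I_n -> colour) s t :
  nested c a s -> uniq t -> {subset t <= s} -> nested c a t.
Proof.
case=> h1 h2 h3 h4 h5 ut k; split=> //.
- by move=> S /k /h2.
- move=> S /k /h3 [cw [l [lS al hl]]]; split=> //; exists l; split=> // S' /k.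
  exact: hl.
- by move=> S S' k' /k hS /k; apply: h4.
- by move=> S S' /k hS /k; apply: h5.
Qed.

Lemma tree_perm c n (a : 'I_n -> colour) s t :
  perm_eq s t -> tree c a s -> tree c a t.
Proof.
move=> pst [hm hn]; split.
  by apply: (mandatory_sub hm) => x; rewrite (perm_mem pst).
apply: (nested_sub hn); last by move=> x; rewrite (perm_mem pst).
by rewrite -(perm_uniq pst); case: hn.
Qed.

Lemma tree_remove c n (a : 'I_n -> colour) s1 x s2 : removable x ->
  tree c a (s1 ++ x :: s2) -> tree c a (s1 ++ s2).
Proof.
move=> rx [hm hn]; split.
  apply: (mandatory_sub hm) => y; rewrite !mem_cat inE.
  by case: eqP => [->|_ //]; rewrite rx.
apply: (nested_sub hn); last first.
  by move=> y; rewrite !mem_cat inE => /orP[->|->]; rewrite ?orbT.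
case: hn => un _ _ _ _; apply: subseq_uniq un.
by rewrite cat_subseq // subseq_cons.
Qed.

Section OutsInns.
Variables (X Y Z : eqType) (cl : Z -> option (X + Y)).

Lemma mem_outs a s :
  reflect (exists2 c, c \in s & cl c = Some (inl a)) (a \in outs cl s).
Proof.
apply: (iffP idP) => [|[c cs e]].
  rewrite /outs mem_pmap => /mapP[c cs]; case E: (cl c) => [[a'|b]|] // [->].
  by exists c.
by rewrite /outs mem_pmap; apply/mapP; exists c; rewrite ?e.
Qed.

Lemma mem_inns b s :
  reflect (exists2 c, c \in s & cl c = Some (inr b)) (b \in inns cl s).
Proof.
apply: (iffP idP) => [|[c cs e]].
  rewrite /inns mem_pmap => /mapP[c cs]; case E: (cl c) => [[a'|b']|] // [->].
  by exists c.
by rewrite /inns mem_pmap; apply/mapP; exists c; rewrite ?e.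
Qed.

Lemma uniq_join s : all (fun c => cl c : bool) s ->
  uniq (outs cl s) -> uniq (inns cl s) -> uniq s.
Proof.
elim: s => //= c s IH /andP[]; rewrite /outs /inns /=.
case E: (cl c) => [[a|b]|] //= _ hs.
  move=> /andP[na u1] u2; rewrite IH // andbT; apply: contra na => cs.
  by apply/mem_outs; exists c.
move=> u1 /andP[nb u2]; rewrite IH // andbT; apply: contra nb => cs.
by apply/mem_inns; exists c.
Qed.

Hypothesis inj : forall c c', cl c -> cl c = cl c' -> c = c'.

Lemma uniq_outs s : uniq s -> uniq (outs cl s).
Proof.
elim: s => //= c s IH /andP[cs us]; rewrite /outs /=.
case E: (cl c) => [[a|b]|] //=; rewrite IH // andbT.
apply: contra cs => /mem_outs [c' c's e]; rewrite (inj (c := c) (c' := c')) ?E //.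
Qed.

Lemma uniq_inns s : uniq s -> uniq (inns cl s).
Proof.
elim: s => //= c s IH /andP[cs us]; rewrite /inns /=.
case E: (cl c) => [[a|b]|] //=; rewrite IH // andbT.
apply: contra cs => /mem_inns [c' c's e]; rewrite (inj (c := c) (c' := c')) ?E //.
Qed.
End OutsInns.

Section CutSpec.
Variables (p q n : nat) (e : colour) (u : 'I_p -> option 'I_n) (v : 'I_q -> 'I_n).

Lemma cut_inlP c x : cut e u v c = Some (inl x) ->
  [/\ c.1 != set0, ~~ within (iswavy e) (img v) c.1, sat (img v) c.1
    & x = (outer_set u (img v) c.1, c.2)].
Proof.
rewrite /cut; case: eqP => // _; case: ifP => // _; case: ifP => // _.
by case=> ->.
Qed.

Lemma cut_inrP c x : cut e u v c = Some (inr x) ->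
  [/\ c.1 != set0, within (iswavy e) (img v) c.1 & x = (v @^-1: c.1, c.2)].
Proof.
rewrite /cut; case: eqP => // _; case: ifP => // _; last by case: ifP.
by case=> ->.
Qed.

Lemma cut_inl c : c.1 != set0 -> ~~ within (iswavy e) (img v) c.1 ->
  sat (img v) c.1 -> cut e u v c = Some (inl (outer_set u (img v) c.1, c.2)).
Proof. by rewrite /cut => /negbTE -> /negbTE -> ->. Qed.

Lemma cut_inr c : c.1 != set0 -> within (iswavy e) (img v) c.1 ->
  cut e u v c = Some (inr (v @^-1: c.1, c.2)).
Proof. by rewrite /cut => /negbTE -> ->. Qed.

Lemma cut_defined c : cut e u v c ->
  c.1 != set0 /\ (within (iswavy e) (img v) c.1 || sat (img v) c.1).
Proof.
by rewrite /cut; case: eqP => // _; case: ifP => // _; case: ifP.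
Qed.
End CutSpec.

Lemma within_sub n w (A S : {set 'I_n}) : within w A S -> S \subset A.
Proof. by case/andP. Qed.

Section TreeCut.
Variables (p q n : nat) (c e : colour) (a : 'I_p -> colour) (b : 'I_q -> colour)
  (z : 'I_n -> colour) (u : 'I_p -> option 'I_n) (v : 'I_q -> 'I_n).
Hypothesis h : grafting a e b z u v.
Let A := img v.
Let cl := cut e u v.

Lemma cut_inj : (0 < q)%N -> forall x x', cl x -> cl x = cl x' -> x = x'.
Proof.
move=> q0 [S k] [S' k']; have A0 := img_neq0 v q0.
case E: (cl (S, k)) => [[y|y]|] // _ E'.
  have [/= _ _ sS ey] := cut_inlP E; have [/= _ _ sS' ey'] := cut_inlP (esym E').
  by move: ey'; rewrite ey => -[/eqP]; rewrite (outer_eq h sS sS' A0) => /eqP -> ->.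
have [/= _ /within_sub sS ey] := cut_inrP E.
have [/= _ /within_sub sS' ey'] := cut_inrP (esym E').
by move: ey'; rewrite ey => -[/eqP]; rewrite (inner_eq sS sS') => /eqP -> ->.
Qed.

Lemma slot_colour i : u i = None -> a i = e.
Proof. exact: grafting_slot_colour h i. Qed.

Lemma outer_img i : u i = None -> outer_set u A A = [set i].
Proof.
move=> ui; apply/setP => j; rewrite in_outer inE.
case E: (u j) => [l|]; last by rewrite subxx (grafting_slot_uniq h E ui) eqxx.
rewrite (negbTE (grafting_notin h E)); apply/esym/negP => /eqP ej.
by rewrite -ej E in ui.
Qed.

Lemma outer_set1 i l : u i = Some l -> (0 < q)%N -> outer_set u A [set l] = [set i].
Proof.
move=> ui q0; apply/setP => j; rewrite in_outer inE.
case E: (u j) => [l'|].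
  rewrite inE; apply/eqP/eqP => [el|ej]; last by move: E; rewrite ej ui => -[].
  by rewrite el in E; exact: (grafting_inju h E ui).
have nj : j <> i by move=> ej; rewrite ej ui in E.
move/eqP/negbTE: nj => ->; apply/negP => /subsetP /(_ (v (Ordinal q0)) (mem_img _ _)).
rewrite inE => /eqP vl; have := grafting_notin h ui.
by rewrite -vl mem_img.
Qed.

Lemma outer_setT : outer_set u A setT = setT.
Proof.
apply/setP => i; rewrite in_outer !inE.
by case: (u i) => [l|]; rewrite ?inE ?subsetT.
Qed.

Lemma sat_set1 l : l \notin A -> sat A [set l].
Proof. by move=> lA; apply: sat_disj; rewrite disjoint_sym disjoints1. Qed.

Lemma satT : sat A setT.
Proof. by apply: sat_sub; apply: subsetT. Qed.

Lemma satA : sat A A.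
Proof. exact: sat_sub. Qed.

Lemma ord_all_eq m : (0 < m)%N -> (forall i j : 'I_m, i = j) -> m = 1%N.
Proof.
case: m => [//|[//|m]] _ /(_ ord0 ord_max) /(congr1 val); discriminate.
Qed.

Lemma ord_eq_all m (i j : 'I_m) : m = 1%N -> i = j.
Proof. by move=> e1; move: i j; rewrite e1 => i j; rewrite !ord1. Qed.

Lemma cut_arity1 : p = 1%N -> q = 1%N -> n = 1%N.
Proof.
move=> p1 q1; have [i ui] := grafting_slotP h.
have inA l : l \in A.
  case: (grafting_cover h l) => // -[j uj].
  by move: uj; rewrite (ord_eq_all j i p1) ui.
apply: ord_all_eq.
  by apply: leq_ltn_trans (ltn_ord (v (Ordinal (m := 0) _))) => //; rewrite q1.
move=> l l'; have /imgP[j <-] := inA l; have /imgP[j' <-] := inA l'.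
by rewrite (ord_eq_all j j').
Qed.

Section Word.
Variable s : seq (sym n).
Hypothesis hs : all (fun x => cl x : bool) s.

Lemma word_cases S k : (S, k) \in s ->
  [/\ ~~ within (iswavy e) A S, sat A S & (outer_set u A S, k) \in outs cl s]
  \/ within (iswavy e) A S /\ (v @^-1: S, k) \in inns cl s.
Proof.
move=> Ss; have := allP hs _ Ss; case E: (cl (S, k)) => [[x|x]|] // _.
  have [/= S0 nw sS ex] := cut_inlP E; left; split=> //.
  by apply/mem_outs; exists (S, k); rewrite // E ex.
have [/= S0 nw ex] := cut_inrP E; right; split=> //.
by apply/mem_inns; exists (S, k); rewrite // E ex.
Qed.

Lemma outs_source P k : (P, k) \in outs cl s ->
  exists S, [/\ (S, k) \in s, S != set0, ~~ within (iswavy e) A S, sat A S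
    & P = outer_set u A S].
Proof.
case/mem_outs => -[S k'] Ss E; have [/= S0 nw sS [-> ->]] := cut_inlP E.
by exists S.
Qed.

Lemma inns_source P k : (P, k) \in inns cl s ->
  exists S, [/\ (S, k) \in s, S != set0, within (iswavy e) A S
    & P = v @^-1: S].
Proof.
case/mem_inns => -[S k'] Ss E; have [/= S0 nw [-> ->]] := cut_inrP E.
by exists S.
Qed.

(** Grafting two trees yields a tree. Conditions on symbols of one factor are
    inherited from it; of two symbols of different factors the inner one lies
    in A, and the outer one contains A or avoids it. *)
Lemma tree_join : tree c a (outs cl s) -> tree e b (inns cl s) -> tree c z s.
Proof.
move=> [ma na] [mb nb].
have q0 := t_pos mb; have A0 := img_neq0 v q0.
have [i0 ui0] := grafting_slotP h.
have ei0 := slot_colour ui0.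
have straightA : ~~ iswavy e -> forall l, l \in A -> ~~ iswavy (z l).
  by move=> se l /imgP[j <-]; rewrite -(grafting_inner_colour h); apply: (t_col mb).
have pull S : sat A S -> forall T, sat A T -> outer_set u A S = outer_set u A T -> S = T.
  by move=> sS T sT /eqP; rewrite (outer_eq h sS sT A0) => /eqP.
have pulli (S T : {set 'I_n}) : S \subset A -> T \subset A -> v @^-1: S = v @^-1: T -> S = T.
  by move=> sS sT /eqP; rewrite (inner_eq sS sT) => /eqP.
split; split.
- exact: leq_ltn_trans (ltn_ord (v (Ordinal q0))).
- move=> sc l; have se : ~~ iswavy e by rewrite -ei0; apply: (t_col ma).
  case: (grafting_cover h l) => [[i ui]|]; last exact: straightA.
  by rewrite -(grafting_outer_colour h ui); apply: (t_col ma).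
- move=> wc wz; have we : iswavy e.
    apply: contraT => se; have := straightA se _ (mem_img v (Ordinal q0)).
    by rewrite wz.
  apply: cut_arity1.
    apply: (t_triv ma wc) => i; case E: (u i) => [l|]; last by rewrite slot_colour.
    by rewrite (grafting_outer_colour h E).
  apply: (t_triv mb we) => j; by rewrite (grafting_inner_colour h).
- move=> l sl nt; have [|lA] := boolP (l \in A); last first.
    have [i ui] := grafting_outP h lA.
    have : ([set i], false) \in outs cl s.
      apply: (t_leaf ma); first by rewrite (grafting_outer_colour h ui).
      right=> p1; by rewrite (ord_eq_all i i0 p1) ui0 in ui.
    case/outs_source => S [Ss _ _ sS]; rewrite -(outer_set1 ui q0) => eS.
    by rewrite (pull _ (sat_set1 lA) _ sS eS).
  case/imgP=> j vj; have sj : ~~ iswavy (b j) by rewrite (grafting_inner_colour h) vj.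
  have [triv|ntb] : (~~ iswavy e /\ q = 1%N) \/ (iswavy e \/ q <> 1%N).
    by case: (iswavy e); case: (q =P 1%N); auto.
    have eA : A = [set l].
      apply/setP => l'; rewrite inE; apply/imgP/eqP => [[j' <-]|->]; last by exists j.
      by rewrite -vj (ord_eq_all j' j triv.2).
    have : ([set i0], false) \in outs cl s.
      apply: (t_leaf ma); first by rewrite ei0 triv.1.
      case: nt => [->|n1]; [by left|right => p1]; apply: n1.
      exact: cut_arity1 p1 triv.2.
    case/outs_source => S [Ss _ _ sS]; rewrite -(outer_img ui0) => eS.
    by rewrite -eA (pull _ satA _ sS eS).
  have := t_leaf mb sj ntb; case/inns_source => S [Ss _ /within_sub SA eS].
  have eS' : v @^-1: [set l] = v @^-1: S.
    by rewrite -eS; apply/setP => j'; rewrite !inE -vj (inj_eq (grafting_injv h)).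
  have lA : [set l] \subset A by rewrite sub1set -vj mem_img.
  by rewrite (pulli _ _ lA SA eS').
- move=> l wc sl.
  have [[i si]|allw] : (exists i, ~~ iswavy (a i)) \/ forall i, iswavy (a i).
    have [/existsP|/existsPn k] := boolP [exists i, ~~ iswavy (a i)]; first by left.
    by right=> i; apply: negbNE.
    have := t_root ma wc si; case/outs_source => S [Ss _ _ sS].
    by rewrite -outer_setT => eS; rewrite (pull _ satT _ sS eS).
  have p1 := t_triv ma wc allw; have we : iswavy e by rewrite -ei0.
  have AT : A = setT.
    apply/setP => l'; rewrite inE; case: (grafting_cover h l') => // -[i ui].
    by rewrite (ord_eq_all i i0 p1) ui0 in ui.
  have /imgP[j vj] : l \in A by rewrite AT inE.
  have := @t_root _ _ _ _ mb j we; rewrite (grafting_inner_colour h) vj => /(_ sl).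
  case/inns_source => S [Ss _ /within_sub SA]; rewrite -(inner_img v) => eS.
  by rewrite -AT [A](pulli _ _ (subxx _) SA eS).
- exact: uniq_join hs (t_uniq na) (t_uniq nb).
- move=> S Ss; have S0 : S != set0 by have [] := cut_defined (allP hs _ Ss).
  case: (word_cases Ss) => [[nw sS Po]|[wS Pi]].
    have [_ col nT] := t_str na Po; split=> //.
      move=> l lS; have [lA|lA] := boolP (l \in A).
        have AS : A \subset S.
          by case/orP: sS => // dS; have := disjointFr dS lA; rewrite lS.
        apply: straightA lA; rewrite -ei0; apply: col.
        by rewrite in_outer ui0.
      have [i ui] := grafting_outP h lA.
      by rewrite -(grafting_outer_colour h ui) col // in_outer ui.
    by case/orP: nT => [->//|]; rewrite -outer_setT (outer_eq h sS satT A0) => ->; rewrite orbT.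
  have [_ col nT] := t_str nb Pi; split=> //.
    move=> l lS; have /imgP[j vj] := subsetP (within_sub wS) _ lS.
    by rewrite -vj -(grafting_inner_colour h) col // inE vj.
  case wc: (iswavy c) => //=; have se : ~~ iswavy e.
    by rewrite -ei0; apply: (t_col ma); rewrite wc.
  case/andP: wS => SA; rewrite (negbTE se) /=; apply: contra => /eqP ST.
  by rewrite eqEsubset SA ST subsetT.
- move=> S Ss; case: (word_cases Ss) => [[nw sS Po]|[wS Pi]].
    have [wc [i [iS si hi]]] := t_wav na Po; split=> //.
    move: iS; rewrite in_outer; case E: (u i) => [l|] lS.
      have lA := grafting_notin h E.
      exists l; split=> //; first by rewrite -(grafting_outer_colour h E).
      move=> S' S's pS; case: (word_cases S's) => [[nw' sS' Po']|[wS' Pi']]; last first.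
        exact: contra (subsetP (within_sub wS') l) lA.
      have := hi _ Po'; rewrite in_outer E; apply.
      by rewrite properE !(outer_sub h) // -properE.
    have se : ~~ iswavy e by rewrite -(slot_colour E).
    pose l := v (Ordinal q0); have lA : l \in A by apply: mem_img.
    exists l; split; [exact: (subsetP lS)|exact: straightA|].
    move=> S' S's pS; case: (word_cases S's) => [[nw' sS' Po']|[wS' Pi']]; last first.
      by have [we _] := t_wav nb Pi'; rewrite we in se.
    case/orP: sS' => [AS'|dS']; last by rewrite (disjointFr dS' lA).
    have pP : outer_set u A S' \proper outer_set u A S.
      by rewrite properE !(outer_sub h) // sat_sub.
    by have := hi _ Po' pP; rewrite in_outer E AS'.
  have [we [j [jS sj hj]]] := t_wav nb Pi; split.
    apply: contraT => sc; have := t_col ma sc i0.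
    by rewrite ei0 we.
  rewrite inE in jS; exists (v j); split=> //; first by rewrite -(grafting_inner_colour h).
  move=> S' S's pS.
  have wS' : within (iswavy e) A S'.
    by rewrite /within we andbT (subset_trans (proper_sub pS)) // (within_sub wS).
  case: (word_cases S's) => [[]|[_ Pi']]; first by rewrite wS'.
  have := hj _ Pi'; rewrite inE; apply.
  by rewrite properE !inner_sub ?(within_sub wS) ?(within_sub wS').
- move=> S S' k Ss S's.
  case: (word_cases Ss) => [[nw sS Po]|[wS Pi]];
    case: (word_cases S's) => [[nw' sS' Po']|[wS' Pi']].
  + by have := t_lam na Po Po'; rewrite (outer_disj h) // !(outer_sub h).
  + have SA' := within_sub wS'; case/orP: sS => [AS|dS].
      by apply: Or33; apply: subset_trans AS.
    by apply: Or31; rewrite disjoint_sym (disjointWl SA').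
  + have SA := within_sub wS; case/orP: sS' => [AS|dS].
      by apply: Or32; apply: subset_trans AS.
    by apply: Or31; rewrite (disjointWl SA).
  + have SA := within_sub wS; have SA' := within_sub wS'.
    by have := t_lam nb Pi Pi'; rewrite inner_disj // !inner_sub.
- move=> S S' Ss S's.
  case: (word_cases Ss) => [[nw sS Po]|[wS Pi]];
    case: (word_cases S's) => [[nw' sS' Po']|[wS' Pi']].
  + by have := t_mix na Po Po'; rewrite (outer_disj h) // !(outer_sub h).
  + have [we _] := t_wav nb Pi'; have SA' := within_sub wS'.
    case/orP: sS => [AS|dS]; last by left; rewrite disjoint_sym (disjointWl SA').
    have [_ col _] := t_str na Po; have := col i0.
    by rewrite in_outer ui0 AS ei0 we => /(_ erefl).
  + have SA := within_sub wS; case/orP: sS' => [AS|dS].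
      by right; apply: subset_trans AS.
    by left; rewrite (disjointWl SA).
  + have SA := within_sub wS; have SA' := within_sub wS'.
    by have := t_mix nb Pi Pi'; rewrite inner_disj // !inner_sub.
Qed.

(** Conversely a tree falls into two trees. The assumptions on the mandatory
    symbols express that it is cut along an edge. *)
Lemma nested_cut : mandatory c a (outs cl s) -> mandatory e b (inns cl s) ->
  nested c z s -> nested c a (outs cl s) /\ nested e b (inns cl s).
Proof.
move=> ma mb ns.
have q0 := t_pos mb; have A0 := img_neq0 v q0.
have [i0 ui0] := grafting_slotP h.
have ei0 := slot_colour ui0.
have rootA l : iswavy e -> l \in A -> ~~ iswavy (z l) -> (A, true) \in s.
  move=> we /imgP[j <-]; rewrite -(grafting_inner_colour h) => sj.
  have := t_root mb we sj; case/inns_source => S [Ss _ /within_sub SA].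
  rewrite -(inner_img v) => /eqP; rewrite (inner_eq (subxx _) SA) => /eqP eS.
  by rewrite [A]eS.
split; split.
- exact: uniq_outs (cut_inj q0) _ (t_uniq ns).
- move=> P /outs_source [S [Ss S0 nw sS ->]]; have [_ col nT] := t_str ns Ss.
  split; first by rewrite (outer_eq0 h).
    move=> i; rewrite in_outer; case E: (u i) => [l|].
      by rewrite (grafting_outer_colour h E); apply: col.
    move=> AS; rewrite (slot_colour E); apply/negP => we.
    have lA := mem_img v (Ordinal q0).
    have At := rootA _ we lA (col _ (subsetP AS _ lA)).
    case: (t_mix ns Ss At) => [dS|SA].
      by have := disjointFl dS lA; rewrite (subsetP AS _ lA).
    by case/negP: nw; rewrite /within SA we.
  by case/orP: nT => [->//|nT]; rewrite -outer_setT (outer_eq h sS satT A0) nT orbT.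
- move=> P /outs_source [S [Ss S0 nw sS ->]]; have [wc [l [lS sl hl]]] := t_wav ns Ss.
  split=> //; have [lA|lA] := boolP (l \in A); last first.
    have [i ui] := grafting_outP h lA; exists i; split.
    + by rewrite in_outer ui.
    + by rewrite (grafting_outer_colour h ui).
    move=> P' /outs_source [S' [S's S'0 nw' sS' ->]].
    by rewrite properE !(outer_sub h) // -properE in_outer ui; apply: hl.
  have AS : A \subset S by case/orP: sS => // dS; have := disjointFr dS lA; rewrite lS.
  have se : ~~ iswavy e.
    apply/negP => we; have At := rootA _ we lA sl.
    have : l \notin A; last by rewrite lA.
    apply: hl At _; rewrite properEneq AS andbT; apply: contra nw => /eqP <-.
    by rewrite /within subxx we.
  exists i0; split; [by rewrite in_outer ui0|by rewrite ei0|].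
  move=> P' /outs_source [S' [S's S'0 nw' sS' ->]].
  rewrite properE !(outer_sub h) // -properE in_outer ui0 => pS.
  by apply: contra (hl _ S's pS) => AS'; apply: (subsetP AS').
- move=> P P' k /outs_source [S [Ss S0 nw sS ->]] /outs_source [S' [S's S'0 nw' sS' ->]].
  by rewrite (outer_disj h) // !(outer_sub h) //; exact: (t_lam ns Ss S's).
- move=> P P' /outs_source [S [Ss S0 nw sS ->]] /outs_source [S' [S's S'0 nw' sS' ->]].
  by rewrite (outer_disj h) // !(outer_sub h) //; exact: (t_mix ns Ss S's).
- exact: uniq_inns (cut_inj q0) _ (t_uniq ns).
- move=> P /inns_source [S [Ss S0 wS ->]]; have [_ col nT] := t_str ns Ss.
  have SA := within_sub wS; split; first by rewrite inner_eq0.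
    by move=> j; rewrite inE (grafting_inner_colour h); apply: col.
  case/andP: wS => _; case: (iswavy e) => //= nA.
  by rewrite -(inner_img v) inner_eq.
- move=> P /inns_source [S [Ss S0 wS ->]]; have [wc [l [lS sl hl]]] := t_wav ns Ss.
  have SA := within_sub wS; split.
    apply: contraT => se; have : ([set i0], false) \in outs cl s.
      by apply: (t_leaf ma); [rewrite ei0|left].
    case/outs_source => S' [S's S'0 _ sS']; rewrite -(outer_img ui0) => /eqP.
    rewrite (outer_eq h satA sS' A0) => /eqP eS'; rewrite -eS' in S's.
    case/andP: wS => _; rewrite (negbTE se) /= => nA.
    case: (t_mix ns S's Ss) => [dS|AS]; last by case/negP: nA; rewrite eqEsubset SA.
    by have := disjointFl dS lS; rewrite (subsetP SA).
  have /imgP[j vj] := subsetP SA _ lS; exists j; split; first by rewrite inE vj.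
    by rewrite (grafting_inner_colour h) vj.
  move=> P' /inns_source [S' [S's S'0 wS' ->]].
  rewrite properE !inner_sub ?(within_sub wS') // -properE inE vj; exact: hl.
- move=> P P' k /inns_source [S [Ss S0 wS ->]] /inns_source [S' [S's S'0 wS' ->]].
  have SA := within_sub wS; have SA' := within_sub wS'.
  by rewrite inner_disj // !inner_sub //; exact: (t_lam ns Ss S's).
- move=> P P' /inns_source [S [Ss S0 wS ->]] /inns_source [S' [S's S'0 wS' ->]].
  have SA := within_sub wS; have SA' := within_sub wS'.
  by rewrite inner_disj // !inner_sub //; exact: (t_mix ns Ss S's).
Qed.

End Word.
End TreeCut.

(** Renaming acts on functions of words, hence symbols are pulled back. *)
Definition rename n (s : 'S_n) (x : sym n) : sym n := (s @^-1: x.1, x.2).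

Lemma preim_perm_eq n (s : 'S_n) (S T : {set 'I_n}) :
  (s @^-1: S == s @^-1: T) = (S == T).
Proof.
apply/eqP/eqP => [e|->//]; apply/setP => l.
by have := congr1 (fun U : {set 'I_n} => (s^-1)%g l \in U) e; rewrite /= !inE permKV.
Qed.

Lemma rename_inj n (s : 'S_n) : injective (@rename n s).
Proof. by move=> [S k] [S' k'] [/eqP]; rewrite preim_perm_eq => /eqP -> ->. Qed.

Lemma renameM n (s t : 'S_n) x : rename s (rename t x) = rename (s * t)%g x.
Proof.
by rewrite /rename /=; congr pair; apply/setP => i; rewrite !inE permM.
Qed.

Lemma rename1 n (x : sym n) : rename 1%g x = x.
Proof.
by case: x => S k; rewrite /rename /=; congr pair; apply/setP => i; rewrite !inE perm1.
Qed.

Lemma renameK n (s : 'S_n) : cancel (rename s) (rename s^-1).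
Proof. by move=> x; rewrite renameM mulVg rename1. Qed.

Lemma renameVK n (s : 'S_n) : cancel (rename s^-1) (rename s).
Proof. by move=> x; rewrite renameM mulgV rename1. Qed.

Lemma preim_perm_sub n (s : 'S_n) (S T : {set 'I_n}) :
  (s @^-1: S \subset s @^-1: T) = (S \subset T).
Proof.
apply/subsetP/subsetP => k l; last by rewrite !inE; apply: k.
by have := k (s^-1 l)%g; rewrite !inE permKV.
Qed.

Lemma preim_perm_disj n (s : 'S_n) (S T : {set 'I_n}) :
  [disjoint s @^-1: S & s @^-1: T] = [disjoint S & T].
Proof.
apply/pred0P/pred0P => k l /=; last by rewrite !inE; apply: k.
by have := k (s^-1 l)%g; rewrite /= !inE permKV.
Qed.

Lemma tree_rename c n (a b : 'I_n -> colour) (s : 'S_n) t :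
  (forall i, b (s i) = a i) -> tree c a (map (rename s) t) -> tree c b t.
Proof.
move=> hb [[p1 p2 p3 p4 p5] [n1 n2 n3 n4 n5]].
have hb' l : b l = a (s^-1 l)%g by rewrite -hb permKV.
have mm S k : ((S, k) \in t) = ((s @^-1: S, k) \in map (rename s) t).
  exact/esym/(mem_map (@rename_inj _ s) t (S, k)).
split; split=> //.
- by move=> sc l; rewrite hb'; apply: p2.
- by move=> wc wl; apply: p3 => // l; rewrite -hb.
- move=> l; rewrite hb' => sl nt; rewrite mm.
  have -> : s @^-1: [set l] = [set (s^-1)%g l].
    by apply/setP => i; rewrite !inE; apply/eqP/eqP => [<-|->]; rewrite ?permK ?permKV.
  exact: p4.
- by move=> l wc; rewrite hb' mm preimsetT => /(p5 _ wc).
- by move: n1; rewrite map_inj_uniq //; apply: rename_inj.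
- move=> S; rewrite mm => /n2 [S0 col nT]; split.
  + by apply: contraNneq S0 => ->; rewrite preimset0.
  + by move=> l lS; rewrite hb'; apply: col; rewrite inE permKV.
  + by case/orP: nT => [->//|nT]; apply/orP; right; apply: contraNneq nT => ->; rewrite preimsetT.
- move=> S; rewrite mm => /n3 [wc [l [lS sl hl]]]; split=> //; exists (s l); split.
  + by rewrite inE in lS.
  + by rewrite hb.
  + move=> S'; rewrite mm => /hl; rewrite !properE !preim_perm_sub => k /k.
    by rewrite inE.
- by move=> S S' k; rewrite !mm => /n4 k1 /k1; rewrite preim_perm_disj !preim_perm_sub.
- by move=> S S'; rewrite !mm => /n5 k1 /k1; rewrite preim_perm_disj !preim_perm_sub.
Qed.

(** * The operad of tree functions *)

Definition nstr n (a : 'I_n -> colour) : nat := #|[set l | ~~ iswavy (a l)]|.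

(** The degree of a tree in terms of its symbols: for ell_m there are m symbols
    and m straight inputs, for f_{m,n} there are m + 1 and m, which gives 2 - m
    and 1 - m; grafting adds degrees by nstr_grafting. *)
Definition tdeg (c : colour) n (a : 'I_n -> colour) (s : seq (sym n)) : int :=
  (size s)%:Z - (2 * nstr a)%:Z + (2 * ~~ iswavy c)%:Z.

(** Grafting along a straight edge uses up a straight input of the outer
    factor. *)
Lemma nstr_grafting p q n (a : 'I_p -> colour) e (b : 'I_q -> colour)
    (z : 'I_n -> colour) u v : (0 < q)%N -> grafting a e b z u v ->
  (nstr z + ~~ iswavy e = nstr a + nstr b)%N.
Proof.
move=> q0 h; have [i0 ui0] := grafting_slotP h.
pose l0 := v (Ordinal q0).
pose f i := odflt l0 (u i).
rewrite /nstr -(cardsID (img v)).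
have -> : [set l | ~~ iswavy (z l)] :&: img v = v @: [set j | ~~ iswavy (b j)].
  apply/setP => l; rewrite !inE; apply/andP/imsetP => [[sl /imgP[j vj]]|[j]].
    by exists j; rewrite // inE (grafting_inner_colour h) vj.
  by rewrite inE (grafting_inner_colour h) => sj ->; rewrite mem_img.
have -> : [set l | ~~ iswavy (z l)] :\: img v = f @: ([set i | ~~ iswavy (a i)] :\ i0).
  apply/setP => l; rewrite !inE; apply/andP/imsetP => [[lA sl]|[i]].
    have [i ui] := grafting_outP h lA; exists i; last by rewrite /f ui.
    rewrite !inE (grafting_outer_colour h ui) sl andbT; apply/eqP => ei.
    by rewrite ei ui0 in ui.
  rewrite !inE /f; case E: (u i) => [l'|] /andP[ni si] /= ->.
    by split; [exact: (grafting_notin h E) | rewrite -(grafting_outer_colour h E)].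
  by rewrite (grafting_slot_uniq h E ui0) eqxx in ni.
rewrite (card_imset _ (grafting_injv h)) card_in_imset; last first.
  move=> i i'; rewrite !inE /f => /andP[ni _] /andP[ni' _].
  case E: (u i) => [l|]; last by rewrite (grafting_slot_uniq h E ui0) eqxx in ni.
  case E': (u i') => [l'|]; last by rewrite (grafting_slot_uniq h E' ui0) eqxx in ni'.
  by move=> /= el; rewrite el in E; exact: (grafting_inju h E E').
rewrite (cardsD1 i0 [set i | ~~ iswavy (a i)]) inE (grafting_slot_colour h ui0).
by rewrite addnC addnAC addnA.
Qed.

Lemma nstr_perm n (a b : 'I_n -> colour) (s : 'S_n) :
  (forall i, b (s i) = a i) -> nstr b = nstr a.
Proof.
move=> hb; rewrite /nstr -(card_imset [set l | ~~ iswavy (a l)] (@perm_inj _ s)).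
apply: eq_card => l; rewrite !inE; apply/idP/imsetP => [sl|[i]].
  by exists (s^-1 l)%g; rewrite ?permKV // inE -hb permKV.
by rewrite inE -hb => si ->.
Qed.

Section TreeFunctions.
Variable K : fieldType.

(** A linear combination of trees, given by its coefficients. Each tree comes
    with an orientation, an ordering of its symbols up to even permutations, so
    that the coefficients alternate. *)
Record tfun (c : colour) n (a : 'I_n -> colour) (d : int) := TFun {
  fval : seq (sym n) -> K;
  fval_alt : alternating fval;
  fval_supp : forall s, fval s != 0 -> tree c a s /\ d = tdeg c a s
}.

Section Module.
Variables (c : colour) (n : nat) (a : 'I_n -> colour) (d : int).
Local Notation T := (tfun c a d).

Lemma fval_inj (x y : T) : fval x =1 fval y -> x = y.
Proof.
case: x y => [x h1 h2] [y h3 h4] /= /funext e; subst y.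
by congr TFun; apply: Prop_irrelevance.
Qed.

HB.instance Definition _ := gen_eqMixin T.
HB.instance Definition _ := gen_choiceMixin T.

Program Definition tzero : T := TFun (fval := fun=> 0) _ _.
Next Obligation. by move=> *; rewrite oppr0. Qed.
Next Obligation. by rewrite eqxx in H. Qed.

Program Definition tlin (k : K) (x y : T) : T :=
  TFun (fval := fun s => k * fval x s + fval y s) _ _.
Next Obligation.
by move=> s1 u v s2; rewrite (fval_alt x) (fval_alt y) mulrN opprD.
Qed.
Next Obligation.
have [x0|/fval_supp//] := eqVneq (fval x s) 0.
by apply: (@fval_supp _ _ _ _ y); move: H; rewrite x0 mulr0 add0r.
Qed.

Definition tadd x y := tlin 1 x y.
Definition topp x := tlin (-1) x tzero.
Definition tscale k x := tlin k x tzero.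

Fact taddA : associative tadd.
Proof. by move=> x y t; apply: fval_inj => s /=; rewrite !mul1r addrA. Qed.
Fact taddC : commutative tadd.
Proof. by move=> x y; apply: fval_inj => s /=; rewrite !mul1r addrC. Qed.
Fact tadd0 : left_id tzero tadd.
Proof. by move=> x; apply: fval_inj => s /=; rewrite mulr0 add0r. Qed.
Fact taddN : left_inverse tzero topp tadd.
Proof. by move=> x; apply: fval_inj => s /=; rewrite mul1r addr0 mulN1r addNr. Qed.

HB.instance Definition _ := GRing.isZmodule.Build T taddA taddC tadd0 taddN.

Fact tscaleA k l x : tscale k (tscale l x) = tscale (k * l) x.
Proof. by apply: fval_inj => s /=; rewrite !addr0 mulrA. Qed.
Fact tscale1 : left_id 1 tscale.
Proof. by move=> x; apply: fval_inj => s /=; rewrite addr0 mul1r. Qed.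
Fact tscaleDr : right_distributive tscale +%R.
Proof. by move=> k x y; apply: fval_inj => s /=; rewrite !addr0 !mul1r mulrDr. Qed.
Fact tscaleDl x : {morph tscale^~ x : k l / k + l}.
Proof. by move=> k l; apply: fval_inj => s /=; rewrite !addr0 !mul1r mulrDl. Qed.

HB.instance Definition _ :=
  GRing.Zmodule_isLmodule.Build K T tscaleA tscale1 tscaleDr tscaleDl.

Lemma fval0 s : fval (0 : T) s = 0. Proof. by []. Qed.
Lemma fvalD (x y : T) s : fval (x + y) s = fval x s + fval y s.
Proof. by rewrite /= mul1r. Qed.
Lemma fvalN (x : T) s : fval (- x) s = - fval x s.
Proof. by rewrite /= addr0 mulN1r. Qed.
Lemma fvalZ k (x : T) s : fval (k *: x) s = k * fval x s.
Proof. by rewrite /= addr0. Qed.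
Lemma fval_sum (I : Type) (r : seq I) (P : pred I) (F : I -> T) s :
  fval (\sum_(i <- r | P i) F i) s = \sum_(i <- r | P i) fval (F i) s.
Proof. by rewrite (big_morph (fun x : T => fval x s) (fun x y => fvalD x y s) (fval0 s)). Qed.

Lemma fval_perm_neq0 (x : T) s t : perm_eq s t -> (fval x s != 0) = (fval x t != 0).
Proof. exact: alternating_neq0 (fval_alt x). Qed.

(** Degree and number of letters have the same parity; this turns the signs of
    words into Koszul signs. *)
Lemma fval_homog (x : T) : homog (odd `|d|) (fval x).
Proof. by move=> s /fval_supp [_ ->]; rewrite /tdeg; lia. Qed.

End Module.

Definition idw X : seq X -> K := fun s => (nilp s)%:R.

Lemma idw_neq0 X (s : seq X) : (idw s != 0) = nilp s.
Proof. by rewrite /idw; case: nilp; rewrite ?oner_eq0 ?eqxx. Qed.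

Lemma tree_nil c : tree c (fun _ : 'I_1 => c) [::].
Proof.
split; split=> //.
- by move=> l sc [wc|//]; rewrite wc in sc.
- by move=> l wc; rewrite wc.
Qed.

Program Definition tid c : tfun c (fun _ : 'I_1 => c) 0 :=
  TFun (fval := @idw _) _ _.
Next Obligation.
by move=> [|? ?] ? ? ? ; rewrite /idw /= oppr0.
Qed.
Next Obligation.
rewrite idw_neq0 in H; rewrite (nilP H); split; first exact: tree_nil.
rewrite /tdeg /nstr /=; case: (c) => /=.
  by rewrite (_ : [set _ | _] = setT) ?cardsT ?card_ord //; apply/setP => i; rewrite !inE.
by rewrite (_ : [set _ | _] = set0) ?cards0 //; apply/setP => i; rewrite !inE.
Qed.

Section Act.
Variables (c : colour) (n : nat) (a b : 'I_n -> colour) (d : int) (s : 'S_n).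
Hypothesis hb : forall i, b (s i) = a i.

Program Definition tact_def (x : tfun c a d) : tfun c b d :=
  TFun (fval := fval x \o map (rename s)) _ _.
Next Obligation.
by move=> s1 u v s2 /=; rewrite !map_cat /= (fval_alt x).
Qed.
Next Obligation.
have [ht ->] := fval_supp H; split; first exact: tree_rename hb ht.
by rewrite /tdeg size_map (nstr_perm hb).
Qed.
End Act.

Definition tact c n (a b : 'I_n -> colour) d (s : 'S_n) (x : tfun c a d) : tfun c b d :=
  if pselect (forall i, b (s i) = a i) is left h then tact_def h x else 0.

Lemma tactE c n (a b : 'I_n -> colour) d (s : 'S_n) (x : tfun c a d) :
  (forall i, b (s i) = a i) -> fval (tact b s x) = fval x \o map (rename s).
Proof. by move=> h; rewrite /tact; case: pselect. Qed.

Section Comp.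
Variables (c e : colour) (p q n : nat) (a : 'I_p -> colour) (b : 'I_q -> colour)
    (z : 'I_n -> colour) (d1 d2 d : int) (u : 'I_p -> option 'I_n) (v : 'I_q -> 'I_n).
Hypothesis h : grafting a e b z u v.
Hypothesis hd : d = d1 + d2.

Lemma tcomp_alt (x : tfun c a d1) (y : tfun e b d2) :
  alternating (wcomp (cut e u v) (fval x) (fval y)).
Proof. by apply: wcomp_alternating; apply: fval_alt. Qed.

Lemma tcomp_supp (x : tfun c a d1) (y : tfun e b d2) s :
  wcomp (cut e u v) (fval x) (fval y) s != 0 -> tree c z s /\ d = tdeg c z s.
Proof.
rewrite wcomp_neq0 => /and3P[hs /fval_supp[tx dx] /fval_supp[ty dy]].
split; first exact: (tree_join h hs tx ty).
have := nstr_grafting (t_pos ty.1) h.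
rewrite hd dx dy /tdeg (size_outs_inns hs); lia.
Qed.

Definition tcomp_def x y : tfun c z d := TFun (tcomp_alt x y) (@tcomp_supp x y).
End Comp.

Definition tcomp c e p q n (a : 'I_p -> colour) (b : 'I_q -> colour)
    (z : 'I_n -> colour) d1 d2 d u v
    (x : tfun c a d1) (y : tfun e b d2) : tfun c z d :=
  match pselect (grafting a e b z u v), pselect (d = d1 + d2) with
  | left h, left h' => tcomp_def h h' x y
  | _, _ => 0
  end.

Lemma tcompE c e p q n (a : 'I_p -> colour) (b : 'I_q -> colour)
    (z : 'I_n -> colour) d1 d2 d u v (x : tfun c a d1) (y : tfun e b d2) :
  grafting a e b z u v -> d = d1 + d2 ->
  fval (tcomp z d u v x y) = wcomp (cut e u v) (fval x) (fval y).
Proof.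
by move=> h h'; rewrite /tcomp; case: pselect => // ?; case: pselect.
Qed.

Lemma tact_linear c n (a b : 'I_n -> colour) d (s : 'S_n) k (x y : tfun c a d) :
  tact b s (k *: x + y) = k *: tact b s x + tact b s y.
Proof.
case: (pselect (forall i, b (s i) = a i)) => h; last first.
  by rewrite /tact; case: pselect => // _; rewrite scaler0 addr0.
by apply: fval_inj => t; rewrite fvalD fvalZ !tactE // -fvalZ -fvalD.
Qed.

Lemma tcomp_junk c e p q n (a : 'I_p -> colour) (b : 'I_q -> colour)
    (z : 'I_n -> colour) d1 d2 d u v :
  ~ (grafting a e b z u v /\ d = d1 + d2) ->
  forall (x : tfun c a d1) (y : tfun e b d2), tcomp z d u v x y = 0.
Proof.
move=> h x y; rewrite /tcomp.
by case: pselect => // h1; case: pselect => // h2; case: h.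
Qed.

Lemma tcomp_linearl c e p q n (a : 'I_p -> colour) (b : 'I_q -> colour)
    (z : 'I_n -> colour) d1 d2 d u v k (x x' : tfun c a d1) (y : tfun e b d2) :
  tcomp z d u v (k *: x + x') y = k *: tcomp z d u v x y + tcomp z d u v x' y.
Proof.
case: (pselect (grafting a e b z u v /\ d = d1 + d2)) => [[h h']|h]; last first.
  by rewrite !tcomp_junk // scaler0 addr0.
apply: fval_inj => t; rewrite fvalD fvalZ !tcompE // -wcomp_linearl.
by congr wcomp; apply: funext => s; rewrite fvalD fvalZ.
Qed.

Lemma tcomp_linearr c e p q n (a : 'I_p -> colour) (b : 'I_q -> colour)
    (z : 'I_n -> colour) d1 d2 d u v k (x : tfun c a d1) (y y' : tfun e b d2) :
  tcomp z d u v x (k *: y + y') = k *: tcomp z d u v x y + tcomp z d u v x y'.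
Proof.
case: (pselect (grafting a e b z u v /\ d = d1 + d2)) => [[h h']|h]; last first.
  by rewrite !tcomp_junk // scaler0 addr0.
apply: fval_inj => t; rewrite fvalD fvalZ !tcompE // -wcomp_linearr.
by congr wcomp; apply: funext => s; rewrite fvalD fvalZ.
Qed.

Lemma tact1 c n (a : 'I_n -> colour) d (x : tfun c a d) : tact a 1%g x = x.
Proof.
apply: fval_inj => s; rewrite tactE /=; last by move=> i; rewrite perm1.
by rewrite (eq_map (@rename1 n)) map_id.
Qed.

Lemma tactM c n (a b b' : 'I_n -> colour) d (s t : 'S_n) (x : tfun c a d) :
  (forall i, b (s i) = a i) -> (forall i, b' (t i) = b i) ->
  tact b' t (tact b s x) = tact b' (s * t)%g x.
Proof.
move=> hs ht; apply: fval_inj => r; rewrite !tactE //=; last first.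
  by move=> i; rewrite permM ht.
by rewrite -map_comp; congr fval; apply: eq_map => y; rewrite /= renameM.
Qed.

Lemma cut_rename p q n e (u : 'I_p -> option 'I_n) (v : 'I_q -> 'I_n) (s : 'S_n) x :
  cut e u v (rename s x) = cut e (omap s \o u) (s \o v) x.
Proof.
have hA : img v = s @^-1: (img (s \o v)).
  apply/setP => l; rewrite inE; apply/imgP/imgP => -[j] /=.
    by move=> <-; exists j.
  by move=> /perm_inj <-; exists j.
rewrite /cut /within /sat /= hA -(preimset0 s) !preim_perm_sub preim_perm_disj !preim_perm_eq preimset0.
case: ifP => // _; case: ifP => // _.
  by congr (Some (inr (_, _))); apply/setP => j; rewrite !inE.
case: ifP => // _; congr (Some (inl (_, _))); apply/setP => i; rewrite !inE /=.
by case: (u i) => [l|] /=; rewrite ?inE // preim_perm_sub.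
Qed.

Lemma tact_comp c e p q n (a : 'I_p -> colour) (b : 'I_q -> colour)
    (z z' : 'I_n -> colour) d1 d2 d u v (s : 'S_n)
    (x : tfun c a d1) (y : tfun e b d2) :
  grafting a e b z u v -> d = d1 + d2 -> (forall i, z' (s i) = z i) ->
  tact z' s (tcomp z d u v x y) = tcomp z' d (omap s \o u) (s \o v) x y.
Proof.
move=> h hd hz; apply: fval_inj => r.
rewrite tactE // !tcompE //; last exact: grafting_rename h hz.
rewrite /= wcomp_map; apply: eq_wcomp => l /=; exact: cut_rename.
Qed.

Lemma tcomp_actl c e p q n (a a' : 'I_p -> colour)
    (b : 'I_q -> colour) (z : 'I_n -> colour) d1 d2 d u v (s : 'S_p)
    (x : tfun c a d1) (y : tfun e b d2) :
  grafting a' e b z u v -> d = d1 + d2 -> (forall i, a' (s i) = a i) ->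
  tcomp z d u v (tact a' s x) y = tcomp z d (u \o s) v x y.
Proof.
move=> h hd ha; apply: fval_inj => r.
rewrite !tcompE //; last exact: grafting_actl h ha.
rewrite tactE // wcomp_mapl; apply: eq_wcomp => l; rewrite /cut.
case: ifP => // _; case: ifP => // _; case: ifP => // _.
by congr (Some (inl (_, _))); apply/setP => i; rewrite !inE.
Qed.

Lemma tcomp_actr c e p q n (a : 'I_p -> colour)
    (b b' : 'I_q -> colour) (z : 'I_n -> colour) d1 d2 d u v (s : 'S_q)
    (x : tfun c a d1) (y : tfun e b d2) :
  grafting a e b' z u v -> d = d1 + d2 -> (forall i, b' (s i) = b i) ->
  tcomp z d u v x (tact b' s y) = tcomp z d u (v \o s) x y.
Proof.
move=> h hd ha; apply: fval_inj => r.
rewrite !tcompE //; last exact: grafting_actr h ha.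
have hA : img (v \o s) = img v.
  apply/setP => l; apply/imgP/imgP => -[j] /= <-; first by exists (s j).
  by exists (s^-1 j)%g; rewrite /= permKV.
rewrite tactE // wcomp_mapr; apply: eq_wcomp => l; rewrite /cut hA.
case: ifP => // _; case: ifP => // _; last by case: ifP.
by congr (Some (inr (_, _))); apply/setP => i; rewrite !inE.
Qed.

(** Together with the next lemma, this is composition with an identity, whose
    only tree is the empty word. *)
Lemma wcomp_inner X Y Z (cl : Z -> option (X + Y)) (f : Z -> Y) (x : seq X -> K) y s :
  all (fun c => if cl c is Some (inr _) then true else false) s ->
  (forall c b, cl c = Some (inr b) -> b = f c) ->
  wcomp cl x y s = x [::] * y (map f s).
Proof.
move=> + hf; elim: s x y => //= c s IH x y /andP[].
case E: (cl c) => [[?|b]|] // _ hs; rewrite IH // /hat /= mul1r.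
by rewrite (hf _ _ E).
Qed.

Lemma wcomp_outer X Y Z (cl : Z -> option (X + Y)) (f : Z -> X) (x : seq X -> K) y s :
  all (fun c => if cl c is Some (inl _) then true else false) s ->
  (forall c b, cl c = Some (inl b) -> b = f c) ->
  wcomp cl x y s = x (map f s) * y [::].
Proof.
move=> + hf; elim: s x y => //= c s IH x y /andP[].
by case E: (cl c) => [[b|?]|] // _ hs; rewrite IH // (hf _ _ E).
Qed.

Lemma nilp_outs X Y Z (cl : Z -> option (X + Y)) s :
  all (fun c => cl c : bool) s -> nilp (outs cl s) ->
  all (fun c => if cl c is Some (inr _) then true else false) s.
Proof.
elim: s => //= c s IH /andP[]; rewrite /outs /=.
by case: (cl c) => [[?|?]|] //= _ hs; apply: IH.
Qed.

Lemma nilp_inns X Y Z (cl : Z -> option (X + Y)) s :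
  all (fun c => cl c : bool) s -> nilp (inns cl s) ->
  all (fun c => if cl c is Some (inl _) then true else false) s.
Proof.
elim: s => //= c s IH /andP[]; rewrite /inns /=.
by case: (cl c) => [[?|?]|] //= _ hs; apply: IH.
Qed.

Lemma tcomp_idl c n (a z : 'I_n -> colour) d (s : 'S_n) (x : tfun c a d) :
  (forall i, z (s i) = a i) ->
  tcomp z d (fun _ : 'I_1 => None) s (tid c) x = tact z s x.
Proof.
move=> hz; apply: fval_inj => t.
have hg := grafting_idl c hz.
rewrite tcompE ?add0r // tactE //.
have sT : img s = setT.
  by apply/setP => l; rewrite inE; apply/imgP; exists (s^-1 l)%g; rewrite permKV.
case: (boolP (all (fun y => if cut c (fun _ : 'I_1 => None) s y is Some (inr _) then true else false) t)) => ht.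
  rewrite (wcomp_inner (f := rename s)) //= /idw ?mul1r //.
  by move=> y b /cut_inrP [_ _ ->].
have -> : wcomp (cut c (fun=> None) s) (fval (tid c)) (fval x) t = 0.
  apply/eqP; apply: contraNT ht; rewrite wcomp_neq0 /= idw_neq0 => /and3P[h1 h2 _].
  exact: nilp_outs.
apply/esym/eqP; apply: contraNT ht => /= /fval_supp [ht _].
have {}ht := tree_rename hz ht; apply/allP => -[S k] Sk.
have [S0 wS] : S != set0 /\ iswavy c || (S != setT).
  case: k Sk => Sk; last by have [? _ ?] := t_str ht.2 Sk.
  have [-> [l [lS _ _]]] := t_wav ht.2 Sk; split=> //.
  by apply/set0Pn; exists l.
by rewrite cut_inr //= /within sT subsetT.
Qed.

Lemma tcomp_idr c e n (a z : 'I_n -> colour) d u v (s : 'S_n) (x : tfun c a d) :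
  grafting a e (fun _ : 'I_1 => e) z u v ->
  (forall i, odflt (v ord0) (u i) = s i) ->
  tcomp z d u v x (tid e) = tact z s x.
Proof.
move=> h hs; have hz := grafting_idr h hs; apply: fval_inj => t.
rewrite tcompE ?addr0 // tactE //.
have vA : img v = [set v ord0].
  by apply/setP => l; rewrite inE; apply/imgP/eqP => [[j <-]|->]; [rewrite ord1|exists ord0].
case: (boolP (all (fun y => if cut e u v y is Some (inl _) then true else false) t)) => ht.
  rewrite (wcomp_outer (f := rename s)) //= /idw ?mulr1 //.
  move=> [S k] b /cut_inlP [_ _ _ ->]; congr pair; apply/setP => i.
  by rewrite /= in_outer inE -hs; case: (u i) => [l|] //=; rewrite vA sub1set.
have -> : wcomp (cut e u v) (fval x) (fval (tid e)) t = 0.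
  apply/eqP; apply: contraNT ht; rewrite wcomp_neq0 /= idw_neq0 => /and3P[h1 _ h2].
  exact: nilp_inns.
apply/esym/eqP; apply: contraNT ht => /= /fval_supp [ht _].
have {}ht := tree_rename hz ht; apply/allP => -[S k] Sk.
have [l [lS sl lT]] : exists l, [/\ l \in S, ~~ iswavy (z l) &
    forall l', k = false -> l' \in S -> ~~ iswavy (z l')].
  case: k Sk => Sk.
    by have [_ [l [lS ? _]]] := t_wav ht.2 Sk; exists l.
  have [/set0Pn [l lS] col _] := t_str ht.2 Sk; exists l; split=> // [|l' _]; exact: col.
have S0 : S != set0 by apply/set0Pn; exists l.
rewrite cut_inl //=; last first.
  rewrite vA /sat sub1set; case: (boolP (_ \in S)) => //= nS.
  by rewrite disjoints1.
rewrite vA /within; apply/negP => /andP[SA we].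
have el : l = v ord0 by apply/eqP; rewrite -in_set1; apply: (subsetP SA).
have eS : S == [set v ord0] by rewrite eqEsubset SA sub1set -el.
by rewrite eS orbF el -(grafting_inner_colour h) in we sl; rewrite we in sl.
Qed.

Lemma tfun_eq0 c n (a : 'I_n -> colour) d (x : tfun c a d) :
  fval x = (fun=> 0) \/ exists s, fval x s != 0.
Proof.
case: (pselect (exists s, fval x s != 0)) => [h|h]; [by right|left].
apply: funext => s; apply/eqP; apply: contraT => xs; case: h; by exists s.
Qed.

Lemma tcomp_sequential c e g p q r m m' n
    (a : 'I_p -> colour) (b : 'I_q -> colour) (b' : 'I_r -> colour)
    (w : 'I_m -> colour) (w' : 'I_m' -> colour) (z : 'I_n -> colour)
    d1 d2 d3 d12 d23 d u1 v1 u2 v2 u3 v3 u4 v4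
    (x : tfun c a d1) (y : tfun e b d2) (t : tfun g b' d3) :
  grafting a e b w u1 v1 -> grafting w g b' z u2 v2 ->
  grafting b g b' w' u3 v3 -> grafting a e w' z u4 v4 ->
  d12 = d1 + d2 -> d23 = d2 + d3 -> d = d1 + d2 + d3 ->
  obind u2 \o u1 =1 u4 -> u2 \o v1 =1 omap v4 \o u3 -> v2 =1 v4 \o v3 ->
  tcomp z d u2 v2 (tcomp w d12 u1 v1 x y) t
  = tcomp z d u4 v4 x (tcomp w' d23 u3 v3 y t).
Proof.
move=> h1 h2 h3 h4 e12 e23 ed k1 k2 k3; apply: fval_inj => s.
rewrite !tcompE ?e12 ?e23 ?addrA //.
have [->|[sy /fval_supp[ty _]]] := tfun_eq0 y.
  have -> : wcomp (cut e u1 v1) (fval x) (fun=> 0) = fun=> 0.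
    by apply: funext => ?; rewrite wcomp0r.
  have -> : wcomp (cut g u3 v3) (fun=> 0) (fval t) = fun=> 0.
    by apply: funext => ?; rewrite wcomp0l.
  by rewrite wcomp0l wcomp0r.
have [->|[st /fval_supp[tt _]]] := tfun_eq0 t.
  rewrite wcomp0r; have -> : wcomp (cut g u3 v3) (fval y) (fun=> 0) = fun=> 0.
    by apply: funext => ?; rewrite wcomp0r.
  by rewrite wcomp0r.
apply: wcomp_sequential => l.
apply: (cut_sequential h1 h2 h3 h4 k1 k2 k3 (t_pos tt.1)).
move=> wg; apply: contraT => se.
have [j uj] := grafting_slotP h3; have := t_col ty.1 se j.
by rewrite (grafting_slot_colour h3 uj) wg.
Qed.

Lemma signz_odd (d : int) : (-1 : K) ^ d = (-1) ^+ odd `|d|.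
Proof.
case: d => m; first by rewrite signr_odd.
by rewrite /exprz -exprVn invrN1 signr_odd.
Qed.

Lemma tcomp_parallel c e g p q r m m' n
    (a : 'I_p -> colour) (b : 'I_q -> colour) (b' : 'I_r -> colour)
    (w : 'I_m -> colour) (w' : 'I_m' -> colour) (z : 'I_n -> colour)
    d1 d2 d3 d12 d13 d u1 v1 u2 v2 u3 v3 u4 v4
    (x : tfun c a d1) (y : tfun e b d2) (t : tfun g b' d3) :
  grafting a e b w u1 v1 -> grafting w g b' z u2 v2 ->
  grafting a g b' w' u3 v3 -> grafting w' e b z u4 v4 ->
  d12 = d1 + d2 -> d13 = d1 + d3 -> d = d1 + d2 + d3 ->
  (forall i, u1 i = None -> u3 i <> None) ->
  obind u2 \o u1 =1 obind u4 \o u3 ->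
  u2 \o v1 =1 Some \o v4 -> Some \o v2 =1 u4 \o v3 ->
  tcomp z d u2 v2 (tcomp w d12 u1 v1 x y) t
  = (-1) ^ (d2 * d3) *: tcomp z d u4 v4 (tcomp w' d13 u3 v3 x t) y.
Proof.
move=> h1 h2 h3 h4 e12 e13 ed k0 k1 k2 k3; apply: fval_inj => s.
rewrite fvalZ !tcompE ?e12 ?e13 ?addrA // ?ed 1?addrAC //.
have [->|[sy /fval_supp[ty _]]] := tfun_eq0 y.
  have -> : wcomp (cut e u1 v1) (fval x) (fun=> 0) = fun=> 0.
    by apply: funext => ?; rewrite wcomp0r.
  by rewrite wcomp0l wcomp0r mulr0.
have [->|[st /fval_supp[tt _]]] := tfun_eq0 t.
  rewrite wcomp0r; have -> : wcomp (cut g u3 v3) (fval x) (fun=> 0) = fun=> 0.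
    by apply: funext => ?; rewrite wcomp0r.
  by rewrite wcomp0l mulr0.
rewrite signz_odd abszM oddM.
apply: wcomp_parallel; try exact: fval_homog.
by move=> l; apply: (cut_parallel h1 h2 h3 h4 k0 k1 k2 k3 (t_pos ty.1) (t_pos tt.1)).
Qed.

Definition treeop : operad K :=
  Operad tact_linear tcomp_linearl tcomp_linearr
    tact1 tactM tact_comp tcomp_actl tcomp_actr
    tcomp_idl tcomp_idr tcomp_sequential tcomp_parallel.

End TreeFunctions.

(** * The differential on tree functions *)

Section Differential.
Variable K : fieldType.

Lemma removable_rename n (s : 'S_n) x : removable (rename s x) = removable x.
Proof.
case: x => S [] /=; rewrite /removable /=.
  by rewrite -{1}(preimsetT s) preim_perm_eq.
congr (_ != _); rewrite -(card_imset (s @^-1: S) (@perm_inj _ s)).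
apply: eq_card => l; apply/imsetP/idP => [[i]|lS]; first by rewrite inE => iS ->.
by exists (s^-1 l)%g; rewrite ?inE permKV.
Qed.

(** The coefficient of a tree in the differential collects the coefficients of
    its contractions along one internal edge. The sum is restricted to trees,
    since a word that is not a tree can become one when a symbol is removed. *)
Definition tdiff_val c n (a : 'I_n -> colour) (x : seq (sym n) -> K) s :=
  if `[< tree c a s >] then dsum (@removable n) x s else 0.

Lemma tdiff_alt c n (a : 'I_n -> colour) d (x : tfun K c a d) :
  alternating (tdiff_val c a (fval x)).
Proof.
move=> s1 y y' s2; rewrite /tdiff_val.
have pe : perm_eq (s1 ++ [:: y, y' & s2]) (s1 ++ [:: y', y & s2]).
  by rewrite perm_cat2l; apply/permPl; exact: (perm_catCA [:: y] [:: y'] s2).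
have -> : `[< tree c a (s1 ++ [:: y, y' & s2]) >] = `[< tree c a (s1 ++ [:: y', y & s2]) >].
  apply/asboolP/asboolP; apply: tree_perm => //; by rewrite perm_sym.
case: ifP => _; last by rewrite oppr0.
exact/dsum_alternating/fval_alt.
Qed.

Lemma tdiff_supp c n (a : 'I_n -> colour) d (x : tfun K c a d) s :
  tdiff_val c a (fval x) s != 0 -> tree c a s /\ d + 1 = tdeg c a s.
Proof.
rewrite /tdiff_val; case: asboolP => [ht|_]; last by rewrite eqxx.
move=> /dsum_neq0 [s1 [y [s2 [es _ /fval_supp [_ ->]]]]]; split=> //.
by rewrite es /tdeg !size_cat /=; lia.
Qed.

Definition tdiff c n (a : 'I_n -> colour) d (x : tfun K c a d) : tfun K c a (d + 1) :=
  TFun (tdiff_alt x) (@tdiff_supp _ _ _ _ x).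

Lemma tdiff_linear c n (a : 'I_n -> colour) d k (x y : tfun K c a d) :
  tdiff (k *: x + y) = k *: tdiff x + tdiff y.
Proof.
apply: fval_inj => s; rewrite fvalD fvalZ /= /tdiff_val.
case: ifP => _; last by rewrite mulr0 addr0.
rewrite -dsum_linear; congr dsum; apply: funext => t.
by rewrite /= mul1r addr0.
Qed.

Lemma tdiff0 c n (a : 'I_n -> colour) d : tdiff (0 : tfun K c a d) = 0.
Proof.
have := tdiff_linear (-1) (0 : tfun K c a d) 0.
by rewrite scaler0 addr0 scaleN1r addNr.
Qed.

(** Contraction preserves trees, so the restriction to trees does not disturb
    the cancellation in dsum_dsum. *)
Lemma tdiff_square c n (a : 'I_n -> colour) d (x : tfun K c a d) :
  tdiff (tdiff x) = 0.
Proof.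
apply: fval_inj => s /=; rewrite /tdiff_val; case: asboolP => // ht.
rewrite -[RHS](dsum_dsum (@removable n) (fval x) s); apply: eq_dsum => s1 y s2 es.
case: ifP => // ry; case: asboolP => // -[].
by rewrite es in ht; apply: tree_remove ry ht.
Qed.

Lemma tdiff_act c n (a b : 'I_n -> colour) d (s : 'S_n) (x : tfun K c a d) :
  (forall i, b (s i) = a i) -> tdiff (tact b s x) = tact b s (tdiff x).
Proof.
move=> hb; apply: fval_inj => t; rewrite tactE //= /tdiff_val.
have -> : `[< tree c b t >] = `[< tree c a (map (rename s) t) >].
  apply/asboolP/asboolP; last exact: tree_rename hb.
  have hb' i : a ((s^-1)%g i) = b i by rewrite -hb permKV.
  move=> ht; apply: (tree_rename hb'); rewrite -map_comp.
  by rewrite (eq_map (_ : _ =1 id)) ?map_id // => y /=; rewrite renameK.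
case: ifP => // _; rewrite tactE // dsum_map; apply: eq_dsum => s1 y s2 es.
by rewrite /= removable_rename.
Qed.

Section Derivation.
Variables (c e : colour) (p q n : nat) (a : 'I_p -> colour) (b : 'I_q -> colour)
  (z : 'I_n -> colour) (u : 'I_p -> option 'I_n) (v : 'I_q -> 'I_n).
Hypothesis h : grafting a e b z u v.
Local Notation A := (img v).
Local Notation cl := (cut e u v).

(** The edge along which a composite is cut is itself one of its symbols,
    unless one of the factors is an identity; the last two cases cover
    identities. *)
Lemma cut_present s : all (fun x => cl x : bool) s ->
  tree c a (outs cl s) -> tree e b (inns cl s) ->
  [\/ (A, iswavy e) \in s, exists l, A = [set l] | ~~ iswavy c /\ A = setT].
Proof.
move=> hs [ma na] [mb nb]; have q0 := t_pos mb; have A0 := img_neq0 v q0.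
have [i0 ui0] := grafting_slotP h; have ei0 := slot_colour h ui0.
case we: (iswavy e).
  have [/existsP [j sj]|/existsPn k] := boolP [exists j, ~~ iswavy (b j)].
    have := t_root mb we sj; case/inns_source => S [Ss _ /within_sub SA].
    rewrite -(inner_img v) => /eqP; rewrite (inner_eq (subxx _) SA) => /eqP ->.
    by apply: Or31.
  have q1 : q = 1%N by apply: (t_triv mb) => // j; apply: negbNE.
  apply: Or32; exists (v (Ordinal q0)); apply/setP => l; rewrite inE.
  apply/imgP/eqP => [[j <-]|->]; last by exists (Ordinal q0).
  by congr v; apply: ord_eq_all.
have [triv|nt] : (~~ iswavy c /\ p = 1%N) \/ (iswavy c \/ p <> 1%N).
  by case: (iswavy c); case: (p =P 1%N); auto.
  apply: Or33; split; first by case: triv.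
  apply/setP => l; rewrite inE; case: (grafting_cover h l) => // -[i ui].
  by rewrite (ord_eq_all i i0 triv.2) ui0 in ui.
have := t_leaf ma _ nt; move/(_ i0); rewrite ei0 we => /(_ erefl).
case/outs_source => S [Ss _ _ sS]; rewrite -(outer_img h ui0) => /eqP.
by rewrite (outer_eq h (satA _) sS A0) => /eqP ->; apply: Or31.
Qed.

(** A tree has no symbol that crosses the edge on A, so that all its symbols
    can be cut. *)
Lemma present_compat s x : tree c z s ->
  [\/ (A, iswavy e) \in s, exists l, A = [set l] | ~~ iswavy c /\ A = setT] ->
  x \in s -> cl x.
Proof.
case: x => S k [_ ns] hp Sk.
have S0 : S != set0.
  case: k Sk => Sk; last by have [? _ _] := t_str ns Sk.
  by have [_ [l [lS _ _]]] := t_wav ns Sk; apply/set0Pn; exists l.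
suff ws : within (iswavy e) A S || sat A S.
  case/orP: ws => ws; first by rewrite cut_inr.
  by case: (boolP (within (iswavy e) A S)) => nw; [rewrite cut_inr|rewrite cut_inl].
have inA : S \subset A -> within (iswavy e) A S || sat A S.
  move=> SA; rewrite /within SA /=; case: eqP => [->|]; last by rewrite orbT.
  by rewrite satA orbT.
case: hp => [At|[l eA]|[_ AT]].
- case: k (iswavy e) At Sk inA => -[] At Sk inA.
  + by case: (t_lam ns At Sk) => [d|AS|/inA //]; rewrite /sat ?d ?AS ?orbT.
  + by case: (t_mix ns At Sk) => [d|AS]; rewrite /sat ?d ?AS ?orbT.
  + case: (t_mix ns Sk At) => [d|/inA //].
    by rewrite /sat disjoint_sym d !orbT.
  + by case: (t_lam ns At Sk) => [d|AS|/inA //]; rewrite /sat ?d ?AS ?orbT.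
- by rewrite eA /sat sub1set; case: (boolP (_ \in S)) => lS; rewrite ?orbT // disjoints1 lS !orbT.
- by apply: inA; rewrite AT subsetT.
Qed.

(** The only symbol whose status differs between the composite and its factors
    is the one on A. It occurs in the rest of the word, hence is not the symbol
    in question. *)
Lemma removable_cut s1 x s2 : tree c z (s1 ++ x :: s2) ->
  all (fun y => cl y : bool) (s1 ++ s2) ->
  tree c a (outs cl (s1 ++ s2)) -> tree e b (inns cl (s1 ++ s2)) ->
  match cl x with Some (inl y) => removable y | Some (inr y) => removable y
    | None => false end = removable x.
Proof.
case: x => S k tz hs ta tb; have q0 := t_pos tb.1; have A0 := img_neq0 v q0.
have [i0 ui0] := grafting_slotP h; have ei0 := slot_colour h ui0.
have notin : (S, k) \notin s1 ++ s2.
  by have := t_uniq tz.2; rewrite -cat1s uniq_catCA /= => /andP[].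
have inz : (S, k) \in s1 ++ (S, k) :: s2 by rewrite mem_cat mem_head orbT.
have inz' y : y \in s1 ++ s2 -> y \in s1 ++ (S, k) :: s2.
  by rewrite !mem_cat inE => /orP[->|->]; rewrite ?orbT.
have hp := cut_present hs ta tb.
have : cl (S, k).
  apply: present_compat tz _ inz.
  by case: hp => [/inz' ?|?|?]; [apply: Or31|apply: Or32|apply: Or33].
case E: (cl (S, k)) => [[y|y]|] // _.
  have [/= S0 nw sS ->] := cut_inlP E; case: k E notin inz tz {inz'} => E notin inz tz.
    by rewrite /removable /= -{1}(outer_setT u v) (outer_eq h) // satT.
  rewrite /removable /=; congr (~~ _); apply/eqP/eqP => [/eqP/cards1P[i eS]|/eqP/cards1P[l eS]].
    case ui: (u i) => [l|].
      move/eqP: eS; rewrite -(outer_set1 h ui q0) (outer_eq h) //.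
        by move/eqP => ->; rewrite cards1.
      by apply: sat_set1; apply: grafting_notin h _ _ ui.
    move/eqP: eS; rewrite -(outer_img h ui) (outer_eq h) ?satA // => /eqP eS.
    subst S; case: hp => [At|[l ->]|[sc AT]]; last 1 first.
    - by have [_ _] := t_str tz.2 inz; rewrite (negbTE sc) AT eqxx.
    - have se : iswavy e = false by move: nw; rewrite /within subxx eqxx orbF; case: iswavy.
      by rewrite se (negbTE notin) in At.
    - by rewrite cards1.
  case lA: (l \in A).
    have eSA : S = A.
      case/orP: sS => [AS|dS]; last by have := disjointFr dS lA; rewrite eS inE eqxx.
      by apply/eqP; rewrite eqEsubset AS andbT eS sub1set.
    by rewrite eSA (outer_img h ui0) cards1.
  have [i ui] := grafting_outP h (negbT lA).
  by rewrite eS (outer_set1 h ui q0) cards1.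
have [/= S0 wS ->] := cut_inrP E; case: k E notin inz tz {inz'} => E notin inz tz.
  rewrite /removable /= -(inner_img v) inner_eq // ?(within_sub wS) //.
  congr (~~ _); apply/eqP/eqP => eS; last first.
    by apply/eqP; rewrite eqEsubset (within_sub wS) /= eS subsetT.
  subst S; have [_ [l [lA sl _]]] := t_wav tz.2 inz.
  have we : iswavy e by case/andP: wS; rewrite eqxx orbF.
  case: hp => [|[l' eA]|[_ ->//]]; first by rewrite we (negbTE notin).
  have /imgP[j vj] := lA; have := @t_root _ _ _ _ tb.1 j we.
  rewrite (grafting_inner_colour h) vj => /(_ sl) /inns_source [S' [S's _ /within_sub SA]].
  rewrite -(inner_img v) => /eqP; rewrite (inner_eq (subxx _) SA) => /eqP eS'.
  by rewrite eS' S's in notin.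
rewrite /removable /=; congr (~~ (_ == _)).
rewrite -(card_imset (v @^-1: S) (grafting_injv h)); apply: eq_card => l.
apply/imsetP/idP => [[j]|lS]; first by rewrite inE => jS ->.
by have /imgP[j vj] := subsetP (within_sub wS) _ lS; exists j; rewrite // inE vj.
Qed.

(** This is dsum_wcomp, once the restrictions to trees on both sides are seen
    to agree: by nested_cut a tree is cut into trees. *)
Lemma wcomp_dsum_tree d1 d2 (x : tfun K c a d1) (y : tfun K e b d2) s :
  tree c z s -> all (fun y => cl y : bool) s ->
  dsum (@removable n) (wcomp cl (fval x) (fval y)) s
  = wcomp cl (tdiff_val c a (fval x)) (fval y) s
    + (-1) ^+ odd `|d1| * wcomp cl (fval x) (tdiff_val e b (fval y)) s.
Proof.
move=> tz hs.
pose R w := match cl w with Some (inl y) => removable y | Some (inr y) => removable y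
    | None => false end.
transitivity (dsum R (wcomp cl (fval x) (fval y)) s).
  apply: eq_dsum => s1 w s2 es.
  have [->|] := eqVneq (wcomp cl (fval x) (fval y) (s1 ++ s2)) 0; first by do 2 case: ifP.
  rewrite wcomp_neq0 => /and3P[h1 /fval_supp[ta _] /fval_supp[tb _]].
  by rewrite es in tz; rewrite -(removable_cut tz h1 ta tb).
rewrite (dsum_wcomp (Ra := @removable p) (Rb := @removable q)); first last.
- by move=> w; rewrite /R => ->.
- by move=> w b'; rewrite /R => ->.
- by move=> w a'; rewrite /R => ->.
rewrite (homog_hat (@fval_homog _ _ _ _ _ x)) wcompZl.
have mand m g (f : 'I_m -> colour) d (t : tfun K g f d) r :
    dsum (@removable m) (fval t) r != 0 -> mandatory g f r.
  move=> /dsum_neq0 [s1 [w [s2 [-> rw /fval_supp[[mt _] _]]]]].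
  apply: (mandatory_sub mt) => w'; rewrite !mem_cat inE => /orP[->//|->].
  by rewrite !orbT.
have [k hk] := wcompE K cl s; rewrite !hk hs; congr (_ * _ + _ * (_ * _)).
  have [->|/fval_supp[tb _]] := eqVneq (fval y (inns cl s)) 0; first by rewrite !mulr0.
  rewrite /tdiff_val; case: asboolP => // nt.
  have [->//|/mand ma] := eqVneq (dsum (@removable p) (fval x) (outs cl s)) 0.
  by case: nt; split=> //; apply: (nested_cut h ma tb.1 tz.2).1.
have [->|/fval_supp[ta _]] := eqVneq (fval x (outs cl s)) 0; first by rewrite !mul0r.
rewrite /tdiff_val; case: asboolP => // nt.
have [->//|/mand mb] := eqVneq (dsum (@removable q) (fval y) (inns cl s)) 0.
by case: nt; split=> //; apply: (nested_cut h ta.1 mb tz.2).2.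
Qed.
End Derivation.

Lemma tdiff_comp c e p q n (a : 'I_p -> colour) (b : 'I_q -> colour)
    (z : 'I_n -> colour) d1 d2 d u v (x : tfun K c a d1) (y : tfun K e b d2) :
  grafting a e b z u v -> d = d1 + d2 ->
  tdiff (tcomp z d u v x y)
  = tcomp z (d + 1) u v (tdiff x) y
    + (-1) ^ d1 *: tcomp z (d + 1) u v x (tdiff y).
Proof.
move=> h hd; apply: fval_inj => s; rewrite fvalD fvalZ signz_odd.
have e1 : d + 1 = d1 + 1 + d2 by rewrite hd addrAC.
have e2 : d + 1 = d1 + (d2 + 1) by rewrite hd addrA.
rewrite -[LHS]/(tdiff_val c z (fval (tcomp z d u v x y)) s) /tdiff_val.
case: asboolP => ht; last first.
  have z1 : fval (tcomp z (d + 1) u v (tdiff x) y) s = 0.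
    by apply/eqP; apply: contraT => /fval_supp [].
  have z2 : fval (tcomp z (d + 1) u v x (tdiff y)) s = 0.
    by apply/eqP; apply: contraT => /fval_supp [].
  by rewrite z1 z2 mulr0 addr0.
rewrite !tcompE //; case: (boolP (all (fun y => cut e u v y : bool) s)) => hs.
  exact: (wcomp_dsum_tree h x y ht hs).
have wz X Y : wcomp (cut e u v) X Y s = 0 :> K.
  by have [k ->] := wcompE K (cut e u v) s; rewrite (negbTE hs).
rewrite !wz mulr0 addr0; apply/eqP; apply: contraNT hs.
move=> /dsum_neq0 [s1 [w [s2 [es rw]]]].
rewrite wcomp_neq0 => /and3P[h1 /fval_supp[ta _] /fval_supp[tb _]].
apply/allP => w' ws; apply: (present_compat u ht) => //.
have inz y' : y' \in s1 ++ s2 -> y' \in s.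
  by rewrite es !mem_cat inE => /orP[->|->]; rewrite ?orbT.
by case: (cut_present h h1 ta tb) => [/inz ?|?|?]; [apply: Or31|apply: Or32|apply: Or33].
Qed.

End Differential.

(** * The generating corollas as tree functions *)

Section Permutations.
Variable K : fieldType.

Lemma alternating_swap X (x : seq X -> K) s1 a s2 b s3 : alternating x ->
  x (s1 ++ a :: s2 ++ b :: s3) = - x (s1 ++ b :: s2 ++ a :: s3).
Proof.
move=> hx; rewrite (alternating_move s1 a s2 _ hx).
rewrite (alternating_move s1 b s2 _ hx) -mulrN; congr (_ * _).
by have := hx (s1 ++ s2) a b s3; rewrite -!catA.
Qed.

Lemma alternating_tperm n X (x : seq X -> K) (g : 'I_n -> X) e i j :
  alternating x -> uniq e -> i \in e -> j \in e -> i != j ->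
  x (map (g \o tperm i j) e) = - x (map g e).
Proof.
move=> hx.
suff H s1 s2 s3 i' j' : uniq (s1 ++ i' :: s2 ++ j' :: s3) ->
    x (map (g \o tperm i' j') (s1 ++ i' :: s2 ++ j' :: s3))
    = - x (map g (s1 ++ i' :: s2 ++ j' :: s3)).
  move=> ue ie je ij; case/splitPr: ie je ue => s1 s2.
  rewrite mem_cat inE (eq_sym j) (negbTE ij) /=; case/orP => js ue.
    case/splitPr: js ue => s3 s4; rewrite -catA /= => ue.
    by rewrite tpermC; apply: H.
  by case/splitPr: js ue => s3 s4 ue; apply: H.
have pe : perm_eq (s1 ++ i' :: s2 ++ j' :: s3) (i' :: j' :: s1 ++ s2 ++ s3).
  by apply/seq.permP => P; rewrite /= !count_cat /= !count_cat /=; lia.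
rewrite (perm_uniq pe) /= !(inE, mem_cat) !negb_or.
case/and3P=> /andP[ij /and3P[i1 n4 i3]] /and3P[nj1 n6 n5] _.
have mapid s : i' \notin s -> j' \notin s -> map (g \o tperm i' j') s = map g s.
  move=> hi hj; apply/eq_in_map => k ks /=; rewrite tpermD //.
    by apply: contraNneq hi => ->.
  by apply: contraNneq hj => ->.
rewrite !map_cat /= !map_cat /= tpermL tpermR !mapid //.
exact: alternating_swap.
Qed.

Lemma alternating_permute n X (x : seq X -> K) (g : 'I_n -> X) (s : 'S_n) :
  alternating x ->
  x (map (g \o s) (enum 'I_n)) = (-1) ^+ odd_perm s * x (map g (enum 'I_n)).
Proof.
move=> hx; have [ts -> dts] := prod_tpermP s.
elim: ts g dts => [|[i j] ts IH] g /=.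
  rewrite big_nil odd_perm1 mul1r => _; congr x; apply: eq_map => k /=.
  by rewrite perm1.
case/andP=> ij dts; rewrite big_cons odd_permM odd_tperm ij.
have -> : map (g \o (tperm i j * \prod_(t <- ts) tperm t.1 t.2)%g) (enum 'I_n)
   = map ((g \o (\prod_(t <- ts) tperm t.1 t.2)%g) \o tperm i j) (enum 'I_n).
  by apply: eq_map => k /=; rewrite permM.
rewrite alternating_tperm ?enum_uniq ?mem_enum //.
by rewrite IH // signrN mulNr.
Qed.

End Permutations.

Definition leaf n (l : 'I_n) : sym n := ([set l], false).

Lemma leaf_inj n : injective (@leaf n).
Proof. by move=> i j [/set1_inj]. Qed.

Definition ell_word m : seq (sym m) := map (@leaf m) (enum 'I_m).

Definition f_word m n : seq (sym (m + n)) :=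
  (setT, true) :: map (@leaf (m + n) \o lshift n) (enum 'I_m).

Lemma ell_word_uniq m : uniq (ell_word m).
Proof. by rewrite map_inj_uniq ?enum_uniq //; apply: leaf_inj. Qed.

Lemma leaf_lshift_inj m n : injective (@leaf (m + n) \o lshift n).
Proof. by move=> i j /leaf_inj/lshift_inj. Qed.

Lemma f_word_uniq m n : uniq (f_word m n).
Proof.
rewrite /= map_inj_uniq ?enum_uniq ?andbT; last exact: leaf_lshift_inj.
by apply/mapP => -[].
Qed.

Lemma mem_ell_word m (x : sym m) : reflect (exists l, x = leaf l) (x \in ell_word m).
Proof.
apply: (iffP mapP) => [[l _ ->]|[l ->]]; first by exists l.
by exists l; rewrite ?mem_enum.
Qed.

Lemma mem_f_word m n (x : sym (m + n)) :
  reflect (x = (setT, true) \/ exists l : 'I_m, x = leaf (lshift n l)) (x \in f_word m n).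
Proof.
rewrite inE; apply: (iffP orP) => [[/eqP|/mapP[l _ ->]]|[->|[l ->]]].
- by left.
- by right; exists l.
- by left.
- by right; apply/mapP; exists l; rewrite ?mem_enum.
Qed.

Lemma straight_wavyl m n i : @straight_wavy m n (lshift n i) = straight.
Proof. by rewrite /straight_wavy juxtl. Qed.
Lemma straight_wavyr m n i : @straight_wavy m n (rshift m i) = wavy.
Proof. by rewrite /straight_wavy juxtr. Qed.

Lemma straight_wavyP m n (l : 'I_(m + n)) :
  reflect (exists i, l = lshift n i) (~~ iswavy (@straight_wavy m n l)).
Proof.
case: (split_ordP l) => i ->.
  by rewrite straight_wavyl; apply: ReflectT; exists i.
rewrite straight_wavyr; apply: ReflectF => -[j] /eqP.
by rewrite eq_sym eq_lrshift.
Qed.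

Lemma disjoint_set1 (T : finType) (i j : T) : i != j -> [disjoint [set i] & [set j]].
Proof. by move=> ij; rewrite disjoints1 inE. Qed.

Lemma ell_tree m : (2 <= m)%N -> tree straight (fun _ : 'I_m => straight) (ell_word m).
Proof.
move=> m2; split; split=> //; rewrite ?(ltnW m2) //.
- by move=> l _ _; apply/mem_ell_word; exists l.
- exact: ell_word_uniq.
- move=> S /mem_ell_word[l [->]]; split=> //=.
    by apply/set0Pn; exists l; rewrite inE.
  apply/eqP => eT; have := cardsT 'I_m; rewrite -eT cards1 card_ord => e1.
  by rewrite -e1 in m2.
- by move=> S /mem_ell_word[l].
- move=> S S' k /mem_ell_word[l [-> _]] /mem_ell_word[l' [-> _]].
  have [->|ll] := eqVneq l l'; first by apply: Or32.
  by apply: Or31; apply: disjoint_set1.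
- by move=> S S' _ /mem_ell_word[l].
Qed.

Lemma f_tree m n : (1 <= m)%N -> tree wavy (@straight_wavy m n) (f_word m n).
Proof.
move=> m1; split; split=> //.
- by rewrite addn_gt0 m1.
- move=> _ /(_ (lshift n (Ordinal m1))); by rewrite straight_wavyl.
- by move=> l /straight_wavyP[i ->] _; apply/mem_f_word; right; exists i.
- by move=> l _ _; apply/mem_f_word; left.
- exact: f_word_uniq.
- move=> S /mem_f_word [//|[l [->]]]; split=> //.
    by apply/set0Pn; exists (lshift n l); rewrite inE.
  by move=> l'; rewrite inE => /eqP ->; rewrite straight_wavyl.
- move=> S /mem_f_word [[->]|[l] //]; split=> //.
  exists (lshift n (Ordinal m1)); rewrite inE straight_wavyl; split=> //.
  move=> S' /mem_f_word [[->]|[l] //]; by rewrite properxx.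
- move=> S S' k /mem_f_word[[-> _]|[l [-> _]]] /mem_f_word[[-> _]|[l' [-> _]]].
  + by apply: Or32.
  + by apply: Or33; apply: subsetT.
  + by apply: Or32; apply: subsetT.
  have [->|ll] := eqVneq l l'; first by apply: Or32.
  by apply: Or31; apply: disjoint_set1; rewrite eq_lshift.
- move=> S S' _ /mem_f_word[[->]|[l] //]; right; exact: subsetT.
Qed.

Lemma nstr_ell m : nstr (fun _ : 'I_m => straight) = m.
Proof.
rewrite /nstr -[RHS](card_ord m) -cardsT; apply: eq_card => i.
by rewrite !inE.
Qed.

Lemma nstr_f m n : nstr (@straight_wavy m n) = m.
Proof.
rewrite /nstr (_ : [set _ | _] = lshift n @: [set: 'I_m]).
  by rewrite card_imset ?cardsT ?card_ord //; apply: lshift_inj.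
apply/setP => l; rewrite inE; apply/straight_wavyP/imsetP => [[i ->]|[i _ ->]]; by exists i.
Qed.

Section Generators.
Variable K : fieldType.

(** The normalization of corollas for which contractions reproduce the signs in
    the formulas for the differential. It works because 'C(m + 1, 2) is
    quadratic in m with polarization the product, see tri_add. *)
Definition gsign (m : nat) : K := (-1) ^+ 'C(m.+1, 2).

Definition word_fun (X : eqType) m (w s : seq X) : K := gsign m * alt K w s.

Lemma word_fun_alt (X : eqType) m (w : seq X) : uniq w -> alternating (word_fun m w).
Proof.
by move=> uw s1 a b s2; rewrite /word_fun (alt_alternating K uw) mulrN.
Qed.

Lemma word_fun_neq0 (X : eqType) m (w : seq X) s :
  (word_fun m w s != 0) = perm_eq w s.
Proof. by rewrite /word_fun mulf_eq0 signr_eq0 /= alt_neq0. Qed.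

Lemma tell_supp m (hm : (2 <= m)%N) s : word_fun m (ell_word m) s != 0 ->
  tree straight (fun _ : 'I_m => straight) s
  /\ 2 - m%:Z = tdeg straight (fun _ : 'I_m => straight) s.
Proof.
rewrite word_fun_neq0 => ps; split; first exact: tree_perm ps (ell_tree hm).
rewrite /tdeg -(perm_size ps) size_map size_enum_ord nstr_ell /=; lia.
Qed.

Lemma tf_supp m n (hm : (1 <= m)%N) s : word_fun m (f_word m n) s != 0 ->
  tree wavy (@straight_wavy m n) s /\ 1 - m%:Z = tdeg wavy (@straight_wavy m n) s.
Proof.
rewrite word_fun_neq0 => ps; split; first exact: tree_perm ps (f_tree n hm).
rewrite /tdeg -(perm_size ps) /= size_map size_enum_ord nstr_f; lia.
Qed.

Definition tell m (hm : (2 <= m)%N) :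
    treeop K straight m (fun _ => straight) (2 - m%:Z) :=
  TFun (word_fun_alt m (ell_word_uniq m)) (@tell_supp m hm).

Definition tf m n (hm : (1 <= m)%N) :
    treeop K wavy (m + n)%N (@straight_wavy m n) (1 - m%:Z) :=
  TFun (word_fun_alt m (f_word_uniq m n)) (@tf_supp m n hm).

Definition tgen : realization HSoo_corollas (treeop K) :=
  fun g => match g with
           | HSoo_ell_gen m h => tell h
           | HSoo_f_gen m n h => tf n h
           end.

Lemma rename_leaf n (s : 'S_n) l : rename s (leaf (s l)) = leaf l.
Proof.
rewrite /rename /leaf /=; congr pair; apply/setP => i; rewrite !inE.
by rewrite (inj_eq perm_inj).
Qed.

Lemma rename_tperm n (i j l : 'I_n) : rename (tperm i j) (leaf l) = leaf (tperm i j l).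
Proof. by rewrite -{1}(tpermK i j l) rename_leaf. Qed.

(** A transposition of straight inputs exchanges two letters, whereas wavy
    inputs have no letters. *)
Lemma tgen_symmetric g : corolla_symmetric (tgen g).
Proof.
have key n c (a : 'I_n -> colour) d (x : treeop K c n a d) w i j k :
    a i = a j -> (forall s, (fval x s != 0) = perm_eq w s) ->
    perm_eq w (map (rename (tperm i j)) w) ->
    fval x (map (rename (tperm i j)) w) = k * fval x w ->
    op_act a (tperm i j) x = k *: x.
  move=> aij xw pw hk; apply: fval_inj => s.
  have ha l : a (tperm i j l) = a l by case: tpermP => // ->.
  rewrite fvalZ /= tactE //=.
  have alts : alternating (fval x \o map (rename (tperm i j))).
    by move=> s1 y y' s2 /=; rewrite !map_cat /= (fval_alt x).
  have [ps|nps] := boolP (perm_eq s w); last first.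
    have x0 : fval x s = 0 by apply/eqP; apply: contraNT nps; rewrite xw perm_sym.
    rewrite x0 mulr0; apply/eqP; apply: contraNT nps; rewrite xw => pw'.
    apply: (perm_map_inj (@rename_inj _ (tperm i j))).
    by rewrite perm_sym in pw'; apply: perm_trans pw' pw.
  apply: (@alternating_eq K (sym n) (fval x \o map (rename (tperm i j)))
            (fun t => k * fval x t) s w) => //.
  by move=> s1 y y' s2; rewrite (fval_alt x) mulrN.
case: g => [m hm|m n hm] i j ij aij.
  have e : map (rename (tperm i j)) (ell_word m) = map (@leaf m \o tperm i j) (enum 'I_m).
    by rewrite -map_comp; apply: eq_map => l; apply: rename_tperm.
  rewrite [cor_in i]/= -scaleN1r.
  have hx : fval (tgen (HSoo_ell_gen hm)) (map (rename (tperm i j)) (ell_word m))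
      = - 1 * fval (tgen (HSoo_ell_gen hm)) (ell_word m).
    rewrite e mulN1r; apply: alternating_tperm; rewrite ?enum_uniq ?mem_enum //.
      exact: fval_alt (tell hm).
    exact/eqP.
  have pw : perm_eq (ell_word m) (map (rename (tperm i j)) (ell_word m)).
    by rewrite -(word_fun_neq0 m) -[word_fun _ _ _]/(fval (tell hm) _) [X in X != _]hx mulN1r oppr_eq0 word_fun_neq0.
  exact: (@key m straight (fun=> straight) _ (tell hm) (ell_word m) i j (-1) aij (word_fun_neq0 m _) pw hx).
case: (boolP (iswavy (@straight_wavy m n i))) => wi.
  have wj : iswavy (@straight_wavy m n j) by have /= <- := aij.
  have -> : op_act (@cor_in HSoo_corollas (HSoo_f_gen n hm)) (tperm i j) (tgen (HSoo_f_gen n hm))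
     = 1 *: tgen (HSoo_f_gen n hm).
    have e : map (rename (tperm i j)) (f_word m n) = f_word m n.
      rewrite /= {1}/rename /= preimsetT; congr cons; rewrite -map_comp.
      apply: eq_map => l; rewrite /= rename_tperm tpermD //.
        by apply: contraTneq wi => ->; rewrite straight_wavyl.
      by apply: contraTneq wj => ->; rewrite straight_wavyl.
    apply: (key _ _ _ _ _ (f_word m n)) => //; rewrite ?e ?mul1r //.
    by move=> s; apply: word_fun_neq0.
  by rewrite scale1r /=; move: wi; case: (straight_wavy i).
have /straight_wavyP[i' ei] := wi.
have /straight_wavyP[j' ej] : ~~ iswavy (@straight_wavy m n j) by have /= <- := aij.
have -> : (if @cor_in HSoo_corollas (HSoo_f_gen n hm) i is straight
   then - tgen (HSoo_f_gen n hm) else tgen (HSoo_f_gen n hm)) = - 1 *: tgen (HSoo_f_gen n hm).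
  by rewrite scaleN1r /=; move: wi; case: (straight_wavy i).
have e : map (rename (tperm i j)) (f_word m n) =
    (setT, true) :: map ((@leaf (m + n) \o lshift n) \o tperm i' j') (enum 'I_m).
  rewrite /= {1}/rename /= preimsetT; congr cons; rewrite -map_comp.
  apply: eq_map => l; rewrite /= rename_tperm ei ej; congr leaf.
  case: (tpermP i' j' l) => [->|->|/eqP li /eqP lj]; rewrite ?tpermL ?tpermR //.
  by rewrite tpermD // eq_lshift eq_sym.
have hx : fval (tgen (HSoo_f_gen n hm)) (map (rename (tperm i j)) (f_word m n))
      = - 1 * fval (tgen (HSoo_f_gen n hm)) (f_word m n).
  rewrite e mulN1r.
  apply: (@alternating_tperm K m _ (fval (tf n hm) \o cons (setT, true)));
    rewrite ?enum_uniq ?mem_enum //.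
    by apply: alternating_cons; apply: fval_alt (tf n hm).
  by apply/eqP => eij; apply: ij; rewrite ei ej eij.
have pw : perm_eq (f_word m n) (map (rename (tperm i j)) (f_word m n)).
  by rewrite -(word_fun_neq0 m) -[word_fun _ _ _]/(fval (tf n hm) _) [X in X != _]hx mulN1r oppr_eq0 word_fun_neq0.
exact: (@key _ wavy (@straight_wavy m n) _ (tf n hm) (f_word m n) i j (-1) aij (word_fun_neq0 m _) pw hx).
Qed.

Lemma tgen_model : is_model (@no_relations K HSoo_corollas) tgen.
Proof. by split=> //; apply: tgen_symmetric. Qed.

(** The expansion of an operation into trees. *)
Definition Phi c n (a : 'I_n -> colour) d (x : HSoo K c n a d) : treeop K c n a d :=
  qvalue tgen x.

Lemma Phi_morphism : is_morphism Phi.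
Proof. exact: qvalue_morphism tgen_model. Qed.

Lemma Phi_gen g : Phi (@HSoo_generators K g) = tgen g.
Proof. exact: qvalue_gen tgen_model. Qed.

End Generators.

(** * Linearity of operads and induction on presented operads *)

Lemma fun_choice X Y (P : X -> Y -> Prop) :
  (forall x, exists y, P x y) -> exists f, forall x, P x (f x).
Proof. by case/choice => f hf; exists f. Qed.

Section OperadLinear.
Variables (K : fieldType) (P : operad K).

Lemma op_act0 c n (a b : 'I_n -> colour) d (s : 'S_n) :
  op_act b s (0 : P c n a d) = 0.
Proof.
have := op_act_linear b s (-1) (0 : P c n a d) 0.
by rewrite scaler0 addr0 scaleN1r addNr.
Qed.

Lemma op_actZ c n (a b : 'I_n -> colour) d (s : 'S_n) k (x : P c n a d) :
  op_act b s (k *: x) = k *: op_act b s x.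
Proof. by have := op_act_linear b s k x 0; rewrite !addr0 op_act0 addr0. Qed.

Lemma op_comp0l c e p q n (a : 'I_p -> colour) (b : 'I_q -> colour)
    (z : 'I_n -> colour) d1 d2 d u v (y : P e q b d2) :
  op_comp z d u v (0 : P c p a d1) y = 0.
Proof.
have := op_comp_linearl z d u v (-1) (0 : P c p a d1) 0 y.
by rewrite scaler0 addr0 scaleN1r addNr.
Qed.

Lemma op_comp0r c e p q n (a : 'I_p -> colour) (b : 'I_q -> colour)
    (z : 'I_n -> colour) d1 d2 d u v (x : P c p a d1) :
  op_comp z d u v x (0 : P e q b d2) = 0.
Proof.
have := op_comp_linearr z d u v (-1) x (0 : P e q b d2) 0.
by rewrite scaler0 addr0 scaleN1r addNr.
Qed.

Lemma op_compZl c e p q n (a : 'I_p -> colour) (b : 'I_q -> colour)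
    (z : 'I_n -> colour) d1 d2 d u v k (x : P c p a d1) (y : P e q b d2) :
  op_comp z d u v (k *: x) y = k *: op_comp z d u v x y.
Proof. by have := op_comp_linearl z d u v k x 0 y; rewrite !addr0 op_comp0l addr0. Qed.

Lemma op_compZr c e p q n (a : 'I_p -> colour) (b : 'I_q -> colour)
    (z : 'I_n -> colour) d1 d2 d u v k (x : P c p a d1) (y : P e q b d2) :
  op_comp z d u v x (k *: y) = k *: op_comp z d u v x y.
Proof. by have := op_comp_linearr z d u v k x y 0; rewrite !addr0 op_comp0r addr0. Qed.
End OperadLinear.

Section MorphismLinear.
Variables (K : fieldType) (P Q : operad K).
Variable phi : forall c n (a : 'I_n -> colour) d, P c n a d -> Q c n a d.
Hypothesis hphi : is_morphism phi.

Lemma mor0 c n (a : 'I_n -> colour) d : phi (0 : P c n a d) = 0.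
Proof.
have := mor_linear hphi (-1) (0 : P c n a d) 0.
by rewrite scaler0 addr0 scaleN1r addNr.
Qed.

Lemma morZ c n (a : 'I_n -> colour) d k (x : P c n a d) : phi (k *: x) = k *: phi x.
Proof. by have := mor_linear hphi k x 0; rewrite !addr0 mor0 addr0. Qed.

Lemma morD c n (a : 'I_n -> colour) d (x y : P c n a d) : phi (x + y) = phi x + phi y.
Proof. by have := mor_linear hphi 1 x y; rewrite !scale1r. Qed.

Lemma morN c n (a : 'I_n -> colour) d (x : P c n a d) : phi (- x) = - phi x.
Proof. by rewrite -scaleN1r morZ scaleN1r. Qed.

Lemma mor_sum c n (a : 'I_n -> colour) d (I : Type) (r : seq I) (F : pred I)
    (X : I -> P c n a d) :
  phi (\sum_(i <- r | F i) X i) = \sum_(i <- r | F i) phi (X i).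
Proof. exact: (big_morph (@phi c n a d) (@morD c n a d) (@mor0 c n a d)). Qed.
End MorphismLinear.

Section PresentedInduction.
Variables (K : fieldType) (G : corollas) (R : relations K G).
Local Notation P := (presented R).
Variable prop : forall c n (a : 'I_n -> colour) d, P c n a d -> Prop.
Hypothesis prop_gen : forall g, prop (pres_gen R g).
Hypothesis prop_id : forall c, prop (op_id P c).
Hypothesis prop_act : forall c n (a b : 'I_n -> colour) d (s : 'S_n) (x : P c n a d),
  (forall i, b (s i) = a i) -> prop x -> prop (op_act b s x).
Hypothesis prop_comp : forall c e p q n (a : 'I_p -> colour) (b : 'I_q -> colour)
    (z : 'I_n -> colour) d1 d2 d u v (x : P c p a d1) (y : P e q b d2),
  grafting a e b z u v -> d = d1 + d2 -> prop x -> prop y ->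
  prop (op_comp z d u v x y).
Hypothesis prop0 : forall c n (a : 'I_n -> colour) d, prop (0 : P c n a d).
Hypothesis prop_lin : forall c n (a : 'I_n -> colour) d k (x y : P c n a d),
  prop x -> prop y -> prop (k *: x + y).

(** Elements of a presented operad are classes of expressions. *)
Lemma presented_ind c n (a : 'I_n -> colour) d (x : P c n a d) : prop x.
Proof.
have -> : x = cls R (generic_quotient.repr x) by rewrite /cls generic_quotient.reprK.
elim: (generic_quotient.repr x) => {c n a d x}.
- exact: prop_gen.
- exact: prop_id.
- move=> c n a b d s hs t IH.
  suff -> : cls R (Eact hs t) = op_act b s (cls R t : P c n a d) by exact: prop_act.
  by apply: qvalue_inj => Q q hq; rewrite qvalue_act // !qvalue_cls.
- move=> c e p r n a b z d1 d2 d u v h h' t IH t' IH'.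
  suff -> : cls R (Ecomp h h' t t') =
      op_comp z d u v (cls R t : P c p a d1) (cls R t' : P e r b d2) by exact: prop_comp.
  by apply: qvalue_inj => Q q hq; rewrite qvalue_comp // !qvalue_cls.
- move=> c n a d.
  suff -> : cls R (Ezero K G c a d) = (0 : P c n a d) by exact: prop0.
  by apply: qvalue_inj => Q q hq; rewrite qvalue_cls // qvalue0.
- move=> c n a d k t IH t' IH'.
  suff -> : cls R (Elin k t t') = k *: (cls R t : P c n a d) + cls R t' by exact: prop_lin.
  by apply: qvalue_inj => Q q hq; rewrite qvalueD // qvalueZ // !qvalue_cls.
Qed.
End PresentedInduction.

(** The degrees outside D are closed under addition and contain those of the
    generators and of the identities. *)
Lemma presented_vanish (K : fieldType) (G : corollas) (R : relations K G) (D : int -> Prop) :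
  ~ D 0 -> (forall g : G, ~ D (cor_deg g)) -> (forall i j, D (i + j) -> D i \/ D j) ->
  forall c n (a : 'I_n -> colour) d (x : presented R c n a d), D d -> x = 0.
Proof.
move=> D0 Dg DD; apply: presented_ind.
- by move=> g /Dg.
- by move=> c /D0.
- by move=> c n a b d s x _ IH /IH ->; rewrite op_act0.
- move=> c e p q n a b z d1 d2 d u v x y _ -> IHx IHy /DD[/IHx|/IHy] ->.
    by rewrite op_comp0l.
  by rewrite op_comp0r.
- by [].
- by move=> c n a d k x y IHx IHy hd; rewrite IHx // IHy // scaler0 addr0.
Qed.

(** * Rearranging graftings *)

(** The labelling, with one free slot, of the outer part of a tree that is to
    be cut along C. *)
Lemma outer_labels n (C : {set 'I_n}) :
  exists (m : nat) (u : 'I_m -> option 'I_n) (i0 : 'I_m),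
  [/\ u i0 = None, forall i, u i = None -> i = i0,
      forall i i' l, u i = Some l -> u i' = Some l -> i = i',
      forall i l, u i = Some l -> l \notin C
    & exists idx : 'I_n -> 'I_m, forall l, l \notin C -> u (idx l) = Some l].
Proof.
exists (1 + #|~: C|)%N, (juxt graft_slot (fun j : 'I_#|~: C| => Some (enum_val j))).
exists (lshift _ ord0); rewrite juxtE; split=> //.
- move=> i; case: (split_ordP i) => k ->; rewrite juxtE // => _.
  by rewrite (ord1 k).
- move=> i i' l; case: (split_ordP i) => k ->; rewrite juxtE // => -[<-].
  by case: (split_ordP i') => k' ->; rewrite juxtE // => -[/enum_val_inj ->].
- move=> i l; case: (split_ordP i) => k ->; rewrite juxtE // => -[<-].
  by have := enum_valP k; rewrite inE.
- apply: (@fun_choice _ _ (fun l i => l \notin C -> _ i = Some l)) => l; case: (boolP (l \in C)) => lC; first by exists (lshift _ ord0).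
  have lC' : l \in ~: C by rewrite inE.
  by exists (rshift 1 (enum_rank_in lC' l)) => _; rewrite juxtE enum_rankK_in.
Qed.

Lemma inner_labels n (B : {set 'I_n}) :
  exists (m : nat) (v : 'I_m -> 'I_n), injective v /\ img v = B.
Proof.
exists #|B|, (fun j : 'I_#|B| => enum_val j); split; first exact: enum_val_inj.
apply/setP => l; apply/imgP/idP => [[j <-]|lB]; first exact: enum_valP.
exact: enum_val_surj.
Qed.

Section SeqRight.
Variables (p q r m' n : nat) (e g : colour)
    (a : 'I_p -> colour) (b : 'I_q -> colour) (b' : 'I_r -> colour)
    (w' : 'I_m' -> colour) (z : 'I_n -> colour).
Variables (u3 : 'I_q -> option 'I_m') (v3 : 'I_r -> 'I_m')
  (u4 : 'I_p -> option 'I_n) (v4 : 'I_m' -> 'I_n).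
Hypotheses (h3 : grafting b g b' w' u3 v3) (h4 : grafting a e w' z u4 v4).

(** Rebracketing x o (y o t) as (x o y) o t: the intermediate arity, colouring
    and labels of x o y have to be invented. *)
Lemma grafting_seq_right : exists (m : nat) (w : 'I_m -> colour)
  (u1 : 'I_p -> option 'I_m) (v1 : 'I_q -> 'I_m)
  (u2 : 'I_m -> option 'I_n) (v2 : 'I_r -> 'I_n),
  [/\ grafting a e b w u1 v1, grafting w g b' z u2 v2,
      obind u2 \o u1 =1 u4, u2 \o v1 =1 omap v4 \o u3 & v2 =1 v4 \o v3].
Proof.
have [m [u2 [i0 [ui0 u2slot u2inj u2C [idx hidx]]]]] := outer_labels (img (v4 \o v3)).
have nC4 l : l \notin img v4 -> l \notin img (v4 \o v3).
  by apply: contra => /imgP[j <-]; apply: mem_img.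
have nC3 k : k \notin img v3 -> v4 k \notin img (v4 \o v3).
  apply: contra => /imgP[j /= /(grafting_injv h4) <-]; exact: mem_img.
pose w i := if u2 i is Some l then z l else g.
pose u1 i := omap idx (u4 i).
pose v1 j := if u3 j is Some k then idx (v4 k) else i0.
have n4 i l : u4 i = Some l -> l \notin img v4 := @grafting_notin _ _ _ _ _ _ _ _ _ h4 i l.
have n3 i l : u3 i = Some l -> l \notin img v3 := @grafting_notin _ _ _ _ _ _ _ _ _ h3 i l.
have u2v1 j : u2 (v1 j) = omap v4 (u3 j).
  rewrite /v1; case E: (u3 j) => [k|] //=; exact/hidx/nC3/(n3 _ _ E).
have u2u1 i : obind u2 (u1 i) = u4 i.
  rewrite /u1; case E: (u4 i) => [l|] //=; exact/hidx/nC4/(n4 _ _ E).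
exists m, w, u1, v1, u2, (v4 \o v3); split=> //.
- have [i4 ui4] := grafting_slotP h4.
  apply: (grafting_intro (i0 := i4)); rewrite /u1 ?ui4 //.
  + exact: (grafting_slot_colour h4 ui4).
  + move=> i ni; case E: (u4 i) => [l|].
      exists (idx l) => //; rewrite /w hidx ?nC4 ?(n4 _ _ E) //.
      exact: (grafting_outer_colour h4 E).
    by case: ni; exact: (grafting_slot_uniq h4 E ui4).
  + move=> j; rewrite /w u2v1; case E: (u3 j) => [k|] /=.
      by rewrite -(grafting_inner_colour h4) (grafting_outer_colour h3 E).
    exact: (grafting_slot_colour h3 E).
  + move=> i i' l; case E: (u4 i) => [k|] //= -[<-].
    case E': (u4 i') => [k'|] //= -[/(congr1 u2)].
    rewrite !hidx ?nC4 ?(n4 _ _ E) ?(n4 _ _ E') // => -[ek].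
    by rewrite ek in E'; exact: (grafting_inju h4 E E').
  + move=> j j' /(congr1 u2); rewrite !u2v1.
    case E: (u3 j) => [k|]; case E': (u3 j') => [k'|] //=.
      move=> [/(grafting_injv h4) ek]; rewrite ek in E.
      exact: (grafting_inju h3 E E').
    by move=> _; apply: (grafting_slot_uniq h3 E E').
  + move=> i j; case E: (u4 i) => [l|] //= -[/(congr1 u2)].
    rewrite u2v1 hidx ?nC4 ?(n4 _ _ E) //.
    case: (u3 j) => [k|] //= -[el]; have := n4 _ _ E.
    by rewrite el mem_img.
  + move=> i; case E: (u2 i) => [l|].
      have lC := u2C _ _ E; case: (grafting_cover h4 l) => [[i' ui']|/imgP[k vk]].
        left; exists i'; rewrite ui' /=; congr Some; apply: (u2inj _ _ l) => //.
        by rewrite hidx.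
      case: (grafting_cover h3 k) => [[j uj]|/imgP[j vj]].
        right; exists j; apply: (u2inj _ _ l) => //.
        by rewrite u2v1 uj /= vk.
      by move: lC; rewrite -vk -vj (mem_img (v4 \o v3)).
    have [j uj] := grafting_slotP h3; right; exists j.
    by rewrite (u2slot _ E) /v1 uj.
- apply: (grafting_intro (i0 := i0)); rewrite ?ui0 //.
  + by rewrite /w ui0.
  + move=> i ni; case E: (u2 i) => [l|]; first by exists l; rewrite // /w E.
    by case: ni; apply: u2slot.
  + by move=> j; rewrite /= -(grafting_inner_colour h4) (grafting_inner_colour h3).
  + by move=> j j' /= /(grafting_injv h4)/(grafting_injv h3).
  + by move=> i j /u2C; rewrite mem_img.
  + move=> l; case lC: (l \in img (v4 \o v3)).
      by right; apply/imgP.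
    by left; exists (idx l); rewrite hidx ?lC.
Qed.
End SeqRight.

Section SeqLeft.
Variables (p q r m n : nat) (e g : colour)
    (a : 'I_p -> colour) (b : 'I_q -> colour) (b' : 'I_r -> colour)
    (w : 'I_m -> colour) (z : 'I_n -> colour).
Variables (u1 : 'I_p -> option 'I_m) (v1 : 'I_q -> 'I_m)
  (u2 : 'I_m -> option 'I_n) (v2 : 'I_r -> 'I_n).
Hypotheses (h1 : grafting a e b w u1 v1) (h2 : grafting w g b' z u2 v2).

(** Rebracketing in the other direction, for t grafted into an input of y. *)
Lemma grafting_seq_left j0 : u2 (v1 j0) = None ->
  exists (m' : nat) (w' : 'I_m' -> colour)
  (u3 : 'I_q -> option 'I_m') (v3 : 'I_r -> 'I_m')
  (u4 : 'I_p -> option 'I_n) (v4 : 'I_m' -> 'I_n),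
  [/\ grafting b g b' w' u3 v3, grafting a e w' z u4 v4 &
  [/\ obind u2 \o u1 =1 u4, u2 \o v1 =1 omap v4 \o u3, v2 =1 v4 \o v3
    & img v4 = [set l | (l \in img v2) || [exists j, u2 (v1 j) == Some l]]]].
Proof.
move=> uj0.
have [m' [v4 [injv4 imv4]]] :=
  inner_labels [set l | (l \in img v2) || [exists j, u2 (v1 j) == Some l]].
have inB2 j : v2 j \in img v4 by rewrite imv4 inE mem_img.
have inB1 j l : u2 (v1 j) = Some l -> l \in img v4.
  by move=> e'; rewrite imv4 inE; apply/orP; right; apply/existsP; exists j; apply/eqP.
have [u3 hu3] : exists u3 : 'I_q -> option 'I_m', forall j, omap v4 (u3 j) = u2 (v1 j).
  apply: (@fun_choice _ _ (fun j o => omap v4 o = u2 (v1 j))) => j.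
  case E: (u2 (v1 j)) => [l|]; last by exists None.
  by have /imgP[k <-] := inB1 _ _ E; exists (Some k).
have [v3 hv3] : exists v3 : 'I_r -> 'I_m', forall j, v4 (v3 j) = v2 j.
  apply: (@fun_choice _ _ (fun j k => v4 k = v2 j)) => j.
  by have /imgP[k <-] := inB2 j; exists k.
have u3N j : u3 j = None -> u2 (v1 j) = None by move=> E; rewrite -hu3 E.
have u3S j k : u3 j = Some k -> u2 (v1 j) = Some (v4 k) by move=> E; rewrite -hu3 E.
exists m', (z \o v4), u3, v3, (obind u2 \o u1), v4; split; last split=> //.
- apply: (grafting_intro (i0 := j0)) => //=.
  + by have := hu3 j0; rewrite uj0; case: (u3 j0).
  + by rewrite (grafting_inner_colour h1) (grafting_slot_colour h2 uj0).
  + move=> j nj; case E: (u3 j) => [k|].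
      exists k => //; rewrite (grafting_inner_colour h1).
      exact: (grafting_outer_colour h2 (u3S _ _ E)).
    case: nj; apply: (grafting_injv h1).
    exact: (grafting_slot_uniq h2 (u3N _ E) uj0).
  + by move=> j; rewrite hv3 (grafting_inner_colour h2).
  + move=> j j' k /u3S E /u3S E'; apply: (grafting_injv h1).
    exact: (grafting_inju h2 E E').
  + move=> j j' /(congr1 v4); rewrite !hv3; exact: (grafting_injv h2).
  + move=> i j /u3S; rewrite hv3; exact: (grafting_disj h2).
  + move=> k; have : v4 k \in img v4 by apply: mem_img.
    rewrite imv4 inE => /orP[/imgP[j vj]|/existsP[j /eqP E]].
      by right; exists j; apply: injv4; rewrite hv3.
    left; exists j; case E': (u3 j) => [k'|]; last by rewrite u3N in E.
    by move: E; rewrite (u3S _ _ E') => -[/injv4 ->].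
- have [i1 ui1] := grafting_slotP h1.
  have u1N i l : u1 i = Some l -> u2 l <> None.
    move=> E E'; have := grafting_disj h1 (i := i) (j := j0).
    by rewrite E (grafting_slot_uniq h2 E' uj0).
  apply: (grafting_intro (i0 := i1)) => //=.
  + by rewrite ui1.
  + exact: (grafting_slot_colour h1 ui1).
  + move=> i ni; case E: (u1 i) => [l|] /=.
      case E2: (u2 l) => [k|]; last by case: (u1N _ _ E E2).
      exists k => //; rewrite (grafting_outer_colour h1 E).
      exact: (grafting_outer_colour h2 E2).
    by case: ni; apply: (grafting_slot_uniq h1 E ui1).
  + move=> i i' l; case E: (u1 i) => [k|] //= E2; case E': (u1 i') => [k'|] //= E2'.
    rewrite (grafting_inju h2 E2 E2') in E; exact: (grafting_inju h1 E E').
  + move=> i k; case E: (u1 i) => [l|] //= E2.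
    have : v4 k \in img v4 by apply: mem_img.
    rewrite imv4 inE => /orP[/imgP[j vj]|/existsP[j /eqP E3]].
      by move: E2; rewrite -vj; apply: (grafting_disj h2).
    rewrite (grafting_inju h2 E2 E3) in E; exact: (grafting_disj h1 E).
  + move=> l; case lB: (l \in img v4); first by right; apply/imgP.
    move: lB; rewrite imv4 inE => /negbT; rewrite negb_or => /andP[l2 /existsPn l1].
    have [k uk] := grafting_outP h2 l2.
    case: (grafting_cover h1 k) => [[i ui]|/imgP[j vj]].
      by left; exists i; rewrite ui.
    by have := l1 j; rewrite vj uk eqxx.
- by move=> j /=; rewrite hu3.
- by move=> j /=; rewrite hv3.
Qed.
End SeqLeft.

Section ParallelExchange.
Variables (p q r m n : nat) (e g : colour)
    (a : 'I_p -> colour) (b : 'I_q -> colour) (b' : 'I_r -> colour)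
    (w : 'I_m -> colour) (z : 'I_n -> colour).
Variables (u1 : 'I_p -> option 'I_m) (v1 : 'I_q -> 'I_m)
  (u2 : 'I_m -> option 'I_n) (v2 : 'I_r -> 'I_n).
Hypotheses (h1 : grafting a e b w u1 v1) (h2 : grafting w g b' z u2 v2).

(** Exchange of two graftings into different inputs of x. *)
Lemma grafting_parallel i2 w2 : u1 i2 = Some w2 -> u2 w2 = None ->
  exists (m' : nat) (w' : 'I_m' -> colour)
  (u3 : 'I_p -> option 'I_m') (v3 : 'I_r -> 'I_m')
  (u4 : 'I_m' -> option 'I_n) (v4 : 'I_q -> 'I_n),
  [/\ grafting a g b' w' u3 v3, grafting w' e b z u4 v4,
    forall i, u1 i = None -> u3 i <> None &
  [/\ obind u2 \o u1 =1 obind u4 \o u3, u2 \o v1 =1 Some \o v4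
    & Some \o v2 =1 u4 \o v3]].
Proof.
move=> ui2 uw2.
have [v4 hv4] : exists v4 : 'I_q -> 'I_n, forall j, u2 (v1 j) = Some (v4 j).
  apply: (@fun_choice _ _ (fun j l => u2 (v1 j) = Some l)) => j.
  case E: (u2 (v1 j)) => [l|]; first by exists l.
  by have := grafting_disj h1 (i := i2) (j := j); rewrite ui2 (grafting_slot_uniq h2 E uw2).
have [m' [u4 [i0 [ui0 u4slot u4inj u4C [idx hidx]]]]] := outer_labels (img v4).
have inj4 : injective v4.
  move=> j j' ej; apply: (grafting_injv h1); apply: (grafting_inju h2 (hv4 j)).
  by rewrite ej.
have v2C j : v2 j \notin img v4.
  by apply/imgP => -[j' ej]; apply: (grafting_disj h2 (i := v1 j') (j := j)); rewrite hv4 ej.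
have u2C i k l : u1 i = Some k -> u2 k = Some l -> l \notin img v4.
  move=> E1 E2; apply/imgP => -[j ej]; have := hv4 j; rewrite ej => E3.
  by rewrite (grafting_inju h2 E2 E3) in E1; apply: (grafting_disj h1 E1).
pose w' i := if u4 i is Some l then z l else e.
pose u3 i := if u1 i is Some k then omap idx (u2 k) else Some i0.
pose v3 j := idx (v2 j).
have [i1 ui1] := grafting_slotP h1.
exists m', w', u3, v3, u4, v4; split.
- apply: (grafting_intro (i0 := i2)).
  + by rewrite /u3 ui2 uw2.
  + by rewrite (grafting_outer_colour h1 ui2) (grafting_slot_colour h2 uw2).
  + move=> i ni; rewrite /u3; case E: (u1 i) => [k|]; last first.
      by exists i0; rewrite // /w' ui0 (grafting_slot_colour h1 E).
    case E2: (u2 k) => [l|] /=.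
      exists (idx l) => //; rewrite /w' hidx ?(u2C _ _ _ E E2) //.
      by rewrite (grafting_outer_colour h1 E) (grafting_outer_colour h2 E2).
    case: ni; rewrite (grafting_slot_uniq h2 E2 uw2) in E.
    exact: (grafting_inju h1 E ui2).
  + by move=> j; rewrite /w' /v3 hidx // (grafting_inner_colour h2).
  + move=> i i' k; rewrite /u3; case E: (u1 i) => [l|]; case E': (u1 i') => [l'|] //.
    * case E2: (u2 l) => [x|] //= -[<-]; case E2': (u2 l') => [x'|] //= -[/(congr1 u4)].
      rewrite !hidx ?(u2C _ _ _ E E2) ?(u2C _ _ _ E' E2') // => -[ex].
      rewrite ex in E2'; rewrite (grafting_inju h2 E2 E2') in E.
      exact: (grafting_inju h1 E E').
    * case E2: (u2 l) => [x|] //= -[<-] [/(congr1 u4)].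
      by rewrite ui0 hidx ?(u2C _ _ _ E E2).
    * move=> [<-]; case E2: (u2 l') => [x|] //= -[/(congr1 u4)].
      by rewrite ui0 hidx ?(u2C _ _ _ E' E2).
    * by move=> _ _; apply: (grafting_slot_uniq h1 E E').
  + move=> j j'; rewrite /v3 => /(congr1 u4); rewrite !hidx // => -[].
    exact: (grafting_injv h2).
  + move=> i j; rewrite /u3 /v3; case E: (u1 i) => [l|].
      case E2: (u2 l) => [x|] //= -[/(congr1 u4)].
      rewrite !hidx ?(u2C _ _ _ E E2) // => -[ex].
      by rewrite ex in E2; apply: (grafting_disj h2 E2).
    by move=> [/(congr1 u4)]; rewrite ui0 hidx.
  + move=> i; case E: (u4 i) => [l|]; last first.
      by left; exists i1; rewrite /u3 ui1 (u4slot _ E).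
    have lC := u4C _ _ E; case: (grafting_cover h2 l) => [[k uk]|/imgP[j vj]]; last first.
      by right; exists j; apply: (u4inj _ _ l) => //; rewrite /v3 vj hidx.
    case: (grafting_cover h1 k) => [[i' ui']|/imgP[j vj]].
      left; exists i'; rewrite /u3 ui' uk /=; congr Some.
      by apply: (u4inj _ _ l) => //; rewrite hidx.
    by move: lC; have := hv4 j; rewrite vj uk => -[->]; rewrite mem_img.
- apply: (grafting_intro (i0 := i0)) => //.
  + by rewrite /w' ui0.
  + move=> i ni; case E: (u4 i) => [l|]; first by exists l; rewrite // /w' E.
    by case: ni; apply: u4slot.
  + move=> j; rewrite (grafting_inner_colour h1).
    exact: (grafting_outer_colour h2 (hv4 j)).
  + by move=> i j /u4C; rewrite mem_img.
  + move=> l; case lC: (l \in img v4); first by right; apply/imgP.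
    by left; exists (idx l); rewrite hidx ?lC.
- by move=> i E; rewrite /u3 E.
- split.
  + move=> i /=; rewrite /u3; case E: (u1 i) => [k|] //=.
    by case E2: (u2 k) => [l|] //=; rewrite hidx ?(u2C _ _ _ E E2).
  + exact: hv4.
  + by move=> j /=; rewrite /v3 hidx.
Qed.
End ParallelExchange.

Lemma inj_same_image (T : eqType) q q' (f : 'I_q -> T) (f' : 'I_q' -> T) :
  injective f -> injective f' ->
  (forall y, (exists j, f j = y) <-> (exists j, f' j = y)) -> q = q'.
Proof.
have le r r' (h : 'I_r -> T) (h' : 'I_r' -> T) : injective h ->
    (forall y, (exists j, h j = y) -> (exists j, h' j = y)) -> (r <= r')%N.
  move=> ih im; have [g hg] : exists g : 'I_r -> 'I_r', forall j, h' (g j) = h j.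
    by apply: (@fun_choice _ _ (fun j i => h' i = h j)) => j; apply: im; exists j.
  have ig : injective g by move=> j j' eg; apply: ih; rewrite -!hg eg.
  by have := leq_card g ig; rewrite !card_ord.
move=> i1 i2 im; apply/eqP; rewrite eqn_leq (le _ _ f f') ?(le _ _ f' f) //;
  by move=> y /im.
Qed.

Lemma inj_same_image_perm (T : eqType) q (f f' : 'I_q -> T) :
  injective f -> injective f' ->
  (forall y, (exists j, f' j = y) -> (exists j, f j = y)) ->
  exists s : 'S_q, f' =1 f \o s.
Proof.
move=> i1 i2 im; have [g hg] : exists g : 'I_q -> 'I_q, forall j, f (g j) = f' j.
  by apply: (@fun_choice _ _ (fun j i => f i = f' j)) => j; apply: im; exists j.
have ig : injective g by move=> j j' eg; apply: i2; rewrite -!hg eg.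
by exists (perm ig) => j /=; rewrite permE hg.
Qed.

(** Both arities can be read off from the label set of the inner tree. *)
Lemma grafting_unique p q p' q' n (a : 'I_p -> colour) (a' : 'I_p' -> colour) e
    (b : 'I_q -> colour) (b' : 'I_q' -> colour) (z : 'I_n -> colour) u v u' v' :
  grafting a e b z u v -> grafting a' e b' z u' v' -> img v = img v' ->
  p = p' /\ q = q'.
Proof.
move=> h h' ei; split; last first.
  apply: (inj_same_image (grafting_injv h) (grafting_injv h')) => l.
  by split=> /imgP; rewrite (ei, esym ei) => /imgP.
have inj r s (c : 'I_r -> colour) (d : 'I_s -> colour) x y :
    grafting c e d z x y -> injective x.
  move=> hg i i'; case E: (x i) => [l|] E'; first exact: (grafting_inju hg E).
  exact: (grafting_slot_uniq hg E).
apply: (inj_same_image (inj _ _ _ _ _ _ h) (inj _ _ _ _ _ _ h')) => -[l|].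
  split=> [[i /(grafting_notin h)]|[i /(grafting_notin h')]].
    by rewrite ei => /(grafting_outP h').
  by rewrite -ei => /(grafting_outP h).
by split=> _; [exact: (grafting_slotP h')|exact: (grafting_slotP h)].
Qed.

(** Both graftings enumerate the same labels, so they differ by renamings of
    the two factors. *)
Lemma grafting_unique_perm p q n (a a' : 'I_p -> colour) e
    (b b' : 'I_q -> colour) (z : 'I_n -> colour) u v u' v' :
  grafting a e b z u v -> grafting a' e b' z u' v' -> img v = img v' ->
  exists (s : 'S_p) (t : 'S_q), [/\ u' = u \o s, v' = v \o t,
    forall i, a (s i) = a' i & forall j, b (t j) = b' j].
Proof.
move=> h h' ei.
have [t ht] : exists t : 'S_q, v' =1 v \o t.
  apply: (inj_same_image_perm (grafting_injv h) (grafting_injv h')) => l.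
  by move/imgP; rewrite -ei => /imgP.
have inj (c : 'I_p -> colour) (d : 'I_q -> colour) x y :
    grafting c e d z x y -> injective x.
  move=> hg i i'; case E: (x i) => [l|] E'; first exact: (grafting_inju hg E).
  exact: (grafting_slot_uniq hg E).
have [s hs] : exists s : 'S_p, u' =1 u \o s.
  apply: (inj_same_image_perm (inj _ _ _ _ h) (inj _ _ _ _ h')) => -[l|].
    by case=> i /(grafting_notin h'); rewrite -ei => /(grafting_outP h).
  by move=> _; exact: (grafting_slotP h).
exists s, t; split; [exact: funext|exact: funext| |].
- move=> i; have := hs i; rewrite /=; case E: (u (s i)) => [l|] E'.
    by rewrite (grafting_outer_colour h E) (grafting_outer_colour h' E').
  by rewrite (grafting_slot_colour h E) (grafting_slot_colour h' E').
- move=> j; rewrite (grafting_inner_colour h) (grafting_inner_colour h').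
  by rewrite ht.
Qed.

(** * Monomials of the free operad *)

Section Lift.
Variables (p q n : nat) (a : 'I_p -> colour) (e : colour) (b : 'I_q -> colour)
  (z : 'I_n -> colour) (u : 'I_p -> option 'I_n) (v : 'I_q -> 'I_n).
Hypotheses (h : grafting a e b z u v) (q0 : (0 < q)%N).

(** With lift_in, the inverse of cut: the slot is expanded to the label set of
    the inner tree. *)
Definition lift_out (x : sym p) : sym n :=
  ([set l | [exists i, (i \in x.1) && (u i == Some l)]
            || (l \in img v) && [exists i, (i \in x.1) && (u i == None)]], x.2).

Definition lift_in (x : sym q) : sym n := (v @: x.1, x.2).

Lemma mem_lift_out x i l : u i = Some l -> (l \in (lift_out x).1) = (i \in x.1).
Proof.
move=> ui; rewrite inE (negbTE (grafting_notin h ui)) orbF.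
apply/existsP/idP => [[i' /andP[ix /eqP ui']]|ix]; last by exists i; rewrite ix ui /=.
by rewrite (grafting_inju h ui ui').
Qed.

Lemma mem_lift_out_slot x i l : u i = None -> l \in img v ->
  (l \in (lift_out x).1) = (i \in x.1).
Proof.
move=> ui lA; rewrite inE lA /=; apply/orP/idP => [[/existsP|/existsP]|ix].
- by case=> i' /andP[_ /eqP /(grafting_notin h)]; rewrite lA.
- by case=> i' /andP[ix /eqP ui']; rewrite (grafting_slot_uniq h ui ui').
- by right; apply/existsP; exists i; rewrite ix ui.
Qed.

Lemma cut_lift_out x : x.1 != set0 ->
  (if x.2 then exists2 i, i \in x.1 & ~~ iswavy (a i)
   else forall i, i \in x.1 -> ~~ iswavy (a i)) ->
  cut e u v (lift_out x) = Some (inl x).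
Proof.
case: x => P k /= P0 hk; have [i0 ui0] := grafting_slotP h.
set x := (P, k); have A0 := img_neq0 v q0; set S := (lift_out x).1.
have sS : sat (img v) S.
  case iP: (i0 \in P); [apply: sat_sub|apply: sat_disj].
    by apply/subsetP => l lA; rewrite (mem_lift_out_slot x ui0 lA).
  apply/pred0P => l /=; case lA: (l \in img v) => //=.
  by rewrite (mem_lift_out_slot x ui0 lA).
have oS : outer_set u (img v) S = P.
  apply/setP => i; rewrite in_outer; case E: (u i) => [l|]; first exact: mem_lift_out.
  rewrite (grafting_slot_uniq h E ui0).
  have vA := mem_img v (Ordinal q0); rewrite -[i0 \in P](mem_lift_out_slot x ui0 vA).
  apply/idP/idP => [/subsetP ->//|vS]; case/orP: sS => // dS.
  by have := disjointFr dS vA; rewrite vS.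
rewrite cut_inl //=; first by rewrite oS.
  by rewrite -/S -(outer_eq0 h sS A0) oS.
rewrite -/S; apply/negP => /andP[SA we].
have eP : P = [set i0].
  apply/eqP; rewrite -oS -(outer_img h ui0) (outer_eq h) ?satA //.
  move: sS; rewrite eqEsubset SA; case/orP => [->//|dS]; case/negP: P0.
  rewrite -oS (outer_eq0 h) ?sat_disj // -subset0; apply/subsetP => l lS.
  by have := disjointFl dS lS; rewrite (subsetP SA).
have eS : S == img v.
  by rewrite -(outer_eq h) ?satA // oS eP (outer_img h ui0).
rewrite eS orbF in we.
have si0 : ~~ iswavy (a i0).
  case: k hk {x S sS oS SA we eS} => [[i]|]; rewrite eP; first by rewrite inE => /eqP ->.
  by apply; rewrite inE.
by rewrite (grafting_slot_colour h ui0) we in si0.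
Qed.

Lemma cut_lift_in x : x.1 != set0 -> iswavy e || (x.1 != setT) ->
  cut e u v (lift_in x) = Some (inr x).
Proof.
case: x => P k /= P0 hk.
have hP : v @^-1: (v @: P) = P.
  by apply/setP => j; rewrite inE mem_imset //; apply: grafting_injv h.
have PA : v @: P \subset img v by apply: imsetS; apply: subsetT.
rewrite cut_inr //= ?hP //.
  by case/set0Pn: P0 => j jP; apply/set0Pn; exists (v j); apply: imset_f.
rewrite /within PA /=; case/orP: hk => [->//|nT]; apply/orP; right.
by rewrite -(inner_eq PA (subxx _)) hP inner_img.
Qed.
End Lift.

Lemma tree_sym_neq0 c n (a : 'I_n -> colour) s x : tree c a s -> x \in s -> x.1 != set0.
Proof.
case: x => S [] [_ ns] Sk /=; last by have [] := t_str ns Sk.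
by have [_ [l [lS _ _]]] := t_wav ns Sk; apply/set0Pn; exists l.
Qed.

Section JoinTrees.
Variables (c e : colour) (p q n : nat) (a : 'I_p -> colour) (b : 'I_q -> colour)
  (z : 'I_n -> colour) (u : 'I_p -> option 'I_n) (v : 'I_q -> 'I_n).
Hypothesis h : grafting a e b z u v.
Local Notation cl := (cut e u v).

(** The word T lists the lifts of the symbols of both trees; no other word has
    these parts, since cut is injective. *)
Lemma graft_trees Ta Tb : tree c a Ta -> tree e b Tb ->
  exists T, forall s, all (fun x => cl x : bool) s && (perm_eq Ta (outs cl s) && perm_eq Tb (inns cl s))
    = perm_eq T s.
Proof.
move=> ta tb; have q0 := t_pos tb.1.
have hlo x : x \in Ta -> cl (lift_out u v x) = Some (inl x).
  move=> xT; apply: (cut_lift_out h q0); first exact: tree_sym_neq0 ta xT.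
  case: x xT => P [] /= xT; last by have [] := t_str ta.2 xT.
  by have [_ [i [iP si _]]] := t_wav ta.2 xT; exists i.
have hli x : x \in Tb -> cl (lift_in v x) = Some (inr x).
  move=> xT; apply: (cut_lift_in h); first exact: tree_sym_neq0 tb xT.
  case: x xT => P [] /= xT; last by have [] := t_str tb.2 xT.
  by have [-> _] := t_wav tb.2 xT.
pose T := map (lift_out u v) Ta ++ map (lift_in v) Tb.
have aT : all (fun x => cl x : bool) T.
  rewrite all_cat !all_map; apply/andP; split; apply/allP => x xT /=.
    by rewrite hlo.
  by rewrite hli.
have oT : outs cl T = Ta.
  rewrite /outs pmap_cat.
  rewrite [X in X ++ _](_ : _ = Ta) ?[X in _ ++ X](_ : _ = [::]) ?cats0 //.
    elim: (Tb) hli => //= x r IH hr; rewrite hr ?mem_head //; apply: IH => y yr.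
    by apply: hr; rewrite inE yr orbT.
  elim: (Ta) hlo => //= x r IH hr; rewrite hr ?mem_head //= IH // => y yr.
  by apply: hr; rewrite inE yr orbT.
have iT : inns cl T = Tb.
  rewrite /inns pmap_cat.
  rewrite [X in _ ++ X](_ : _ = Tb) ?[X in X ++ _](_ : _ = [::]) //.
    elim: (Ta) hlo => //= x r IH hr; rewrite hr ?mem_head //; apply: IH => y yr.
    by apply: hr; rewrite inE yr orbT.
  elim: (Tb) hli => //= x r IH hr; rewrite hr ?mem_head //= IH // => y yr.
  by apply: hr; rewrite inE yr orbT.
exists T => s; apply/idP/idP => [/and3P[hs po pi]|pT]; last first.
  rewrite -(perm_all _ pT) aT /= -{1}oT -{1}iT.
  by rewrite /outs /inns !perm_pmap.
have us : uniq s.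
  apply: (uniq_join hs).
    by rewrite -(perm_uniq po) (t_uniq ta.2).
  by rewrite -(perm_uniq pi) (t_uniq tb.2).
have uT : uniq T.
  by apply: (uniq_join aT); rewrite ?oT ?iT ?(t_uniq ta.2) ?(t_uniq tb.2).
have cinj := cut_inj h q0.
have sub s1 s2 : all (fun x => cl x : bool) s1 ->
    outs cl s1 =i outs cl s2 -> inns cl s1 =i inns cl s2 -> {subset s1 <= s2}.
  move=> h1 ho hi x xs; have := allP h1 _ xs; case E: (cl x) => [[y|y]|] // _.
    have : y \in outs cl s1 by apply/mem_outs; exists x.
    by rewrite ho => /mem_outs[x' x's E']; rewrite (cinj x x') ?E.
  have : y \in inns cl s1 by apply/mem_inns; exists x.
  by rewrite hi => /mem_inns[x' x's E']; rewrite (cinj x x') ?E.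
have eo : outs cl T =i outs cl s by rewrite oT; apply: perm_mem.
have ei : inns cl T =i inns cl s by rewrite iT; apply: perm_mem.
apply: uniq_perm => // x; apply/idP/idP; apply: sub => // y; by rewrite ?eo ?ei.
Qed.
End JoinTrees.

Section Monomials.
Variable K : fieldType.
Local Notation gens := (@HSoo_generators K).

Inductive mono : forall c n (a : 'I_n -> colour) d, HSoo K c n a d -> Prop :=
| Mono_gen g : mono (gens g)
| Mono_act c n (a b : 'I_n -> colour) d (s : 'S_n) (x : HSoo K c n a d) :
    (forall i, b (s i) = a i) -> mono x -> mono (op_act b s x)
| Mono_comp c e p q n (a : 'I_p -> colour) (b : 'I_q -> colour)
    (z : 'I_n -> colour) d1 d2 d u v (x : HSoo K c p a d1) (y : HSoo K e q b d2) :
    grafting a e b z u v -> d = d1 + d2 ->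
    mono x -> mono y -> mono (op_comp z d u v x y)
| Mono_scale c n (a : 'I_n -> colour) d k (x : HSoo K c n a d) :
    k != 0 -> mono x -> mono (k *: x).

Lemma Phi_actE c n (a b : 'I_n -> colour) d (s : 'S_n) (x : HSoo K c n a d) t :
  (forall i, b (s i) = a i) ->
  fval (Phi (op_act b s x)) t = fval (Phi x) (map (rename s) t).
Proof.
move=> hb; have -> := mor_act (Phi_morphism K) x hb.
by rewrite /= tactE.
Qed.

Lemma Phi_compE c e p q n (a : 'I_p -> colour) (b : 'I_q -> colour)
    (z : 'I_n -> colour) d1 d2 d u v (x : HSoo K c p a d1) (y : HSoo K e q b d2) t :
  grafting a e b z u v -> d = d1 + d2 ->
  fval (Phi (op_comp z d u v x y)) t = wcomp (cut e u v) (fval (Phi x)) (fval (Phi y)) t.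
Proof.
move=> h hd; have -> := mor_comp (Phi_morphism K) x y h hd.
by rewrite /= tcompE.
Qed.

Lemma Phi_scaleE c n (a : 'I_n -> colour) d k (x : HSoo K c n a d) t :
  fval (Phi (k *: x)) t = k * fval (Phi x) t.
Proof. by rewrite (morZ (Phi_morphism K)) fvalZ. Qed.

(** The expansion of x consists of the single tree T. *)
Definition on_tree c n (a : 'I_n -> colour) d (x : HSoo K c n a d) T :=
  forall s, (fval (Phi x) s != 0) = perm_eq T s.

Lemma on_tree_tree c n (a : 'I_n -> colour) d (x : HSoo K c n a d) T :
  on_tree x T -> tree c a T /\ d = tdeg c a T.
Proof. by move=> hT; apply: (@fval_supp _ _ _ _ _ (Phi x)); rewrite hT. Qed.

Definition cor_word (g : HSoo_corollas) : seq (sym (cor_arity g)) :=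
  match g with HSoo_ell_gen m _ => ell_word m | HSoo_f_gen m n _ => f_word m n end.

Lemma on_tree_gen g : on_tree (gens g) (cor_word g).
Proof.
move=> s; rewrite Phi_gen; case: g s => [m h|m n h] s; exact: word_fun_neq0.
Qed.

Lemma on_tree_act c n (a b : 'I_n -> colour) d (s : 'S_n) (x : HSoo K c n a d) T :
  (forall i, b (s i) = a i) -> on_tree x T ->
  on_tree (op_act b s x) (map (rename s^-1) T).
Proof.
move=> hb hT t; rewrite Phi_actE // hT.
apply/idP/idP => pT.
  by have := perm_map (rename s^-1) pT; rewrite (mapK (renameK s)).
by have := perm_map (rename s) pT; rewrite (mapK (renameVK s)).
Qed.

Lemma on_tree_scale c n (a : 'I_n -> colour) d k (x : HSoo K c n a d) T :
  k != 0 -> on_tree (k *: x) T <-> on_tree x T.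
Proof.
move=> k0; split=> hT s; have := hT s;
by rewrite Phi_scaleE mulf_eq0 (negbTE k0).
Qed.

Lemma mono_tree c n (a : 'I_n -> colour) d (x : HSoo K c n a d) :
  mono x -> exists T, on_tree x T.
Proof.
elim=> {c n a d x}.
- by move=> g; exists (cor_word g); apply: on_tree_gen.
- by move=> c n a b d s x hb _ [T hT]; exists (map (rename s^-1) T); apply: on_tree_act.
- move=> c e p q n a b z d1 d2 d u v x y h hd _ [Tx hx] _ [Ty hy].
  have [T hT] := graft_trees h (on_tree_tree hx).1 (on_tree_tree hy).1.
  by exists T => s; rewrite Phi_compE // wcomp_neq0 -hT hx hy.
- by move=> c n a d k x k0 _ [T hT]; exists T; apply/on_tree_scale.
Qed.

Lemma on_tree_neq0 c n (a : 'I_n -> colour) d (x : HSoo K c n a d) s :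
  mono x -> fval (Phi x) s != 0 -> on_tree x s.
Proof.
move=> /mono_tree [T hT]; rewrite hT => pT t.
by rewrite hT; apply/idP/idP; apply: perm_trans; rewrite // perm_sym.
Qed.

Lemma on_tree_comp c e p q n (a : 'I_p -> colour) (b : 'I_q -> colour)
    (z : 'I_n -> colour) d1 d2 d u v (x : HSoo K c p a d1) (y : HSoo K e q b d2) T :
  grafting a e b z u v -> d = d1 + d2 -> mono x -> mono y ->
  on_tree (op_comp z d u v x y) T ->
  [/\ all (fun x => cut e u v x : bool) T, on_tree x (outs (cut e u v) T)
    & on_tree y (inns (cut e u v) T)].
Proof.
move=> h hd mx my /(_ T); rewrite perm_refl Phi_compE // wcomp_neq0.
by case/and3P=> hs hx hy; split=> //; apply: on_tree_neq0.
Qed.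

Lemma mono_nontrivial c n (a : 'I_n -> colour) d (x : HSoo K c n a d) T :
  mono x -> on_tree x T -> T != [::].
Proof.
move=> mx; elim: mx T => {c n a d x}.
- move=> g T /(_ (cor_word g)); rewrite on_tree_gen perm_refl => /esym pT.
  apply/eqP => e; move: pT; rewrite e => /perm_size {T e}.
  by case: g => [m h|m n h] //=; rewrite size_map size_enum_ord; case: m h.
- move=> c n a b d s x hb mx IH T; have [T' hT'] := mono_tree mx.
  have := on_tree_act hb hT' => h1 /(_ (map (rename s^-1) T')).
  rewrite h1 perm_refl => /esym/perm_size; rewrite size_map => e.
  by have := IH _ hT'; rewrite -!size_eq0 e.
- move=> c e p q n a b z d1 d2 d u v x y h hd mx IHx my IHy T hT.
  have [hs hx hy] := on_tree_comp h hd mx my hT.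
  rewrite -size_eq0 (size_outs_inns hs); have := IHx _ hx.
  by rewrite -size_eq0; case: (size (outs _ _)).
- move=> c n a d k x k0 mx IH T /on_tree_scale hT; exact: IH (hT k0).
Qed.

Lemma nontrivial_tree c n (a : 'I_n -> colour) T : tree c a T -> T != [::] ->
  (~~ iswavy c -> n <> 1%N) /\ (iswavy c -> exists l, ~~ iswavy (a l)).
Proof.
case: T => [//|[S k] T] tT _; have inT := mem_head (S, k) T.
split=> [sc n1|wc]; last first.
  case: k {tT} (tT) inT => tT inT.
    by have [_ [l [_ sl _]]] := t_wav tT.2 inT; exists l.
  by have [/set0Pn[l lS] col _] := t_str tT.2 inT; exists l; apply: col.
case: k {tT} (tT) inT => tT inT.
  by have [wc] := t_wav tT.2 inT; rewrite wc in sc.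
have [/set0Pn[l lS] _] := t_str tT.2 inT; rewrite (negbTE sc) /= => /eqP; case.
by apply/setP => l'; rewrite inE (ord_eq_all l' l n1).
Qed.

(** If both factors have symbols, neither is an identity, so that the edge of
    the cut is an internal one. *)
Lemma cut_symbol c e p q n (a : 'I_p -> colour) (b : 'I_q -> colour)
    (z : 'I_n -> colour) u v T :
  grafting a e b z u v ->
  tree c a (outs (cut e u v) T) -> tree e b (inns (cut e u v) T) ->
  outs (cut e u v) T != [::] -> inns (cut e u v) T != [::] ->
  (img v, iswavy e) \in T /\ removable (img v, iswavy e).
Proof.
move=> h ta tb na nb; have q0 := t_pos tb.1; have A0 := img_neq0 v q0.
have [i0 ui0] := grafting_slotP h; have ei0 := slot_colour h ui0.
have [a1 a2] := nontrivial_tree ta na; have [b1 b2] := nontrivial_tree tb nb.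
case we: (iswavy e) a1 a2 b1 b2 => a1 a2 b1 b2.
  have [//|j sj] := b2; split.
    have := t_root tb.1 we sj; case/inns_source => S [Ss _ /within_sub SA].
    by rewrite -(inner_img v) => /eqP; rewrite (inner_eq (subxx _) SA) => /eqP ->.
  rewrite /removable /=; apply/eqP => AT.
  have onlyslot i : i = i0.
    case E: (u i) => [l|]; last exact: (grafting_slot_uniq h E ui0).
    by have := grafting_notin h E; rewrite AT inE.
  case wc: (iswavy c).
    have [i si] := a2 wc; by rewrite (onlyslot i) ei0 we in si.
  by have := t_col ta.1 (negbT wc) i0; rewrite ei0 we.
split.
  have := t_leaf ta.1 (l := i0); rewrite ei0 we => /(_ erefl).
  have nt : iswavy c \/ p <> 1%N.
    by case wc: (iswavy c); [left|right; apply: a1; rewrite wc].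
  move=> /(_ nt) /outs_source [S [Ss _ _ sS]]; rewrite -(outer_img h ui0) => /eqP.
  by rewrite (outer_eq h (satA _) sS A0) => /eqP ->.
rewrite /removable /= card_imset ?cardsT ?card_ord; last exact: grafting_injv h.
by apply/eqP; apply: b1.
Qed.

Definition colour_of (k : bool) := if k then wavy else straight.

Lemma iswavy_colour_of k : iswavy (colour_of k) = k. Proof. by case: k. Qed.
Lemma colour_of_iswavy e : colour_of (iswavy e) = e. Proof. by case: e. Qed.

Definition factors c n (z : 'I_n -> colour) d (x : HSoo K c n z d) (s : sym n) : Prop :=
  exists p q (a : 'I_p -> colour) (b : 'I_q -> colour) u v d1 d2
    (y : HSoo K c p a d1) (t : HSoo K (colour_of s.2) q b d2) k,
  [/\ k != 0, grafting a (colour_of s.2) b z u v, d = d1 + d2, img v = s.1 &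
  [/\ mono y, mono t & x = k *: op_comp z d u v y t]].

Lemma factorsI c e p q n (a : 'I_p -> colour) (b : 'I_q -> colour)
    (z : 'I_n -> colour) d1 d2 d u v (y : HSoo K c p a d1) (t : HSoo K e q b d2) k s :
  k != 0 -> grafting a e b z u v -> d = d1 + d2 -> img v = s.1 -> iswavy e = s.2 ->
  mono y -> mono t -> factors (k *: op_comp z d u v y t) s.
Proof.
move=> k0 h hd hB hw my mt.
have ee : e = colour_of s.2 by rewrite -hw colour_of_iswavy.
by subst e; exists p, q, a, b, u, v, d1, d2, y, t, k; split.
Qed.

(** Every internal edge of a monomial comes from one of its compositions; the
    associativity axioms bring that composition to the outside. The induction
    follows the position of the edge: in the inner factor, in the outer factor
    below the other composition, or in the outer factor beside it. *)
Lemma mono_factors c n (z : 'I_n -> colour) d (x : HSoo K c n z d) T s :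
  mono x -> on_tree x T -> s \in T -> removable s -> factors x s.
Proof.
move=> mx; elim: mx T s => {c n z d x}.
- move=> g T s /(_ (cor_word g)); rewrite on_tree_gen perm_refl => /esym pT.
  rewrite (perm_mem pT); case: g {pT T} s => [m h|m n h] s.
    by move/mem_ell_word => [l ->]; rewrite /removable /= cards1.
  by move/mem_f_word => [->|[l ->]]; rewrite /removable /= ?cards1 ?eqxx.
- move=> c n a b d r x hb mx IH T s hT sT rs.
  have [T' hT'] := mono_tree mx.
  have : rename r s \in T'.
    have := on_tree_act hb hT' => h1; have := h1 (map (rename r^-1) T').
    rewrite hT perm_refl => pT; move: sT; rewrite (perm_mem pT) => /mapP[y yT ->].
    by rewrite renameVK.
  move/(IH _ _ hT'); rewrite removable_rename => /(_ rs).
  case=> p [q [a' [b' [u [v [d1 [d2 [y [t [k [k0 h hd hv [my mt ->]]]]]]]]]]]].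
  exists p, q, a', b', (omap r \o u), (r \o v), d1, d2, y, t, k; split=> //.
  + exact: grafting_rename h hb.
  + apply/setP => l.
    have -> : (l \in s.1) = ((r^-1)%g l \in img v) by rewrite hv inE permKV.
    by apply/imgP/imgP => -[j] /= ej; exists j; [rewrite -ej permK | rewrite /= ej permKV].
  + by split=> //; rewrite op_actZ (op_act_comp _ _ h hd hb).
- move=> c g p q n a b z d1 d2 d u v y t h hd my IHy mt IHt T s hT sT rs.
  have [hs hy ht] := on_tree_comp h hd my mt hT.
  have [ty dy] := on_tree_tree hy; have [tt dt] := on_tree_tree ht.
  have q0 := t_pos tt.1; have A0 := img_neq0 v q0.
  have [i0 ui0] := grafting_slotP h.
  have direct : img v = s.1 -> iswavy g = s.2 -> factors (op_comp z d u v y t) s.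
    by move=> e1 e2; rewrite -[op_comp _ _ _ _ _ _]scale1r; apply: factorsI; rewrite ?oner_eq0.
  case: s sT rs direct => B k sT rs direct.
  case: (word_cases hs sT) => [[nw sB Po]|[wB Pi]]; last first.
    have BA := within_sub wB.
    have [eB|rB] : (k /\ B = img v) \/ removable (v @^-1: B, k).
      move: rs; rewrite /removable /=; case: (k) => rs.
        case: (boolP (v @^-1: B == setT)) => [|nT]; last by right.
        by rewrite -(inner_img v) inner_eq // => /eqP ->; left.
      right; rewrite -(card_imset (v @^-1: B) (grafting_injv h)).
      rewrite (_ : v @: _ = B) //; apply/setP => l; apply/imsetP/idP => [[j]|lB].
        by rewrite inE => jB ->.
      by have /imgP[j vj] := subsetP BA _ lB; exists j; rewrite // inE vj.
      apply: direct => //=; first by rewrite eB.2.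
      case: eB wB => -> -> ; by rewrite /within subxx eqxx orbF.
    (* the edge is one of the inner factor *)
    have := IHt _ _ ht Pi rB.
    case=> q1 [r [b1 [b2 [u3 [v3 [e1 [e2 [t1 [t2 [k' [k'0 h3 hd3 hv3 [m1 m2 ->]]]]]]]]]]]].
    have [m [w [u1 [v1 [u2 [v2 [h1 h2 k1 k2 k3]]]]]]] := grafting_seq_right h3 h.
    rewrite op_compZr -(op_comp_sequential _ _ _ h1 h2 h3 h (erefl (d1 + e1)) hd3 _ k1 k2 k3); last first.
      by rewrite hd hd3 addrA.
    apply: factorsI => //.
    + by rewrite hd hd3 addrA.
    + rewrite /=; apply/setP => l; apply/imgP/idP => [[j]|lB].
        by rewrite k3 => <-; have := mem_img v3 j; rewrite hv3 inE.
      have /imgP[j vj] := subsetP BA _ lB; have : j \in img v3 by rewrite hv3 inE vj.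
      by case/imgP => i vi; exists i; rewrite k3 /= vi.
    + exact: iswavy_colour_of.
    + exact: Mono_comp.
  have [eB|rB] : (~~ k /\ B = img v) \/ removable (outer_set u (img v) B, k).
    move: rs; rewrite /removable /=; case: (k) => rs.
      by right; rewrite -(outer_setT u v) (outer_eq h) // satT.
    case: (boolP (#|outer_set u (img v) B| == 1%N)) => [/cards1P[i eB]|]; last by right.
    left; split=> //; apply/eqP; rewrite -(outer_eq h sB (satA _) A0) eB.
    case E: (u i) => [l|]; last by rewrite (outer_img h E).
    move/eqP: eB; rewrite -(outer_set1 h E q0) (outer_eq h) //; last first.
      by apply: sat_set1; apply: (grafting_notin h E).
    by move/eqP => eB; rewrite eB cards1 in rs.
    apply: direct => /=; first by rewrite eB.2.
    case: eB nw => /negbTE -> ->; rewrite /within subxx eqxx orbF /=.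
    by case: iswavy.
  have := IHy _ _ hy Po rB.
  case=> p1 [q1 [a1 [b1 [u1 [v1 [e1 [e2 [y1 [y2 [k' [k'0 h1 hd1 hv1 [m1 m2 ->]]]]]]]]]]]].
  have {}hv1 : img v1 = outer_set u (img v) B := hv1.
  rewrite op_compZl.
  have [[j uj]|nslot] := pselect (exists j, u (v1 j) = None).
    (* t is grafted above the edge *)
    have [m' [w' [u3 [v3 [u4 [v4 [h3 h4 [k1 k2 k3 imv4]]]]]]]] := grafting_seq_left h1 h uj.
    have AB : img v \subset B.
      have : v1 j \in outer_set u (img v) B by rewrite -hv1 mem_img.
      by rewrite in_outer uj.
    rewrite (op_comp_sequential _ _ _ h1 h h3 h4 hd1 (erefl (e2 + d2)) _ k1 k2 k3); last first.
      by rewrite hd hd1.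
    apply: factorsI => //.
    + by rewrite hd hd1 addrA.
    + rewrite /= imv4; apply/setP => l; rewrite inE; apply/orP/idP => [[/(subsetP AB)//|/existsP[j' /eqP uj']]|lB].
        have : v1 j' \in outer_set u (img v) B by rewrite -hv1 mem_img.
        by rewrite in_outer uj'.
      case: (boolP (l \in img v)) => lA; [by left|right].
      have [i ui] := grafting_outP h lA; have : i \in img v1 by rewrite hv1 in_outer ui.
      by case/imgP=> j' vj'; apply/existsP; exists j'; rewrite vj' ui.
    + exact: iswavy_colour_of.
    + exact: Mono_comp.
  (* t is grafted beside or below the edge *)
  have [i2 [w2 [ui2 uw2]]] : exists i2 w2, u1 i2 = Some w2 /\ u w2 = None.
    case: (grafting_cover h1 i0) => [[i ui]|/imgP[j vj]]; first by exists i, i0.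
    by case: nslot; exists j; rewrite vj.
  have [m' [w' [u3 [v3 [u4 [v4 [h3 h4 k0 [k1 k2 k3]]]]]]]] := grafting_parallel h1 h ui2 uw2.
  rewrite (op_comp_parallel _ _ _ h1 h h3 h4 hd1 (erefl (e1 + d2)) _ k0 k1 k2 k3); last first.
    by rewrite hd hd1.
  rewrite scalerA; apply: factorsI => //.
  + by rewrite mulf_neq0 // signz_odd signr_eq0.
  + by rewrite hd hd1 addrAC.
  + rewrite /=; apply/setP => l; apply/imgP/idP => [[j ej]|lB].
      have : v1 j \in outer_set u (img v) B by rewrite -hv1 mem_img.
      by rewrite in_outer (k2 j : u (v1 j) = Some (v4 j)) ej.
    have lA : l \notin img v.
      apply/negP => lA; have : i0 \in outer_set u (img v) B.
        rewrite in_outer ui0; case/orP: sB => // dB.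
        by have := disjointFr dB lA; rewrite lB.
      by rewrite -hv1 => /imgP[j vj]; apply: nslot; exists j; rewrite vj.
    have [i ui] := grafting_outP h lA; have : i \in img v1 by rewrite hv1 in_outer ui.
    case/imgP=> j vj; exists j; have := k2 j; rewrite /= vj ui => -[->] //.
  + exact: iswavy_colour_of.
  + exact: Mono_comp.
- move=> c n a d k x k0 mx IH T s /on_tree_scale hT sT rs.
  have := IH _ _ (hT k0) sT rs.
  case=> p [q [a' [b' [u [v [d1 [d2 [y [t [k' [k'0 h hd hv [my mt ->]]]]]]]]]]]].
  exists p, q, a', b', u, v, d1, d2, y, t, (k * k'); split=> //.
    by rewrite mulf_neq0.
  by split=> //; rewrite scalerA.
Qed.
End Monomials.

(** * The free operad embeds into tree functions *)

(** Colour-preserving permutations are products of transpositions of inputs of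
    the same colour. *)
Lemma corolla_symmetric_perm (K : fieldType) (P : operad K) c n
    (a : 'I_n -> colour) d (x : P c n a d) (t : 'S_n) :
  corolla_symmetric x -> (forall i, a (t i) = a i) ->
  exists2 k, k != 0 & op_act a t x = k *: x.
Proof.
move=> hx; have [m] := ubnP #|[set i | t i != i]|.
elim: m t => // m IH t ltm ht.
have [/existsP[i ti]|/existsPn tid] := boolP [exists i, t i != i]; last first.
  exists 1; rewrite ?oner_eq0 // scale1r -[RHS]op_act1; congr op_act.
  by apply/permP => i; rewrite perm1; apply/eqP; rewrite -[_ == _]negbK tid.
pose r := tperm i (t i); pose t' := (t * r)%g.
have hr j : a (r j) = a j by rewrite /r; case: tpermP => // ->; rewrite ht.
have ht' j : a (t' j) = a j by rewrite /t' permM hr ht.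
have tE : t = (t' * r)%g by rewrite /t' -mulgA /r tperm2 mulg1.
have [|k k0 hk] := IH t' _ ht'.
  rewrite -ltnS; apply: leq_trans ltm; rewrite ltnS; apply: proper_card.
  apply/properP; split; last first.
    by exists i; rewrite inE // /t' permM /r tpermR eqxx.
  apply/subsetP => j; rewrite !inE; apply: contra => /eqP tj.
  rewrite /t' permM tj /r tpermD //.
    by apply: contraNneq ti => ->; rewrite tj.
  by apply: contraNneq ti => e; apply/eqP/(@perm_inj _ t); rewrite e tj.
exists (if a i is straight then - k else k).
  by case: (a i); rewrite ?oppr_eq0.
rewrite tE -(op_actM (b := a)) // hk op_actZ hx; first last.
- by rewrite ht.
- by move/eqP; rewrite eq_sym (negbTE ti).
by case: (a i); rewrite // scalerN scaleNr.
Qed.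

(** Proof irrelevance replaces decidability of equality, which index types such
    as 'I_n -> colour lack. *)
Lemma inj_existT (U : Type) (Q : U -> Type) p (x y : Q p) :
  existT Q p x = existT Q p y -> x = y.
Proof.
move=> e; have := projT2_eq e.
by rewrite (Prop_irrelevance (projT1_eq e) erefl).
Qed.

Section Injectivity.
Variable K : fieldType.
Local Notation gens := (@HSoo_generators K).
Local Notation P := (HSoo K).

Inductive basic : forall c n (a : 'I_n -> colour) d, P c n a d -> Prop :=
| Basic g (b : 'I_(cor_arity g) -> colour) (s : 'S_(cor_arity g)) k :
    (forall i, b (s i) = cor_in i) -> basic (k *: op_act b s (gens g)).

(** A composite of two monomials would have an internal edge, by cut_symbol. *)
Lemma mono_basic c n (a : 'I_n -> colour) d (x : P c n a d) :
  mono x -> (forall T, on_tree x T -> forall s, s \in T -> ~~ removable s) -> basic x.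
Proof.
elim=> {c n a d x}.
- move=> g _; rewrite -[gens g]scale1r -[gens g]op_act1.
  by apply: Basic => i; rewrite perm1.
- move=> c n a b d r x hb mx IH hT.
  have [T' hT'] := mono_tree mx.
  have {}IH : basic x.
    apply: IH => T hxT s sT; rewrite -(removable_rename r^-1).
    by apply: (hT _ (on_tree_act hb hxT)); apply: map_f.
  case: IH b r hb {T' hT' hT} => g b s k hs b' r hb.
  rewrite op_actZ (op_actM _ hs hb); apply: Basic => i.
  by rewrite permM hb hs.
- move=> c e p q n a b z d1 d2 d u v x y h hd mx _ my _ hT.
  have [T hxy] := mono_tree (Mono_comp h hd mx my).
  have [hs hx hy] := on_tree_comp h hd mx my hxy.
  have [inT rT] := cut_symbol h (on_tree_tree hx).1 (on_tree_tree hy).1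
    (mono_nontrivial mx hx) (mono_nontrivial my hy).
  by have := hT _ hxy _ inT; rewrite rT.
- move=> c n a d k x k0 mx IH hT.
  have : basic x by apply: IH => T hxT; apply: hT; apply/on_tree_scale.
  case=> g b s k' hs; rewrite scalerA; exact: Basic.
Qed.

(** An element together with its colours, arity and degree: elements of
    different components can be compared after packing. *)
Definition pack c n (a : 'I_n -> colour) d (x : P c n a d) :=
  existT (fun c => {n : nat & {a : 'I_n -> colour & {d : int & P c n a d}}}) c
    (existT (fun n => {a : 'I_n -> colour & {d : int & P c n a d}}) n
      (existT (fun a => {d : int & P c n a d}) a
        (existT (fun d => P c n a d : Type) d x))).

Lemma basic_pack c n (a : 'I_n -> colour) d (x : P c n a d) : basic x ->
  exists (g : HSoo_gen) (b : 'I_(@cor_arity HSoo_corollas g) -> colour)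
    (s : 'S_(@cor_arity HSoo_corollas g)) (k : K),
    [/\ forall i, b (s i) = @cor_in HSoo_corollas g i, c = @cor_out HSoo_corollas g,
      n = @cor_arity HSoo_corollas g, nstr a = nstr (@cor_in HSoo_corollas g)
      & pack x = pack (k *: op_act b s (gens g))].
Proof.
case=> g b s k hs; exists g, b, s, k; split=> //.
exact: nstr_perm hs.
Qed.

Lemma gen_inj (g g' : HSoo_gen) :
  @cor_out HSoo_corollas g = @cor_out HSoo_corollas g' ->
  @cor_arity HSoo_corollas g = @cor_arity HSoo_corollas g' ->
  nstr (@cor_in HSoo_corollas g) = nstr (@cor_in HSoo_corollas g') -> g = g'.
Proof.
case: g g' => [m h|m n h] [m' h'|m' n' h'] //= _.
  by move=> e _; subst m'; rewrite (bool_irrelevance h h').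
rewrite !nstr_f => + e; subst m' => /addnI e'; subst n'.
by rewrite (bool_irrelevance h h').
Qed.

(** The generator is determined by its output, its arity and its number of
    straight inputs, and its renamings differ by colour-preserving
    permutations. *)
Lemma basic_unique c n (a : 'I_n -> colour) d (x x' : P c n a d) :
  basic x -> basic x' -> x != 0 -> exists k, x' = k *: x.
Proof.
move=> hx; case: hx x' => g b s k hs x' hx'.
have [g' [b' [s' [k' [hs' ec en ea e]]]]] := basic_pack hx'.
have eg : g = g'.
  by apply: gen_inj => //; rewrite -ea (nstr_perm hs).
subst g'.
have e1 := inj_existT (inj_existT e).
have eb : b = b' by have := congr1 (@projT1 _ _) e1.
subst b'; have {e1}ex := inj_existT (inj_existT e1).
rewrite ex scaler_eq0 negb_or => /andP[k0 _].
pose t := (s' * s^-1)%g.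
have ht i : @cor_in HSoo_corollas g (t i) = @cor_in HSoo_corollas g i.
  by rewrite -hs /t permM permKV hs'.
have [k1 k10 hk1] := @corolla_symmetric_perm K P _ _ _ _ (gens g) t
  (@pres_gen_symmetric K HSoo_corollas _ g) ht.
exists (k' * k1 / k).
have -> : op_act b s' (gens g) = k1 *: op_act b s (gens g).
  rewrite -op_actZ -hk1 (op_actM _ ht hs); congr op_act.
  by rewrite /t mulgKV.
by rewrite !scalerA divfK // mulrC.
Qed.

Lemma on_tree_nonzero c n (a : 'I_n -> colour) d (x : P c n a d) T : on_tree x T -> x != 0.
Proof.
move=> hT; apply/eqP => x0; have := hT T.
by rewrite perm_refl x0 (mor0 (Phi_morphism K)) eqxx.
Qed.

(** Either both monomials are corollas, or both can be cut at the same internal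
    edge, and induction applies to the factors. *)
Lemma mono_unique m c n (a : 'I_n -> colour) d (x x' : P c n a d) T :
  (size T < m)%N -> mono x -> mono x' -> on_tree x T -> on_tree x' T ->
  exists k, x' = k *: x.
Proof.
elim: m c n a d x x' T => // m IH c n z d x x' T ltm mx mx' hx hx'.
have [/hasP[s sT rs]|/hasPn nr] := boolP (has (@removable n) T); last first.
  have base (y : P c n z d) : mono y -> on_tree y T -> basic y.
    move=> my hy; apply: mono_basic my _ => T' hT' s sT'; apply: nr.
    by have := hT' T; rewrite hy perm_refl => /esym/perm_mem <-.
  by apply: basic_unique; rewrite ?(on_tree_nonzero hx) //; apply: base.
have := mono_factors mx hx sT rs.
case=> p [q [a [b [u [v [d1 [d2 [y [t [k [k0 h hd hv [my mt ex]]]]]]]]]]]].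
have := mono_factors mx' hx' sT rs.
case=> p' [q' [a' [b' [u' [v' [d1' [d2' [y' [t' [k' [k'0 h' hd' hv' [my' mt' ex']]]]]]]]]]]].
have eimg : img v = img v' by rewrite hv.
have [ep eq_] := grafting_unique h h' eimg; subst p' q'.
have [r [r' [eu ev hr hr']]] := grafting_unique_perm h h' eimg.
have {}ex' : x' = k' *: op_comp z d u v (op_act a r y') (op_act b r' t').
  rewrite ex' (op_comp_actr _ _ h hd' hr').
  by rewrite (op_comp_actl _ _ (grafting_actr h hr') hd' hr) eu ev.
have hx1 : on_tree (op_comp z d u v y t) T by apply/(on_tree_scale _ _ k0); rewrite -ex.
have hx1' : on_tree (op_comp z d u v (op_act a r y') (op_act b r' t')) T.
  by apply/(on_tree_scale _ _ k'0); rewrite -ex'.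
have mz : mono (op_act a r y') by apply: Mono_act.
have mw : mono (op_act b r' t') by apply: Mono_act.
have [hs oy ot] := on_tree_comp h hd my mt hx1.
have [_ oy' ot'] := on_tree_comp h hd' mz mw hx1'.
have e1 : d1 = d1' by rewrite (on_tree_tree oy).2 (on_tree_tree oy').2.
have e2 : d2 = d2' by rewrite (on_tree_tree ot).2 (on_tree_tree ot').2.
subst d1' d2'.
have sz := size_outs_inns hs.
have ny : (0 < size (outs (cut (colour_of s.2) u v) T))%N.
  by rewrite lt0n size_eq0; apply: mono_nontrivial oy.
have nt : (0 < size (inns (cut (colour_of s.2) u v) T))%N.
  by rewrite lt0n size_eq0; apply: mono_nontrivial ot.
have [|ky ey] := IH _ _ _ _ _ _ _ _ my mz oy oy'.
  by rewrite -ltnS (leq_trans _ ltm) // ltnS sz -addn1 leq_add2l.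
have [|kt et] := IH _ _ _ _ _ _ _ _ mt mw ot ot'.
  by rewrite -ltnS (leq_trans _ ltm) // ltnS sz -add1n leq_add2r.
exists (k' * (kt * ky) / k).
by rewrite ex' ey et op_compZr op_compZl ex !scalerA divfK // mulrA.
Qed.

Inductive unital : forall c n (a : 'I_n -> colour) d, P c n a d -> Prop :=
| Unital c k : k != 0 -> unital (k *: op_id P c).

(** Monomials and multiples of identities; the latter are the elements that
    expand to the empty tree. *)
Definition good c n (a : 'I_n -> colour) d (x : P c n a d) := mono x \/ unital x.

Lemma on_tree_unital c n (a : 'I_n -> colour) d (x : P c n a d) :
  unital x -> on_tree x [::].
Proof.
case=> {a d x n}{}c k k0; apply/on_tree_scale => // s.
rewrite (mor_id (Phi_morphism K)) /= idw_neq0.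
by case: s => // y s; apply/esym/negP => /perm_size.
Qed.

Lemma unital_pack c n (a : 'I_n -> colour) d (x : P c n a d) :
  unital x -> exists c' (k' : K), pack x = pack (k' *: op_id P c').
Proof. by case=> c' k' _; exists c', k'. Qed.

Lemma good_tree c n (a : 'I_n -> colour) d (x : P c n a d) :
  good x -> exists T, on_tree x T.
Proof. by case=> [/mono_tree//|/on_tree_unital h]; exists [::]. Qed.

Lemma good_unique c n (a : 'I_n -> colour) d (x x' : P c n a d) T :
  good x -> good x' -> on_tree x T -> on_tree x' T -> exists k, x' = k *: x.
Proof.
have nil (y : P c n a d) : unital y -> on_tree y T -> T = [::].
  move=> /on_tree_unital h1 /(_ T); rewrite h1 perm_refl.
  by case: T => // w T /perm_size.
case=> [mx|ux] [mx'|ux'] hx hx'.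
- exact: mono_unique (ltnSn _) mx mx' hx hx'.
- by have := mono_nontrivial mx hx; rewrite (nil _ ux' hx').
- by have := mono_nontrivial mx' hx'; rewrite (nil _ ux hx).
case: ux x' ux' {hx hx' nil} => c0 k k0 x' ux'.
have [c' [k' e]] := unital_pack ux'.
have ec : c0 = c' by have := congr1 (@projT1 _ _) e.
subst c'; have {}e := inj_existT (inj_existT (inj_existT (inj_existT e))).
by exists (k' / k); rewrite e scalerA divfK.
Qed.

Lemma good_act c n (a b : 'I_n -> colour) d (s : 'S_n) (x : P c n a d) :
  (forall i, b (s i) = a i) -> good x -> good (op_act b s x).
Proof.
move=> hb [mx|ux]; first by left; apply: Mono_act.
right; case: ux b s hb => {a d x n}{}c k k0 b s hb.
have s1 : s = 1%g by apply/permP => i; rewrite !ord1.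
subst s; have eb : b = fun=> c by apply: funext => i; rewrite -(hb i) perm1.
by subst b; rewrite op_act1; apply: Unital.
Qed.

Lemma good_scale c n (a : 'I_n -> colour) d k (x : P c n a d) :
  k != 0 -> good x -> good (k *: x).
Proof.
move=> k0 [mx|ux]; first by left; apply: Mono_scale.
right; case: ux => c' k' k'0; rewrite scalerA; apply: Unital.
by rewrite mulf_neq0.
Qed.

(** Composition with an identity is a renaming. *)
Lemma good_comp c e p q n (a : 'I_p -> colour) (b : 'I_q -> colour)
    (z : 'I_n -> colour) d1 d2 d u v (x : P c p a d1) (y : P e q b d2) :
  grafting a e b z u v -> d = d1 + d2 -> good x -> good y ->
  good (op_comp z d u v x y).
Proof.
move=> h hd gx gy; case: (gx) => [mx|ux]; last first.
  case: ux u h hd {gx} => {a d1 x p}{}c k k0 u h hd.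
  rewrite op_compZl; apply: good_scale => //.
  have ce : c = e by have [i ui] := grafting_slotP h; rewrite -(grafting_slot_colour h ui).
  subst e; rewrite add0r in hd; subst d2.
  have [i0 ui0] := grafting_slotP h.
  have uN i : u i = None by rewrite (ord1 i) -(ord1 i0).
  have covers l : l \in img v by case: (grafting_cover h l) => // -[i]; rewrite uN.
  have eq_ : q = n.
    apply: (inj_same_image (grafting_injv h) (@inj_id 'I_n)) => l.
    by split=> _; [exists l|apply/imgP].
  subst n; have [s hs] : exists s : 'S_q, v =1 id \o s.
    by apply: (inj_same_image_perm (@inj_id _) (grafting_injv h)) => l _; exists l.
  have ev : v = s by apply: funext => j; rewrite hs.
  have eu : u = fun=> None by apply: funext.
  have hz j : z (s j) = b j by rewrite (grafting_inner_colour h) ev.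
  by rewrite eu ev (op_comp_idl _ hz); apply: good_act.
case: (gy) => [my|uy]; first by left; apply: Mono_comp.
case: uy v h hd {gy} => {b d2 y q}{}e k k0 v h hd.
rewrite op_compZr; apply: good_scale => //.
rewrite addr0 in hd; subst d1.
have fi : injective (fun i => odflt (v ord0) (u i)).
  move=> i i'; case E: (u i) => [l|]; case E': (u i') => [l'|] /=.
  - by move=> el; rewrite -el in E'; apply: (grafting_inju h E E').
  - by move=> el; have := grafting_disj h (i := i) (j := ord0); rewrite E el.
  - by move=> el; have := grafting_disj h (i := i') (j := ord0); rewrite E' -el.
  - by move=> _; apply: (grafting_slot_uniq h E E').
have eq_ : p = n.
  apply: (inj_same_image fi (@inj_id 'I_n)) => l; split=> _; first by exists l.
  case: (grafting_cover h l) => [[i ui]|/imgP[j <-]]; first by exists i; rewrite ui.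
  by have [i ui] := grafting_slotP h; exists i; rewrite ui (ord1 j).
subst n; have [s hs] : exists s : 'S_p, (fun i => odflt (v ord0) (u i)) =1 id \o s.
  by apply: (inj_same_image_perm (@inj_id _) fi) => l _; exists l.
rewrite (op_comp_idr _ h hs); apply: good_act => //.
exact: grafting_idr h hs.
Qed.

(** A chosen element of the free operad for every tree. *)
Definition basis c n (a : 'I_n -> colour) d (T : {set sym n}) : P c n a d :=
  if pselect (exists x : P c n a d, good x /\ on_tree x (enum T)) is left h
  then sval (cid h) else 0.

Lemma basis_spec c n (a : 'I_n -> colour) d (T : {set sym n}) :
  basis c a d T = 0 \/ good (basis c a d T) /\ on_tree (basis c a d T) (enum T).
Proof.
rewrite /basis; case: pselect => h; last by left.
by right; case: cid.
Qed.

Lemma good_basis c n (a : 'I_n -> colour) d (x : P c n a d) : good x ->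
  exists T k, x = k *: basis c a d T.
Proof.
move=> gx; have [s hs] := good_tree gx; exists [set y in s].
have us : uniq s by apply: t_uniq (on_tree_tree hs).1.2.
have ps : perm_eq s (enum [set y in s]).
  by apply: uniq_perm => // [|y]; rewrite ?enum_uniq ?mem_enum ?inE.
have hT : on_tree x (enum [set y in s]).
  by move=> t; rewrite hs; apply/idP/idP; apply: perm_trans; rewrite // perm_sym.
rewrite /basis; case: pselect => [h|[]]; last by exists x.
by case: cid => y [gy hy] /=; apply: good_unique gy gx hy hT.
Qed.

Definition spanned c n (a : 'I_n -> colour) d (x : P c n a d) :=
  exists k : {set sym n} -> K, x = \sum_T k T *: basis c a d T.

Lemma spanned_lin c n (a : 'I_n -> colour) d k (x y : P c n a d) :
  spanned x -> spanned y -> spanned (k *: x + y).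
Proof.
move=> [f ->] [g ->]; exists (fun T => k * f T + g T).
rewrite scaler_sumr -big_split /=; apply: eq_bigr => T _.
by rewrite scalerDl scalerA.
Qed.

Lemma spanned0 c n (a : 'I_n -> colour) d : spanned (0 : P c n a d).
Proof. by exists (fun=> 0); rewrite big1 // => T _; rewrite scale0r. Qed.

Lemma spanned_scale c n (a : 'I_n -> colour) d k (x : P c n a d) :
  spanned x -> spanned (k *: x).
Proof. by move=> hx; rewrite -[_ *: x]addr0; apply: spanned_lin => //; apply: spanned0. Qed.

Lemma spanned_sum c n (a : 'I_n -> colour) d (I : finType) (F : I -> P c n a d) :
  (forall i, spanned (F i)) -> spanned (\sum_i F i).
Proof.
move=> h; elim/big_ind: _ => //; first exact: spanned0.
by move=> x y hx hy; rewrite -[x]scale1r; apply: spanned_lin.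
Qed.

Lemma good_spanned c n (a : 'I_n -> colour) d (x : P c n a d) : good x -> spanned x.
Proof.
case/good_basis => T [k ->]; exists (fun T' => if T' == T then k else 0).
rewrite (bigD1 T) //= eqxx big1 ?addr0 // => T' /negbTE ->.
by rewrite scale0r.
Qed.

Lemma spannedP c n (a : 'I_n -> colour) d (x : P c n a d) : spanned x.
Proof.
apply: (presented_ind (R := @no_relations K HSoo_corollas) (prop := @spanned)) => {c n a d x}.
- by move=> g; apply: good_spanned; left; apply: Mono_gen.
- move=> c; apply: good_spanned; right.
  rewrite -[op_id P c]scale1r; apply: Unital; exact: oner_neq0.
- move=> c n a b d s _ hb [k ->].
  have -> : op_act b s (\sum_T k T *: basis c a d T) = \sum_T k T *: op_act b s (basis c a d T) :> P c n b d.
    by elim/big_rec2: _ => [|T y y' _ <-]; [exact: op_act0|rewrite op_act_linear].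
  apply: spanned_sum => T; apply: spanned_scale.
  case: (basis_spec c a d T) => [->|[gT _]]; first by rewrite op_act0; apply: spanned0.
  exact/good_spanned/good_act.
- move=> c e p q n a b z d1 d2 d u v _ _ h hd [k ->] [k' ->].
  have -> Y : op_comp z d u v (\sum_T k T *: basis c a d1 T) Y
    = \sum_T k T *: op_comp z d u v (basis c a d1 T) Y :> P c n z d.
    by elim/big_rec2: _ => [|T w w' _ <-]; [exact: op_comp0l|rewrite op_comp_linearl].
  apply: spanned_sum => T; apply: spanned_scale.
  have -> X : op_comp z d u v X (\sum_T k' T *: basis e b d2 T)
    = \sum_T k' T *: op_comp z d u v X (basis e b d2 T) :> P c n z d.
    by elim/big_rec2: _ => [|T' w w' _ <-]; [exact: op_comp0r|rewrite op_comp_linearr].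
  apply: spanned_sum => T'; apply: spanned_scale.
  case: (basis_spec c a d1 T) => [->|[g1 _]]; first by rewrite op_comp0l; apply: spanned0.
  case: (basis_spec e b d2 T') => [->|[g2 _]]; first by rewrite op_comp0r; apply: spanned0.
  exact/good_spanned/good_comp.
- by move=> c n a d; apply: spanned0.
- by move=> c n a d k x y hx hy; apply: spanned_lin.
Qed.

(** The basis elements expand to different trees. *)
Lemma Phi_injective c n (a : 'I_n -> colour) d (x : P c n a d) : Phi x = 0 -> x = 0.
Proof.
case: (spannedP x) => k -> e0; apply: big1 => T0 _.
have h T : T != T0 -> fval (Phi (basis c a d T)) (enum T0) = 0.
  case: (basis_spec c a d T) => [->|[_ hT]]; first by rewrite (mor0 (Phi_morphism K)).
  apply: contraNeq; rewrite hT => /perm_mem e; apply/eqP/setP => y.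
  by have := e y; rewrite !mem_enum.
have : fval (Phi (\sum_T k T *: basis c a d T)) (enum T0) = 0 by rewrite e0.
rewrite (mor_sum (Phi_morphism K)) fval_sum (bigD1 T0) //= big1 ?addr0; last first.
  by move=> T nT; rewrite Phi_scaleE h // mulr0.
rewrite Phi_scaleE => /eqP; rewrite mulf_eq0 => /orP[/eqP ->|]; first by rewrite scale0r.
case: (basis_spec c a d T0) => [->|[_ hT]]; first by rewrite scaler0.
by move=> /negPn; rewrite hT perm_refl.
Qed.

Lemma Phi_inj c n (a : 'I_n -> colour) d (x y : P c n a d) : Phi x = Phi y -> x = y.
Proof.
move=> e; apply/eqP; rewrite -subr_eq0; apply/eqP/Phi_injective.
by rewrite (morD (Phi_morphism K)) (morN (Phi_morphism K)) e subrr.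
Qed.

End Injectivity.

(** * Every tree function comes from the free operad *)

(** Every internal edge of a tree separates two trees. The mandatory symbols
    that nested_cut asks for are present because the edge itself becomes an
    input edge of the outer tree or the root vertex of the inner one. *)
Lemma tree_cut c n (z : 'I_n -> colour) (T : seq (sym n)) (B : {set 'I_n}) (k : bool) :
  tree c z T -> (B, k) \in T -> removable (B, k) -> exists p q (a : 'I_p -> colour) (b : 'I_q -> colour) u v,
  [/\ grafting a (colour_of k) b z u v,
      all (fun x => cut (colour_of k) u v x : bool) T,
      tree c a (outs (cut (colour_of k) u v) T) /\ tree (colour_of k) b (inns (cut (colour_of k) u v) T)
    & outs (cut (colour_of k) u v) T != [::] /\ inns (cut (colour_of k) u v) T != [::]].
Proof.
move=> tT BT rB.
have [p [u [i0 [ui0 uslot uinj uB [idx hidx]]]]] := outer_labels B.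
have [q [v [injv imv]]] := inner_labels B.
pose a i := if u i is Some l then z l else colour_of k.
pose b j := z (v j).
have h : grafting a (colour_of k) b z u v.
  apply: (grafting_intro (i0 := i0)) => //.
  - by rewrite /a ui0.
  - move=> i ni; case E: (u i) => [l|]; first by exists l; rewrite // /a E.
    by case: ni; apply: uslot.
  - by move=> i j /uB; rewrite -imv mem_img.
  - move=> l; case lB: (l \in img v); first by right; apply/imgP.
    by left; exists (idx l); rewrite hidx // -imv lB.
have B0 : B != set0 := tree_sym_neq0 tT BT.
have q0 : (0 < q)%N.
  by case/set0Pn: B0 => l; rewrite -imv => /imgP[j _]; apply: leq_ltn_trans (ltn_ord j).
have hall : all (fun x => cut (colour_of k) u v x : bool) T.
  apply/allP => x xT; apply: (present_compat u tT) => //.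
  by apply: Or31; rewrite imv iswavy_colour_of.
have wck : iswavy (colour_of k) = k := iswavy_colour_of k.
have kc : k -> iswavy c.
  by move: BT; case: (k) => // BT' _; have [] := t_wav tT.2 BT'.
have strB : k = false -> forall l, l \in B -> ~~ iswavy (z l).
  by move=> k0; rewrite k0 in BT; have [] := t_str tT.2 BT.
have existsB : exists2 l, l \in B & ~~ iswavy (z l).
  case ek: k; last first.
    by case/set0Pn: B0 => l lB; exists l => //; apply: strB.
  by rewrite ek in BT; have [_ [l [lB sl _]]] := t_wav tT.2 BT; exists l.
have [l0 l0B sl0] := existsB.
have outer S k' : (S, k') \in T -> ~~ within k B S -> sat B S ->
    (outer_set u B S, k') \in outs (cut (colour_of k) u v) T.
  move=> ST nw sS; apply/mem_outs; exists (S, k') => //.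
  rewrite cut_inl /= ?imv ?wck //; exact: (tree_sym_neq0 tT ST).
have inner S k' : (S, k') \in T -> within k B S ->
    (v @^-1: S, k') \in inns (cut (colour_of k) u v) T.
  move=> ST wS; apply/mem_inns; exists (S, k') => //.
  rewrite cut_inr /= ?imv ?wck //; exact: (tree_sym_neq0 tT ST).
have nBB : k = false -> ~~ within k B B by move=> ->; rewrite /within subxx eqxx.
have outB : outer_set u B B = [set i0] by rewrite -{1 2}imv; apply: outer_img h _ ui0.
have outT : outer_set u B setT = setT by rewrite -imv; apply: outer_setT.
have nwT : ~~ within k B setT.
  rewrite /within subTset; apply/negP => /andP[/eqP BT' ]; rewrite BT' eqxx orbF => kt.
  by move: rB; rewrite /removable BT' /= kt eqxx.
have rootT : iswavy c -> (setT, true) \in T by move=> wc; apply: (t_root tT.1 wc sl0).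
have ma : mandatory c a (outs (cut (colour_of k) u v) T).
  split.
  - exact: leq_ltn_trans (ltn_ord i0).
  - move=> sc i; rewrite /a; case: (u i) => [l|]; first exact: (t_col tT.1).
    by rewrite wck; apply: contra sc.
  - move=> wc wa; have ek : k by rewrite -wck; have := wa i0; rewrite /a ui0.
    rewrite ek in BT rB; have [_ [l [_ sl hl]]] := t_wav tT.2 (rootT wc).
    have lB : l \notin B by apply: (hl _ BT); rewrite properEneq subsetT andbT.
    by have := wa (idx l); rewrite /a hidx // (negbTE sl).
  - move=> i; rewrite /a; case E: (u i) => [l|]; last first.
      rewrite wck => /negbTE ek _; rewrite (uslot _ E) -outB.
      rewrite ek in BT; apply: outer => //; [exact: nBB|exact: sat_sub].
    move=> sl _; have lB := uB _ _ E.
    have nt : iswavy c \/ n <> 1%N.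
      by right=> n1; rewrite (ord_eq_all l l0 n1) l0B in lB.
    have := t_leaf tT.1 sl nt => /outer; rewrite -imv (outer_set1 h E q0) imv; apply.
      by rewrite /within sub1set (negbTE lB).
    by rewrite -imv; apply: sat_set1; rewrite imv.
  - move=> i wc _; rewrite -outT; apply: outer => //; first exact: rootT.
    exact/sat_sub/subsetT.
have cardB : #|B| = q by rewrite -imv card_imset ?cardsT ?card_ord.
have qk : ~~ k -> q <> 1%N.
  by move=> nk q1; move: rB; rewrite /removable /= (negbTE nk) cardB q1.
have qn : (q <= n)%N by rewrite -cardB -[X in (_ <= X)%N](card_ord n) max_card.
have mb : mandatory (colour_of k) b (inns (cut (colour_of k) u v) T).
  split=> //.
  - by rewrite wck => nk j; apply: strB; [exact: negbTE|rewrite -imv mem_img].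
  - move=> _ wb; move: l0B; rewrite -imv => /imgP[j vj].
    by have := wb j; rewrite /b vj (negbTE sl0).
  - move=> j sj; rewrite wck => nt.
    have nt' : iswavy c \/ n <> 1%N.
      case ek: k nt kc => [] nt kc'; first by left; apply: kc'.
      by right=> n1; case: nt => // q1; apply: q1; lia.
    have := t_leaf tT.1 sj nt'; move/inner.
    rewrite (_ : v @^-1: _ = [set j]); last first.
      by apply/setP => j'; rewrite !inE (inj_eq injv).
    apply; rewrite /within sub1set -imv mem_img /= imv.
    case ek: k nt => //= -[//|q1]; apply/eqP => eB; apply: q1.
    by rewrite -cardB -eB cards1.
  - move=> j; rewrite wck => ek sj; rewrite ek in BT.
    have <- : v @^-1: B = setT by rewrite -imv inner_img.
    by apply: (inner _ _ BT); rewrite /within subxx ek.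
exists p, q, a, b, u, v; split=> //.
  have [na nb] := nested_cut h ma mb tT.2.
  by split; split.
have nnil (X : eqType) (x : X) (s : seq X) : x \in s -> s != [::] by case: s.
have [ek|ek] : k = true \/ k = false by case: (k); auto.
  have h1 := outer _ _ (rootT (kc ek)) nwT (sat_sub (subsetT B)).
  have wB : within k B B by rewrite /within subxx ek.
  have h2 := inner _ _ BT wB.
  by split; [exact: nnil h1|exact: nnil h2].
have h1 := outer _ _ BT (nBB ek) (sat_sub (subxx B)).
move: l0B; rewrite -imv => /imgP[j vj].
have h2 : ([set j], false) \in inns (cut (colour_of k) u v) T.
  by apply: (t_leaf mb); [rewrite /b vj|right; apply: qk; rewrite ek].
by split; [exact: nnil h1|exact: nnil h2].
Qed.

Lemma colouring_perm n (a b : 'I_n -> colour) : nstr a = nstr b ->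
  exists s : 'S_n, forall i, a (s i) = b i.
Proof.
move=> e.
pose ta := [tuple iswavy (a i) | i < n]; pose tb := [tuple iswavy (b i) | i < n].
have cnt (f : 'I_n -> colour) : count_mem false [tuple iswavy (f i) | i < n] = nstr f.
  rewrite /nstr cardE size_filter /= count_map -enumT.
  by apply: eq_count => i; rewrite /= inE; case: (f i).
have cntT (f : 'I_n -> colour) : (count_mem true [tuple iswavy (f i) | i < n] + nstr f)%N = n.
  rewrite -cnt -[RHS](size_tuple [tuple iswavy (f i) | i < n]).
  rewrite -(count_predC (pred1 true)); congr (_ + _)%N.
  by apply: eq_count => -[].
have : perm_eq tb ta.
  apply/allP => x _ /=; case: x; last by rewrite !cnt e.
  by rewrite -(eqn_add2r (nstr b)) (cntT b) -e (cntT a).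
case/tuple_permP => s /= es; exists s => i.
have : tnth tb i = tnth ta (s i).
  have /val_inj -> : val tb = val [tuple tnth ta (s i) | i < n] by [].
  by rewrite tnth_mktuple.
by rewrite !tnth_mktuple; case: (a _); case: (b _).
Qed.

Section Surjectivity.
Variable K : fieldType.
Local Notation gens := (@HSoo_generators K).
Local Notation P := (HSoo K).

Lemma good_on_tree c n (a : 'I_n -> colour) d (x : P c n a d) s :
  good x -> fval (Phi x) s != 0 -> on_tree x s.
Proof.
move=> /good_tree [T hT]; rewrite hT => pT t.
by rewrite hT; apply/idP/idP; apply: perm_trans; rewrite // perm_sym.
Qed.

Lemma on_tree_perm c n (a : 'I_n -> colour) d (x : P c n a d) s t :
  perm_eq s t -> on_tree x s -> on_tree x t.
Proof.
move=> pst hs r; rewrite hs; apply/idP/idP; apply: perm_trans => //.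
by rewrite perm_sym.
Qed.

(** A tree without internal edges is an identity or a corolla. *)
Lemma rigid_tree c n (a : 'I_n -> colour) T : tree c a T ->
  (forall x, x \in T -> ~~ removable x) ->
  exists d (x : P c n a d), good x /\ on_tree x T.
Proof.
move=> tT nr.
have id1 e : c = e -> n = 1%N -> a = (fun=> e) -> T = [::] ->
    exists d (x : P c n a d), good x /\ on_tree x T.
  move=> ce n1; subst; move=> ea et; subst; exists 0, (op_id P e).
  have ux : unital (op_id P e).
    by rewrite -[op_id P e]scale1r; apply: Unital; apply: oner_neq0.
  by split; [right|apply: on_tree_unital].
have nilT : (forall x, x \notin T) -> T = [::].
  by case: (T) => // x s /(_ x); rewrite mem_head.
have memF S : (S, false) \in T -> exists2 l, S = [set l] & ~~ iswavy (a l).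
  move=> ST; have := nr _ ST; rewrite /removable /= negbK => /cards1P[l eS].
  by exists l => //; have [_ col _] := t_str tT.2 ST; apply: col; rewrite eS inE.
have memT S : (S, true) \in T -> S = setT.
  by move=> ST; have := nr _ ST; rewrite /removable /= negbK => /eqP.
case wc: (iswavy c); last first.
  have ec : c = straight by move: wc; case: (c).
  have ea : a = fun=> straight.
    apply: funext => l; have := t_col tT.1 (negbT wc) l; by case: (a l).
  case: (n =P 1%N) => n1.
    apply: (id1 straight) => //; apply: nilT => -[S [] ]; apply/negP => ST.
      by have [] := t_wav tT.2 ST; rewrite wc.
    have [l eS _] := memF _ ST; have [_ _] := t_str tT.2 ST; rewrite wc eS /= => /eqP[].
    by apply/setP => l'; rewrite !inE (ord_eq_all l' l n1) eqxx.
  have n2 : (2 <= n)%N by have := t_pos tT.1; lia.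
  subst c a; exists _, (gens (HSoo_ell_gen n2)); split; first by left; exact: (Mono_gen K (HSoo_ell_gen n2)).
  refine (@on_tree_perm straight n _ _ (gens (HSoo_ell_gen n2)) (ell_word n) T _ (@on_tree_gen K (HSoo_ell_gen n2))).
  apply: uniq_perm; [exact: ell_word_uniq|exact: t_uniq tT.2|].
  move=> [S k]; apply/mem_ell_word/idP => [[l [-> ->]]|ST].
    by apply: (t_leaf tT.1) => //; right.
  case: k ST => ST; first by have [] := t_wav tT.2 ST.
  by have [l -> _] := memF _ ST; exists l.
have ec : c = wavy by move: wc; case: (c).
have [allw|[l0 sl0]] : (forall l, iswavy (a l)) \/ exists l, ~~ iswavy (a l).
  have [/existsP|/existsPn w] := boolP [exists l, ~~ iswavy (a l)]; first by right.
  by left=> l; apply: negbNE.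
  apply: (id1 wavy) => //; first exact: t_triv tT.1 wc allw.
    by apply: funext => l; have := allw l; case: (a l).
  apply: nilT => -[S []]; apply/negP => ST.
    by have [_ [l [_ sl _]]] := t_wav tT.2 ST; rewrite allw in sl.
  by have [l _] := memF _ ST; rewrite allw.
have [m [n' [en em]]] : exists m n', n = (m + n')%N /\ nstr a = m.
  exists (nstr a), (n - nstr a)%N; split=> //.
  by rewrite subnKC // /nstr -[X in (_ <= X)%N](card_ord n) max_card.
have m1 : (1 <= m)%N by rewrite -em /nstr card_gt0; apply/set0Pn; exists l0; rewrite inE.
subst c n; have [s hs] : exists s : 'S_(m + n'), forall i, a (s i) = @straight_wavy m n' i.
  by apply: colouring_perm; rewrite em nstr_f.
exists _, (op_act a s (gens (HSoo_f_gen n' m1))); split.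
  by left; apply: Mono_act => //; exact: (Mono_gen K (HSoo_f_gen n' m1)).
have h0 := @on_tree_act K wavy (m + n') (@straight_wavy m n') a _ s
  (gens (HSoo_f_gen n' m1)) (f_word m n') hs (@on_tree_gen K (HSoo_f_gen n' m1)).
apply: on_tree_perm h0.
apply: uniq_perm; first by rewrite map_inj_uniq; [exact: f_word_uniq|exact: rename_inj].
  exact: t_uniq tT.2.
move=> [S k]; apply/mapP/idP => [[x /mem_f_word[->|[i ->]] ->]|ST].
- by rewrite /rename /= preimsetT; apply: (t_root tT.1 wc sl0).
- rewrite -[lshift n' i](permKV s^-1) rename_leaf invgK.
  by apply: (t_leaf tT.1); [rewrite hs straight_wavyl|left].
case: k ST => ST; last first.
  have [l eS sl] := memF _ ST; exists (leaf (s^-1 l)%g); last first.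
    by rewrite rename_leaf eS.
  have : ~~ iswavy (@straight_wavy m n' (s^-1 l)%g) by rewrite -hs permKV.
  by case/straight_wavyP => i ei; apply/mem_f_word; right; exists i; rewrite ei.
exists (setT, true); first by apply/mem_f_word; left.
by rewrite /rename /= preimsetT (memT _ ST).
Qed.

Lemma tree_realized m c n (a : 'I_n -> colour) T : (size T < m)%N -> tree c a T ->
  exists d (x : P c n a d), good x /\ on_tree x T.
Proof.
elim: m c n a T => // m IH c n z T ltm tT.
have [/hasP[[B k] BT rB]|/hasPn nr] := boolP (has (@removable n) T); last first.
  exact: rigid_tree.
have [p [q [a [b [u [v [h hall [ta tb] [na nb]]]]]]]] := tree_cut tT BT rB.
rewrite -!size_eq0 -!lt0n in na nb.
have sz := size_outs_inns hall.
have [|d1 [x [gx hx]]] := IH _ _ _ _ _ ta.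
  by rewrite -ltnS (leq_trans _ ltm) // ltnS sz -addn1 leq_add2l.
have [|d2 [y [gy hy]]] := IH _ _ _ _ _ tb.
  by rewrite -ltnS (leq_trans _ ltm) // ltnS sz -add1n leq_add2r.
exists (d1 + d2), (op_comp z (d1 + d2) u v x y); split; first exact: good_comp.
apply: good_on_tree; first exact: good_comp.
by rewrite Phi_compE // wcomp_neq0 hall hx hy !perm_refl.
Qed.

Lemma basis_tree c n (a : 'I_n -> colour) (T : {set sym n}) :
  tree c a (enum T) -> on_tree (basis K c a (tdeg c a (enum T)) T) (enum T).
Proof.
move=> tT; have [d [x [gx hx]]] := tree_realized (ltnSn _) tT.
have ed := (on_tree_tree hx).2; subst d.
rewrite /basis; case: pselect => [h|[]]; last by exists x.
by case: cid => y [].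
Qed.

(** Since basis elements expand to single trees, the coefficients can be read
    off from the values of y. *)
Lemma Phi_surjective c n (a : 'I_n -> colour) d (y : treeop K c n a d) :
  exists x : P c n a d, Phi x = y.
Proof.
exists (\sum_(T : {set sym n})
  (fval y (enum T) / fval (Phi (basis K c a d T)) (enum T)) *: basis K c a d T).
set x := \sum_T _; apply/eqP; rewrite eq_sym -subr_eq0; apply/eqP.
have [e|[s hs]] := tfun_eq0 (y - Phi x : tfun K c a d).
  by apply: fval_inj => t; rewrite e.
have [ts ds] := fval_supp hs; exfalso.
pose T0 := [set w in s].
have ps : perm_eq s (enum T0).
  apply: uniq_perm; rewrite ?enum_uniq ?(t_uniq ts.2) // => w.
  by rewrite mem_enum inE.
move: hs; rewrite (fval_perm_neq0 _ ps).
have tT0 := tree_perm ps ts.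
have dT0 : d = tdeg c a (enum T0) by rewrite ds /tdeg (perm_size ps).
have hT0 : on_tree (basis K c a d T0) (enum T0) by rewrite dT0; apply: basis_tree.
rewrite fvalD fvalN /x (mor_sum (Phi_morphism K)) fval_sum (bigD1 T0) //= big1 ?addr0.
  by rewrite Phi_scaleE divfK ?subrr ?eqxx // hT0 perm_refl.
move=> T nT; rewrite Phi_scaleE.
have [->|] := eqVneq (fval (Phi (basis K c a d T)) (enum T0)) 0; first by rewrite mulr0.
case: (basis_spec K c a d T) => [->|[_ hT]].
  by rewrite (mor0 (Phi_morphism K)) eqxx.
rewrite hT => /perm_mem e; case/negP: nT; apply/eqP/setP => w.
by have := e w; rewrite !mem_enum.
Qed.
End Surjectivity.

(** * Acyclicity below degree zero *)

Section Apex.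
Variables (c : colour) (n : nat) (a : 'I_n -> colour) (l0 : 'I_n).

(** The symbols to be kept by the contracting homotopy: the wavy vertices if
    the output is wavy, and otherwise the internal edges between the input l0
    and the root. *)
Definition special (y : sym n) : bool :=
  if iswavy c then y.2 else [&& ~~ y.2, l0 \in y.1 & #|y.1| != 1%N].

(** Here setT stands for the root, which every tree has. *)
Definition vertices (s : seq (sym n)) : {set {set 'I_n}} :=
  setT |: [set S | ((S, iswavy c) \in s) && special (S, iswavy c)].

Definition counted (l : 'I_n) : bool :=
  if iswavy c then ~~ iswavy (a l) else l != l0.

(** The labels that reach the special vertex S without passing through a
    smaller one. If the output is straight, then l0 belongs to all vertices and
    is left out. *)
Definition cell (W : {set {set 'I_n}}) (S : {set 'I_n}) : {set 'I_n} :=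
  [set l in S | counted l && [forall S' in W, (S' \proper S) ==> (l \notin S')]].

(** A straight edge above which lies one cell with at least two labels. It is
    determined by the special symbols; when it exists, the trees with given
    special symbols form a cone, which is contracted by adding this edge. *)
Definition apex (W : {set {set 'I_n}}) : option (sym n) :=
  if [pick S in W | (1 < #|cell W S|)%N] is Some U then Some (cell W U, false)
  else None.

Lemma in_vertices s S : (S \in vertices s)
  = (S == setT) || ((S, iswavy c) \in s) && special (S, iswavy c).
Proof. by rewrite !inE. Qed.

Lemma apexP W e : apex W = Some e ->
  exists S, [/\ S \in W, (1 < #|cell W S|)%N & e = (cell W S, false)].
Proof.
rewrite /apex; case: pickP => // S /andP[SW hS] [<-].
by exists S.
Qed.

Lemma cell_l0 W S : ~~ iswavy c -> l0 \notin cell W S.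
Proof. by move=> sc; rewrite inE /counted (negbTE sc) eqxx andbF. Qed.

Lemma apex_special W e : apex W = Some e -> special e = false.
Proof.
case/apexP => S [_ _ ->]; rewrite /special /=; case wc: (iswavy c) => //.
by rewrite (negbTE (cell_l0 _ _ _)) ?wc.
Qed.

Lemma apex_removable W e : apex W = Some e -> removable e.
Proof. by case/apexP => S [_ h ->]; rewrite /removable /= neq_ltn h orbT. Qed.

Lemma vertices_perm s t : perm_eq s t -> vertices s = vertices t.
Proof.
by move=> ps; rewrite /vertices; congr (_ |: _); apply/setP => S; rewrite !inE (perm_mem ps).
Qed.

Lemma vertices_drop s1 y s2 : special y = false ->
  vertices (s1 ++ y :: s2) = vertices (s1 ++ s2).
Proof.
move=> ny; rewrite /vertices; congr (_ |: _); apply/setP => S; rewrite !inE.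
rewrite !mem_cat inE; case: eqP => [e|_]; last by [].
by rewrite e ny !andbF.
Qed.

Lemma vertices_cons y s : special y = false -> vertices (y :: s) = vertices s.
Proof. exact: (vertices_drop [::]). Qed.

Lemma cell_sub W S : cell W S \subset S.
Proof. by apply/subsetP => l; rewrite inE => /andP[]. Qed.

Lemma cell_proper (W : {set {set 'I_n}}) (S S' : {set 'I_n}) : S' \in W -> S' \proper S -> [disjoint cell W S & S'].
Proof.
move=> SW pS; apply/pred0P => l /=; rewrite inE; apply/negP => /andP[/and3P[_ _ /forallP/(_ S')]].
by rewrite SW pS /= => /negbTE ->.
Qed.

(** A straight edge of the tree that meets the cell either lies inside the cell
    or contains the whole special vertex, so that the apex can be added. *)
Lemma tree_apex s e : tree c a s -> apex (vertices s) = Some e -> e \notin s ->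
  tree c a (e :: s).
Proof.
move=> [ms ns] /apexP[S [SW hU ->]] nes; set W := vertices s in SW hU nes *.
set U := cell W S in hU nes *.
have US : U \subset S := cell_sub W S.
have U0 : U != set0 by rewrite -card_gt0; apply: ltnW.
have Ucol l : l \in U -> ~~ iswavy (a l).
  rewrite inE /counted => /andP[_ /andP[]]; case wc: (iswavy c) => // _ _.
  by apply: (t_col ms); rewrite wc.
have inW S' : S' \in W -> iswavy c -> (S', true) \in s.
  move=> SW' wc; case/set0Pn: U0 => l lU; move: SW'; rewrite in_vertices wc => /orP[/eqP ->|/andP[]//].
  exact: (t_root ms wc (Ucol _ lU)).
have inWs S' : S' \in W -> ~~ iswavy c -> S' = setT \/ (S', false) \in s.
  move=> SW' sc; move: SW'; rewrite in_vertices (negbTE sc) => /orP[/eqP ->|/andP[]]; first by left.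
  by right.
have l0W S' : S' \in W -> ~~ iswavy c -> l0 \in S'.
  by move=> SW' sc; move: SW'; rewrite in_vertices /special (negbTE sc) /= => /orP[/eqP ->|/and3P[]]; rewrite ?inE.
(* A straight cluster inside S meets a smaller special cluster only by lying
   in it. *)
have inside (S' : {set 'I_n}) : S' \subset S -> (forall l, l \in S' -> counted l) ->
    (forall S'' : {set 'I_n}, S'' \in W -> S'' \proper S -> [disjoint S' & S''] \/ S' \subset S'') ->
    [disjoint U & S'] \/ S' \subset U.
  move=> SS cS hS'.
  have [/existsP[S'' /and3P[W'' p'' n'']]|/existsPn none] :=
      boolP [exists S'', [&& S'' \in W, S'' \proper S & ~~ [disjoint S' & S'']]].
    left; case: (hS' _ W'' p'') => [d|sub]; first by rewrite d in n''.
    by apply: (disjointWr sub); apply: cell_proper.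
  right; apply/subsetP => l lS; rewrite inE (subsetP SS) // cS //=.
  apply/forallP => S''; apply/implyP => W''; apply/implyP => p''.
  have := none S''; rewrite W'' p'' /= negbK => d.
  by rewrite (disjointFr d lS).
have lamU (S' : {set 'I_n}) : (S', false) \in s -> [\/ [disjoint U & S'], U \subset S' | S' \subset U].
  move=> S's; have [_ col _] := t_str ns S's.
  case wc: (iswavy c).
    case: (t_mix ns S's (inW _ SW wc)) => [d|SS].
      by apply: Or31; rewrite disjoint_sym; exact: (disjointWr US d).
    case: (inside S' SS) => [l lS|S'' W'' p''|?|?]; [|exact: (t_mix ns S's (inW _ W'' wc))|by apply: Or31|by apply: Or33].
    by rewrite /counted wc; apply: col.
  have sc : ~~ iswavy c by rewrite wc.
  have lS0 := l0W _ SW sc.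
  case: (boolP (l0 \in S')) => l0S'.
    have [/cards1P[l e1]|n1] := boolP (#|S'| == 1%N).
      apply: Or31; move: l0S'; rewrite e1 inE => /eqP <-.
      by rewrite disjoint_sym disjoints1 cell_l0.
    have W' : S' \in W by rewrite in_vertices wc S's /special wc /= l0S' n1 orbT.
    have nest : S' \subset S \/ S \subset S'.
      case: (inWs _ SW sc) => [->|Ss]; first by left; apply: subsetT.
      case: (t_lam ns Ss S's) => [d|?|?]; [|by right|by left].
      by have := disjointFr d lS0; rewrite l0S'.
    case: nest => [SS|SS]; last by apply: Or32; exact: (subset_trans US SS).
    have [eS|nS] := eqVneq S' S; first by apply: Or32; rewrite eS.
    by apply: Or31; apply: cell_proper => //; rewrite properEneq nS.
  have [SS|d] : S' \subset S \/ [disjoint S' & S].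
    case: (inWs _ SW sc) => [->|Ss]; first by left; apply: subsetT.
    case: (t_lam ns S's Ss) => [?|?|sub]; [by right|by left|].
    by have := subsetP sub _ lS0; rewrite (negbTE l0S').
    case: (inside S' SS) => [l lS|S'' W'' p''|?|?]; [| |by apply: Or31|by apply: Or33].
      by rewrite /counted wc; apply: contraNneq l0S' => <-.
    have S''s : (S'', false) \in s.
      case: (inWs _ W'' sc) => // eT; move: p''; rewrite eT properE.
      by rewrite subsetT andbF.
    case: (t_lam ns S's S''s) => [?|?|sub]; [by left|by right|].
    by have := subsetP sub _ (l0W _ W'' sc); rewrite (negbTE l0S').
  by apply: Or31; rewrite disjoint_sym; exact: (disjointWr US d).
split.
  by apply: (mandatory_sub ms) => y ys _; rewrite inE ys orbT.
split.
- by rewrite /= nes (t_uniq ns).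
- move=> S'; rewrite inE => /orP[/eqP[->]|]; last exact: (t_str ns).
  split=> //; case wc: (iswavy c) => //=; apply: contraT => /negPn /eqP eT.
  by have := @cell_l0 W S; rewrite -/U eT inE wc => /(_ erefl).
- move=> S'; rewrite inE => /orP[/eqP[]//|S's].
  have [wc [l [lS sl hl]]] := t_wav ns S's; split=> //; exists l; split=> // S''.
  by rewrite inE => /orP[/eqP[]//|]; apply: hl.
- move=> S1 S2 k; rewrite !inE => /orP[/eqP[-> ->]|h1] /orP[/eqP e2|h2].
  + by case: e2 => ->; apply: Or32.
  + exact: lamU.
  + case: e2 h1 => -> -> h1.
    by case: (lamU _ h1) => [d|?|?]; [apply: Or31; rewrite disjoint_sym|apply: Or33|apply: Or32].
  + exact: (t_lam ns h1 h2).
- move=> S1 S2; rewrite !inE => /orP[/eqP[->]|h1] /orP[/eqP[]//|h2]; last exact: (t_mix ns h1 h2).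
  have [wc _] := t_wav ns h2.
  have W2 : S2 \in W by rewrite in_vertices wc h2 /special wc /= orbT.
  case: (t_lam ns (inW _ SW wc) h2) => [d|SS|SS].
  + by left; exact: (disjointWl US d).
  + by right; exact: (subset_trans US SS).
  have [->|nS] := eqVneq S2 S; first by right.
  by left; apply: cell_proper => //; rewrite properEneq nS.
Qed.

(** Otherwise every cell has at most one label, hence there are at least as
    many special vertices as labels to be distributed, and the tree has
    nonnegative degree. *)
Lemma apex_exists s : tree c a s -> (tdeg c a s < 0)%R -> apex (vertices s) != None.
Proof.
move=> [ms ns] ltd; apply/negP => /eqP eN; set W := vertices s in eN.
have small S : S \in W -> (#|cell W S| <= 1)%N.
  move=> SW; move: eN; rewrite /apex; case: pickP => // /(_ S).
  by rewrite SW /= ltnNge => /negbFE.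
pose C := [set l | counted l].
have TW : setT \in W by rewrite in_vertices eqxx.
have [f hf] : exists f : 'I_n -> {set 'I_n}, forall l, l \in C -> f l \in W /\ l \in cell W (f l).
  suff H l : exists S : {set 'I_n}, l \in C -> S \in W /\ l \in cell W S.
    by exists (fun l => sval (cid (H l))) => l lC; exact: (svalP (cid (H l)) lC).
  case: (boolP (l \in C)) => lC; last by exists setT.
  have p0 : (setT \in W) && (l \in [set: 'I_n]) by rewrite TW inE.
  case: (@arg_minnP _ setT (fun S => (S \in W) && (l \in S)) (fun S : {set 'I_n} => #|S|) p0).
  move=> S /andP[SW lS] minS; exists S => _; split=> //.
  rewrite !inE lS; move: lC; rewrite inE => -> /=.
  apply/forallP => S'; apply/implyP => SW'; apply/implyP => pS.
  apply/negP => lS'; have := minS S'; rewrite SW' lS' => /(_ erefl).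
  by rewrite leqNgt proper_card.
have injf : {in C &, injective f}.
  move=> l l' lC lC' ef; have [fW lf] := hf _ lC; have [_ lf'] := hf _ lC'.
  rewrite -ef in lf'; have := small _ fW; rewrite leqNgt => /negP ns1.
  apply/eqP; apply: contraT => nl; case: ns1; apply/card_gt1P.
  by exists l, l'.
have leCW : (#|C| <= #|W|)%N.
  rewrite -(card_in_imset injf); apply: subset_leq_card.
  by apply/subsetP => S /imsetP[l lC ->]; have [] := hf _ lC.
pose Lv := [set ([set l], false) | l in [set l | ~~ iswavy (a l)]].
have cLv : #|Lv| = nstr a.
  by rewrite card_imset // => l l' [/set1_inj].
have szs : size s = #|[set y in s]|.
  rewrite cardsE; apply/esym/card_uniqP; exact: t_uniq ns.
case wc: (iswavy c).
  case: (posnP (nstr a)) => [m0|m0].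
    by move: ltd; rewrite /tdeg m0 wc; lia.
  have [l1] := card_gt0P m0; rewrite inE => sl1.
  pose V := [set (S, true) | S in W].
  have cV : #|V| = #|W| by rewrite card_imset // => S S' [].
  have sub : Lv :|: V \subset [set y in s].
    apply/subsetP => y; rewrite !inE => /orP[/imsetP[l]|/imsetP[S]].
      by rewrite inE => sl ->; apply: (t_leaf ms sl); left.
    by rewrite in_vertices wc => /orP[/eqP ->|/andP[Ss _]] -> //; apply: (t_root ms wc sl1).
  have := subset_leq_card sub; rewrite cardsU cLv cV -szs.
  have -> : Lv :&: V = set0.
    by apply/setP => y; rewrite !inE; apply/negP => /andP[/imsetP[l _ ->] /imsetP[S _ []]].
  rewrite cards0 subn0; have : #|C| = nstr a.
    by apply: eq_card => l; rewrite !inE /counted wc.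
  by move: ltd leCW; rewrite /tdeg wc /=; lia.
have na : nstr a = n.
  rewrite /nstr -[RHS](card_ord n) -cardsT; apply: eq_card => l; rewrite !inE.
  by apply: (t_col ms); rewrite wc.
case: (n =P 1%N) => [n1|n1].
  by move: ltd; rewrite /tdeg na wc /=; lia.
pose V := [set (S, false) | S in W :\ setT].
have cV : #|V| = (#|W|).-1.
  rewrite card_imset; last by move=> S S' [].
  by rewrite (cardsD1 setT W) TW add1n.
have sub : Lv :|: V \subset [set y in s].
  apply/subsetP => y; rewrite !inE => /orP[/imsetP[l]|/imsetP[S]].
    by rewrite inE => sl ->; apply: (t_leaf ms sl); right.
  by rewrite in_setD1 in_vertices wc => /andP[/negbTE -> /= /andP[Ss _]] ->.
have := subset_leq_card sub; rewrite cardsU cLv cV -szs.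
have -> : Lv :&: V = set0.
  apply/setP => y; rewrite !inE; apply/negP => /andP[/imsetP[l _ ->] /imsetP[S]].
  rewrite in_setD1 in_vertices => /andP[/negbTE -> /=]; rewrite /special wc /= => /and3P[_ _ n1'] [eS].
  by rewrite -eS cards1 in n1'.
have cC : #|C| = n.-1.
  rewrite -[in RHS](card_ord n) -cardsT (cardsD1 l0 setT) inE add1n /=.
  by apply: eq_card => l; rewrite !inE /counted wc andbT.
rewrite cards0 subn0 => h1; rewrite cC in leCW.
move: ltd h1 leCW (t_pos ms); rewrite /tdeg wc na /=.
move: (size s) (#|W|) => x y; lia.
Qed.
End Apex.

Section Homotopy.
Variables (K : fieldType) (c : colour) (n : nat) (a : 'I_n -> colour) (l0 : 'I_n).
Local Notation special := (special c l0).
Local Notation vertices := (vertices c l0).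
Local Notation apex := (apex c a l0).

(** The contraction of the cone: the coefficient of s is that of s with the
    apex added. *)
Definition htp_val (x : seq (sym n) -> K) (s : seq (sym n)) : K :=
  if apex (vertices s) is Some e then if e \in s then 0 else x (e :: s) else 0.

Lemma htp_alt x : alternating x -> alternating (htp_val x).
Proof.
move=> hx s1 y y' s2; rewrite /htp_val.
have pe : perm_eq (s1 ++ [:: y, y' & s2]) (s1 ++ [:: y', y & s2]).
  by rewrite perm_cat2l; apply/permPl; exact: (perm_catCA [:: y] [:: y'] s2).
rewrite (vertices_perm c l0 pe); case: apex => [e|]; last by rewrite oppr0.
rewrite (perm_mem pe); case: ifP => _; first by rewrite oppr0.
exact: (alternating_cons e hx).
Qed.

Variable d : int.

Lemma htp_supp (x : tfun K c a (d + 1)) s :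
  htp_val (fval x) s != 0 -> tree c a s /\ d = tdeg c a s.
Proof.
rewrite /htp_val; case E: (apex _) => [e|]; last by rewrite eqxx.
case: ifP => _; first by rewrite eqxx.
move=> /fval_supp [ht hd]; split; last by move: hd; rewrite /tdeg /=; lia.
exact: (tree_remove (s1 := [::]) (apex_removable E) ht).
Qed.

Definition htp (x : tfun K c a (d + 1)) : tfun K c a d :=
  TFun (htp_alt (fval_alt x)) (@htp_supp x).

(** The differential may also remove special symbols. Trees are therefore
    treated in the order of the number of their special symbols, as these terms
    vanish on the trees of a cocycle that have the fewest. *)
Definition layer_val j (x : seq (sym n) -> K) s : K :=
  if count special s == j then x s else 0.

Lemma layer_alt j x : alternating x -> alternating (layer_val j x).
Proof.
move=> hx s1 y y' s2; rewrite /layer_val !count_cat /= hx (addnCA (special y)).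
by case: ifP; rewrite ?oppr0.
Qed.

Lemma layer_supp j (x : tfun K c a (d + 1)) s :
  layer_val j (fval x) s != 0 -> tree c a s /\ d + 1 = tdeg c a s.
Proof. by rewrite /layer_val; case: ifP => _; [apply: fval_supp|rewrite eqxx]. Qed.

Definition layer j (x : tfun K c a (d + 1)) : tfun K c a (d + 1) :=
  TFun (layer_alt j (fval_alt x)) (@layer_supp j x).

(** On the lowest layer of a cocycle the terms that remove a special symbol
    vanish, and the remaining terms are those of the cone, which the homotopy
    contracts. *)
Lemma layer_exact j (x : tfun K c a (d + 1)) s : d + 1 < 0 -> tdiff x = 0 ->
  (forall s, (count special s < j)%N -> fval x s = 0) ->
  (count special s <= j)%N -> fval (x - tdiff (htp (layer j x))) s = 0.
Proof.
move=> d0 hx low les; apply/eqP; apply: contraT => nz.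
have [ts ds] := fval_supp nz; case/negP: (nz); rewrite fvalD fvalN.
rewrite -[fval (tdiff _) s]/(tdiff_val c a (htp_val (layer_val j (fval x))) s).
rewrite /tdiff_val asboolT //.
set y := htp_val _; have hlow t : (count special t < j)%N -> y t = 0.
  move=> lt; rewrite /y /htp_val; case E: (apex _) => [e|] //.
  by rewrite /layer_val /= (apex_special E) add0n ltn_eqF //; case: ifP.
have cnt s1 w s2 : count special (s1 ++ w :: s2) = (special w + count special (s1 ++ s2))%N.
  by rewrite !count_cat /=; lia.
have [lt|] := ltnP (count special s) j.
  rewrite low // add0r oppr_eq0; apply: contraT => /dsum_neq0 [s1 [w [s2 [es _]]]].
  by rewrite hlow ?eqxx //; move: lt; rewrite es cnt; case: (special w); lia.
move=> ges; have ej : count special s = j by apply/eqP; rewrite eqn_leq les ges.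
pose R' w := removable w && ~~ special w.
have -> : dsum (@removable n) y s = dsum R' y s.
  apply: eq_dsum => s1 w s2 es; rewrite /R'; case: ifP => //= _; case: ifP => //.
  move/negbFE => sw; apply: hlow; move: ej; rewrite es cnt sw; lia.
have : apex (vertices s) != None by apply: apex_exists; rewrite -?ds.
case E: (apex (vertices s)) => [e|] // _.
have se := apex_special E; have re := apex_removable E.
have same s1 w s2 : s = s1 ++ w :: s2 -> ~~ special w -> apex (vertices (s1 ++ s2)) = Some e.
  by move=> es /negbTE nw; rewrite -E es (vertices_drop _ _ nw).
have [es|nes] := boolP (e \in s); last first.
  have tes := tree_apex ts E nes.
  have : fval (tdiff x) (e :: s) = 0 by rewrite hx.
  rewrite -[fval _ _]/(tdiff_val c a (fval x) (e :: s)) /tdiff_val asboolT //= re.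
  move/eqP; rewrite subr_eq0 => /eqP ->; rewrite subr_eq0; apply/eqP.
  apply: eq_dsum => s1 w s2 es; rewrite /R'; case: ifP => //= _; case: ifP => [nw|/negbFE sw].
    rewrite /y /htp_val (same _ _ _ es nw).
    have -> : (e \in s1 ++ s2) = false.
      by apply: contraNF nes; rewrite es !mem_cat inE => /orP[->|->]; rewrite ?orbT.
    rewrite /layer_val /= se add0n; move: ej; rewrite es cnt (negbTE nw) add0n => ->.
    by rewrite eqxx.
  by apply: low; move: ej; rewrite /= se es cnt sw; lia.
case/splitPr: es nz ts ds les ges ej E same => s1 s2 _ ts ds _ _ ej E same.
have ps : perm_eq (s1 ++ e :: s2) (e :: s1 ++ s2).
  by apply/permPl; exact: (perm_catCA s1 [:: e] s2).
rewrite subr_eq0; apply/eqP.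
apply: (@alternating_eq K _ (fval x) (dsum R' y) _ (e :: s1 ++ s2)) => //.
- exact: fval_alt.
- by apply/dsum_alternating/htp_alt/layer_alt/fval_alt.
have ut : uniq (e :: s1 ++ s2) by rewrite -(perm_uniq ps); apply: t_uniq ts.2.
have Et : apex (vertices (s1 ++ s2)) = Some e by rewrite -E (vertices_drop _ _ se).
rewrite /= {1}/R' re se /= -[LHS]subr0; congr (_ - _).
  rewrite /y /htp_val Et; move: ut => /= /andP[/negbTE -> _].
  rewrite /layer_val /= se add0n; move: ej; rewrite cnt se add0n => ->.
  by rewrite eqxx.
apply/esym/eqP; apply: contraT => /dsum_neq0 [t1 [w [t2 [et /andP[_ nw]]]]].
rewrite /y /= /htp_val.
have -> : vertices (e :: t1 ++ t2) = vertices (s1 ++ s2).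
  by rewrite (vertices_cons _ se) et (vertices_drop _ _ (negbTE nw)).
by rewrite Et mem_head eqxx.
Qed.

(** The layers are removed one by one; they are finitely many since the degree
    determines the number of symbols. *)
Lemma exact_above k j (x : tfun K c a (d + 1)) : d + 1 < 0 -> tdiff x = 0 ->
  (forall s, (count special s < j)%N -> fval x s = 0) ->
  (forall s, fval x s != 0 -> (size s < j + k)%N) ->
  exists x' : tfun K c a d, x = tdiff x'.
Proof.
move=> d0; elim: k j x => [|k IH] j x hx low top.
  exists 0; apply: fval_inj => s; rewrite tdiff0 fval0; apply/eqP; apply: contraT => nz.
  have := top _ nz; rewrite addn0 => lt; move: nz; rewrite low ?eqxx //.
  exact: leq_ltn_trans (count_size _ _) lt.
pose x' := htp (layer j x).
have hx1 : tdiff (x - tdiff x') = 0.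
  have -> : x - tdiff x' = -1 *: tdiff x' + x by rewrite scaleN1r [RHS]addrC.
  by rewrite tdiff_linear tdiff_square hx scaler0 addr0.
have [|s nz|x1 hx1'] := IH j.+1 (x - tdiff x') hx1.
- by move=> s lt; apply: layer_exact.
- have [_ e1] := fval_supp nz.
  have [x0|[t /[dup] tnz /fval_supp [_ e2]]] := tfun_eq0 x.
    case/negP: nz; rewrite (_ : x = 0); last by apply: fval_inj => t; rewrite x0.
    have -> : x' = 0.
      apply: fval_inj => t; rewrite -[LHS]/(htp_val (layer_val j (fval x)) t) x0.
      rewrite /htp_val /layer_val; case: apex => // e; case: ifP => // _.
      by case: ifP.
    by rewrite tdiff0 subr0.
  by have := top _ tnz; move: e1; rewrite e2 /tdeg; lia.
exists (x1 + x'); apply/eqP; rewrite -(scale1r x1) tdiff_linear scale1r -hx1'.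
by rewrite subrK.
Qed.

Lemma tdiff_exact (x : tfun K c a (d + 1)) : d + 1 < 0 -> tdiff x = 0 ->
  exists x' : tfun K c a d, x = tdiff x'.
Proof.
move=> d0 hx.
(* N is the number of symbols of a tree of degree d + 1. *)
pose N := absz (d + 1 + (2 * nstr a)%N%:Z - (2 * ~~ iswavy c)%N%:Z)%R.
apply: (@exact_above N.+1 0 x d0 hx) => // s /fval_supp [_ e].
by rewrite /N e /tdeg; lia.
Qed.
End Homotopy.

(** * The differential of the free operad *)

Section Evaluation.
Variable K : fieldType.

(** No letter is crossed if the letters of the first factor come first. *)
Lemma wcomp_cat X Y Z (cl : Z -> option (X + Y)) (x : seq X -> K) y s1 s2 t1 t2 :
  map cl s1 = map (Some \o inl) t1 -> map cl s2 = map (Some \o inr) t2 ->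
  wcomp cl x y (s1 ++ s2) = x t1 * y t2.
Proof.
elim: s1 x t1 => [|c s1 IH] x [|a t1] //= h1 h2; last first.
  case: h1 => -> h1; exact: (IH (x \o cons a) t1 h1 h2).
elim: s2 x y t2 h2 {h1} => [|c s2 IH] x y [|b t2] //= [-> h2].
by rewrite (IH _ _ t2) // /hat /= mul1r.
Qed.

Lemma dsum_skip X (P : pred X) (x : seq X -> K) s : all (predC P) s -> dsum P x s = 0.
Proof.
elim: s x => //= a s IH x /andP[/negbTE -> hs].
by rewrite IH // subr0.
Qed.

Lemma dsum_single X (P : pred X) (x : seq X -> K) s1 a s2 :
  P a -> all (predC P) s1 -> all (predC P) s2 ->
  dsum P x (s1 ++ a :: s2) = (-1) ^+ size s1 * x (s1 ++ s2).
Proof.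
move=> Pa h1 h2; elim: s1 x h1 => [|b s1 IH] x /=.
  by move=> _; rewrite Pa dsum_skip // subr0 mul1r.
by move=> /andP[/negbTE -> h1]; rewrite IH // sub0r exprS mulN1r mulNr.
Qed.
End Evaluation.
Arguments dsum_single {K X} P x s1 a s2.
Arguments wcomp_cat {K X Y Z} cl x y s1 s2 t1 t2.

(** The source of the signs |J1| |J2| in the formulas for the differential. *)
Lemma tri_add a b : 'C((a + b).+1, 2) = ('C(a.+1, 2) + 'C(b.+1, 2) + a * b)%N.
Proof.
elim: a => [|a IH]; first by rewrite mul0n addn0.
by rewrite addSn !(binS _.+1 1) IH !bin1; lia.
Qed.

Lemma tri_succ b : 'C((1 + b).+1, 2) = (1 + 'C(b.+1, 2) + b)%N.
Proof. by rewrite tri_add mul1n. Qed.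

Lemma sign_congr (R : pzRingType) i j : odd i = odd j -> (-1) ^+ i = (-1) ^+ j :> R.
Proof. by move=> e; rewrite -signr_odd e signr_odd. Qed.

Section Delta.
Variable K : fieldType.
Local Notation P := (HSoo K).

(** The differential of trees, transported to the free operad. *)
Definition delta c n (a : 'I_n -> colour) d (x : P c n a d) : P c n a (d + 1) :=
  sval (cid (Phi_surjective (tdiff (Phi x)))).

Lemma Phi_delta c n (a : 'I_n -> colour) d (x : P c n a d) :
  Phi (delta x) = tdiff (Phi x).
Proof. exact: svalP (cid (Phi_surjective (tdiff (Phi x)))). Qed.

Lemma delta_linear c n (a : 'I_n -> colour) d k (x y : P c n a d) :
  delta (k *: x + y) = k *: delta x + delta y.
Proof.
apply: Phi_inj; rewrite !(mor_linear (Phi_morphism K), Phi_delta).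
exact: tdiff_linear.
Qed.

Lemma delta0 c n (a : 'I_n -> colour) d : delta (0 : P c n a d) = 0.
Proof.
have := delta_linear (-1) (0 : P c n a d) 0.
by rewrite scaler0 addr0 scaleN1r addNr.
Qed.

Lemma delta_differential : is_differential delta.
Proof.
split.
- exact: delta_linear.
- move=> c n a d x; apply: Phi_inj; rewrite !Phi_delta (mor0 (Phi_morphism K)).
  exact: tdiff_square.
- move=> c n a b d s x hb; apply: Phi_inj.
  rewrite Phi_delta (mor_act (Phi_morphism K)) // (mor_act (Phi_morphism K)) // Phi_delta.
  exact: tdiff_act.
- move=> c e p q n a b z d1 d2 d u v x y h hd; apply: Phi_inj.
  have e1 : d + 1 = d1 + 1 + d2 by rewrite hd addrAC.
  have e2 : d + 1 = d1 + (d2 + 1) by rewrite hd addrA.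
  rewrite Phi_delta (mor_comp (Phi_morphism K)) // (morD (Phi_morphism K)).
  rewrite (morZ (Phi_morphism K)) !(mor_comp (Phi_morphism K)) // !Phi_delta.
  exact: tdiff_comp.
Qed.

Lemma delta_exact c n (a : 'I_n -> colour) d (x : P c n a (d + 1)) :
  d + 1 < 0 -> delta x = 0 -> exists x' : P c n a d, x = delta x'.
Proof.
move=> d0 dx0.
have [x0|[s /fval_supp [[ms _] _]]] := tfun_eq0 (Phi x).
  exists 0; apply: Phi_inj; rewrite Phi_delta (mor0 (Phi_morphism K)).
  by rewrite tdiff0; apply: fval_inj => s; rewrite x0.
have hx : tdiff (Phi x) = 0 by rewrite -Phi_delta dx0 (mor0 (Phi_morphism K)).
have [y ey] := tdiff_exact (Ordinal (t_pos ms)) d0 hx.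
have [x' ex'] := Phi_surjective (y : treeop K c n a d).
by exists x'; apply: Phi_inj; rewrite Phi_delta ex'.
Qed.

Lemma ell_gen m (hm : (2 <= m)%N) : ell K m = HSoo_generators K (HSoo_ell_gen hm).
Proof.
rewrite /ell; case: {-}_ / idP => [h|//].
by rewrite (bool_irrelevance h hm).
Qed.

Lemma fcor_gen m n (hm : (1 <= m)%N) : fcor K m n = HSoo_generators K (HSoo_f_gen n hm).
Proof.
rewrite /fcor; case: {-}_ / idP => [h|//].
by rewrite (bool_irrelevance h hm).
Qed.

Lemma Phi_ell m : (2 <= m)%N -> fval (Phi (ell K m)) = word_fun K m (ell_word m).
Proof. by move=> hm; rewrite (ell_gen hm); exact: (congr1 (fun x => fval x) (Phi_gen K (HSoo_ell_gen hm))). Qed.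

Lemma Phi_fcor m n : (1 <= m)%N -> fval (Phi (fcor K m n)) = word_fun K m (f_word m n).
Proof. by move=> hm; rewrite (fcor_gen n hm); exact: (congr1 (fun x => fval x) (Phi_gen K (HSoo_f_gen n hm))). Qed.

Lemma word_fun_self (X : eqType) m (w : seq X) : word_fun K m w w = gsign K m.
Proof. by rewrite /word_fun alt_refl mulr1. Qed.

(** The shuffle of J is, by definition, the permutation that lists J before its
    complement. *)
Lemma alternating_shuffle m (J : {set 'I_m}) (X : eqType) (x : seq X -> K) (g : 'I_m -> X) :
  alternating x ->
  x (map g (enum J ++ enum (~: J))) = (-1) ^+ shuffle_sign J * x (map g (enum 'I_m)).
Proof.
move=> hx; rewrite -(alternating_permute g _ hx); congr x.
case: m J g => [|m] J g.
  have e0 (s : seq 'I_0) : s = [::] by case: s => // -[].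
  by rewrite (e0 (_ ++ _)) (e0 (enum _)).
have sz : size (enum J ++ enum (~: J)) = m.+1.
  by rewrite size_cat -!cardE cardsC card_ord.
rewrite -[LHS](mkseq_nth (g ord0)) size_map sz /mkseq.
rewrite -[in LHS](val_enum_ord m.+1) -map_comp; apply: eq_map => i /=.
rewrite (nth_map ord0) ?sz // permE /shuffle_fun.
by congr g; apply: set_nth_default; rewrite sz.
Qed.

Lemma alternating_coshuffle m (J : {set 'I_m}) (X : eqType) (x : seq X -> K) (g : 'I_m -> X) :
  alternating x ->
  x (map g (enum (~: J) ++ enum J))
  = (-1) ^+ (#|J| * #|~: J|) * ((-1) ^+ shuffle_sign J * x (map g (enum 'I_m))).
Proof.
move=> hx; rewrite -(alternating_shuffle J g hx) !map_cat.
have := alternating_cat [::] (map g (enum (~: J))) (map g (enum J)) [::] hx.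
by rewrite !cats0 /= !size_map -!cardE mulnC.
Qed.

Lemma enum_ordD p q : enum 'I_(p + q)
  = map (lshift q) (enum 'I_p) ++ map (@rshift p q) (enum 'I_q).
Proof.
apply: (inj_map val_inj); rewrite val_enum_ord map_cat iotaD add0n; congr (_ ++ _).
  by rewrite -val_enum_ord -[in RHS]map_comp; apply: eq_map.
rewrite -[in LHS](addn0 p) iotaDl -val_enum_ord -[in LHS]map_comp -[in RHS]map_comp.
exact: eq_map.
Qed.

Lemma leaf_removable n (l : 'I_n) : removable (leaf l) = false.
Proof. by rewrite /removable /= cards1. Qed.

Lemma leaves_rigid n (s : seq 'I_n) : all (predC (@removable n)) (map (@leaf n) s).
Proof. by apply/allP => x /mapP[l _ ->] /=; rewrite leaf_removable. Qed.

Lemma map_enum_val (T : finType) (A : {set T}) : map (enum_val : 'I_#|A| -> T) (enum 'I_#|A|) = enum A.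
Proof.
case: (pickP [in A]) => [x xA|A0].
  rewrite -[RHS](mkseq_nth x) -cardE /mkseq -(val_enum_ord #|A|) -map_comp.
  by apply: eq_map => i; apply: enum_val_nth.
have A0' : #|A| = 0%N by apply: eq_card0.
by rewrite [RHS]size0nil -?cardE //; apply: size0nil; rewrite size_map size_enum_ord.
Qed.

Section EllFormula.
Variable m : nat.
Hypothesis m2 : (2 <= m)%N.
Local Notation straights := (fun _ => straight).

Definition ell_u (J : {set 'I_m}) : 'I_(1 + #|~: J|) -> option 'I_m :=
  juxt graft_slot (fun j : 'I_#|~: J| => Some (enum_val j)).
Definition ell_v (J : {set 'I_m}) : 'I_#|J| -> 'I_m := fun j => enum_val j.
Arguments ell_u : clear implicits.
Arguments ell_v : clear implicits.

Lemma img_ell_v (J : {set 'I_m}) : img (ell_v J) = J.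
Proof.
apply/setP => l; apply/imgP/idP => [[j <-]|lJ]; first exact: enum_valP.
exact: enum_val_surj.
Qed.

(** If S is the only internal edge of the word then only the composite along S
    can contribute. *)
Lemma ell_term_zero (J S : {set 'I_m}) (s : seq (sym m)) :
  (2 <= #|J|)%N -> (1 <= #|~: J|)%N ->
  (forall S' : {set 'I_m}, (S', false) \in s -> #|S'| = 1%N \/ S' = S) -> J != S ->
  wcomp (cut straight (ell_u J) (ell_v J)) (word_fun K (1 + #|~: J|) (ell_word _))
    (word_fun K #|J| (ell_word _)) s = 0.
Proof.
move=> J2 J1 hs nJ; apply/eqP; apply: contraNT nJ; rewrite wcomp_neq0 => /and3P[_ + _].
rewrite word_fun_neq0 => /perm_mem /(_ (leaf (lshift _ ord0))).
rewrite (introT (mem_ell_word _)); last by exists (lshift _ ord0).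
have h := ell_ell_grafting J.
move/esym/outs_source => [S' [S's _ _ sS]].
have u0 : ell_u J (lshift _ ord0) = None by rewrite /ell_u juxtE.
rewrite -(outer_img h u0) -/(ell_u J) -/(ell_v J) => /eqP.
have J0 : img (ell_v J) != set0 by rewrite img_ell_v -card_gt0 ltnW.
rewrite (outer_eq h (satA _) sS J0) img_ell_v => /eqP eJ.
case: (hs _ S's) => [e1|<-]; last by rewrite eJ.
by move: J2; rewrite eJ e1.
Qed.

(** In this order of the letters no signs arise. *)
Lemma ell_term (J : {set 'I_m}) : (2 <= #|J|)%N -> (1 <= #|~: J|)%N ->
  wcomp (cut straight (ell_u J) (ell_v J)) (word_fun K (1 + #|~: J|) (ell_word _))
    (word_fun K #|J| (ell_word _)) ((J, false) :: map (@leaf m) (enum (~: J) ++ enum J))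
  = gsign K (1 + #|~: J|) * gsign K #|J|.
Proof.
move=> J2 J1; have h := ell_ell_grafting J.
have J0 : J != set0 by rewrite -card_gt0 ltnW.
have q0 : (0 < #|J|)%N by apply: ltnW.
have u0 : ell_u J (lshift _ ord0) = None by rewrite /ell_u juxtE.
rewrite map_cat -cat_cons (wcomp_cat _ _ _ _ _ (ell_word _) (ell_word _)).
- by rewrite !word_fun_self.
- rewrite /ell_word enum_ordD map_cat /= enum_ordSl /= enum_ord0 /=; congr cons.
    have eo : outer_set (ell_u J) (img (ell_v J)) (img (ell_v J)) = _ := outer_img h u0.
    rewrite cut_inl //=; first by rewrite -[X in outer_set _ _ X](img_ell_v J) eo.
      by rewrite /within img_ell_v eqxx andbF.
    by apply: sat_sub; rewrite img_ell_v.
  rewrite -{1}map_enum_val -!map_comp; apply: eq_map => j /=.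
  have uj : ell_u J (rshift 1 j) = Some (enum_val j) by rewrite /ell_u juxtE.
  have nJ := grafting_notin h uj.
  rewrite cut_inl /=.
  + by rewrite (outer_set1 h uj).
  + by apply/set0Pn; exists (enum_val j); rewrite inE.
  + by rewrite /within sub1set (negbTE nJ).
  + exact: sat_set1.
- rewrite -{1}(map_enum_val J) /ell_word -!map_comp; apply: eq_map => j /=.
  rewrite cut_inr /=.
  + do 2 f_equal; congr pair; apply/setP => j'; rewrite !inE.
    by rewrite (inj_eq enum_val_inj).
  + by apply/set0Pn; exists (enum_val j); rewrite inE.
  + rewrite /within img_ell_v sub1set enum_valP /=; apply/eqP => e1.
    by move: J2; rewrite -e1 cards1.
Qed.

(** Both sides are supported on trees with one internal edge (S, false); they
    are compared at one ordering of the symbols of each such tree. *)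
Lemma delta_ell :
  delta (ell K m) =
        \sum_(J : {set 'I_m} | (2 <= #|J|)%N && (1 <= #|~: J|)%N)
          (-1) ^+ (#|~: J| + 1 + shuffle_sign J)%N *:
          op_comp _ _
            (juxt graft_slot (fun j : 'I_#|~: J| => Some (enum_val j)))
            (fun j : 'I_#|J| => enum_val j)
            (ell K (1 + #|~: J|)%N) (ell K #|J|).
Proof.
apply: Phi_inj; rewrite Phi_delta; set rhs := \sum_(J | _) _.
have rhsE s : fval (Phi rhs) s
    = \sum_(J : {set 'I_m} | (2 <= #|J|)%N && (1 <= #|~: J|)%N)
      (-1) ^+ (#|~: J| + 1 + shuffle_sign J)%N *
      wcomp (cut straight (ell_u J) (ell_v J)) (word_fun K (1 + #|~: J|) (ell_word _))
        (word_fun K #|J| (ell_word _)) s.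
  rewrite /rhs (mor_sum (Phi_morphism K)) fval_sum; apply: eq_bigr => J /andP[J2 J1].
  rewrite Phi_scaleE Phi_compE; [|exact: ell_ell_grafting|].
    by rewrite !Phi_ell.
  by have := cardsC J; rewrite card_ord; lia.
apply/eqP; rewrite -subr_eq0; apply/eqP.
have [e|[s hs]] := tfun_eq0 (tdiff (Phi (ell K m)) - Phi rhs : tfun K _ _ _).
  by apply: fval_inj => t; rewrite e.
exfalso; have [ts ds] := fval_supp hs.
have szs : size s = m.+1 by move: ds; rewrite /tdeg nstr_ell /=; lia.
have leaves : {subset ell_word m <= s}.
  by move=> x /mem_ell_word[l ->]; apply: (t_leaf ts.1) => //; right; lia.
(* Besides the input edges, s has exactly one more symbol y. *)
have [y ys ny] : exists2 y, y \in s & y \notin ell_word m.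
  apply/hasP/negPn/negP; rewrite -all_predC => /allP sub.
  have := uniq_leq_size (t_uniq ts.2) (s2 := ell_word m).
  rewrite szs size_map size_enum_ord ltnn => le; suff: false by []; apply: le => x xs.
  by apply: negbNE; apply: sub.
case: y ys ny => S k Ss nS.
have ek : k = false by case: k Ss nS => // Ss; have [] := t_wav ts.2 Ss.
subst k; have [S0 _ ST] := t_str ts.2 Ss.
have S2 : (2 <= #|S|)%N.
  rewrite ltn_neqAle card_gt0 S0 andbT eq_sym; apply: contra nS => /cards1P[l ->].
  by apply/mem_ell_word; exists l.
have S1 : (1 <= #|~: S|)%N by rewrite card_gt0; apply: contraNneq ST => e; rewrite -[S]setCK e setC0.
have u1 : uniq ((S, false) :: map (@leaf m) (enum (~: S) ++ enum S)).
  rewrite /= map_inj_uniq ?cat_uniq ?enum_uniq ?andbT /=; last exact: leaf_inj.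
  apply/andP; split; last by apply/hasPn => l; rewrite !mem_enum inE negbK.
  by apply: contra nS => /mapP[l _ ->]; apply/mem_ell_word; exists l.
have ps : perm_eq ((S, false) :: map (@leaf m) (enum (~: S) ++ enum S)) s.
  apply: uniq_perm => //; first exact: t_uniq ts.2.
  apply: (fun h1 h2 => (uniq_min_size u1 h1 h2).2) => [x|].
    rewrite inE => /orP[/eqP -> //|/mapP[l _ ->]]; apply: leaves.
    by apply/mem_ell_word; exists l.
  by rewrite szs /= size_map size_cat -!cardE addnC cardsC card_ord.
move: hs; rewrite -(fval_perm_neq0 _ ps) fvalD fvalN subr_eq0 => /negP; apply.
have ts' : tree straight straights ((S, false) :: map (@leaf m) (enum (~: S) ++ enum S)).
  by apply: tree_perm ts; rewrite perm_sym.
rewrite -[fval (tdiff _) _]/(tdiff_val _ _ (fval (Phi (ell K m))) _) /tdiff_val asboolT //.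
rewrite Phi_ell // rhsE (dsum_single _ _ [::]) ?leaves_rigid //; last first.
  by rewrite /removable /= neq_ltn S2 orbT.
rewrite mul1r alternating_coshuffle; last by apply: word_fun_alt; apply: ell_word_uniq.
rewrite word_fun_self (bigD1 S); last by rewrite S2 S1.
rewrite big1 ?Monoid.mulm1; last first.
  move=> J /andP[/andP[J2 J1] nJ]; rewrite (ell_term_zero (S := S)) ?mulr0 // => S'.
  rewrite inE => /orP[/eqP[->]|/mapP[l _ [->]]]; first by right.
  by left; rewrite cards1.
rewrite ell_term // /gsign -!exprD; apply/eqP.
have e1 : 'C(m.+1, 2) = ('C(#|S|.+1, 2) + 'C(#|~: S|.+1, 2) + #|S| * #|~: S|)%N.
  by rewrite -tri_add cardsC card_ord.
apply: sign_congr; rewrite e1 tri_succ.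
move: 'C(#|S|.+1, 2) 'C(#|~: S|.+1, 2) (#|S| * #|~: S|)%N (nat_of_bool (shuffle_sign S)) (#|~: S|)%N => i j k l o.
by lia.
Qed.
End EllFormula.
End Delta.

Section Sources.
Variables (p q n : nat) (a : 'I_p -> colour) (e : colour) (b : 'I_q -> colour)
  (z : 'I_n -> colour) (u : 'I_p -> option 'I_n) (v : 'I_q -> 'I_n).
Hypothesis h : grafting a e b z u v.

(** An input edge of the outer tree at the slot is the edge of the cut. *)
Lemma slot_source i k s : u i = None -> (0 < q)%N ->
  ([set i], k) \in outs (cut e u v) s -> (img v, k) \in s.
Proof.
move=> ui q0 /outs_source[S [Ss _ _ sS]].
rewrite -(outer_img h ui) => /eqP.
by rewrite (outer_eq h (sat_sub (subxx _)) sS (img_neq0 v q0)) => /eqP ->.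
Qed.

(** The root vertex of the inner tree is the wavy vertex on its label set. *)
Lemma root_source k s : (setT, k) \in inns (cut e u v) s -> (img v, k) \in s.
Proof.
case/inns_source=> S [Ss _ /within_sub sS eS].
suff -> : img v = S by [].
apply/eqP; rewrite eqEsubset sS andbT; apply/subsetP => l /imgP[j <-].
by have := in_setT j; rewrite eS inE.
Qed.
End Sources.

Section FFormula.
Variable K : fieldType.
Variables m n : nat.
Hypothesis m1 : (1 <= m)%N.

Definition fl_u (J : {set 'I_m}) : 'I_((1 + #|~: J|) + n) -> option 'I_(m + n) :=
  juxt (juxt graft_slot (fun j : 'I_#|~: J| => Some (lshift n (enum_val j))))
    (fun k : 'I_n => Some (rshift m k)).
Definition fl_v (J : {set 'I_m}) : 'I_#|J| -> 'I_(m + n) :=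
  fun j => lshift n (enum_val j).
Definition ff_u (J : {set 'I_m}) (I : {set 'I_n}) :
    'I_(#|J| + (1 + #|I|)) -> option 'I_(m + n) :=
  juxt (fun j : 'I_#|J| => Some (lshift n (enum_val j)))
    (juxt graft_slot (fun k : 'I_#|I| => Some (rshift m (enum_val k)))).
Definition ff_v (J : {set 'I_m}) (I : {set 'I_n}) :
    'I_(#|~: J| + #|~: I|) -> 'I_(m + n) :=
  juxt (fun j : 'I_#|~: J| => lshift n (enum_val j))
    (fun k : 'I_#|~: I| => rshift m (enum_val k)).
Arguments fl_u : clear implicits.
Arguments fl_v : clear implicits.
Arguments ff_u : clear implicits.
Arguments ff_v : clear implicits.

Definition fl_value (J : {set 'I_m}) : seq (sym (m + n)) -> K :=
  wcomp (cut straight (fl_u J) (fl_v J))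
    (word_fun K (1 + #|~: J|) (f_word (1 + #|~: J|) n)) (word_fun K #|J| (ell_word #|J|)).
Definition ff_value (J : {set 'I_m}) (I : {set 'I_n}) : seq (sym (m + n)) -> K :=
  wcomp (cut wavy (ff_u J I) (ff_v J I))
    (word_fun K #|J| (f_word #|J| (1 + #|I|)))
    (word_fun K #|~: J| (f_word #|~: J| #|~: I|)).

Lemma mem_img_fl_l (J : {set 'I_m}) i : (lshift n i \in img (fl_v J)) = (i \in J).
Proof.
apply/imgP/idP => [[j /lshift_inj <-]|iJ]; first exact: enum_valP.
by have [j <-] := enum_val_surj iJ; exists j.
Qed.

Lemma mem_img_fl_r (J : {set 'I_m}) k : (rshift m k \in img (fl_v J)) = false.
Proof. by apply/imgP => -[j /lshift_neq_rshift]. Qed.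

Lemma card_img_fl (J : {set 'I_m}) : #|img (fl_v J)| = #|J|.
Proof.
by rewrite card_imset ?cardsT ?card_ord // => x y /lshift_inj/enum_val_inj.
Qed.

Lemma mem_img_ff_l (J : {set 'I_m}) I i : (lshift n i \in img (ff_v J I)) = (i \notin J).
Proof.
rewrite -in_setC; apply/imgP/idP => [[j]|iJ].
  rewrite /ff_v; case: (split_ordP j) => j' ->; rewrite juxtE.
    by move/lshift_inj <-; exact: enum_valP.
  by move/esym/lshift_neq_rshift.
by have [j <-] := enum_val_surj iJ; exists (lshift _ j); rewrite /ff_v juxtE.
Qed.

Lemma mem_img_ff_r (J : {set 'I_m}) I k : (rshift m k \in img (ff_v J I)) = (k \notin I).
Proof.
rewrite -in_setC; apply/imgP/idP => [[j]|iJ].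
  rewrite /ff_v; case: (split_ordP j) => j' ->; rewrite juxtE.
    by move/lshift_neq_rshift.
  by move/rshift_inj <-; exact: enum_valP.
by have [j <-] := enum_val_surj iJ; exists (rshift _ j); rewrite /ff_v juxtE.
Qed.

Lemma fl_value_source (J : {set 'I_m}) s : (2 <= #|J|)%N -> fl_value J s != 0 -> (img (fl_v J), false) \in s.
Proof.
move=> J2; rewrite wcomp_neq0 => /and3P[_ + _].
rewrite word_fun_neq0 => /perm_mem /(_ (leaf (lshift n (lshift _ ord0)))).
rewrite (introT (mem_f_word _)); last by right; exists (lshift _ ord0).
move/esym; apply: (slot_source (f_ell_grafting n J)); last exact: ltnW.
by rewrite !juxtE.
Qed.

Lemma ff_value_source (J : {set 'I_m}) (I : {set 'I_n}) s : (1 <= #|~: J|)%N -> ff_value J I s != 0 ->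
  (img (ff_v J I), true) \in s.
Proof.
move=> J2; rewrite wcomp_neq0 => /and3P[_ _].
rewrite word_fun_neq0 => /perm_mem /(_ (setT, true)).
rewrite (introT (mem_f_word _)); last by left.
by move/esym => hin; apply: (root_source (e := wavy) (u := ff_u J I) hin).
Qed.

Definition sleaf (i : 'I_m) : sym (m + n) := leaf (lshift n i).

Lemma sleaf_inj : injective sleaf.
Proof. by move=> i j /leaf_inj/lshift_inj. Qed.

Lemma fl_value_word (J : {set 'I_m}) : (2 <= #|J|)%N ->
  fl_value J [:: (setT, true), (img (fl_v J), false) & map sleaf (enum (~: J) ++ enum J)]
  = gsign K (1 + #|~: J|) * gsign K #|J|.
Proof.
move=> J2; have h := f_ell_grafting n J.
have q0 : (0 < #|J|)%N by apply: ltnW.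
have A0 := img_neq0 (fl_v J) q0.
have u0 : fl_u J (lshift _ (lshift _ ord0)) = None by rewrite /fl_u !juxtE.
rewrite map_cat -!cat_cons /fl_value
  (wcomp_cat _ _ _ _ _ (f_word (1 + #|~: J|) n) (ell_word _)).
- by rewrite !word_fun_self.
- rewrite /f_word enum_ordD !map_cat /= enum_ordSl /= enum_ord0 /=; congr [:: _, _ & _].
  + rewrite cut_inl /=; first by rewrite (outer_setT _ _).
    * by apply/set0Pn; exists (fl_v J (Ordinal q0)); rewrite inE.
    * by rewrite /within subTset /= eq_sym; case: eqP.
    * exact: sat_sub (subsetT _).
  + have eo : outer_set (fl_u J) (img (fl_v J)) (img (fl_v J)) = _ := outer_img h u0.
    rewrite cut_inl //=; first by rewrite eo.
      by rewrite /within eqxx andbF.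
    exact: sat_sub.
  rewrite -{1}map_enum_val -!map_comp; apply: eq_map => j /=.
  have uj : fl_u J (lshift n (rshift 1 j)) = Some (lshift n (enum_val j)).
    by rewrite /fl_u !juxtE.
  have nJ := grafting_notin h uj.
  rewrite cut_inl /=.
  + by rewrite (outer_set1 h uj).
  + by apply/set0Pn; exists (lshift n (enum_val j)); rewrite inE.
  + by rewrite /within sub1set (negbTE nJ).
  + exact: sat_set1.
- rewrite -{1}(map_enum_val J) /ell_word -!map_comp; apply: eq_map => j /=.
  rewrite cut_inr /=.
  + do 2 f_equal; congr pair; apply/setP => j'; rewrite !inE.
    by rewrite (inj_eq (@lshift_inj _ _)) (inj_eq enum_val_inj).
  + by apply/set0Pn; exists (lshift n (enum_val j)); rewrite inE.
  + rewrite /within sub1set mem_img_fl_l enum_valP /=; apply/eqP => e1.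
    have := congr1 (fun A : {set _} => #|A|) e1.
    rewrite cards1 card_imset ?cardsT ?card_ord; first by move=> e; rewrite -e in J2.
    by move=> x y /lshift_inj/enum_val_inj.
Qed.

Lemma ff_value_word (J : {set 'I_m}) (I : {set 'I_n}) : (1 <= #|J|)%N -> (1 <= #|~: J|)%N ->
  ff_value J I (((setT, true) :: map sleaf (enum J))
     ++ ((img (ff_v J I), true) :: map sleaf (enum (~: J))))
  = gsign K #|J| * gsign K #|~: J|.
Proof.
move=> J1 J2; have h := f_f_grafting J I.
have q0 : (0 < #|~: J| + #|~: I|)%N by rewrite addn_gt0 J2.
have A0 := img_neq0 (ff_v J I) q0.
have nT : img (ff_v J I) != setT.
  have [i iJ] := card_gt0P J1.
  by apply: contraTneq (in_setT (lshift n i)) => <-; rewrite mem_img_ff_l iJ.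
rewrite /ff_value (wcomp_cat _ _ _ _ _ (f_word _ _) (f_word _ _)).
- by rewrite !word_fun_self.
- rewrite /f_word /=; congr cons.
    rewrite cut_inl /=; first by rewrite (outer_setT _ _).
    + by apply/set0Pn; exists (ff_v J I (Ordinal q0)); rewrite inE.
    + by rewrite /within subTset (negbTE nT).
    + exact: sat_sub (subsetT _).
  rewrite -{1}map_enum_val -!map_comp; apply: eq_map => j /=.
  have uj : ff_u J I (lshift _ j) = Some (lshift n (enum_val j)).
    by rewrite /ff_u !juxtE.
  have nJ := grafting_notin h uj.
  rewrite cut_inl /=.
  + by rewrite (outer_set1 h uj).
  + by apply/set0Pn; exists (lshift n (enum_val j)); rewrite inE.
  + by rewrite /within sub1set (negbTE nJ).
  + exact: sat_set1.
- rewrite /f_word /=; congr cons.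
    rewrite cut_inr //=; last by rewrite /within subxx.
    do 2 f_equal; congr pair; apply/setP => j'; rewrite !inE.
    exact: mem_img.
  rewrite -{1}(map_enum_val (~: J)) -!map_comp; apply: eq_map => j /=.
  have vj : ff_v J I (lshift _ j) = lshift n (enum_val j) by rewrite /ff_v juxtE.
  rewrite cut_inr /=.
  + do 2 f_equal; congr pair; apply/setP => j'; rewrite !inE -vj.
    by rewrite (inj_eq (grafting_injv h)).
  + by apply/set0Pn; exists (lshift n (enum_val j)); rewrite inE.
  + by rewrite /within sub1set -vj mem_img.
Qed.
Definition rhs_value s : K := \sum_(J : {set 'I_m} | (2 <= #|J|)%N)
      (-1) ^+ (#|~: J| + shuffle_sign J)%N * fl_value J s
    - \sum_(J : {set 'I_m} | (1 <= #|J|)%N && (1 <= #|~: J|)%N)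
      \sum_(I : {set 'I_n})
      (-1) ^+ (#|J| * (#|~: J| + 1) + shuffle_sign J)%N * ff_value J I s.

Lemma Phi_fcor_formula s :
  fval (Phi (\sum_(J : {set 'I_m} | (2 <= #|J|)%N)
          (-1) ^+ (#|~: J| + shuffle_sign J)%N *:
          op_comp (@straight_wavy m n) (1 - m%:Z + 1) (fl_u J) (fl_v J)
            (fcor K (1 + #|~: J|)%N n) (ell K #|J|)
        - \sum_(J : {set 'I_m} | (1 <= #|J|)%N && (1 <= #|~: J|)%N)
          \sum_(I : {set 'I_n})
          (-1) ^+ (#|J| * (#|~: J| + 1) + shuffle_sign J)%N *:
          op_comp (@straight_wavy m n) (1 - m%:Z + 1) (ff_u J I) (ff_v J I)
            (fcor K #|J| (1 + #|I|)%N) (fcor K #|~: J| #|~: I|))) s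
  = rhs_value s.
Proof.
rewrite (morD (Phi_morphism K)) (morN (Phi_morphism K)) fvalD fvalN.
rewrite !(mor_sum (Phi_morphism K)) !fval_sum; congr (_ - _).
  apply: eq_bigr => J J2.
  rewrite Phi_scaleE Phi_compE; [|exact: f_ell_grafting|].
    by rewrite Phi_fcor ?Phi_ell.
  by have := cardsC J; rewrite card_ord; lia.
apply: eq_bigr => J /andP[J1 J2].
rewrite (mor_sum (Phi_morphism K)) fval_sum; apply: eq_bigr => I _.
rewrite Phi_scaleE Phi_compE; [|exact: f_f_grafting|].
  by rewrite !Phi_fcor.
by have := cardsC J; rewrite card_ord; lia.
Qed.

(** The trees in the differential of f_{m,n}: fl_word has a straight internal
    edge, ff_word a second wavy vertex. The order of the letters suits the
    evaluation of the composites. *)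
Definition fl_word (J : {set 'I_m}) : seq (sym (m + n)) :=
  [:: (setT, true), (img (fl_v J), false) & map sleaf (enum (~: J) ++ enum J)].
Definition ff_word (J : {set 'I_m}) (I : {set 'I_n}) : seq (sym (m + n)) :=
  ((setT, true) :: map sleaf (enum J)) ++ ((img (ff_v J I), true) :: map sleaf (enum (~: J))).

Lemma mem_fl_word (J : {set 'I_m}) x : x \in fl_word J ->
  [\/ x = (setT, true), x = (img (fl_v J), false) | exists i, x = sleaf i].
Proof.
rewrite !inE => /or3P[/eqP|/eqP|/mapP[i _ ->]]; [exact: Or31|exact: Or32|].
by apply: Or33; exists i.
Qed.

Lemma mem_ff_word (J : {set 'I_m}) (I : {set 'I_n}) x : x \in ff_word J I ->
  [\/ x = (setT, true), x = (img (ff_v J I), true) | exists i, x = sleaf i].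
Proof.
rewrite mem_cat !inE => /orP[/orP[/eqP|/mapP[i _ ->]]|/orP[/eqP|/mapP[i _ ->]]];
  by [exact: Or31 | exact: Or32 | apply: Or33; exists i].
Qed.

Lemma rhs_fl_word (J : {set 'I_m}) : (2 <= #|J|)%N ->
  rhs_value (fl_word J)
  = (-1) ^+ (#|~: J| + shuffle_sign J)%N * (gsign K (1 + #|~: J|) * gsign K #|J|).
Proof.
move=> J2; rewrite -(fl_value_word J2) -/(fl_word J) /rhs_value (bigD1 J J2).
rewrite [X in X - _](_ : _ = (-1) ^+ (#|~: J| + shuffle_sign J)%N * fl_value J (fl_word J)); last first.
  rewrite big1 ?Monoid.mulm1 // => J' /andP[J2' nJ].
  apply/eqP; rewrite mulf_eq0; apply/orP; right; apply: contraNT nJ.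
  move=> /(fl_value_source J2')/mem_fl_word[//|[e]|[i [e]]]; last first.
    by move: J2'; rewrite -card_img_fl e cards1.
  by apply/eqP/setP => i; rewrite -!mem_img_fl_l e.
rewrite big1 ?subr0 // => J' /andP[J1 J2'].
apply: big1 => I _; apply/eqP; rewrite mulf_eq0; apply/orP; right; apply/negPn/negP.
move=> /(ff_value_source J2')/mem_fl_word[[e]|//|[i //]].
have [i iJ] := card_gt0P J1.
by have := in_setT (lshift n i); rewrite -e mem_img_ff_l iJ.
Qed.

Lemma rhs_ff_word (J : {set 'I_m}) (I : {set 'I_n}) : (1 <= #|J|)%N -> (1 <= #|~: J|)%N ->
  rhs_value (ff_word J I)
  = - ((-1) ^+ (#|J| * (#|~: J| + 1) + shuffle_sign J)%N * (gsign K #|J| * gsign K #|~: J|)).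
Proof.
move=> J1 J2; rewrite -(ff_value_word I J1 J2) -/(ff_word J I) /rhs_value.
rewrite [X in X - _]big1 ?sub0r => [|J' J2']; last first.
  apply/eqP; rewrite mulf_eq0; apply/orP; right; apply/negPn/negP.
  move=> /(fl_value_source J2')/mem_ff_word[//|//|[i [e]]].
  by move: J2'; rewrite -card_img_fl e cards1.
have only (J' : {set 'I_m}) (I' : {set 'I_n}) : (1 <= #|J'|)%N -> (1 <= #|~: J'|)%N -> ff_value J' I' (ff_word J I) != 0 ->
    J' = J /\ I' = I.
  move=> J1' J2' /(ff_value_source J2')/mem_ff_word[[e]|[e]|[i //]].
    have [i iJ] := card_gt0P J1'.
    by have := in_setT (lshift n i); rewrite -e mem_img_ff_l iJ.
  split; apply/setP => i; apply: negb_inj.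
    by rewrite -(mem_img_ff_l J' I') -(mem_img_ff_l J I) e.
  by rewrite -(mem_img_ff_r J' I') -(mem_img_ff_r J I) e.
congr (- _); rewrite (bigD1 J); last by rewrite J1 J2.
rewrite [X in _ = X](_ : _ = (-1) ^+ (#|J| * (#|~: J| + 1) + shuffle_sign J)%N * ff_value J I (ff_word J I) + 0); last by rewrite addr0.
congr (_ + _).
  rewrite (bigD1 I isT) big1 ?Monoid.mulm1 // => I' /andP[_ nI].
  apply/eqP; rewrite mulf_eq0; apply/orP; right; apply: contraNT nI.
  by move/(only _ _ J1 J2) => [_ ->].
apply: big1 => J' /andP[/andP[J1' J2'] nJ]; apply: big1 => I' _.
apply/eqP; rewrite mulf_eq0; apply/orP; right; apply: contraNT nJ.
by move/(only _ _ J1' J2') => [-> _].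
Qed.

Lemma lhs_fl_word (J : {set 'I_m}) : (2 <= #|J|)%N ->
  dsum (@removable _) (word_fun K m (f_word m n)) (fl_word J)
  = - ((-1) ^+ (#|J| * #|~: J|) * ((-1) ^+ shuffle_sign J * gsign K m)).
Proof.
move=> J2; have alt_f : alternating (word_fun K m (f_word m n)) by apply/word_fun_alt/f_word_uniq.
rewrite /fl_word (dsum_single (@removable _) _ [:: (setT, true)]) /=.
- have := alternating_coshuffle J sleaf (alternating_cons ((setT, true) : sym (m + n)) alt_f).
  by rewrite /= => ->; rewrite -[_ :: _]/(f_word m n) word_fun_self expr1 mulN1r.
- by rewrite /removable /= card_img_fl; case: #|J| J2 => [|[]].
- by rewrite /removable /= eqxx.
- by rewrite (map_comp (@leaf _) (lshift n)) leaves_rigid.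
Qed.

Lemma lhs_ff_word (J : {set 'I_m}) (I : {set 'I_n}) : (1 <= #|J|)%N ->
  dsum (@removable _) (word_fun K m (f_word m n)) (ff_word J I)
  = (-1) ^+ (1 + #|J|) * ((-1) ^+ shuffle_sign J * gsign K m).
Proof.
move=> J1; have alt_f : alternating (word_fun K m (f_word m n)) by apply/word_fun_alt/f_word_uniq.
rewrite /ff_word dsum_single.
- have := alternating_shuffle J sleaf (alternating_cons ((setT, true) : sym (m + n)) alt_f).
  rewrite map_cat /= => ->; rewrite -[_ :: map _ _]/(f_word m n) word_fun_self.
  by rewrite size_map -cardE.
- rewrite /removable /=; have [i iJ] := card_gt0P J1.
  by apply: contraTneq (in_setT (lshift n i)) => <-; rewrite mem_img_ff_l iJ.
- by rewrite /= /removable /= eqxx /= (map_comp (@leaf _) (lshift n)) leaves_rigid.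
- by rewrite (map_comp (@leaf _) (lshift n)) leaves_rigid.
Qed.

Lemma gsign_split (J : {set 'I_m}) :
  'C(m.+1, 2) = ('C(#|J|.+1, 2) + 'C(#|~: J|.+1, 2) + #|J| * #|~: J|)%N.
Proof. by rewrite -tri_add cardsC card_ord. Qed.

Lemma sides_fl_word (J : {set 'I_m}) : (2 <= #|J|)%N ->
  dsum (@removable _) (word_fun K m (f_word m n)) (fl_word J) = rhs_value (fl_word J).
Proof.
move=> J2; rewrite lhs_fl_word // rhs_fl_word // /gsign -[LHS]mulN1r -!exprD -exprS.
apply: sign_congr; rewrite (gsign_split J) tri_succ.
move: 'C(#|J|.+1, 2) 'C(#|~: J|.+1, 2) (#|J| * #|~: J|)%N (nat_of_bool (shuffle_sign J)) (#|~: J|)%N => i j k l o.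
by lia.
Qed.

Lemma sides_ff_word (J : {set 'I_m}) (I : {set 'I_n}) : (1 <= #|J|)%N -> (1 <= #|~: J|)%N ->
  dsum (@removable _) (word_fun K m (f_word m n)) (ff_word J I) = rhs_value (ff_word J I).
Proof.
move=> J1 J2; rewrite lhs_ff_word // rhs_ff_word // /gsign -[RHS]mulN1r -!exprD -exprS.
apply: sign_congr; rewrite (gsign_split J) mulnDr muln1.
move: 'C(#|J|.+1, 2) 'C(#|~: J|.+1, 2) (#|J| * #|~: J|)%N (nat_of_bool (shuffle_sign J)) (#|J|)%N => i j k l o.
by lia.
Qed.

Lemma sleaf_cat_uniq (A B : {set 'I_m}) : [disjoint A & B] ->
  uniq (map sleaf (enum A ++ enum B)).
Proof.
move=> AB; rewrite map_inj_uniq ?cat_uniq ?enum_uniq ?andbT /=; last exact: sleaf_inj.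
apply/hasPn => l; rewrite !mem_enum => lB.
by rewrite (disjointFl AB lB).
Qed.

(** A tree in the differential has one symbol more than the corolla, which is a
    straight edge or a second wavy vertex; the two kinds give the two sums. *)
Lemma delta_fcor :
  delta (fcor K m n) = \sum_(J : {set 'I_m} | (2 <= #|J|)%N)
          (-1) ^+ (#|~: J| + shuffle_sign J)%N *:
          op_comp _ _ (fl_u J) (fl_v J)
            (fcor K (1 + #|~: J|)%N n) (ell K #|J|)
        - \sum_(J : {set 'I_m} | (1 <= #|J|)%N && (1 <= #|~: J|)%N)
          \sum_(I : {set 'I_n})
          (-1) ^+ (#|J| * (#|~: J| + 1) + shuffle_sign J)%N *:
          op_comp _ _ (ff_u J I) (ff_v J I)
            (fcor K #|J| (1 + #|I|)%N) (fcor K #|~: J| #|~: I|).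
Proof.
apply: Phi_inj; rewrite Phi_delta; have := Phi_fcor_formula; set rhs := (X in Phi X) => rhsE.
apply/eqP; rewrite -subr_eq0; apply/eqP.
have [e|[s hs]] := tfun_eq0 (tdiff (Phi (fcor K m n)) - Phi rhs : tfun K _ _ _).
  by apply: fval_inj => t; rewrite e.
exfalso; have [ts ds] := fval_supp hs.
have szs : size s = m.+2 by move: ds; rewrite /tdeg nstr_f /=; lia.
have i0 : 'I_m := Ordinal m1.
have roots : (setT, true) \in s.
  by apply: (@t_root _ _ _ _ ts.1 (lshift n i0)); rewrite ?straight_wavyl.
have leaves i : sleaf i \in s.
  by apply: (t_leaf ts.1); [rewrite straight_wavyl|left].
(* Besides the symbols of the corolla, s has exactly one more symbol y. *)
have [y ys ny] : exists2 y, y \in s & y \notin f_word m n.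
  apply/hasP/negPn/negP; rewrite -all_predC => /allP sub.
  have := uniq_leq_size (t_uniq ts.2) (s2 := f_word m n).
  rewrite szs /= size_map size_enum_ord ltnn => le; suff: false by []; apply: le => x xs.
  by apply: negbNE; apply: sub.
case: y ys ny => S k Ss nS.
(* The single additional edge (S, k) determines s up to order. *)
have perm_s t : uniq t -> size t = m.+2 ->
    (forall x, x \in t -> [\/ x = (setT, true), x = (S, k) | exists i, x = sleaf i]) ->
    perm_eq t s.
  move=> ut st sub; apply: (uniq_perm ut (t_uniq ts.2)).
  apply: (fun h1 h2 => (uniq_min_size ut h1 h2).2) => [x /sub[->|->|[i ->]] //|].
  by rewrite szs st.
have contra t : perm_eq t s ->
    dsum (@removable _) (word_fun K m (f_word m n)) t <> rhs_value t.
  move=> pt; rewrite -rhsE => et.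
  move: hs; rewrite -(fval_perm_neq0 _ pt) fvalD fvalN subr_eq0 => /negP; apply.
  rewrite -[fval (tdiff _) _]/(tdiff_val _ _ (fval (Phi (fcor K m n))) _) /tdiff_val asboolT.
    by rewrite Phi_fcor // et.
  by apply: tree_perm ts; rewrite perm_sym.
have nroot : (S, k) != (setT, true) by apply: contraNneq nS => ->; apply/mem_f_word; left.
have nleaf i : (S, k) != sleaf i.
  by apply: contraNneq nS => ->; apply/mem_f_word; right; exists i.
have notleaf (A B : {set 'I_m}) : (S, k) \notin map sleaf (enum A ++ enum B).
  by apply/negP => /mapP[i _ /eqP]; rewrite (negbTE (nleaf i)).
have size_leaves (J : {set 'I_m}) : size (map sleaf (enum J ++ enum (~: J))) = m.
  by rewrite size_map size_cat -!cardE cardsC card_ord.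
have rootleaf (A B : {set 'I_m}) : (setT, true) \notin map sleaf (enum A ++ enum B).
  by apply/mapP => -[].
case: k Ss nS nroot nleaf notleaf perm_s => Ss nS nroot nleaf notleaf perm_s.
  pose J := [set i | lshift n i \notin S]; pose I := [set k | rshift m k \notin S].
  have eS : img (ff_v J I) = S.
    apply/setP => l; case: (split_ordP l) => i ->;
      by rewrite ?mem_img_ff_l ?mem_img_ff_r inE negbK.
  have J1 : (1 <= #|J|)%N.
    have [_ [l [_ /straight_wavyP[i ->] hl]]] := t_wav ts.2 roots.
    apply/card_gt0P; exists i; rewrite inE.
    by apply: (hl S) => //; rewrite properT; apply: contraNneq nroot => ->.
  have J2 : (1 <= #|~: J|)%N.
    have [_ [l [lS /straight_wavyP[i el] _]]] := t_wav ts.2 Ss.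
    by apply/card_gt0P; exists i; rewrite !inE negbK -el.
  apply: (contra (ff_word J I)); last exact: sides_ff_word.
  have pw : perm_eq (ff_word J I)
      [:: (setT, true), (S, true) & map sleaf (enum J ++ enum (~: J))].
    rewrite /ff_word cat_cons perm_cons eS -cat1s perm_catCA map_cat.
    exact: perm_refl.
  apply: perm_s.
  - rewrite (perm_uniq pw) /= inE negb_or eq_sym nroot rootleaf notleaf /=.
    by apply: sleaf_cat_uniq; rewrite -setI_eq0 setICr.
  - by rewrite (perm_size pw) /= size_leaves.
  - by rewrite -eS; apply: mem_ff_word.
have [S0 hS _] := t_str ts.2 Ss.
pose J := [set i | lshift n i \in S].
have eS : img (fl_v J) = S.
  apply/setP => l; case: (split_ordP l) => i ->; first by rewrite mem_img_fl_l inE.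
  rewrite mem_img_fl_r; apply/esym/negP => /hS.
  by rewrite straight_wavyr.
have J2 : (2 <= #|J|)%N.
  rewrite -card_img_fl eS ltn_neqAle card_gt0 S0 andbT eq_sym.
  apply/negP => /cards1P[l el]; have := hS l; rewrite el inE eqxx => /(_ isT)/straight_wavyP[i ei].
  by have := nleaf i; rewrite el ei eqxx.
apply: (contra (fl_word J)); last exact: sides_fl_word.
apply: perm_s.
- rewrite /fl_word /= eS inE negb_or eq_sym nroot rootleaf notleaf /=.
  by apply: sleaf_cat_uniq; rewrite -setI_eq0 setIC setICr.
- by rewrite /fl_word /= -[in X in enum X ++ _](setCK (~: J)) ?setCK -{2}(setCK J) size_leaves.
- by rewrite -eS; apply: mem_fl_word.
Qed.
End FFormula.

Section Resolution.
Variable K : fieldType.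
Local Notation P := (HSoo K).

Lemma HSoo_nonpositive c n (a : 'I_n -> colour) d (x : P c n a d) : 0 < d -> x = 0.
Proof.
apply: (presented_vanish (D := fun d => 0 < d)) => //.
- by case=> [m hm|m k hm] /=; lia.
- by move=> i j; lia.
Qed.

Lemma HS_degree0 c n (a : 'I_n -> colour) d (x : HS K c n a d) : d <> 0 -> x = 0.
Proof.
apply: (presented_vanish (D := fun d => d <> 0)) => //.
- by move=> g; apply.
- by move=> i j; lia.
Qed.

(** * Decomposability *)

Lemma decomposable_sum (G : corollas) (Q : operad K) (p : realization G Q) c n
    (a : 'I_n -> colour) d (I : finType) (A : pred I) (F : I -> Q c n a d) :
  (forall i, A i -> decomposable p (F i)) -> decomposable p (\sum_(i | A i) F i).
Proof.
move=> hF; apply: (big_ind (fun x : Q c n a d => decomposable p x)) => [|x y hx hy|//].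
  exact: Dec_0.
by rewrite -[x]scale1r; apply: Dec_lin.
Qed.

Lemma decomposableZ (G : corollas) (Q : operad K) (p : realization G Q) c n
    (a : 'I_n -> colour) d k (x : Q c n a d) : decomposable p x -> decomposable p (k *: x).
Proof. by move=> hx; rewrite -[_ *: _]addr0; apply: Dec_lin => //; apply: Dec_0. Qed.

Lemma decomposableB (G : corollas) (Q : operad K) (p : realization G Q) c n
    (a : 'I_n -> colour) d (x y : Q c n a d) :
  decomposable p x -> decomposable p y -> decomposable p (x - y).
Proof. by move=> hx hy; rewrite addrC -scaleN1r; apply: Dec_lin. Qed.

Lemma augmentation_ell m : augmentation (HSoo_generators K) (ell K m).
Proof. by rewrite /ell; case: {-}_ / idP => h; [exact: (Aug_gen (HSoo_generators K) (HSoo_ell_gen h))|exact: Aug_0]. Qed.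

Lemma augmentation_fcor m n : augmentation (HSoo_generators K) (fcor K m n).
Proof. by rewrite /fcor; case: {-}_ / idP => h; [exact: (Aug_gen (HSoo_generators K) (HSoo_f_gen n h))|exact: Aug_0]. Qed.

Lemma delta_decomposable g : decomposable (HSoo_generators K) (delta (HSoo_generators K g)).
Proof.
case: g => [m hm|m n hm].
  have : decomposable (HSoo_generators K) (delta (ell K m)); last by rewrite (ell_gen K hm).
  rewrite delta_ell //; apply: decomposable_sum => J /andP[J2 J1]; apply: decomposableZ.
  apply: Dec_comp; [exact: ell_ell_grafting| |exact: augmentation_ell|exact: augmentation_ell].
  by have := cardsC J; rewrite card_ord; lia.
have : decomposable (HSoo_generators K) (delta (fcor K m n)); last by rewrite (fcor_gen K n hm).
rewrite delta_fcor //; apply: decomposableB; apply: decomposable_sum => J.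
  move=> J2; apply: decomposableZ.
  apply: Dec_comp; [exact: f_ell_grafting| |exact: augmentation_fcor|exact: augmentation_ell].
  by have := cardsC J; rewrite card_ord; lia.
move=> /andP[J1 J2]; apply: decomposable_sum => I _; apply: decomposableZ.
apply: Dec_comp; [exact: f_f_grafting| |exact: augmentation_fcor|exact: augmentation_fcor].
by have := cardsC J; rewrite card_ord; lia.
Qed.

(** * The relations of HS as boundaries *)

(** The sign is forced: for F_n = f_{1,n} the bracket term of the second
    relation would have the wrong sign in the boundary of f_{2,n}. *)
Definition HS_lift : realization HS_corollas P := fun g =>
  match g with
  | HS_bracket => (ell K 2 : P straight 2%N (fun _ => straight) 0)
  | HS_field n => - (fcor K 1 n : P wavy (1 + n)%N (@straight_wavy 1 n) 0)
  end.

(** The arities p and q will be cardinalities, which equal 2 only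
    propositionally. *)
Lemma double_bracketE p q (u : 'I_p -> option 'I_3) (v : 'I_q -> 'I_3) (i j k : 'I_3) :
  p = 2%N -> q = 2%N -> (forall x, u x = if val x == 0%N then None else Some k) ->
  (forall x, v x = if val x == 0%N then i else j) ->
  op_comp (fun _ => straight) 0 u v (ell K p) (ell K q) = HS_double_bracket HS_lift i j k.
Proof.
move=> ep eq; subst p q => hu hv; rewrite /HS_double_bracket /=.
have -> : u = tnth [tuple None; Some k].
  by apply: funext => x; rewrite hu; case: x => [[|[|//]]].
have -> // : v = tnth [tuple i; j].
by apply: funext => x; rewrite hv; case: x => [[|[|//]]].
Qed.

Lemma double_bracket_anti (i j k : 'I_3) : uniq [:: i; j; k] ->
  HS_double_bracket HS_lift j i k = - HS_double_bracket HS_lift i j k.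
Proof.
move=> un; rewrite /HS_double_bracket.
have sym : op_act (fun _ : 'I_2 => straight) (tperm ord0 ord_max) (ell K 2) = - ell K 2.
  rewrite (ell_gen K (isT : (2 <= 2)%N)).
  exact: (@pres_gen_symmetric K HSoo_corollas _ (HSoo_ell_gen (isT : (2 <= 2)%N)) ord0 ord_max).
have h := bracket_bracket_grafting un.
have e := @op_comp_actr K P _ _ _ _ _ _ _ _ _ 0 0 0 _ _ (tperm ord0 ord_max)
  (ell K 2) (ell K 2) h (erefl _) (fun _ => erefl _).
have -> : tnth [tuple j; i] = tnth [tuple i; j] \o tperm ord0 ord_max.
  apply: funext => -[[|[|//]] lt] /=.
    by rewrite (_ : Ordinal lt = ord0) ?tpermL //; apply: val_inj.
  by rewrite (_ : Ordinal lt = ord_max) ?tpermR //; apply: val_inj.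
rewrite -[LHS]e sym -scaleN1r.
by rewrite -scaleN1r op_compZr.
Qed.

End Resolution.

Section SmallShuffles.
Variable K : fieldType.

(** This makes signs of shuffles computable. *)
Lemma shuffle_alt m (J : {set 'I_m}) :
  (-1) ^+ shuffle_sign J = alt K (enum 'I_m) (enum J ++ enum (~: J)).
Proof.
have hx := @alt_alternating K _ (enum 'I_m) (enum_uniq _).
have := @alternating_shuffle K m J _ _ id hx.
by rewrite !map_id alt_refl mulr1.
Qed.

Lemma enum3 : enum 'I_3 = [:: 0; 1; 1 + 1].
Proof. by apply: (inj_map val_inj); rewrite val_enum_ord. Qed.

Lemma enum2 : enum 'I_2 = [:: 0; 1].
Proof. by apply: (inj_map val_inj); rewrite val_enum_ord. Qed.

Lemma enum_set_filter (T : finType) (A : {set T}) : enum A = [seq x <- enum T | x \in A].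
Proof. by rewrite enumT. Qed.

Lemma enum_coset3 : [/\ enum (~: [set 0 : 'I_3]) = [:: 1; 1 + 1],
  enum (~: [set 1 : 'I_3]) = [:: 0; 1 + 1] & enum (~: [set 1 + 1 : 'I_3]) = [:: 0; 1]].
Proof. by split; rewrite enum_set_filter enum3 /= !inE. Qed.

Lemma sign3 : [/\ (-1) ^+ shuffle_sign (~: [set 0 : 'I_3]) = 1 :> K,
  (-1) ^+ shuffle_sign (~: [set 1 : 'I_3]) = -1 :> K
  & (-1) ^+ shuffle_sign (~: [set 1 + 1 : 'I_3]) = 1 :> K].
Proof.
have [e0 e1 e2] := enum_coset3.
split; rewrite shuffle_alt setCK enum_set1 enum3 ?e0 ?e1 ?e2 /=.
by rewrite sqrrN expr1n !expr0 !mul1r.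
by rewrite expr1 !expr0 !mulr1 mul1r.
by rewrite !expr0 !mul1r.
Qed.

Lemma sign2 : (-1) ^+ shuffle_sign [set 0 : 'I_2] = 1 :> K
  /\ (-1) ^+ shuffle_sign [set 1 : 'I_2] = -1 :> K.
Proof.
have e0 : enum (~: [set 0 : 'I_2]) = [:: 1] by rewrite enum_set_filter enum2 /= !inE.
have e1 : enum (~: [set 1 : 'I_2]) = [:: 0] by rewrite enum_set_filter enum2 /= !inE.
split; rewrite shuffle_alt enum_set1 enum2 ?e0 ?e1 /=.
  by rewrite !expr0 !mul1r.
by rewrite expr1 expr0 !mulr1.
Qed.

Lemma sign_setT m : (-1) ^+ shuffle_sign [set: 'I_m] = 1 :> K.
Proof.
by rewrite shuffle_alt setCT enum_set0 cats0 enum_setT -enumT alt_refl.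
Qed.

End SmallShuffles.

Section Opposites.
Variables (K : fieldType) (Q : operad K) (c e : colour) (p q n : nat) (a : 'I_p -> colour)
  (b : 'I_q -> colour) (z : 'I_n -> colour) (d1 d2 d : int)
  (u : 'I_p -> option 'I_n) (v : 'I_q -> 'I_n) (x : Q c p a d1) (y : Q e q b d2).

Lemma op_compNl : op_comp z d u v (- x) y = - op_comp z d u v x y.
Proof. by rewrite -scaleN1r op_compZl scaleN1r. Qed.

Lemma op_compNN : op_comp z d u v (- x) (- y) = op_comp z d u v x y.
Proof. by rewrite -[- x]scaleN1r op_compZl -[- y]scaleN1r op_compZr scalerA mulrNN mulr1 scale1r. Qed.
End Opposites.

Section Boundaries.
Variable K : fieldType.
Local Notation P := (HSoo K).

Lemma sum_ord3 (V : nmodType) (F : 'I_3 -> V) : \sum_k F k = F 0 + (F 1 + F (1 + 1)).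
Proof.
rewrite !big_ord_recl big_ord0 addr0.
by congr (F _ + (F _ + F _)); apply: val_inj.
Qed.

Lemma sum_ord2 (V : nmodType) (F : 'I_2 -> V) : \sum_k F k = F 0 + F 1.
Proof. by rewrite !big_ord_recl big_ord0 addr0; congr (F _ + F _); apply: val_inj. Qed.

Lemma ell3_term (i j k : 'I_3) (J := ~: [set k]) : enum J = [:: i; j] ->
  (-1) ^+ (#|~: J| + 1 + shuffle_sign J)%N *: op_comp (fun _ => straight) 0
    (juxt graft_slot (fun l : 'I_#|~: J| => Some (enum_val l))) (fun l : 'I_#|J| => enum_val l)
    (ell K (1 + #|~: J|)) (ell K #|J|)
  = (-1) ^+ shuffle_sign J *: HS_double_bracket (@HS_lift K) i j k.
Proof.
move=> eJ; have J2 : #|J| = 2%N by rewrite cardE eJ.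
have J1 : #|~: J| = 1%N by rewrite setCK cards1.
congr (_ *: _); first by rewrite J1 exprD sqrrN expr1n mul1r.
apply: double_bracketE => //.
- by rewrite J1.
- move=> x; case: (split_ordP x) => y ->; rewrite juxtE /=; first by rewrite ord1.
  by move: (enum_valP y); move: (enum_val y) => l; rewrite setCK inE => /eqP ->.
- move=> x; rewrite (enum_val_nth i) eJ /=; have := ltn_ord x.
  by move: (nat_of_ord x) => l; rewrite J2; case: l => [|[|]].
Qed.

(** The sign of the middle one of the three shuffles is absorbed by the
    antisymmetry of the bracket. *)
Lemma delta_ell3 : (delta (ell K 3) : P straight 3%N (fun _ => straight) 0)
  = HS_double_bracket (@HS_lift K) 0 1 (1 + 1) + HS_double_bracket (@HS_lift K) (1 + 1) 0 1
    + HS_double_bracket (@HS_lift K) 1 (1 + 1) 0.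
Proof.
rewrite delta_ell //.
rewrite (reindex_onto (fun k : 'I_3 => ~: [set k]) (fun J => odflt 0 [pick k in ~: J])); last first.
  move=> J /andP[J2 J1]; have J1' : #|~: J| = 1%N.
    have := cardsC J; rewrite card_ord; move: (#|J|) (#|~: J|) J1 J2 => p q; lia.
  have [k ek] := cards1P (introT eqP J1').
  by rewrite ek; case: pickP => [k'|/(_ k)]; rewrite inE ?eqxx // => /eqP -> /=; rewrite -ek setCK.
rewrite (eq_bigl predT) => [|k]; last first.
  rewrite setCK cardsC1 card_ord cards1 /=.
  by case: pickP => [k'|/(_ k)]; rewrite inE ?eqxx // => /eqP ->; rewrite eqxx.
have [e0 e1 e2] := enum_coset3; have [s0 s1 s2] := sign3 K.
rewrite sum_ord3 (ell3_term e0) (ell3_term e1) (ell3_term e2) s0 s1 s2 !scale1r.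
rewrite (@double_bracket_anti K 0 (1 + 1) 1) // scaleN1r.
by rewrite [LHS]addrC [in LHS](addrC (- _)).
Qed.

Lemma field_bracketE n p q (g : 'I_p -> 'I_2) (g' : 'I_q -> 'I_2) :
  p = 0%N -> q = 2%N -> (forall j, val (g' j) = val j) ->
  op_comp (@straight_wavy 2 n) 0
    (juxt (juxt graft_slot (fun j : 'I_p => Some (lshift n (g j)))) (fun k : 'I_n => Some (rshift 2 k)))
    (fun j => lshift n (g' j)) (fcor K (1 + p) n) (ell K q)
  = - HS_field_bracket (@HS_lift K) n.
Proof.
move=> ep eq; subst p q => hg.
apply: etrans (_ : op_comp _ _ (juxt graft_slot (fun j : 'I_n => Some (rshift 2 j)))
  (fun i : 'I_2 => lshift n i) (fcor K 1 n) (ell K 2) = _); last first.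
  by apply: oppr_inj; rewrite opprK -op_compNl.
congr (op_comp _ _ _ _ _ _); last first.
  by apply: funext => j; congr lshift; apply: val_inj; rewrite hg.
congr juxt; apply: funext => j.
have -> : j = lshift 0 (ord0 : 'I_1) by apply: val_inj; case: j => -[].
by rewrite juxtE.
Qed.

Lemma field_fieldE n p q (g : 'I_p -> 'I_2) (g' : 'I_q -> 'I_2) i j (I : {set 'I_n}) :
  p = 1%N -> q = 1%N -> (forall x, g x = i) -> (forall x, g' x = j) ->
  op_comp (@straight_wavy 2 n) 0
    (juxt (fun x : 'I_p => Some (lshift n (g x)))
       (juxt graft_slot (fun l : 'I_#|~: I| => Some (rshift 2 (enum_val l)))))
    (juxt (fun x : 'I_q => lshift n (g' x)) (fun l : 'I_#|I| => rshift 2 (enum_val l)))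
    (fcor K p (1 + #|~: I|)) (fcor K q #|I|)
  = HS_field_field (@HS_lift K) i j I.
Proof.
move=> ep eq; subst p q => hg hg'; rewrite -op_compNN.
congr (op_comp _ _ _ _ _ _); congr juxt; apply: funext => x; first by rewrite hg.
by rewrite hg'.
Qed.

(** The sum is taken over complements, since the relation is indexed by the
    wavy inputs of the inner operation. *)
Lemma f2_term n (i j : 'I_2) (J := [set i]) : ~: [set i] = [set j] ->
  \sum_(I : {set 'I_n}) (-1) ^+ (#|J| * (#|~: J| + 1) + shuffle_sign J)%N *:
    op_comp (@straight_wavy 2 n) 0 (@ff_u 2 n J I) (@ff_v 2 n J I)
      (fcor K #|J| (1 + #|I|)) (fcor K #|~: J| #|~: I|)
  = (-1) ^+ shuffle_sign J *: \sum_(I : {set 'I_n}) HS_field_field (@HS_lift K) i j I.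
Proof.
move=> eJ; rewrite scaler_sumr (reindex_inj (@setC_inj _)); apply: eq_bigr => I _.
congr (_ *: _).
  by rewrite eJ !cards1 mul1n exprD sqrrN expr1n mul1r.
rewrite /ff_u /ff_v setCK; apply: field_fieldE.
- exact: cards1.
- by rewrite eJ cards1.
- by move=> x; have := enum_valP x; rewrite inE => /eqP.
- by move=> x; move: (enum_valP x); move: (enum_val x) => l; rewrite eJ inE => /eqP.
Qed.

(** The set of both labels gives the bracket term, the two singletons give the
    commutator. *)
Lemma delta_f2 n : (delta (fcor K 2 n) : P wavy (2 + n)%N (@straight_wavy 2 n) 0)
  = - (HS_field_bracket (@HS_lift K) n
       + \sum_(I : {set 'I_n}) (HS_field_field (@HS_lift K) 0 1 I - HS_field_field (@HS_lift K) 1 0 I)).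
Proof.
rewrite delta_fcor // opprD sumrB; congr (_ - _).
  rewrite (bigD1 setT) /=; last by rewrite cardsT card_ord.
  rewrite big1 ?addr0 => [|J /andP[J2 nJ]]; last first.
    move: nJ; rewrite -properT => /proper_card; rewrite cardsT card_ord => J2'.
    by move: (leq_ltn_trans J2 J2').
  rewrite [X in X *: _](_ : _ = 1) ?scale1r; last by rewrite setCT cards0 sign_setT.
  apply: field_bracketE.
  - by rewrite setCT cards0.
  - by rewrite cardsT card_ord.
  - move=> j; rewrite (enum_val_nth 0) enum_setT -enumT; apply: nth_enum_ord.
    by rewrite -[X in (_ < X)%N](card_ord 2) -cardsT.
have [s0 s1] := sign2 K.
rewrite (reindex_onto (fun k : 'I_2 => [set k]) (fun J => odflt 0 [pick k in J])); last first.
  move=> J /andP[J2 J1]; have J1' : #|J| = 1%N.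
    by have := cardsC J; rewrite card_ord; move: (#|J|) (#|~: J|) J1 J2 => p q; lia.
  have [k ek] := cards1P (introT eqP J1').
  by rewrite ek; case: pickP => [k'|/(_ k)]; rewrite inE ?eqxx // => /eqP ->.
rewrite (eq_bigl predT) => [|k]; last first.
  rewrite cardsC1 card_ord cards1 /=.
  by case: pickP => [k'|/(_ k)]; rewrite inE ?eqxx // => /eqP ->; rewrite eqxx.
rewrite sum_ord2 (@f2_term n 0 1) ?(@f2_term n 1 0) ?s0 ?s1 ?scale1r ?scaleN1r //.
  by apply/setP => -[[|[|//]] ?]; rewrite !inE.
by apply/setP => -[[|[|//]] ?]; rewrite !inE.
Qed.

End Boundaries.

(** * Quotients of operads *)

Local Open Scope quotient_scope.

Section Quotient.
Variables (K : fieldType) (P : operad K).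
Variable N : forall c n (a : 'I_n -> colour) d, P c n a d -> Prop.
Record is_ideal : Prop := IsIdeal {
  ideal0 : forall c n (a : 'I_n -> colour) d, N (0 : P c n a d);
  ideal_lin : forall c n (a : 'I_n -> colour) d k (x y : P c n a d),
    N x -> N y -> N (k *: x + y);
  ideal_act : forall c n (a b : 'I_n -> colour) d (s : 'S_n) (x : P c n a d),
    (forall i, b (s i) = a i) -> N x -> N (op_act b s x);
  ideal_compl : forall c e p q n (a : 'I_p -> colour) (b : 'I_q -> colour)
    (z : 'I_n -> colour) d1 d2 d u v (x : P c p a d1) (y : P e q b d2),
    grafting a e b z u v -> d = d1 + d2 -> N x -> N (op_comp z d u v x y);
  ideal_compr : forall c e p q n (a : 'I_p -> colour) (b : 'I_q -> colour)
    (z : 'I_n -> colour) d1 d2 d u v (x : P c p a d1) (y : P e q b d2),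
    grafting a e b z u v -> d = d1 + d2 -> N y -> N (op_comp z d u v x y)
}.

Hypothesis hN : is_ideal.

Lemma idealN c n (a : 'I_n -> colour) d (x : P c n a d) : N x -> N (- x).
Proof. by move=> hx; rewrite -[- x]addr0 -scaleN1r; apply: (ideal_lin hN) => //; apply: ideal0. Qed.

Lemma idealD c n (a : 'I_n -> colour) d (x y : P c n a d) : N x -> N y -> N (x + y).
Proof. by move=> hx hy; rewrite -[x]scale1r; apply: (ideal_lin hN). Qed.

Section Carrier.
Variables (c : colour) (n : nat) (a : 'I_n -> colour) (d : int).

Definition congr_ideal (x y : P c n a d) : bool := `[< N (x - y) >].

Lemma congr_ideal_refl : reflexive congr_ideal.
Proof. by move=> x; apply/asboolP; rewrite subrr; apply: ideal0. Qed.

Lemma congr_ideal_sym : symmetric congr_ideal.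
Proof.
by move=> x y; apply/asboolP/asboolP => /idealN; rewrite opprB.
Qed.

Lemma congr_ideal_trans : transitive congr_ideal.
Proof.
move=> y x z /asboolP h /asboolP h'; apply/asboolP.
by have := idealD h h'; rewrite addrA subrK.
Qed.

Canonical congr_ideal_equiv :=
  EquivRel congr_ideal congr_ideal_refl congr_ideal_sym congr_ideal_trans.

Definition quot_ob := {eq_quot congr_ideal}.

HB.instance Definition _ := Choice.on quot_ob.

Definition qcls (x : P c n a d) : quot_ob := \pi_{eq_quot congr_ideal} x.

Lemma qcls_eq x y : qcls x = qcls y <-> N (x - y).
Proof.
rewrite /qcls; split => [/eqP|h].
  by rewrite eqmodE => /asboolP.
by apply/eqP; rewrite eqmodE; apply/asboolP.
Qed.

Lemma qcls_repr (X : quot_ob) : qcls (repr X) = X.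
Proof. by rewrite /qcls reprK. Qed.

Lemma qcls_ind (Q : quot_ob -> Prop) : (forall x, Q (qcls x)) -> forall X, Q X.
Proof. by move=> h X; rewrite -(qcls_repr X). Qed.

Lemma repr_qcls x : N (repr (qcls x) - x).
Proof. by apply/qcls_eq; rewrite qcls_repr. Qed.

Let zero : quot_ob := qcls 0.
Let add (X Y : quot_ob) := qcls (repr X + repr Y).
Let opp (X : quot_ob) := qcls (- repr X).
Let scale (k : K) (X : quot_ob) := qcls (k *: repr X).

Let addE x y : add (qcls x) (qcls y) = qcls (x + y).
Proof.
apply/qcls_eq; rewrite opprD addrACA.
by apply: idealD; apply: repr_qcls.
Qed.
Let oppE x : opp (qcls x) = qcls (- x).
Proof. by apply/qcls_eq; rewrite -opprD; apply: idealN; apply: repr_qcls. Qed.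
Let scaleE k x : scale k (qcls x) = qcls (k *: x).
Proof.
apply/qcls_eq; rewrite -scalerBr -[_ *: _]addr0.
by apply: (ideal_lin hN); [apply: repr_qcls|apply: ideal0].
Qed.

Let addA : associative add.
Proof. by do 3 elim/qcls_ind => ?; rewrite !addE addrA. Qed.
Let addC : commutative add.
Proof. by do 2 elim/qcls_ind => ?; rewrite !addE addrC. Qed.
Let add0 : left_id zero add.
Proof. by elim/qcls_ind => ?; rewrite addE add0r. Qed.
Let addN : left_inverse zero opp add.
Proof. by elim/qcls_ind => ?; rewrite oppE addE addNr. Qed.

HB.instance Definition _ := GRing.isZmodule.Build quot_ob addA addC add0 addN.

Let scaleA k l X : scale k (scale l X) = scale (k * l) X.
Proof. by elim/qcls_ind: X => ?; rewrite !scaleE scalerA. Qed.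
Let scale1 : left_id 1 scale.
Proof. by elim/qcls_ind => ?; rewrite scaleE scale1r. Qed.
Let scaleDr : right_distributive scale +%R.
Proof.
move=> k; elim/qcls_ind => ?; elim/qcls_ind => ?.
by rewrite [LHS](congr1 (scale k) (addE _ _)) !scaleE scalerDr -addE.
Qed.
Let scaleDl X : {morph scale^~ X : k l / k + l}.
Proof. by move=> k l; elim/qcls_ind: X => ?; rewrite !scaleE scalerDl -addE. Qed.

HB.instance Definition _ :=
  GRing.Zmodule_isLmodule.Build K quot_ob scaleA scale1 scaleDr scaleDl.

Lemma qcls_linear k x y : qcls (k *: x + y) = k *: qcls x + qcls y.
Proof. by rewrite -addE -scaleE. Qed.

Lemma qcls_eq0 x : qcls x = 0 <-> N x.
Proof. by rewrite -[0]/(qcls 0) qcls_eq subr0. Qed.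
End Carrier.

(** The operations are zero where they are meaningless, since the ideal is
    stable only under meaningful operations. *)
Definition quot_act c n (a b : 'I_n -> colour) d (s : 'S_n)
    (X : quot_ob c a d) : quot_ob c b d :=
  if pselect (forall i, b (s i) = a i) then qcls (op_act b s (repr X)) else 0.

Definition quot_comp c e p q n (a : 'I_p -> colour) (b : 'I_q -> colour)
    (z : 'I_n -> colour) d1 d2 d u v
    (X : quot_ob c a d1) (Y : quot_ob e b d2) : quot_ob c z d :=
  if pselect (grafting a e b z u v /\ d = d1 + d2)
  then qcls (op_comp z d u v (repr X) (repr Y)) else 0.

Lemma quot_actE c n (a b : 'I_n -> colour) d (s : 'S_n) (x : P c n a d) :
  (forall i, b (s i) = a i) -> quot_act b s (qcls x) = qcls (op_act b s x).
Proof.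
move=> hs; rewrite /quot_act; case: pselect => // h; apply/qcls_eq.
have -> : op_act b s (repr (qcls x)) - op_act b s x
    = op_act b s (-1 *: x + repr (qcls x)) by rewrite op_act_linear scaleN1r addrC.
by apply: (ideal_act hN) => //; rewrite scaleN1r addrC; apply: repr_qcls.
Qed.

Lemma quot_compE c e p q n (a : 'I_p -> colour) (b : 'I_q -> colour)
    (z : 'I_n -> colour) d1 d2 d u v (x : P c p a d1) (y : P e q b d2) :
  grafting a e b z u v -> d = d1 + d2 ->
  quot_comp z d u v (qcls x) (qcls y) = qcls (op_comp z d u v x y).
Proof.
move=> h hd; rewrite /quot_comp; case: pselect => [h12|[]//]; apply/qcls_eq.
have -> : op_comp z d u v (repr (qcls x)) (repr (qcls y)) - op_comp z d u v x y
    = op_comp z d u v (-1 *: x + repr (qcls x)) (repr (qcls y))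
      + op_comp z d u v x (-1 *: y + repr (qcls y)).
  rewrite op_comp_linearl op_comp_linearr !scaleN1r [X in _ = _ + X]addrC [RHS]addrA.
  by rewrite [X in _ = X + _]addrAC addNr add0r.
apply: idealD; [apply: (ideal_compl hN) => //|apply: (ideal_compr hN) => //];
  rewrite scaleN1r addrC; exact: repr_qcls.
Qed.

Lemma quot_act_linear c n (a b : 'I_n -> colour) d (s : 'S_n) k (x y : quot_ob c a d) :
  quot_act b s (k *: x + y) = k *: quot_act b s x + quot_act b s y.
Proof.
elim/qcls_ind: x => x; elim/qcls_ind: y => y.
have [h|h] := pselect (forall i, b (s i) = a i).
  by rewrite -qcls_linear !quot_actE // op_act_linear qcls_linear.
by rewrite /quot_act; case: pselect => // h12; rewrite scaler0 addr0.
Qed.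

Lemma quot_comp_linearl c e p q n (a : 'I_p -> colour) (b : 'I_q -> colour)
    (z : 'I_n -> colour) d1 d2 d u v k
    (x x' : quot_ob c a d1) (y : quot_ob e b d2) :
  quot_comp z d u v (k *: x + x') y = k *: quot_comp z d u v x y + quot_comp z d u v x' y.
Proof.
elim/qcls_ind: x => x; elim/qcls_ind: x' => x'; elim/qcls_ind: y => y.
have [[h h']|h] := pselect (grafting a e b z u v /\ d = d1 + d2).
  by rewrite -qcls_linear !quot_compE // op_comp_linearl qcls_linear.
by rewrite /quot_comp; case: pselect => // h12; rewrite scaler0 addr0.
Qed.

Lemma quot_comp_linearr c e p q n (a : 'I_p -> colour) (b : 'I_q -> colour)
    (z : 'I_n -> colour) d1 d2 d u v k
    (x : quot_ob c a d1) (y y' : quot_ob e b d2) :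
  quot_comp z d u v x (k *: y + y') = k *: quot_comp z d u v x y + quot_comp z d u v x y'.
Proof.
elim/qcls_ind: x => x; elim/qcls_ind: y => y; elim/qcls_ind: y' => y'.
have [[h h']|h] := pselect (grafting a e b z u v /\ d = d1 + d2).
  by rewrite -qcls_linear !quot_compE // op_comp_linearr qcls_linear.
by rewrite /quot_comp; case: pselect => // h12; rewrite scaler0 addr0.
Qed.

Definition quotient_operad : operad K.
Proof.
refine (@Operad K quot_ob (fun c => qcls (op_id P c)) quot_act quot_comp
  quot_act_linear quot_comp_linearl quot_comp_linearr _ _ _ _ _ _ _ _ _).
- move=> c n a d; elim/qcls_ind => x.
  by rewrite quot_actE ?op_act1 // => i; rewrite perm1.
- move=> c n a b b' d s t x hs ht; elim/qcls_ind: x => x.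
  by rewrite !quot_actE ?op_actM // => i; rewrite permM ht.
- move=> c e p q n a b z z' d1 d2 d u v s x y h hd hz; elim/qcls_ind: x => x; elim/qcls_ind: y => y.
  rewrite !quot_compE // ?quot_actE ?op_act_comp //.
  exact: (grafting_rename h hz).
- move=> c e p q n a a' b z d1 d2 d u v s x y h hd ha; elim/qcls_ind: x => x; elim/qcls_ind: y => y.
  rewrite quot_actE // !quot_compE ?op_comp_actl //.
  exact: (grafting_actl h ha).
- move=> c e p q n a b b' z d1 d2 d u v s x y h hd hb; elim/qcls_ind: x => x; elim/qcls_ind: y => y.
  rewrite quot_actE // !quot_compE ?op_comp_actr //.
  exact: (grafting_actr h hb).
- move=> c n a z d s x hz; elim/qcls_ind: x => x.
  rewrite quot_compE ?add0r //; last exact: grafting_idl.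
  by rewrite quot_actE // op_comp_idl.
- move=> c e n a z d u v s x h hs; elim/qcls_ind: x => x.
  rewrite quot_compE ?addr0 // quot_actE; last exact: grafting_idr h hs.
  by rewrite (op_comp_idr x h hs).
- move=> c e g p q r m m' n a b b' w w' z d1 d2 d3 d12 d23 d u1 v1 u2 v2 u3 v3 u4 v4 x y t.
  move=> h1 h2 h3 h4 e12 e23 ed k1 k2 k3.
  elim/qcls_ind: x => x; elim/qcls_ind: y => y; elim/qcls_ind: t => t.
  have ed' : d = d12 + d3 by rewrite e12.
  have ed'' : d = d1 + d23 by rewrite e23 addrA.
  rewrite !quot_compE //; congr qcls.
  apply: op_comp_sequential h1 h2 h3 h4 e12 e23 ed _ _ _; [exact: k1|exact: k2|exact: k3].
- move=> c e g p q r m m' n a b b' w w' z d1 d2 d3 d12 d13 d u1 v1 u2 v2 u3 v3 u4 v4 x y t.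
  move=> h1 h2 h3 h4 e12 e13 ed k0 k1 k2 k3.
  elim/qcls_ind: x => x; elim/qcls_ind: y => y; elim/qcls_ind: t => t.
  have ed' : d = d12 + d3 by rewrite e12.
  have ed'' : d = d13 + d2 by rewrite e13 addrAC.
  rewrite !quot_compE // -[_ *: qcls _]addr0 -[0]/(qcls 0) -qcls_linear addr0; congr qcls.
  by apply: op_comp_parallel h1 h2 h3 h4 e12 e13 ed _ _ _ _.
Defined.

Definition quotient_map c n (a : 'I_n -> colour) d (x : P c n a d) : quotient_operad c n a d :=
  qcls x.

Lemma quotient_morphism : is_morphism quotient_map.
Proof.
split.
- by move=> *; apply: qcls_linear.
- by [].
- by move=> c n a b d s x hb; rewrite /quotient_map -quot_actE.
- by move=> c e p q n a b z d1 d2 d u v x y h hd; rewrite /quotient_map -quot_compE.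
Qed.

Lemma quotient_map_eq0 c n (a : 'I_n -> colour) d (x : P c n a d) :
  quotient_map x = 0 <-> N x.
Proof. exact: qcls_eq0. Qed.

End Quotient.

(** * The cohomology of the free operad *)

Section MorphismRelations.
Variables (K : fieldType) (P Q : operad K)
  (psi : forall c n (a : 'I_n -> colour) d, P c n a d -> Q c n a d)
  (p : realization HS_corollas P).
Hypothesis hpsi : is_morphism psi.
Local Notation psip := (fun g => psi (p g)).

Lemma mor_symmetric c n (a : 'I_n -> colour) d (x : P c n a d) :
  corolla_symmetric x -> corolla_symmetric (psi x).
Proof.
move=> hx i j ij aij; rewrite -(mor_act hpsi); last first.
  by move=> k; case: tpermP => // ->.
by rewrite hx //; case: (a i); rewrite ?(morN hpsi).
Qed.

Lemma mor_double_bracket i j k : uniq [:: i; j; k] ->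
  psi (HS_double_bracket p i j k) = HS_double_bracket psip i j k.
Proof.
by move=> un; rewrite /HS_double_bracket (mor_comp hpsi) //; apply: bracket_bracket_grafting.
Qed.

Lemma mor_field_bracket n : psi (HS_field_bracket p n) = HS_field_bracket psip n.
Proof.
by rewrite /HS_field_bracket (mor_comp hpsi) //; apply: field_bracket_grafting.
Qed.

Lemma mor_field_field n i j (I : {set 'I_n}) : i <> j ->
  psi (HS_field_field p i j I) = HS_field_field psip i j I.
Proof.
by move=> ij; rewrite /HS_field_field (mor_comp hpsi) //; apply: field_field_grafting.
Qed.

Definition jacobiator (O : operad K) (o : realization HS_corollas O) :
    O straight 3%N (fun _ => straight) 0 :=
  HS_double_bracket o 0 1 (1 + 1) + HS_double_bracket o (1 + 1) 0 1 + HS_double_bracket o 1 (1 + 1) 0.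

Definition field_defect (O : operad K) (o : realization HS_corollas O) n :
    O wavy (2 + n)%N (@straight_wavy 2 n) 0 :=
  HS_field_bracket o n
    + \sum_(I : {set 'I_n}) (HS_field_field o 0 1 I - HS_field_field o 1 0 I).

Lemma mor_jacobiator : psi (jacobiator p) = jacobiator psip.
Proof. by rewrite !(morD hpsi) !mor_double_bracket. Qed.

Lemma mor_field_defect n : psi (field_defect p n) = field_defect psip n.
Proof.
rewrite (morD hpsi) mor_field_bracket (mor_sum hpsi); congr (_ + _).
by apply: eq_bigr => I _; rewrite (morD hpsi) (morN hpsi) !mor_field_field.
Qed.
End MorphismRelations.

Section Cohomology.
Variable K : fieldType.
Local Notation P := (HSoo K).
Local Notation HSgen := (@pres_gen K HS_corollas (@HS_relations K)).

(** The generators of negative degree are sent to zero. *)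
Definition HS_image : realization HSoo_corollas (HS K) := fun g =>
  match g with
  | HSoo_ell_gen m _ =>
      match m return HS K straight m (fun _ => straight) (2 - m%:Z) with
      | 2 => HSgen HS_bracket
      | _ => 0
      end
  | HSoo_f_gen m n _ =>
      match m return HS K wavy (m + n)%N (@straight_wavy m n) (1 - m%:Z) with
      | 1 => - (HSgen (HS_field n) : HS K wavy (1 + n)%N (@straight_wavy 1 n) 0)
      | _ => 0
      end
  end.

Lemma symmetric0 (Q : operad K) c n (a : 'I_n -> colour) d : corolla_symmetric (0 : Q c n a d).
Proof. by move=> i j _ _; rewrite op_act0; case: (a i); rewrite ?oppr0. Qed.

Lemma symmetricN (Q : operad K) c n (a : 'I_n -> colour) d (x : Q c n a d) :
  corolla_symmetric x -> corolla_symmetric (- x).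
Proof.
move=> hx i j ij aij; rewrite -scaleN1r op_actZ hx //.
by case: (a i); rewrite ?scalerN.
Qed.

Lemma HS_image_model : is_model (@no_relations K HSoo_corollas) HS_image.
Proof.
split=> // -[m hm|m n hm] /=.
  case: m hm => [|[|[|m]]] hm; try exact: symmetric0.
  exact: (@pres_gen_symmetric K HS_corollas _ HS_bracket).
case: m hm => [|[|m]] hm; try exact: symmetric0.
apply: symmetricN; exact: (@pres_gen_symmetric K HS_corollas _ (HS_field n)).
Qed.

Definition projection c n (a : 'I_n -> colour) d (x : P c n a d) : HS K c n a d :=
  qvalue HS_image x.

Lemma projection_morphism : is_morphism projection.
Proof. exact: qvalue_morphism HS_image_model. Qed.

Lemma projection_gen g : projection (HSoo_generators K g) = HS_image g.
Proof. exact: qvalue_gen HS_image_model. Qed.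

Lemma projection_lift g : projection (HS_lift K g) = HSgen g.
Proof.
case: g => [|n].
  have := projection_gen (HSoo_ell_gen (isT : (2 <= 2)%N)).
  by rewrite -(ell_gen K (isT : (2 <= 2)%N)).
rewrite (morN projection_morphism) (fcor_gen K n (isT : (1 <= 1)%N)).
by rewrite (projection_gen (HSoo_f_gen n (isT : (1 <= 1)%N))) opprK.
Qed.

(** As HS is concentrated in degree zero, only the boundaries of ell_3 and
    f_{2,n} matter, and these are the relations of HS. *)
Lemma projection_delta c n (a : 'I_n -> colour) d (x : P c n a d) : projection (delta x) = 0.
Proof.
have [d0|] := pselect (d + 1 = 0); last exact: HS_degree0.
have lift_gen : (fun g => projection (HS_lift K g)) = HSgen :> realization HS_corollas (HS K).
  by apply: functional_extensionality_dep => g; apply: projection_lift.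
have [jac fields] := (HS_presented K).1.2.
have {}jac : jacobiator HSgen = 0 := jac.
have {}fields k : field_defect HSgen k = 0 := fields k.
move: x d0; apply: (presented_ind (R := @no_relations K HSoo_corollas)
  (prop := fun c n a d x => d + 1 = 0 -> projection (delta x) = 0)).
- move=> [m hm|m k hm] /= hd.
    have em : m = 3%N by lia.
    subst m; have := congr1 (@projection _ _ _ _) (delta_ell3 K).
    rewrite (mor_jacobiator _ projection_morphism) lift_gen jac.
    by rewrite (ell_gen K hm).
  have em : m = 2%N by lia.
  subst m; have := congr1 (@projection _ _ _ _) (delta_f2 K k).
  rewrite (morN projection_morphism) (mor_field_defect _ projection_morphism) lift_gen.
  by rewrite fields oppr0 (fcor_gen K k hm).
- by move=> c0 /=; lia.
- move=> c0 n0 a0 b d' s x hs IH hd.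
  by rewrite (diff_act (delta_differential K)) // (mor_act projection_morphism) // IH // op_act0.
- move=> c0 e p q n0 a0 b z d1 d2 d' u v x y h hd IHx IHy hd'.
  have e1 : d' + 1 = d1 + 1 + d2 by rewrite hd addrAC.
  have e2 : d' + 1 = d1 + (d2 + 1) by rewrite hd addrA.
  rewrite (diff_comp (delta_differential K)) // (morD projection_morphism).
  rewrite (morZ projection_morphism) !(mor_comp projection_morphism) //.
  have -> : projection (delta x) = 0.
    have [/IHx //|] := pselect (d1 + 1 = 0); exact: HS_degree0.
  have -> : projection (delta y) = 0.
    have [/IHy //|] := pselect (d2 + 1 = 0); exact: HS_degree0.
  by rewrite op_comp0l op_comp0r scaler0 addr0.
- by move=> c0 n0 a0 d' _; rewrite delta0; exact: (mor0 projection_morphism).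
- move=> c0 n0 a0 d' k x y IHx IHy hd.
  by rewrite delta_linear (mor_linear projection_morphism) IHx // IHy // scaler0 addr0.
Qed.

Lemma projection_epi : is_epi projection.
Proof.
move=> c n a d; apply: (presented_ind (R := @HS_relations K)
  (prop := fun c n a d y => exists x : P c n a d, projection x = y)).
- by move=> g; exists (HS_lift K g); apply: projection_lift.
- by move=> c0; exists (op_id P c0); apply: (mor_id projection_morphism).
- move=> c0 n0 a0 b d0 s _ hs [x <-]; exists (op_act b s x).
  exact: (mor_act projection_morphism).
- move=> c0 e p q n0 a0 b z d1 d2 d0 u v _ _ h hd [x <-] [y <-].
  by exists (op_comp z d0 u v x y); apply: (mor_comp projection_morphism).
- by move=> c0 n0 a0 d0; exists 0; apply: (mor0 projection_morphism).
- move=> c0 n0 a0 d0 k _ _ [x <-] [y <-]; exists (k *: x + y).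
  exact: (mor_linear projection_morphism).
Qed.

(** Everything outside degree zero, and the boundaries in degree zero.
    Coefficients are compared because d and -1 + 1 are not convertible. *)
Definition null_class c n (a : 'I_n -> colour) d (x : P c n a d) : Prop :=
  d = 0 -> exists y : P c n a (-1), fval (Phi (delta y)) =1 fval (Phi x).

Lemma null_classP c n (a : 'I_n -> colour) (x : P c n a 0) :
  null_class x <-> exists y : P c n a (-1), delta y = x :> P c n a 0.
Proof.
split=> [/(_ erefl)[y hy]|[y hy] _]; exists y; last by rewrite -hy.
by apply: Phi_inj; apply: fval_inj.
Qed.

(** All elements of degree zero are cycles, so a composite of a boundary with
    such an element is a boundary. *)
Lemma null_class_ideal : is_ideal null_class.
Proof.
have N0 c n (a : 'I_n -> colour) d : null_class (0 : P c n a d).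
  by move=> d0; subst d; exists 0 => s; rewrite delta0.
split=> //.
- move=> c n a d k x y hx hy d0; subst d.
  have [x' <-] := (null_classP x).1 hx; have [y' <-] := (null_classP y).1 hy.
  by exists (k *: x' + y'); rewrite delta_linear.
- move=> c n a b d s x hs hx d0; subst d.
  have [x' <-] := (null_classP x).1 hx; exists (op_act b s x').
  by rewrite (diff_act (delta_differential K)).
- move=> c e p q n a b z d1 d2 d u v x y h hd hx.
  have [d1p|d1n|d1z] := ltgtP d1 0.
  + have [d2p|d2n] := ltP 0 d2.
      by rewrite (HSoo_nonpositive y) ?op_comp0r.
    by move=> d0; lia.
  + by rewrite (HSoo_nonpositive x) ?op_comp0l.
  move=> d0; have d2z : d2 = 0 by lia.
  subst d1 d2 d; have [x' <-] := (null_classP x).1 hx.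
  exists (op_comp z (-1) u v x' y).
  rewrite (diff_comp (delta_differential K)) // (HSoo_nonpositive (delta y)) //.
  by rewrite op_comp0r scaler0 addr0.
- move=> c e p q n a b z d1 d2 d u v x y h hd hy.
  have [d1p|d1n|d1z] := ltgtP d2 0.
  + have [d2p|d2n] := ltP 0 d1.
      by rewrite (HSoo_nonpositive x) ?op_comp0l.
    by move=> d0; lia.
  + by rewrite (HSoo_nonpositive y) ?op_comp0r.
  move=> d0; have d2z : d1 = 0 by lia.
  subst d1 d2 d; have [y' <-] := (null_classP y).1 hy.
  exists (op_comp z (-1) u v x y').
  rewrite (diff_comp (delta_differential K)) // (HSoo_nonpositive (delta x)) //.
  by rewrite op_comp0l add0r expr0z scale1r.
Qed.

(** Modulo null classes the lifted generators satisfy the relations of HS.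
    Hence HS maps to this quotient, and by freeness the quotient map factors
    through the projection. *)
Lemma projection_kernel c n (a : 'I_n -> colour) (x : P c n a 0) :
  projection x = 0 -> exists y : P c n a (-1), delta y = x :> P c n a 0.
Proof.
move=> hx; apply/null_classP.
pose rho := quotient_map null_class_ideal.
have hrho : is_morphism rho := quotient_morphism null_class_ideal.
have rho0 := quotient_map_eq0 null_class_ideal.
have hmodel : is_model (@HS_relations K) (fun g => rho _ _ _ _ (HS_lift K g)).
  split.
    move=> g; apply: (mor_symmetric hrho).
    case: g => [|k]; rewrite /HS_lift.
      rewrite (ell_gen K (isT : (2 <= 2)%N)).
      exact: (@pres_gen_symmetric K HSoo_corollas _ (HSoo_ell_gen (isT : (2 <= 2)%N))).
    rewrite (fcor_gen K k (isT : (1 <= 1)%N)); apply: symmetricN.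
    exact: (@pres_gen_symmetric K HSoo_corollas _ (HSoo_f_gen k (isT : (1 <= 1)%N))).
  split=> [|k].
    rewrite -[LHS](mor_jacobiator _ hrho); apply/rho0/null_classP.
    by exists (ell K 3); apply: delta_ell3.
  rewrite -[LHS](mor_field_defect _ hrho); apply/rho0/null_classP.
  exists (- (fcor K 2 k : P wavy (2 + k)%N (@straight_wavy 2 k) (-1))).
  rewrite -scaleN1r -[_ *: _]addr0 delta_linear delta0 addr0 scaleN1r.
  by apply/eqP; rewrite eqr_oppLR; apply/eqP; apply: delta_f2.
have [psi [hpsi psi_gen _]] := (HS_presented K).2 _ _ hmodel.
have hcomp : is_morphism (fun c n a d (y : P c n a d) => psi _ _ _ _ (projection y)).
  split.
  - by move=> *; rewrite (mor_linear projection_morphism) (mor_linear hpsi).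
  - by move=> *; rewrite (mor_id projection_morphism) (mor_id hpsi).
  - by move=> *; rewrite (mor_act projection_morphism) // (mor_act hpsi).
  - by move=> *; rewrite (mor_comp projection_morphism) // (mor_comp hpsi).
have hrhomodel : is_model (@no_relations K HSoo_corollas) (fun g => rho _ _ _ _ (HSoo_generators K g)).
  split=> // g; apply: (mor_symmetric hrho); exact: pres_gen_symmetric.
have [phi [_ _ uniq_phi]] := (HSoo_free K).2 _ _ hrhomodel.
have {}uniq_phi : psi _ _ _ _ (projection x) = rho _ _ _ _ x.
  rewrite (uniq_phi rho) //; apply: uniq_phi hcomp _ _ _ _ _ _ => g.
  rewrite projection_gen; case: g => [m hm|m k hm].
    have [em|nm] := eqVneq m 2%N.
      subst m; rewrite -(ell_gen K hm); exact: psi_gen HS_bracket.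
    rewrite (_ : HS_image _ = 0) ?(mor0 hpsi); last first.
      by case: m hm nm => [|[|[|m]]].
    by apply/esym/rho0 => /= hd; exfalso; move: nm; rewrite (_ : m = 2%N) //; lia.
  have [em|nm] := eqVneq m 1%N.
    subst m; rewrite /= (morN hpsi) -(fcor_gen K k hm).
    apply/eqP; rewrite eqr_oppLR; apply/eqP; rewrite -(morN hrho).
    exact: (psi_gen (HS_field k)).
  rewrite (_ : HS_image _ = 0) ?(mor0 hpsi); last first.
    by case: m hm nm => [|[|m]].
  by apply/esym/rho0 => /= hd; exfalso; move: nm; rewrite (_ : m = 1%N) //; lia.
by apply/rho0; rewrite -[LHS]uniq_phi hx (mor0 hpsi).
Qed.

(** Exactness is delta_exact in negative degrees and projection_kernel in
    degree zero. *)
Lemma projection_quasi_iso : is_quasi_iso (@delta K) (@zero_differential K (HS K)) projection.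
Proof.
move=> c n a d; split=> [x dx [y hy]|y _].
  have [d0|d0|d0] := ltgtP (d + 1) 0.
  - exact: delta_exact.
  - by exists 0; rewrite delta0 (HSoo_nonpositive x).
  have ed : d = -1 by lia.
  subst d; have [x' hx'] := projection_kernel hy.
  by exists x'.
have [d0|d0] := eqVneq (d + 1) 0.
  have ed : d = -1 by lia.
  subst d; have [x hx] := projection_epi y.
  exists x, 0; split; first exact: HSoo_nonpositive.
  by rewrite hx addr0.
exists 0, 0; split; first exact: delta0.
by rewrite (mor0 projection_morphism) addr0 (HS_degree0 y) //; apply/eqP.
Qed.

Lemma minimal_resolution : is_minimal_resolution (HS K) (@HSoo_generators K) (@delta K).
Proof.
split.
- exact: HSoo_free.
- exact: delta_differential.
- exact: delta_decomposable.
exists projection; split.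
- by split; [exact: projection_morphism|move=> *; exact: projection_delta].
- exact: projection_epi.
- exact: projection_quasi_iso.
Qed.

End Cohomology.

Theorem theorem2p6p1 (K : fieldType) (charK : [pchar K] =i pred0) :
  exists delta : forall c n (a : 'I_n -> colour) d,
      HSoo K c n a d -> HSoo K c n a (d + 1),
  [/\ forall m : nat, (2 <= m)%N ->
        delta _ _ _ _ (ell K m) =
        \sum_(J : {set 'I_m} | (2 <= #|J|)%N && (1 <= #|~: J|)%N)
          (-1) ^+ (#|~: J| + 1 + shuffle_sign J)%N *:
          op_comp _ _
            (juxt graft_slot (fun j : 'I_#|~: J| => Some (enum_val j)))
            (fun j : 'I_#|J| => enum_val j)
            (ell K (1 + #|~: J|)%N) (ell K #|J|),
      forall m n : nat, (1 <= m)%N ->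
        delta _ _ _ _ (fcor K m n) =
        \sum_(J : {set 'I_m} | (2 <= #|J|)%N)
          (-1) ^+ (#|~: J| + shuffle_sign J)%N *:
          op_comp _ _
            (juxt
               (juxt graft_slot
                  (fun j : 'I_#|~: J| => Some (lshift n (enum_val j))))
               (fun k : 'I_n => Some (rshift m k)))
            (fun j : 'I_#|J| => lshift n (enum_val j))
            (fcor K (1 + #|~: J|)%N n) (ell K #|J|)
        - \sum_(J : {set 'I_m} | (1 <= #|J|)%N && (1 <= #|~: J|)%N)
          \sum_(I : {set 'I_n})
          (-1) ^+ (#|J| * (#|~: J| + 1) + shuffle_sign J)%N *:
          op_comp _ _
            (juxt (fun j : 'I_#|J| => Some (lshift n (enum_val j)))
               (juxt graft_slot
                  (fun k : 'I_#|I| => Some (rshift m (enum_val k)))))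
            (juxt (fun j : 'I_#|~: J| => lshift n (enum_val j))
               (fun k : 'I_#|~: I| => rshift m (enum_val k)))
            (fcor K #|J| (1 + #|I|)%N) (fcor K #|~: J| #|~: I|)
    & is_minimal_resolution (HS K) (@HSoo_generators K) delta].
Proof.
exists (@delta K); split.
- exact: delta_ell.
- exact: delta_fcor.
- exact: minimal_resolution.
Qed.
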